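(* Let $\Omega\subset\mathbb{R}^d$, $d\in\{1,2,3\}$, be an open, bounded set that is either $C^{1,1}$ regular, or polygonal and convex. Let $\tau,c,\overline{\delta}>0$ and $k\in\mathbb{R}$, and let $C(\tau),K(\tau)$ be the constants described in the context. Let $r>0$ and $T>0$ be such that for some $R>0$ $$\sqrt{C(\tau)\exp(K(\tau)(R^2+1)T)}\; r\le R,\qquad \left(C_{H^2,L^\infty}+C_{H^1,L^4}^2\right)C(\tau)\exp(K(\tau)(R^2+1)T)\,r\,|k|\,\sqrt{T}<1,$$ and let $(p_0,p_1,p_2)\in H^2_\diamondsuit(\Omega)\times H^2_\diamondsuit(\Omega)\times H^1_0(\Omega)$ satisfy $\|\nabla p_2\|_{L^2}^2+\|\Delta p_1\|_{L^2}^2+\|\Delta p_0\|_{L^2}^2\le r^2$. For $\delta\in[0,\overline{\delta}]$ let $p^{(\delta)}\in X^{\mathrm W}$ be the unique solution of $$\tau p_{ttt}+p_{tt}-(\delta+\tau c^2)\Delta p_t-c^2\Delta p=\tfrac12(kp^2)_{tt}\ \text{ in }\Omega\times(0,T),\qquad p|_{\partial\Omega}=0,\qquad (p,p_t,p_{tt})|_{t=0}=(p_0,p_1,p_2).$$ Then the family $\{p^{(\delta)}\}_{\delta>0}$ converges in the energy norm, at a linear rate as $\delta\to0^+$, to the solution $p=p^{(0)}$ of the inviscid JMGT--Westervelt equation ($\delta=0$); that is, there exists a constant $C>0$, independent of $\delta$, such that $$\|p^{(\delta)}-p\|_{\mathrm E}\le C\,\delta\qquad\text{for all }\delta\in(0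,\overline{\delta}].$$
   Context: $H^2_\diamondsuit(\Omega)=H^1_0(\Omega)\cap H^2(\Omega)$. $X^{\mathrm W}=W^{3,\infty}(0,T;L^2(\Omega))\cap W^{2,\infty}(0,T;H^1_0(\Omega))\cap W^{1,\infty}(0,T;H^2_\diamondsuit(\Omega))$. The right-hand side equals $\frac12(kp^2)_{tt}=kpp_{tt}+kp_t^2$. $C_{H^1,L^4}$ and $C_{H^2,L^\infty}$ are embedding constants: $\|v\|_{L^4}\le C_{H^1,L^4}\|\nabla v\|_{L^2}$ for $v\in H^1_0(\Omega)$ and $\|v\|_{L^\infty}\le C_{H^2,L^\infty}\|\Delta v\|_{L^2}$ for $v\in H^2_\diamondsuit(\Omega)$. $C(\tau),K(\tau)>0$ are constants, independent of $\delta,r,R,T$ and the initial data, for which the following well-posedness result holds: whenever $r,T,R>0$ satisfy the two displayed inequalities of the claim, then for all data as in the claim and every $\delta\in[0,\overline{\delta}]$ the problem has a unique solution $p\in X^{\mathrm W}$ (equation holding in $L^\infty(0,T;L^2(\Omega))$), and for almost every $t\in(0,T)$ $$\|\nabla p_{tt}(t)\|_{L^2}^2+\|\Delta p_t(t)\|_{L^2}^2+\|\Delta p(t)\|_{L^2}^2\le C(\tau)e^{K(\tau)(R^2+1)T}\left(\|\nabla p_2\|_{L^2}^2+\|\Delta p_1\|_{L^2}^2+\|\Delta p_0\|_{L^2}^2\right).$$ The energy space is $\mathrm E=W^{2,\infty}(0,T;L^2(\Omega))\cap W^{1,\infty}(0,T;H^1_0(\Omega))$, with norm induced by the energy $$E[p](t)=\tfrac{\tau^2}{2}\|p_{tt}(t)\|_{L^2}^2+\tfrac{\tau^2c^2}{2}\|\nabla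 p_t(t)\|_{L^2}^2+\tfrac{c^2}{2}\|\nabla p(t)\|_{L^2}^2,\qquad \|p\|_{\mathrm E}=\operatorname*{ess\,sup}_{t\in(0,T)}E[p](t)^{1/2}.$$ *)

(* Defs.v *)
From HB Require Import structures.
From mathcomp Require Import all_boot all_order all_algebra.
From mathcomp Require Import all_classical all_reals all_analysis ess_sup_inf.
Set Implicit Arguments. Unset Strict Implicit. Unset Printing Implicit Defensive.
Import Order.TTheory GRing.Theory Num.Theory numFieldNormedType.Exports.
Local Open Scope classical_set_scope.
Local Open Scope ring_scope.

(* The sigma-algebra generated by the coordinates (on a row space over the
   reals, the Borel sets), in the style of the library's instance for tuples. *)
Definition measure_rV_display : measure_display -> measure_display.
Proof. exact. Qed.

Section measurable_rV.
Context {R : realType}.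
Variable n : nat.

Let coord_rV : 'I_n -> 'rV[R]_n -> measurableTypeR R := fun i x => x ord0 i.

Let rV_set0 : g_sigma_preimage coord_rV set0.
Proof. exact: sigma_algebra0. Qed.
Let rV_setC A : g_sigma_preimage coord_rV A -> g_sigma_preimage coord_rV (~` A).
Proof. exact: sigma_algebraC. Qed.
Let rV_bigcup (F : _^nat) : (forall i, g_sigma_preimage coord_rV (F i)) ->
  g_sigma_preimage coord_rV (\bigcup_i (F i)).
Proof. exact: sigma_algebra_bigcup. Qed.

HB.instance Definition _ := @isMeasurable.Build
  (measure_rV_display default_measure_display)
  'rV[R]_n (g_sigma_preimage coord_rV) rV_set0 rV_setC rV_bigcup.

Lemma measurable_rV_coord (i : 'I_n) :
  measurable_fun [set: 'rV[R]_n] (fun x : 'rV[R]_n => x ord0 i : measurableTypeR R).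
Proof.
move=> _ Y mY; rewrite setTI; apply: sub_sigma_algebra => /=.
rewrite -bigcup_seq/=; exists i => /=; first by rewrite mem_index_enum.
by exists Y => //; rewrite setTI.
Qed.

Lemma measurable_fun_rVP d (T : measurableType d) (f : T -> 'rV[R]_n) :
  (forall i, measurable_fun [set: T] (fun x => f x ord0 i : measurableTypeR R)) ->
  measurable_fun [set: T] f.
Proof.
move=> mf.
suff H : g_sigma_preimage (fun i => coord_rV i \o f) `<=` measurable.
  move=> _ A mA; apply: H; rewrite g_sigma_preimage_comp.
  by exists A.
apply: smallest_sub; first exact: sigma_algebra_measurable.
move=> A; rewrite -bigcup_seq => -[i _ /= [B mB <-]].
exact: mf.
Qed.
End measurable_rV.

Section lebesgue_rV.
Context {R : realType}.

Definition rV_cons n (p : measurableTypeR R * 'rV[R]_n) : 'rV[R]_n.+1 :=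
  \row_i if unlift ord0 i is Some j then p.2 ord0 j else p.1.
Definition rV_uncons n (x : 'rV[R]_n.+1) : measurableTypeR R * 'rV[R]_n :=
  (x ord0 ord0, \row_j x ord0 (lift ord0 j)).

Lemma rV_consK n : cancel (@rV_cons n) (@rV_uncons n).
Proof.
move=> [a x]; congr pair; first by rewrite mxE unlift_none.
by apply/rowP => j; rewrite !mxE liftK.
Qed.

Lemma measurable_rV_cons n : measurable_fun [set: _] (@rV_cons n).
Proof.
apply: measurable_fun_rVP => i; rewrite /rV_cons.
case: (unliftP ord0 i) => [j|] ->.
- rewrite [X in measurable_fun _ X](_ : _ =
    (fun x : 'rV[R]_n => x ord0 j : measurableTypeR R) \o snd).
    by apply: measurableT_comp => //; exact: measurable_rV_coord.
  by apply/funext => p; rewrite /= mxE liftK.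
- rewrite [X in measurable_fun _ X](_ : _ = fst)//.
  by apply/funext => p; rewrite /= mxE unlift_none.
Qed.

Lemma measurable_rV_uncons n : measurable_fun [set: _] (@rV_uncons n).
Proof.
apply: measurable_fun_pair; first exact: measurable_rV_coord.
apply: measurable_fun_rVP => i.
rewrite [X in measurable_fun _ X](_ : _ =
  (fun x : 'rV[R]_n.+1 => x ord0 (lift ord0 i) : measurableTypeR R)).
  exact: measurable_rV_coord.
by apply/funext => x; rewrite mxE.
Qed.

Section step.
Variables (n : nat) (mu : {sigma_finite_measure set 'rV[R]_n -> \bar R}).
Local Open Scope ereal_scope.

Definition leb_step : set 'rV[R]_n.+1 -> \bar R :=
  pushforward (@lebesgue_measure R \x mu) (@rV_cons n).

Let step0 : leb_step set0 = 0.
Proof. by rewrite /leb_step /pushforward preimage_set0 measure0. Qed.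

Let step_ge0 A : 0 <= leb_step A.
Proof. by rewrite /leb_step /pushforward measure_ge0. Qed.

Let mcons A : measurable A -> measurable (@rV_cons n @^-1` A).
Proof. by move=> mA; rewrite -[X in measurable X]setTI; exact: measurable_rV_cons. Qed.

Let step_sigma_additive : semi_sigma_additive leb_step.
Proof.
move=> F mF tF mUF; rewrite /leb_step /pushforward preimage_bigcup.
apply: measure_semi_sigma_additive.
- by move=> k; exact: mcons.
- apply/trivIsetP => /= i j _ _ ij; rewrite -preimage_setI.
  by move/trivIsetP : tF => /(_ _ _ _ _ ij) ->//; rewrite preimage_set0.
- by rewrite -preimage_bigcup; exact: mcons.
Qed.

HB.instance Definition _ := isMeasure.Build _ _ _
  leb_step step0 step_ge0 step_sigma_additive.

Let step_sigma_finite : sigma_finite setT leb_step.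
Proof.
have /sigma_finiteP[F [FT ndF Foo]] := sigma_finiteT (@lebesgue_measure R).
have /sigma_finiteP[G [GT ndG Goo]] := sigma_finiteT mu.
exists (fun k => @rV_uncons n @^-1` (F k `*` G k)).
  rewrite -preimage_bigcup [X in _ @^-1` X](_ : _ = setT) ?preimage_setT//.
  rewrite -subTset => -[x y] _.
  have [i _ Fx] : (\bigcup_i F i) x by rewrite -FT.
  have [j _ Gy] : (\bigcup_i G i) y by rewrite -GT.
  exists (maxn i j) => //; split => /=.
  - by move: x Fx; exact/subsetPset/ndF/leq_maxl.
  - by move: y Gy; exact/subsetPset/ndG/leq_maxr.
move=> k; have [mF Fk] := Foo k; have [mG Gk] := Goo k.
have mFG : measurable (F k `*` G k) by exact: measurableX.
split; first by rewrite -[X in measurable X]setTI; exact: measurable_rV_uncons.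
rewrite /leb_step /pushforward -comp_preimage.
rewrite (_ : _ \o _ = id) ?preimage_id; last first.
  by apply/funext => p; exact: rV_consK.
by rewrite product_measure1E// lte_mul_pinfty// ge0_fin_numE.
Qed.

HB.instance Definition _ := Measure_isSigmaFinite.Build _ _ _
  leb_step step_sigma_finite.

End step.

Section base.
Definition leb_zero : set 'rV[R]_0 -> \bar R := @dirac _ 'rV[R]_0 0 R.
HB.instance Definition _ := Measure.on leb_zero.
Let zero_sigma_finite : sigma_finite setT leb_zero.
Proof.
apply: fin_num_fun_sigma_finite; first by rewrite measure0.
have h : leb_zero setT = 1%E by rewrite /leb_zero /dirac indicT.
by apply: lty_fin_num_fun; rewrite [X in (X < _)%E](h) ltey.
Qed.
HB.instance Definition _ := @isSigmaFinite.Build _ _ _ leb_zero zero_sigma_finite.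
End base.

(* Lebesgue measure on R^n, an iterated product measure; the value on boxes is
   lebesgue_rV_box. *)
Fixpoint lebesgue_rV n : {sigma_finite_measure set 'rV[R]_n -> \bar R} :=
  match n return {sigma_finite_measure set 'rV[R]_n -> \bar R} with
  | 0 => leb_zero
  | m.+1 => leb_step (lebesgue_rV m)
  end.

Lemma lebesgue_rV_box n (a b : 'rV[R]_n) : (forall i, a ord0 i <= b ord0 i) ->
  lebesgue_rV n [set x | forall i, a ord0 i <= x ord0 i <= b ord0 i] =
  (\prod_i (b ord0 i - a ord0 i))%:E.
Proof.
elim: n a b => [|n IH] a b ab.
  rewrite big_ord0 /= /leb_zero diracE mem_set//.
  by move=> -[].
set S := (X in lebesgue_rV _ X).
have -> : lebesgue_rV n.+1 S =
  (@lebesgue_measure R \x lebesgue_rV n)%E (@rV_cons n @^-1` S) by [].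
pose a' := (rV_uncons a).2; pose b' := (rV_uncons b).2.
pose B : set 'rV[R]_n := [set x | forall i, a' ord0 i <= x ord0 i <= b' ord0 i].
have -> : @rV_cons n @^-1` S = `[a ord0 ord0, b ord0 ord0] `*` B.
  apply/seteqP; split=> -[x y] /=.
    move=> H; split => /=.
      by rewrite in_itv/=; have := H ord0; rewrite mxE unlift_none.
    by move=> i; have := H (lift ord0 i); rewrite !mxE liftK.
  move=> [/= H1 H2] i; rewrite mxE; case: (unliftP ord0 i) => [j|] -> /=.
    by have := H2 j; rewrite !mxE.
  by move: H1; rewrite in_itv.
have mbox : measurable B.
  rewrite (_ : B = \bigcap_(i in [set: 'I_n])
     [set x : 'rV[R]_n | x ord0 i \in `[a' ord0 i, b' ord0 i]]); last first.
    apply/seteqP; split => x /= H i; first by move=> _ /=; rewrite in_itv/=.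
    by have := H i I; rewrite /= in_itv.
  apply: (@fin_bigcap_measurable _ 'rV[R]_n 'I_n) => [|i _]; first exact: finite_finset.
  rewrite -[X in measurable X]setTI.
  exact: (@measurable_rV_coord _ n i measurableT `[a' ord0 i, b' ord0 i]%classic (measurable_itv _)).
rewrite product_measure1E//= IH.
  rewrite lebesgue_measure_itv /= lte_fin big_ord_recl.
  have -> : (\prod_(i < n) (b ord0 (lift ord0 i) - a ord0 (lift ord0 i)) =
     \prod_i (b' ord0 i - a' ord0 i))%R by apply: eq_bigr => i _; rewrite !mxE.
  case: ltP => [_|]; first by rewrite -EFinB -EFinM.
  move=> ba; have -> : b ord0 ord0 = a ord0 ord0.
    by apply/eqP; rewrite eq_le ba ab.
  by rewrite subrr mul0r mul0e.
by move=> i; rewrite !mxE.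
Qed.
End lebesgue_rV.

Section sobolev.
Context {R : realType} {d : nat}.
Implicit Types (f g phi : 'rV[R]_d -> R) (i j : 'I_d) (Omega : set 'rV[R]_d).
Local Notation mu := (@lebesgue_rV R d).

Definition pderiv i f : 'rV[R]_d -> R := fun x => 'D_(delta_mx ord0 i) f x.

Fixpoint Ck (k : nat) f : Prop :=
  continuous f /\
  if k is k'.+1 then
    (forall i x, derivable f x (delta_mx ord0 i)) /\
    (forall i, Ck k' (pderiv i f))
  else True.

Definition boundary Omega : set 'rV[R]_d := closure Omega `&` closure (~` Omega).

Definition C11_fun f : Prop :=
  (forall x, differentiable f x) /\
  exists L : R, forall i x y, `|pderiv i f x - pderiv i f y| <= L * `|x - y|.

(* Near each boundary point, in the coordinates y = x Q for an orthogonal Q, the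
   set is the strict subgraph y_j < gamma(y) of a C^{1,1} function gamma of the
   other coordinates. *)
Definition C11_domain Omega : Prop :=
  forall x0, boundary Omega x0 ->
  exists (U : set 'rV[R]_d) (Q : 'M[R]_d) (j : 'I_d) (gamma : 'rV[R]_d -> R),
  [/\ nbhs x0 U, Q *m Q^T = 1%:M, C11_fun gamma,
      (forall y z : 'rV[R]_d,
         (forall i, i != j -> y ord0 i = z ord0 i) -> gamma y = gamma z) &
      forall x, U x -> (Omega x <-> (x *m Q) ord0 j < gamma (x *m Q))].

(* The boundary lies on finitely many hyperplanes {x | x . h.1 = h.2}; for d = 2
   these are lines, for d = 3 planes. *)
Definition polygonal Omega : Prop :=
  exists s : seq ('rV[R]_d * R),
    (forall h, h \in s -> h.1 != 0) /\
    (forall x, boundary Omega x ->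
       exists2 h, h \in s & (x *m h.1^T) ord0 ord0 = h.2).

(* Functions on Omega are total functions on R^d whose values off Omega are
   ignored, and functions equal a.e. on Omega are not identified. *)
Definition LpOn Omega (p : \bar R) : set ('rV[R]_d -> R) :=
  [set f | f \_ Omega \in Lfun mu p].

Definition Lpnorm Omega (p : \bar R) f : \bar R :=
  'N[mu]_p [EFin \o (f \_ Omega)]%E.

Definition L2 Omega := LpOn Omega 2%:E.

Definition L2norm Omega f : R := fine (Lpnorm Omega 2%:E f).

Definition test_fun Omega phi : Prop :=
  (forall k, Ck k phi) /\
  exists K : set 'rV[R]_d,
    [/\ compact K, K `<=` Omega & forall x, ~ K x -> phi x = 0].

Definition weak_pderiv Omega i f g : Prop :=
  forall phi, test_fun Omega phi ->
    \int[mu]_(x in Omega) (f x * pderiv i phi x) =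
    - \int[mu]_(x in Omega) (g x * phi x).

(* A chosen L^2 weak derivative (unique up to a.e. equality), 0 if none exists. *)
Definition wD Omega i f : 'rV[R]_d -> R :=
  xget (cst 0) [set g | L2 Omega g /\ weak_pderiv Omega i f g].

Definition H1 Omega : set ('rV[R]_d -> R) := [set f |
  L2 Omega f /\ forall i, exists g, L2 Omega g /\ weak_pderiv Omega i f g].

Definition gradnorm Omega f : R :=
  Num.sqrt (\sum_i L2norm Omega (wD Omega i f) ^+ 2).

Definition H1norm Omega f : R :=
  Num.sqrt (L2norm Omega f ^+ 2 + gradnorm Omega f ^+ 2).

Definition H10 Omega : set ('rV[R]_d -> R) := [set f |
  H1 Omega f /\
  forall e : R, 0 < e -> exists2 phi, test_fun Omega phi & H1norm Omega (f \- phi) < e].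

Definition H2 Omega : set ('rV[R]_d -> R) := [set f |
  H1 Omega f /\ forall i, H1 Omega (wD Omega i f)].

Definition H2norm Omega f : R :=
  Num.sqrt (H1norm Omega f ^+ 2 +
            \sum_i \sum_j L2norm Omega (wD Omega j (wD Omega i f)) ^+ 2).

Definition H2diamond Omega : set ('rV[R]_d -> R) := H10 Omega `&` H2 Omega.

Definition laplacian Omega f : 'rV[R]_d -> R :=
  fun x => \sum_i wD Omega i (wD Omega i f) x.

Definition embedding_H1_L4 Omega (C : R) : Prop :=
  forall f, H10 Omega f -> (Lpnorm Omega 4%:E f <= (C * gradnorm Omega f)%:E)%E.

Definition embedding_H2_Linfty Omega (C : R) : Prop :=
  forall f, H2diamond Omega f ->
    (Lpnorm Omega +oo f <= (C * L2norm Omega (laplacian Omega f))%:E)%E.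

(* Seminormed spaces, as members and seminorm, the target spaces of the Bochner
   spaces; fnorm is meaningful on fmem only. *)
Record fspace := FSpace {
  fmem : set ('rV[R]_d -> R);
  fnorm : ('rV[R]_d -> R) -> R }.

Definition XL2 Omega := FSpace (L2 Omega) (L2norm Omega).
Definition XH10 Omega := FSpace (H10 Omega) (H1norm Omega).
Definition XH2 Omega := FSpace (H2diamond Omega) (H2norm Omega).

End sobolev.

Section bochner.
Context {R : realType} {d : nat}.
Variable T : R.
Implicit Types (X : @fspace R d) (u v : R -> 'rV[R]_d -> R) (w : 'rV[R]_d -> R).
Local Notation I := (`]0, T[%classic : set R).
Local Notation lambda := (@lebesgue_measure R).

Record tsimple X := TSimple {
  ts_size : nat;
  ts_set : 'I_ts_size -> set (measurableTypeR R);
  ts_val : 'I_ts_size -> 'rV[R]_d -> R;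
  ts_setP : forall i, measurable (ts_set i);
  ts_valP : forall i, fmem X (ts_val i) }.
Arguments ts_set {X} t _.
Arguments ts_val {X} t _.

Definition ts_fun X (s : tsimple X) : R -> 'rV[R]_d -> R :=
  fun t x => \sum_i \1_(ts_set s i) t * ts_val s i x.

Definition ts_int X (s : tsimple X) : 'rV[R]_d -> R :=
  fun x => \sum_i fine (lambda (ts_set s i `&` I)) * ts_val s i x.

Definition ts_cvg X (s : nat -> tsimple X) u : Prop :=
  {ae lambda, forall t, I t -> fnorm X (u t \- ts_fun (s k) t) @[k --> \oo] --> (0 : R)}.

Definition ae_mem X u : Prop := {ae lambda, forall t, I t -> fmem X (u t)}.

Definition Linfty X u : Prop :=
  [/\ ae_mem X u,
      exists s : nat -> tsimple X, ts_cvg s u &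
      exists M : R, {ae lambda, forall t, I t -> fnorm X (u t) <= M}].

(* w is the Bochner integral of u over (0, T) in X. *)
Definition bochner_int X u w : Prop :=
  [/\ ae_mem X u, fmem X w &
      exists s : nat -> tsimple X,
      [/\ ts_cvg s u,
          (\int[lambda]_(t in I) (fnorm X (u t \- ts_fun (s k) t))%:E)%E
            @[k --> \oo] --> 0%E &
          fnorm X (ts_int (s k) \- w) @[k --> \oo] --> (0 : R)]].

(* C_c^oo(0, T) *)
Definition time_test (phi : R -> R) : Prop :=
  (forall k t, derivable (derive1n k phi) t 1) /\
  exists a b : R, [/\ 0 < a, b < T & forall t, ~~ (a <= t <= b) -> phi t = 0].

Definition weak_tderiv X u v : Prop :=
  forall phi, time_test phi ->
  exists w, bochner_int X (fun t x => derive1 phi t * u t x) w /\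
            bochner_int X (fun t x => phi t * v t x) (fun x => - w x).

(* W^{k,oo}(0, T; X) *)
Fixpoint Winfty X (k : nat) u : Prop :=
  Linfty X u /\
  if k is k'.+1 then exists v, weak_tderiv X u v /\ Winfty X k' v else True.

Variable Omega : set 'rV[R]_d.

(* A chosen weak time derivative in L^infty(0, T; L^2), unique up to a.e.
   equality, 0 if none exists. *)
Definition dt u : R -> 'rV[R]_d -> R :=
  xget (fun _ _ => 0)
    [set v | Linfty (XL2 Omega) v /\ weak_tderiv (XL2 Omega) u v].

Definition XW u : Prop :=
  [/\ Winfty (XL2 Omega) 3 u, Winfty (XH10 Omega) 2 u & Winfty (XH2 Omega) 1 u].

(* u has a representative in C([0, T]; L^2) taking the value w at t = 0 *)
Definition initial_value u w : Prop :=
  exists v,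
  [/\ (forall t, 0 <= t <= T -> L2 Omega (v t)),
      (forall t, 0 <= t <= T ->
         L2norm Omega (v s \- v t) @[s --> within `[0, T] (nbhs t)] --> (0 : R)),
      {ae lambda, forall t, I t -> L2norm Omega (v t \- u t) = 0} &
      L2norm Omega (v 0 \- w) = 0].

Definition Espace u : Prop :=
  Winfty (XL2 Omega) 2 u /\ Winfty (XH10 Omega) 1 u.

Definition energy (tau c : R) u (t : R) : R :=
  tau ^+ 2 / 2 * L2norm Omega (dt (dt u) t) ^+ 2 +
  tau ^+ 2 * c ^+ 2 / 2 * gradnorm Omega (dt u t) ^+ 2 +
  c ^+ 2 / 2 * gradnorm Omega (u t) ^+ 2.

Definition Enorm (tau c : R) u : \bar R :=
  ess_sup (mrestr lambda (measurable_itv `]0, T[))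
    (fun t => (Num.sqrt (energy tau c u t))%:E).

(* The boundary condition is part of XW, through H10. On XW the square of p lies
   in W^{2,oo}(0, T; L^2), so that the right-hand side is a genuine weak
   derivative. *)
Definition JMGT_solution (tau c k delta : R) (p0 p1 p2 : 'rV[R]_d -> R)
    (p : R -> 'rV[R]_d -> R) : Prop :=
  [/\ XW p,
      {ae lambda, forall t, I t -> {ae lebesgue_rV d, forall x, Omega x ->
        tau * dt (dt (dt p)) t x + dt (dt p) t x
        - (delta + tau * c ^+ 2) * laplacian Omega (dt p t) x
        - c ^+ 2 * laplacian Omega (p t) x
        = 1 / 2 * dt (dt (fun s y => k * p s y ^+ 2)) t x}} &
      [/\ initial_value p p0, initial_value (dt p) p1 &
          initial_value (dt (dt p)) p2]].

End bochner.

Section wellposedness.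
Context {R : realType} {d : nat}.
Variables (Omega : set 'rV[R]_d) (tau c k : R).

Definition data_energy (p0 p1 p2 : 'rV[R]_d -> R) : R :=
  gradnorm Omega p2 ^+ 2 + L2norm Omega (laplacian Omega p1) ^+ 2 +
  L2norm Omega (laplacian Omega p0) ^+ 2.

Definition small_data (CH2 CH1 C K r T Rad : R) : Prop :=
  Num.sqrt (C * expR (K * (Rad ^+ 2 + 1) * T)) * r <= Rad /\
  (CH2 + CH1 ^+ 2) * C * expR (K * (Rad ^+ 2 + 1) * T) * r * `|k| * Num.sqrt T < 1.

(* C and K may depend on the domain, on tau, c, k and on delta_bar, but not on
   delta, r, Rad, T or the initial data. *)
Definition wellposed (delta_bar CH2 CH1 C K : R) : Prop :=
  forall r T Rad : R, 0 < r -> 0 < T -> 0 < Rad ->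
  small_data CH2 CH1 C K r T Rad ->
  forall p0 p1 p2 : 'rV[R]_d -> R,
  H2diamond Omega p0 -> H2diamond Omega p1 -> H10 Omega p2 ->
  data_energy p0 p1 p2 <= r ^+ 2 ->
  forall delta : R, 0 <= delta <= delta_bar ->
  let sol := JMGT_solution T Omega tau c k delta p0 p1 p2 in
  [/\ exists p, sol p,
      (forall p q, sol p -> sol q ->
         {ae @lebesgue_measure R, forall t, 0 < t < T ->
            L2norm Omega (p t \- q t) = 0}) &
      (forall p, sol p ->
         {ae @lebesgue_measure R, forall t, 0 < t < T ->
            gradnorm Omega (dt T Omega (dt T Omega p) t) ^+ 2
            + L2norm Omega (laplacian Omega (dt T Omega p t)) ^+ 2
            + L2norm Omega (laplacian Omega (p t)) ^+ 2
            <= C * expR (K * (Rad ^+ 2 + 1) * T) * data_energy p0 p1 p2})].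

End wellposedness.

(* Main.v *)
(** Put q = p^(delta) - p^(0). Subtracting the two equations, z = tau q_t + q solves
    the wave equation z_tt - c^2 Lap z = f with zero initial data, where f consists of
    delta Lap p^(delta)_t and of the difference of the two nonlinearities. The bounds of
    the well-posedness result and the two embeddings make the first term at most
    delta M and the second a multiple of the square root of
    F = |z_t|^2/2 + c^2 |grad z|^2/2 + |q_t|^2/2 + |grad q|^2/2.
    Since tau q_tt = z_t - q_t and tau grad q_t = grad z - grad q, E[q] is at most a
    multiple of F; testing the equation with z_t gives F' <= L F + M^2 delta^2 / 2 almost
    everywhere, and Groenwall's inequality yields E[q] <= C delta^2. As z_t is only a
    bounded function of time with values in H^1_0, the energy identity is obtained from
    L^2-valued absolutely continuous representatives of the time derivatives and from
    Green's formula at almost every fixed time. *)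

From HB Require Import structures.
Require Import Defs.
From mathcomp Require Import all_boot all_order all_algebra.
From mathcomp Require Import all_classical all_reals all_analysis ess_sup_inf.
From mathcomp Require Import measurable_realfun.
From mathcomp Require Import ring lra.
Set Implicit Arguments. Unset Strict Implicit. Unset Printing Implicit Defensive.
Import Order.TTheory GRing.Theory Num.Theory numFieldNormedType.Exports.
Local Open Scope classical_set_scope.
Local Open Scope ring_scope.

(** The combination [tau q_t + q] is forced by the equation: [tau c^2 Lap q_t + c^2 Lap q] is [c^2]
    times its Laplacian. The viscous term is kept on p^(delta), whose Laplacian well-posedness
    bounds uniformly in delta; it is a forcing of size delta, hence gives an energy of size delta^2.
    The energy of z alone does not see q and q_t, which enter the nonlinear difference, so their
    norms are added to F. That difference is split so that each product has a bounded factor from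
    H^2, except p^(0)_tt times q, where p^(0)_tt lies only in H^1_0 and two L^4 bounds are used. The
    obstacle is regularity in time: [dt] is a choice among a.e. equal candidates, and z_t is not
    differentiable in time with values in H^1_0. Everything is therefore reduced to scalar Lipschitz
    functions [ip (u t) g] with an explicit bounded density. Their product rule follows from an
    error bound quadratic in the time step, and grad z is handled as the time primitive of grad z_t
    rather than through an H^1-valued derivative. *)

(** * Elementary inequalities *)

Lemma discriminant_le (R : realFieldType) (a b c : R) : 0 <= c ->
  (forall t, 0 <= a - 2 * t * b + t ^+ 2 * c) -> b ^+ 2 <= a * c.
Proof.
move=> c0 key; have a0 : 0 <= a by have := key 0; rewrite expr0n/=; lra.
have [c00|cn0] := eqVneq c 0.
  have [->|b0] := eqVneq b 0; first by rewrite expr0n mulr_ge0.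
  (* For c = 0 the polynomial is affine in t; at t = (a + 1) / b it equals - a - 2, which is
     negative. *)
  have := key ((a + 1) * b / b ^+ 2); rewrite c00 mulr0 addr0.
  have -> : 2 * ((a + 1) * b / b ^+ 2) * b = 2 * (a + 1) by field.
  by lra.
have cp : 0 < c by rewrite lt_def cn0.
have := key (b / c); have -> : a - 2 * (b / c) * b + (b / c) ^+ 2 * c = a - b ^+ 2 / c by field.
by rewrite subr_ge0 ler_pdivrMr.
Qed.

Lemma sum_cauchy_schwarz (R : realFieldType) I (r : seq I) (a b : I -> R) :
  (\sum_(i <- r) a i * b i) ^+ 2 <= (\sum_(i <- r) a i ^+ 2) * (\sum_(i <- r) b i ^+ 2).
Proof.
apply: discriminant_le => [|t]; first by apply: sumr_ge0 => i _; exact: sqr_ge0.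
suff -> : \sum_(i <- r) a i ^+ 2 - 2 * t * (\sum_(i <- r) a i * b i) +
    t ^+ 2 * (\sum_(i <- r) b i ^+ 2) = \sum_(i <- r) (a i - t * b i) ^+ 2.
  by apply: sumr_ge0 => i _; exact: sqr_ge0.
by rewrite !mulr_sumr -sumrB -big_split/=; apply: eq_bigr => i _; ring.
Qed.

(** Minkowski's inequality for finite families. The hypothesis is an inequality c <= a + b because
    the entries are themselves norms: the triangle inequality passes from the components to the
    gradient, H^1 and H^2 norms. *)
Lemma sqrt_sum_triangle (R : rcfType) I (r : seq I) (a b c : I -> R) :
  (forall i, 0 <= c i <= a i + b i) -> (forall i, 0 <= a i) -> (forall i, 0 <= b i) ->
  Num.sqrt (\sum_(i <- r) c i ^+ 2) <=
  Num.sqrt (\sum_(i <- r) a i ^+ 2) + Num.sqrt (\sum_(i <- r) b i ^+ 2).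
Proof.
move=> cab a0 b0.
have s0 (f : I -> R) : 0 <= \sum_(i <- r) f i ^+ 2.
  by apply: sumr_ge0 => i _; exact: sqr_ge0.
rewrite -ler_sqr ?nnegrE ?addr_ge0 ?sqrtr_ge0// sqrrD !sqr_sqrtr//.
apply: (@le_trans _ _ (\sum_(i <- r) (a i + b i) ^+ 2)).
  apply: ler_sum => i _; have /andP[ci cabi] := cab i.
  by rewrite lerXn2r// nnegrE// addr_ge0.
have -> : \sum_(i <- r) (a i + b i) ^+ 2 = \sum_(i <- r) a i ^+ 2 +
    (\sum_(i <- r) a i * b i) *+ 2 + \sum_(i <- r) b i ^+ 2.
  by rewrite -sumrMnl -!big_split; apply: eq_bigr => i _; rewrite sqrrD.
rewrite lerD2r lerD2l lerMn2r /= -sqrtrM//.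
rewrite -[leLHS]ger0_norm; last by apply: sumr_ge0 => i _; exact: mulr_ge0.
by rewrite -sqrtr_sqr ler_sqrt ?mulr_ge0//; exact: sum_cauchy_schwarz.
Qed.

(** Locked, so that unification never unfolds an inner product into a Lebesgue integral; [ipE] opens
    it on demand. *)
HB.lock Definition ip d (T : measurableType d) (R : realType)
    (mu : {measure set T -> \bar R}) (D : set T) (f g : T -> R) : R :=
  \int[mu]_(x in D) (f x * g x).
Canonical ip_unlockable := Unlockable ip.unlock.

HB.lock Definition nrm d (T : measurableType d) (R : realType)
    (mu : {measure set T -> \bar R}) (D : set T) (f : T -> R) : R :=
  Num.sqrt (ip mu D f f).
Canonical nrm_unlockable := Unlockable nrm.unlock.

(** * Square-integrable functions *)

Section square_integrable.
Context d (T : measurableType d) (R : realType).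
Variables (mu : {measure set T -> \bar R}) (D : set T).
Hypothesis mD : measurable D.
Implicit Types (f g h : T -> R) (a : R).

Definition sqint f := measurable_fun D f /\
  mu.-integrable D (EFin \o (fun x => f x ^+ 2)).

Local Notation ip := (ip mu D).
Local Notation nrm := (nrm mu D).

Lemma ipE f g : ip f g = \int[mu]_(x in D) (f x * g x).
Proof. by rewrite unlock. Qed.

Lemma nrmE f : nrm f = Num.sqrt (ip f f).
Proof. by rewrite [in LHS]unlock. Qed.

Lemma sqint_meas f : sqint f -> measurable_fun D f.
Proof. by case. Qed.

Lemma sqint_mul f g : sqint f -> sqint g ->
  mu.-integrable D (EFin \o (fun x => f x * g x)).
Proof.
move=> [mf f2] [mg g2].
apply: (@le_integrable _ _ _ mu D mD _ (EFin \o (fun x => f x ^+ 2 + g x ^+ 2))).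
- by apply/measurable_EFinP; exact: measurable_funM.
- move=> x _ /=; rewrite lee_fin [X in _ <= X]ger0_norm; last by nra.
  by rewrite ler_norml; apply/andP; split; nra.
- rewrite [X in mu.-integrable D X](_ : _ = (EFin \o (fun x => f x ^+ 2)) \+
    (EFin \o (fun x => g x ^+ 2)))//.
  exact: integrableD.
Qed.

Lemma sqintZ a f : sqint f -> sqint (fun x => a * f x).
Proof.
move=> [mf f2]; split; first exact: measurable_funM.
rewrite [X in mu.-integrable D X](_ : _ =
  (fun x => (a ^+ 2)%:E * (EFin \o (fun x => (f x ^+ 2)%R)) x)%E).
  exact: integrableZl.
by apply/funext => x /=; rewrite exprMn EFinM.
Qed.

Lemma sqintD f g : sqint f -> sqint g -> sqint (fun x => f x + g x).
Proof.
move=> sf sg; have [mf f2] := sf; have [mg g2] := sg.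
split; first exact: measurable_funD.
rewrite [X in mu.-integrable D X](_ : _ = (EFin \o (fun x => f x ^+ 2)%R) \+
   ((fun x => 2%:E * (EFin \o (fun x => f x * g x)%R) x) \+
    (EFin \o (fun x => g x ^+ 2)%R)))%E.
  apply: integrableD => //; apply: integrableD => //.
  by apply: integrableZl => //; exact: sqint_mul.
by apply/funext => x /=; rewrite -!EFinM -!EFinD; congr EFin; ring.
Qed.

Lemma sqintB f g : sqint f -> sqint g -> sqint (fun x => f x - g x).
Proof.
move=> sf /(sqintZ (-1)) sg; have := sqintD sf sg.
by congr sqint; apply/funext => x; rewrite mulN1r.
Qed.

Lemma sqint0 : sqint (fun=> 0).
Proof.
split => //; rewrite [X in mu.-integrable D X](_ : _ = cst 0%E).
  exact: integrable0.
by apply/funext => x /=; rewrite expr0n.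
Qed.

Lemma sqint_sum I (r : seq I) (P : pred I) (F : I -> T -> R) :
  (forall i, P i -> sqint (F i)) -> sqint (fun x => \sum_(i <- r | P i) F i x).
Proof.
move=> sF; elim: r => [|i r IH].
  by under eq_fun do rewrite big_nil; exact: sqint0.
under eq_fun do rewrite big_cons; case: (boolP (P i)) => // Pi.
by apply: sqintD => //; exact: sF.
Qed.

Lemma sqint_bounded_mul f g (M : R) : measurable_fun D f ->
  (forall x, D x -> `|f x| <= M) -> sqint g -> sqint (fun x => f x * g x).
Proof.
move=> mf fM [mg g2]; split; first exact: measurable_funM.
have ig : mu.-integrable D (fun x => (M ^+ 2)%:E * (g x ^+ 2)%:E)%E.
  exact: (integrableZl mD).
apply: (le_integrable mD _ _ ig).
  by apply/measurable_EFinP/measurable_funX; exact: measurable_funM.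
move=> x Dx /=; rewrite lee_fin ger0_norm ?sqr_ge0// ger0_norm; last first.
  by rewrite mulr_ge0 ?sqr_ge0.
rewrite exprMn ler_wpM2r ?sqr_ge0// -(ger0_norm (sqr_ge0 (f x))) normrX.
by apply: lerXn2r; rewrite ?nnegrE ?(le_trans _ (fM x Dx))// fM.
Qed.

Lemma ipC f g : ip f g = ip g f.
Proof. by rewrite !ipE; apply: eq_Rintegral => x _; rewrite mulrC. Qed.

Lemma ipDl f g h : sqint f -> sqint g -> sqint h ->
  ip (fun x => f x + g x) h = ip f h + ip g h.
Proof.
move=> sf sg sh; rewrite !ipE -RintegralD//; try exact: sqint_mul.
by apply: eq_Rintegral => x _; rewrite mulrDl.
Qed.

Lemma ipZl a f g : sqint f -> sqint g -> ip (fun x => a * f x) g = a * ip f g.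
Proof.
move=> sf sg; rewrite !ipE -RintegralZl//; last exact: sqint_mul.
by apply: eq_Rintegral => x _; rewrite mulrA.
Qed.

Lemma ipBl f g h : sqint f -> sqint g -> sqint h ->
  ip (fun x => f x - g x) h = ip f h - ip g h.
Proof.
move=> sf sg sh; rewrite !ipE -RintegralB//; try exact: sqint_mul.
by apply: eq_Rintegral => x _; rewrite mulrBl.
Qed.

Lemma ipDr f g h : sqint f -> sqint g -> sqint h ->
  ip h (fun x => f x + g x) = ip h f + ip h g.
Proof. by move=> *; rewrite ipC ipDl// ipC (ipC g). Qed.

Lemma ipBr f g h : sqint f -> sqint g -> sqint h ->
  ip h (fun x => f x - g x) = ip h f - ip h g.
Proof. by move=> *; rewrite ipC ipBl// ipC (ipC g). Qed.

Lemma ipZr a f g : sqint f -> sqint g -> ip f (fun x => a * g x) = a * ip f g.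
Proof. by move=> *; rewrite ipC ipZl// ipC. Qed.

Lemma ip0l f : ip (fun=> 0) f = 0.
Proof.
rewrite ipE (@eq_Rintegral _ _ _ _ _ (fun=> 0)) ?Rintegral_cst ?mul0r// => x _.
by rewrite mul0r.
Qed.

Lemma ip_suml I (r : seq I) (F : I -> T -> R) g :
  (forall i, sqint (F i)) -> sqint g ->
  ip (fun x => \sum_(i <- r) F i x) g = \sum_(i <- r) ip (F i) g.
Proof.
move=> sF sg; elim: r => [|i r IH].
  by under eq_fun do rewrite big_nil; rewrite big_nil ip0l.
under eq_fun do rewrite big_cons; rewrite big_cons ipDl ?IH//.
exact: sqint_sum.
Qed.

Lemma ip_ge0 f : 0 <= ip f f.
Proof. by rewrite ipE; apply: Rintegral_ge0 => x _; rewrite -expr2 sqr_ge0. Qed.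

Lemma ip_sqB f g : sqint f -> sqint g ->
  ip (fun x => f x - g x) (fun x => f x - g x) =
  ip f f - 2 * ip f g + ip g g.
Proof.
move=> sf sg; have sB := sqintB sf sg.
by rewrite ipBl// !ipBr// (ipC g f); ring.
Qed.

Lemma ip_sqD f g : sqint f -> sqint g ->
  ip (fun x => f x + g x) (fun x => f x + g x) =
  ip f f + 2 * ip f g + ip g g.
Proof.
move=> sf sg; have sB := sqintD sf sg.
by rewrite ipDl// !ipDr// (ipC g f); ring.
Qed.

Lemma nrm_ge0 f : 0 <= nrm f. Proof. by rewrite nrmE sqrtr_ge0. Qed.

Lemma nrm_sqr f : nrm f ^+ 2 = ip f f.
Proof. by rewrite nrmE sqr_sqrtr// ip_ge0. Qed.

Lemma integral_sqr f : sqint f ->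
  (\int[mu]_(x in D) (f x ^+ 2)%:E = (nrm f ^+ 2)%:E)%E.
Proof.
move=> [_ f2]; rewrite nrm_sqr -[LHS](fineK (integrable_fin_num mD f2)).
by rewrite ipE; congr EFin; apply: eq_Rintegral => x _; rewrite expr2.
Qed.

Lemma cauchy_schwarz f g : sqint f -> sqint g -> `|ip f g| <= nrm f * nrm g.
Proof.
move=> sf sg; rewrite -[leRHS]ger0_norm ?mulr_ge0 ?nrm_ge0//.
rewrite -ler_sqr ?nnegrE// !real_normK ?num_real// exprMn !nrm_sqr.
apply: discriminant_le => [|t]; first exact: ip_ge0.
have := ip_ge0 (fun x => f x - (fun x => t * g x) x).
have sZ := sqintZ t sg.
by rewrite ip_sqB// ipZr// ipZl// ipZr//; congr (_ <= _); ring.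
Qed.

Lemma nrmD f g : sqint f -> sqint g -> nrm (fun x => f x + g x) <= nrm f + nrm g.
Proof.
move=> sf sg; rewrite -ler_sqr ?nnegrE ?addr_ge0 ?nrm_ge0//.
rewrite nrm_sqr ip_sqD// sqrrD !nrm_sqr -[_ *+ 2]mulr_natl.
have := le_trans (ler_norm _) (cauchy_schwarz sf sg); lra.
Qed.

Lemma nrmZ a f : sqint f -> nrm (fun x => a * f x) = `|a| * nrm f.
Proof.
move=> sf; rewrite !nrmE ipZl// ?ipZr//; last exact: sqintZ.
by rewrite mulrA -expr2 sqrtrM ?sqr_ge0// sqrtr_sqr.
Qed.

Lemma nrmB f g : sqint f -> sqint g -> nrm (fun x => f x - g x) <= nrm f + nrm g.
Proof.
move=> sf sg; have := nrmD sf (sqintZ (-1) sg).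
rewrite nrmZ// normrN1 mul1r; apply: le_trans.
by rewrite le_eqVlt; apply/orP; left; apply/eqP; congr nrm; apply/funext => x; rewrite mulN1r.
Qed.

Lemma nrmC f g : nrm (fun x => f x - g x) = nrm (fun x => g x - f x).
Proof.
rewrite !nrmE !ipE; congr (Num.sqrt _); apply: eq_Rintegral => x _.
by rewrite -!expr2 -sqrrN opprB.
Qed.

Lemma ler_dist_nrm f g : sqint f -> sqint g ->
  `|nrm f - nrm g| <= nrm (fun x => f x - g x).
Proof.
move=> sf sg; have sB := sqintB sf sg; have sB' := sqintB sg sf.
have /= := nrmD sB sg; have /= := nrmD sB' sf.
rewrite (_ : (fun x => g x - f x + f x) = g); last by apply/funext => x; rewrite subrK.
rewrite (_ : (fun x => f x - g x + g x) = f); last by apply/funext => x; rewrite subrK.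
rewrite nrmC => A B; rewrite ler_norml; apply/andP; split; lra.
Qed.

Definition aeD f g := {ae mu, forall x, D x -> f x = g x}.

Lemma aeD_sym f g : aeD f g -> aeD g f.
Proof. by apply: filterS => x + Dx => /(_ Dx) ->. Qed.

Lemma eq_ipl f f' g : measurable_fun D f -> measurable_fun D f' ->
  measurable_fun D g -> aeD f f' -> ip f g = ip f' g.
Proof.
move=> mf mf' mg ff'; rewrite !ipE; congr fine; apply: ae_eq_integral => //.
- by apply/measurable_EFinP; exact: measurable_funM.
- by apply/measurable_EFinP; exact: measurable_funM.
- by apply: filterS ff' => x + Dx /= => /(_ Dx) ->.
Qed.

Lemma eq_nrm f f' : measurable_fun D f -> measurable_fun D f' ->
  aeD f f' -> nrm f = nrm f'.
Proof.
move=> mf mf' ff'; rewrite !nrmE (eq_ipl mf mf' mf ff') ipC.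
by rewrite (eq_ipl mf mf' mf' ff').
Qed.

Lemma aeD_sqint f f' : measurable_fun D f' -> aeD f f' -> sqint f -> sqint f'.
Proof.
move=> mf' ff' [mf f2]; split => //; apply/integrableP; split.
  by apply/measurable_EFinP; exact: measurable_funX.
have /integrableP[_] := f2; apply: le_lt_trans.
rewrite le_eqVlt; apply/orP; left; apply/eqP; apply: ae_eq_integral => //.
- apply: measurableT_comp => //; apply/measurable_EFinP; exact: measurable_funX.
- apply: measurableT_comp => //; apply/measurable_EFinP; exact: measurable_funX.
- by apply: filterS ff' => x + Dx /= => /(_ Dx) ->.
Qed.

Lemma nrm0_ae f : sqint f -> nrm f = 0 -> aeD f (fun=> 0).
Proof.
move=> sf n0; have i0 : ip f f = 0 by rewrite -nrm_sqr n0 expr0n.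
rewrite ipE in i0.
have [mf f2] := sf.
have : ae_eq mu D (fun x => (f x ^+ 2)%:E) (cst 0%E).
  apply/(ae_eq_integral_abs mu mD).
    by apply/measurable_EFinP; exact: measurable_funX.
  have fin := integrable_fin_num mD f2.
  transitivity (\int[mu]_(x in D) (f x ^+ 2)%:E)%E.
    by apply: eq_integral => x _; rewrite gee0_abs// lee_fin sqr_ge0.
  by rewrite -[LHS](fineK fin); congr EFin.
by apply: filterS => x + Dx => /(_ Dx) /= [] /eqP; rewrite sqrf_eq0 => /eqP.
Qed.

Lemma nrm_aeD f g : sqint f -> sqint g -> nrm (fun x => f x - g x) = 0 -> aeD f g.
Proof.
move=> sf sg /(nrm0_ae (sqintB sf sg)); apply: filterS => x + Dx.
by move=> /(_ Dx)/eqP; rewrite subr_eq0 => /eqP.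
Qed.

Lemma nrm0 : nrm (fun=> 0) = 0.
Proof. by rewrite nrmE ip0l sqrtr0. Qed.

(** The integral is extended-valued, so a single bound yields membership and norm estimate together.
    This is how Fatou's lemma and the embeddings deliver square integrability. *)
Lemma nrm_fin_bound f (M : R) : 0 <= M -> measurable_fun D f ->
  (\int[mu]_(x in D) (f x ^+ 2)%:E <= (M ^+ 2)%:E)%E -> sqint f /\ nrm f <= M.
Proof.
move=> M0 mf fM.
have sf : sqint f.
  split => //; apply/integrableP; split.
    by apply/measurable_EFinP; exact: measurable_funX.
  apply: le_lt_trans (ltry (M ^+ 2)); apply: le_trans fM.
  by under eq_integral do rewrite gee0_abs ?lee_fin ?sqr_ge0//.
split => //; rewrite -ler_sqr ?nnegrE ?nrm_ge0// nrm_sqr -lee_fin.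
apply: le_trans fM; rewrite ipE /Rintegral fineK; last first.
  apply: integrable_fin_num => //; exact: sqint_mul.
by under eq_integral do rewrite -expr2.
Qed.

End square_integrable.

(** * Completeness of L^2 *)

Lemma cvgn_geometric_steps (R : realType) (a : R^nat) (C : R) :
  (forall k, `|a k.+1 - a k| <= C * 2^-1 ^+ k) -> cvgn a.
Proof.
move=> aC; rewrite (_ : a = fun n => a 0%N + series (telescope a) n); last first.
  by apply/funext => n; rewrite -eq_sum_telescope.
apply: is_cvgD; first exact: is_cvg_cst.
apply: normed_cvg; apply: (@series_le_cvg _ _ (geometric C 2^-1)) => //.
- by move=> n /=.
- move=> n; rewrite /= mulr_ge0 ?exprn_ge0//.
  by have := aC 0%N; rewrite expr0 mulr1; exact: le_trans.
- by apply: is_cvg_geometric_series; rewrite ger0_norm ?invr_ge0// invf_lt1 ?ltr1n.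
Qed.

Section completeness.
Context d (T : measurableType d) (R : realType).
Variables (mu : {measure set T -> \bar R}) (D : set T).
Hypothesis mD : measurable D.
Local Notation sqint := (sqint mu D).
Local Notation nrm := (nrm mu D).
Implicit Types f g h : T -> R.

(** With norms of increments at most 4^-k, the weighted squares 4^k |u_(k+1) - u_k|^2 have integrals
    at most 4^-k. Their sum is therefore finite almost everywhere, and where it is finite the
    increments decay like 2^-k. *)
Let fast_cauchy (u : nat -> T -> R) : (forall n, sqint (u n)) ->
  (forall k m, (k <= m)%N -> nrm (fun x => u m x - u k x) <= 4^-1 ^+ k) ->
  {ae mu, forall x, D x -> cvgn (u ^~ x)}.
Proof.
move=> su uC.
pose F k x := ((4 ^+ k * (u k.+1 x - u k x) ^+ 2)%:E : \bar R).
have sB k : sqint (fun x => u k.+1 x - u k x) by exact: sqintB.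
have mF k : measurable_fun D (F k).
  apply/measurable_EFinP/measurable_funM => //; apply: measurable_funX.
  exact: (sqint_meas (sB k)).
have F0 k x : D x -> (0 <= F k x)%E by move=> _; rewrite /F lee_fin mulr_ge0 ?sqr_ge0 ?exprn_ge0.
have iF k : (\int[mu]_(x in D) F k x <= (4^-1 ^+ k)%:E)%E.
  rewrite /F; under eq_integral do rewrite EFinM.
  have i2 := (sB k).2.
  rewrite integralZl// (integral_sqr mD (sB k)) -EFinM lee_fin.
  apply: (@le_trans _ _ (4 ^+ k * (4^-1 ^+ k) ^+ 2)).
    rewrite ler_wpM2l ?exprn_ge0// lerXn2r ?nnegrE ?nrm_ge0 ?exprn_ge0//.
    exact: uC.
  by rewrite expr2 mulrA -exprMn mulfV// expr1n mul1r.
have iS : (\int[mu]_(x in D) \sum_(0 <= k <oo) F k x <= 2%:E)%E.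
  rewrite integral_nneseries//; apply: lime_le.
    by apply: is_cvg_nneseries => k _ _; apply: integral_ge0 => x; exact: F0.
  apply: nearW => n; rewrite (@le_trans _ _ (\sum_(0 <= k < n) 4^-1 ^+ k)%:E)//.
    by rewrite -sumEFin; apply: lee_sum => k _.
  (* This bound is looser than the exact geometric sum but stable under the induction. *)
  rewrite lee_fin; suff : \sum_(0 <= k < n) 4^-1 ^+ k <= 2 - 2 * 4^-1 ^+ n :> R.
    by move/le_trans; apply; rewrite gerBl mulr_ge0 ?exprn_ge0.
  elim: n => [|n IH]; first by rewrite big_nil expr0; lra.
  rewrite big_nat_recr//= (le_trans (lerD IH (lexx _)))// exprSr.
  by have : 0 <= 4^-1 ^+ n :> R; [rewrite exprn_ge0|lra].
have S0 x : D x -> (0 <= \sum_(0 <= k <oo) F k x)%E.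
  by move=> Dx; apply: nneseries_ge0 => k _ _; exact: F0.
have mS : measurable_fun D (fun x => (\sum_(0 <= k <oo) F k x)%E).
  by apply: ge0_emeasurable_sum => // k x Dx _; exact: F0.
have : mu.-integrable D (fun x => (\sum_(0 <= k <oo) F k x)%E).
  apply/integrableP; split => //; apply: le_lt_trans (ltry 2); apply: le_trans iS.
  rewrite le_eqVlt; apply/orP; left; apply/eqP; apply: eq_integral => x /[!inE] Dx.
  by rewrite gee0_abs// S0.
move/(integrable_ae mD); apply: filterS => x + Dx => /(_ Dx) xfin.
pose M := fine (\sum_(0 <= k <oo) F k x)%E.
have M0 : 0 <= M by rewrite fine_ge0// S0.
apply: (@cvgn_geometric_steps _ _ (Num.sqrt M)) => k.
have FM : 4 ^+ k * (u k.+1 x - u k x) ^+ 2 <= M.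
  rewrite -lee_fin /M fineK//.
  apply: le_trans (nneseries_lim_ge k.+1 _); last by move=> i _ _; exact: F0.
  rewrite big_nat_recr//= leeDr//; apply: sume_ge0 => i _; exact: F0.
rewrite -(@ler_pXn2r _ 2)// ?nnegrE ?mulr_ge0 ?exprn_ge0 ?sqrtr_ge0//.
rewrite real_normK ?num_real// exprMn sqr_sqrtr// -exprM mulnC exprM.
rewrite (_ : 2^-1 ^+ 2 = 4^-1 :> R); last by rewrite expr2; lra.
by rewrite exprVn ler_pdivlMr ?exprn_gt0// mulrC.
Qed.

(** Riesz-Fischer: a fast subsequence converges almost everywhere, and Fatou's lemma turns the
    pointwise limit into a limit in norm of the whole sequence. *)
Lemma sqint_complete (f : nat -> T -> R) : (forall n, sqint (f n)) ->
  (forall e, 0 < e -> exists N, forall m n, (N <= m)%N -> (N <= n)%N ->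
     nrm (fun x => f m x - f n x) < e) ->
  exists2 g, sqint g & nrm (fun x => f n x - g x) @[n --> \oo] --> (0 : R).
Proof.
move=> sf fC.
have /choice[N NP] : forall k, exists N, forall m n, (N <= m)%N -> (N <= n)%N ->
    nrm (fun x => f m x - f n x) < 4^-1 ^+ k.
  by move=> k; apply: fC; rewrite exprn_gt0.
(* Summing the thresholds makes the index map nondecreasing and at least [N k]. *)
pose K k := (k + \sum_(j < k.+1) N j)%N.
have NK k : (N k <= K k)%N by rewrite /K big_ord_recr/= addnA leq_addl.
have KK : {homo K : k m / (k <= m)%N}.
  apply: homo_leq; [exact: leqnn|exact: leq_trans|move=> k].
  by rewrite /K leq_add// [leqRHS]big_ord_recr/= leq_addr.
pose u k := f (K k).
have su k : sqint (u k) by exact: sf.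
have uC k m : (k <= m)%N -> nrm (fun x => u m x - u k x) <= 4^-1 ^+ k.
  by move=> km; apply/ltW/NP => //; exact: leq_trans (NK k) (KK _ _ km).
have [Z [mZ Z0 ZP]] := fast_cauchy su uC.
(* Setting the subsequence to 0 on the null set makes it converge everywhere on D, so that its limit
   is measurable. *)
pose v k := u k \_ (~` Z).
have mv k : measurable_fun D (v k).
  apply/(measurable_restrict (u k) (measurableC mZ) mD).
  by apply: measurable_funS (sqint_meas (su k)) => // x [].
have vcvg x : D x -> cvgn (v ^~ x).
  move=> Dx; have [Zx|Zx] := pselect (Z x).
    rewrite (_ : v ^~ x = cst 0); first exact: is_cvg_cst.
    by apply/funext => k; rewrite /v patchE memNset//; exact.
  have -> : v ^~ x = u ^~ x by apply/funext => k; rewrite /v patchE mem_set.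
  by apply: contrapT => nc; apply: Zx; apply: ZP => /(_ Dx).
pose g x := limn (v ^~ x).
have mg : measurable_fun D g.
  by apply: (measurable_fun_cvg mv) => x Dx; exact: vcvg.
have vu k : aeD mu D (v k) (u k).
  exists Z; split => // x /= /not_implyP[Dx]; apply: contra_notP => Zx.
  by rewrite /v patchE mem_set.
(* Fatou's lemma for f_n - v_k as k grows: an eventual bound on f_n - u_k survives in the limit. *)
have key n e : 0 <= e -> (exists K0, forall k, (K0 <= k)%N -> nrm (fun x => f n x - u k x) <= e) ->
    sqint (fun x => f n x - g x) /\ nrm (fun x => f n x - g x) <= e.
  move=> e0 [K0 K0P]; apply: nrm_fin_bound => //.
    by apply: measurable_funB => //; exact: sqint_meas.
  pose h k x := (((f n x - v k x) ^+ 2)%:E : \bar R).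
  have mh k : measurable_fun D (h k).
    apply/measurable_EFinP/measurable_funX/measurable_funB => //.
    exact: (sqint_meas (sf n)).
  have hg x : D x -> limn_einf (h ^~ x) = ((f n x - g x) ^+ 2)%:E.
    move=> Dx; apply: (cvg_limn_einf_sup _).1; apply: cvg_EFin.
      by apply: nearW.
    apply: (@cvg_comp _ _ _ _ (fun y : R => y ^+ 2)); last exact: exprn_continuous.
    by apply: cvgB; [exact: cvg_cst|exact: vcvg].
  under eq_integral => x /[!inE] Dx do rewrite -hg//.
  apply: (le_trans (fatou mu mD mh _)).
    by move=> k x _; rewrite lee_fin sqr_ge0.
  rewrite limn_einf_lim; apply: lime_le; first exact: is_cvg_einfs.
  exists K0 => // k /= Kk.
  apply: (@le_trans _ _ (\int[mu]_(x in D) h k x)%E).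
    by apply: ereal_inf_lbound; exists k => //=.
  have sB := sqintB mD (sf n) (su k); have [_ i2] := sB.
  have -> : (\int[mu]_(x in D) h k x = \int[mu]_(x in D) ((f n x - u k x) ^+ 2)%:E)%E.
    apply: ae_eq_integral => //; first exact: measurable_int i2.
    by apply: filterS (vu k) => x + Dx => /(_ Dx); rewrite /h => ->.
  rewrite (integral_sqr mD sB) lee_fin.
  by rewrite lerXn2r ?nnegrE ?nrm_ge0// K0P.
have far e : 0 < e -> exists N0, forall n, (N0 <= n)%N ->
    sqint (fun x => f n x - g x) /\ nrm (fun x => f n x - g x) <= e.
  move=> e0; have [N0 N0P] := fC e e0; exists N0 => n Nn; apply: key; first exact: ltW.
  exists N0 => k Nk; apply/ltW/N0P => //.
  by rewrite (leq_trans Nk)// leq_addr.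
exists g.
  have [n0 /(_ n0 (leqnn _))[sg _]] := far 1 ltr01.
  rewrite (_ : g = fun x => f n0 x - (f n0 x - g x)); first exact: sqintB.
  by apply/funext => x; rewrite opprB addrC subrK.
apply/cvgrPdist_le => e e0; have [N0 N0P] := far e e0.
exists N0 => // n /= /N0P[_]; rewrite sub0r normrN ger0_norm//; exact: nrm_ge0.
Qed.

End completeness.

(** * The space L^2 of a domain as square-integrable functions *)

Section L2_link.
Context {R : realType} {d : nat}.
Local Notation mu := (@lebesgue_rV R d).
Variable Omega : set 'rV[R]_d.
Hypothesis mO : measurable Omega.
Implicit Types f g : 'rV[R]_d -> R.

Lemma sqr_restrict f x : ((f \_ Omega) x ^+ 2)%:E = ((fun y => (f y ^+ 2)%:E) \_ Omega) x.
Proof. by rewrite !patchE; case: ifP => //; rewrite expr0n. Qed.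

Lemma Lnorm2E f : 'N[mu]_2%:E [EFin \o (f \_ Omega)]%E =
  ((\int[mu]_(x in Omega) (f x ^+ 2)%:E) `^ 2^-1)%E.
Proof.
rewrite unlock; congr poweR; rewrite [RHS]integral_mkcond; apply: eq_integral => x _.
by rewrite -sqr_restrict /= powR_mulrn// real_normK ?num_real.
Qed.

Lemma L2P f : L2 Omega f <-> sqint mu Omega f.
Proof.
split.
  rewrite /L2 /LpOn /= => h; split.
    apply/(measurable_restrictT f mO).
    by have /andP[] := h; rewrite inE.
  have /integrableP[_ h2] := Lfun2_integrable_sqr h.
  have mf : measurable_fun Omega f.
    by apply/(measurable_restrictT f mO); have /andP[] := h; rewrite inE.
  apply/integrableP; split; first by apply/measurable_EFinP/measurable_funX.
  move: h2; apply: le_lt_trans; rewrite integral_mkcond le_eqVlt.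
  apply/orP; left; apply/eqP; apply: eq_integral => x _ /=.
  by rewrite !patchE; case: ifP => //; rewrite expr0n/= normr0.
move=> sf; have [mf f2] := sf; rewrite /L2 /LpOn /=; apply/andP; split.
  by rewrite inE /=; apply/(measurable_restrictT f mO).
rewrite inE /= /finite_norm Lnorm2E (integral_sqr mO sf) poweR_EFin ltry//.
Qed.

Lemma L2normE f : L2 Omega f -> L2norm Omega f = nrm mu Omega f.
Proof.
move=> /L2P sf; rewrite /L2norm /Lpnorm Lnorm2E (integral_sqr mO sf) poweR_EFin /=.
by rewrite powR12_sqrt ?sqr_ge0// sqrtr_sqr ger0_norm// nrm_ge0.
Qed.

Lemma L2norm_ge0 f : 0 <= L2norm Omega f.
Proof. by rewrite fine_ge0// Lnorm_ge0. Qed.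

End L2_link.

(** * Boxes and Borel sets *)

Section boxes.
Context {R : realType} {d : nat}.
Implicit Types (a b x y : 'rV[R]_d) (Omega : set 'rV[R]_d).

Definition obox a b : set 'rV[R]_d := [set x | forall i, a ord0 i < x ord0 i < b ord0 i].
Definition cbox a b : set 'rV[R]_d := [set x | forall i, a ord0 i <= x ord0 i <= b ord0 i].

Lemma obox_cbox a b : obox a b `<=` cbox a b.
Proof. by move=> x xab i; have /andP[/ltW -> /ltW ->] := xab i. Qed.

Let measurable_box (B : 'I_d -> set R) : (forall i, measurable (B i)) ->
  measurable [set x : 'rV[R]_d | forall i, B i (x ord0 i)].
Proof.
move=> mB; rewrite (_ : mkset _ = \bigcap_(i in [set: 'I_d])
    (fun x : 'rV[R]_d => x ord0 i) @^-1` B i); last first.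
  by apply/seteqP; split => x /= xB i; [move=> _|]; apply: xB.
apply: (@fin_bigcap_measurable _ 'rV[R]_d 'I_d) => [|i _]; first exact: finite_finset.
rewrite -[X in measurable X]setTI.
exact: (@measurable_rV_coord _ d i measurableT _ (mB i)).
Qed.

Lemma measurable_obox a b : measurable (obox a b).
Proof.
rewrite (_ : obox a b = [set x | forall i, `]a ord0 i, b ord0 i[%classic (x ord0 i)]).
  by apply: (@measurable_box (fun i => `]a ord0 i, b ord0 i[%classic)) => i; exact: measurable_itv.
by apply/seteqP; split => x h i; have := h i; rewrite /= in_itv.
Qed.

Lemma measurable_cbox a b : measurable (cbox a b).
Proof.
rewrite (_ : cbox a b = [set x | forall i, `[a ord0 i, b ord0 i]%classic (x ord0 i)]).
  by apply: (@measurable_box (fun i => `[a ord0 i, b ord0 i]%classic)) => i; exact: measurable_itv.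
by apply/seteqP; split => x h i; have := h i; rewrite /= in_itv.
Qed.

Lemma compact_cbox a b : compact (cbox a b).
Proof.
rewrite (_ : cbox a b = [set x | forall i, `[a ord0 i, b ord0 i]%classic (x ord0 i)]).
  by apply: (@rV_compact R d (fun i => `[a ord0 i, b ord0 i]%classic)) => i; exact: segment_compact.
by apply/seteqP; split => x h i; have := h i; rewrite /= in_itv.
Qed.

Definition rat_center (p : 'rV[rat]_d * nat) : 'rV[R]_d := \row_i ratr (p.1 ord0 i).
Definition rat_obox p := obox (rat_center p - const_mx p.2.+1%:R^-1) (rat_center p + const_mx p.2.+1%:R^-1).
Definition rat_cbox p := cbox (rat_center p - const_mx p.2.+1%:R^-1) (rat_center p + const_mx p.2.+1%:R^-1).

(** Two boxes are needed: the closed one lies in the open set and can carry a test function, while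
    the open ones form a countable cover. *)
Lemma open_rat_box Omega x : open Omega -> Omega x ->
  exists2 p, rat_cbox p `<=` Omega & rat_obox p x.
Proof.
move=> oO Ox; have /nbhs_ballP[e /= e0 eO] := open_nbhs_nbhs (conj oO Ox).
(* Twice the radius: x and any point of the closed box are each within one radius of the rational
   centre. *)
have [m me] : exists m : nat, 2 * m.+1%:R^-1 < e.
  have [m _ mP] : \forall m \near \oo, m.+1%:R^-1 < e / 2.
    exact: (near_infty_natSinv_lt (PosNum (divr_gt0 e0 (ltr0Sn R 1)))).
  by exists m; have /= := mP m (leqnn _); rewrite ltr_pdivlMr// mulrC.
have m0 : 0 < m.+1%:R^-1 :> R by rewrite invr_gt0.
have aux (y s : R) : 0 < s -> y - s < y + s by move=> s0; lra.
have /choice[q qP] : forall i, exists r : rat,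
    x ord0 i - m.+1%:R^-1 < ratr r < x ord0 i + m.+1%:R^-1.
  move=> i; have [r rP] := @rat_in_itvoo R (x ord0 i - m.+1%:R^-1) (x ord0 i + m.+1%:R^-1) (aux _ _ m0).
  by exists r; move: rP; rewrite in_itv.
exists (\row_i q i, m).
  move=> y yB; apply: eO; split => // i j; rewrite (ord1 i).
  have := yB j; have := qP j; rewrite !mxE /=.
  rewrite /ball /=; move: (m.+1%:R^-1) me => s me /andP[A B] /andP[C D].
  by rewrite ltr_norml; apply/andP; split; lra.
move=> i; have := qP i; rewrite !mxE /=.
by move: (m.+1%:R^-1) => s /andP[A B]; apply/andP; split; lra.
Qed.

Lemma open_bigcup_rat_box Omega : open Omega ->
  Omega = \bigcup_(p in [set p | rat_cbox p `<=` Omega]) rat_obox p.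
Proof.
move=> oO; apply/seteqP; split => [x Ox|x [p pO] /obox_cbox/pO//].
by have [p pO px] := open_rat_box oO Ox; exists p.
Qed.

Lemma open_measurable_rV Omega : open Omega -> measurable Omega.
Proof.
move=> oO; rewrite (open_bigcup_rat_box oO).
rewrite bigcup_mkcond; apply: (@countable_bigcupT_measurable _ 'rV[R]_d) => // p.
case: ifP => // _; exact: measurable_obox.
Qed.

Lemma continuous_measurable_rV (f : 'rV[R]_d -> R) :
  continuous f -> measurable_fun [set: 'rV[R]_d] f.
Proof.
move=> cf; apply: (measurability _ (RGenOpens.measurableE R)) => // _ [_ [a [b ->]] <-].
rewrite setTI; apply: open_measurable_rV.
by move/continuousP : cf; apply; exact: interval_open.
Qed.

End boxes.

(** * Test functions *)

Section smooth.
Context {R : realType}.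
Implicit Types (f g : R -> R) (a c s t x : R) (k n : nat).

(** Derivatives are given as functions instead of through [derive1n], so that closure under sums,
    products and compositions is a plain induction; [smoothP] converts to the library notion. *)
Fixpoint has_derivs k f : Prop := if k is k'.+1 then
  exists g, (forall x, is_derive x 1 f (g x)) /\ has_derivs k' g else True.

Definition smooth f := forall k, has_derivs k f.

Lemma has_derivsW k f : has_derivs k.+1 f -> has_derivs k f.
Proof.
by elim: k f => // k IH f [g [fg gk]]; exists g; split => //; exact: IH.
Qed.

Lemma smoothP f : smooth f <-> forall k x, derivable (derive1n k f) x 1.
Proof.
split=> [sf k|].
  elim: k f sf => [|k IH] f sf x; first by have [g [fg _]] := sf 1%N; exact: ex_derive.
  have [g [fg _]] := sf 1%N.
  have f'E : f^`()%classic = g.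
    by apply/funext => y; rewrite derive1E; apply: derive_val.
  rewrite derive1Sn f'E; apply: IH => j.
  have [g' [fg' gj]] := sf j.+1; suff -> : g = g' by [].
  by apply/funext => y; have := @derive_val _ _ _ _ _ _ _ (fg y); rewrite derive_val.
move=> df k; elim: k f df => // k IH f df; exists f^`()%classic; split.
  by move=> x; rewrite derive1E; apply/derivableP; exact: (df 0%N).
by apply: IH => j x; rewrite -derive1Sn; exact: df.
Qed.

Lemma smooth_derive1 f : smooth f -> smooth f^`()%classic.
Proof. by move=> /smoothP df; apply/smoothP => k x; rewrite -derive1Sn; exact: df. Qed.

Lemma smooth_is_derive f x : smooth f -> is_derive x 1 f (f^`()%classic x).
Proof. by move=> /smoothP /(_ 0%N x) df; rewrite derive1E; exact/derivableP. Qed.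

Lemma smooth_continuous f : smooth f -> continuous f.
Proof.
move=> /smoothP df x; apply: differentiable_continuous.
exact/derivable1_diffP/(df 0%N).
Qed.

Lemma has_derivs_cst k a : has_derivs k (fun=> a).
Proof.
by elim: k a => // k IH a; exists (fun=> 0); split => [x|]; [exact: is_derive_cst|].
Qed.

Lemma has_derivsD k f g : has_derivs k f -> has_derivs k g ->
  has_derivs k (fun x => f x + g x).
Proof.
elim: k f g => // k IH f g [f' [ff' kf']] [g' [gg' kg']].
exists (fun x => f' x + g' x); split; last exact: IH.
by move=> x; apply: is_deriveD.
Qed.

Lemma has_derivsM k f g : has_derivs k f -> has_derivs k g ->
  has_derivs k (fun x => f x * g x).
Proof.
elim: k f g => // k IH f g kf kg.
have [f' [ff' kf']] := kf; have [g' [gg' kg']] := kg.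
exists (fun x => f x * g' x + g x * f' x); split.
  by move=> x; apply: is_deriveM.
by apply: has_derivsD; apply: IH => //; exact: has_derivsW.
Qed.

Lemma has_derivsZ k a f : has_derivs k f -> has_derivs k (fun x => a * f x).
Proof. by apply: has_derivsM; exact: has_derivs_cst. Qed.

Lemma has_derivs_affine k f s t : has_derivs k f -> has_derivs k (fun x => f (s * x + t)).
Proof.
elim: k f => // k IH f [f' [ff' kf']].
exists (fun x => s * f' (s * x + t)); split; last exact/has_derivsZ/IH.
move=> x; rewrite mulrC.
have -> : (fun x => f (s * x + t)) = f \o (fun x => s * x + t) by [].
apply: is_derive1_comp.
have ds : is_derive x 1 (fun y => s * y) s.
  have := @is_deriveZ _ _ _ id s x 1 1 (is_derive_id _ _).
  by rewrite /GRing.scale /= mulr1.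
have := is_deriveD ds (is_derive_cst t x 1).
by rewrite addr0.
Qed.

(** The classical exp(- c / x), extended by 0. The extra factor x^-n makes the family closed under
    differentiation, and letting c tend to 0 turns the bumps below into indicators. *)
Definition flat c n x : R := if 0 < x then x^-1 ^+ n * expR (- c * x^-1) else 0.

Lemma flat_ge0 c n x : 0 <= flat c n x.
Proof. by rewrite /flat; case: ifP => // x0; rewrite mulr_ge0 ?expR_ge0 ?exprn_ge0 ?invr_ge0 ?ltW. Qed.

(** The exponential dominates the term of degree n + 2 of its series. A quadratic bound suffices for
    the difference quotient at 0 to vanish in the limit. *)
Lemma flat_quadratic c n x : 0 < c -> `|flat c n x| <= (n.+2)`!%:R / c ^+ n.+2 * x ^+ 2.
Proof.
move=> c0; rewrite ger0_norm ?flat_ge0// /flat; case: ifPn => x0; last first.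
  by rewrite mulr_ge0 ?sqr_ge0// divr_ge0// exprn_ge0// ltW.
have u0 : 0 < x^-1 by rewrite invr_gt0.
rewrite mulNr expRN; have := @expR_ge1Dxn _ (c * x^-1) n.+1 (ltW (mulr_gt0 c0 u0)).
set E := expR _; set F := (n.+2)`!%:R => EF.
have F0 : 0 < F by rewrite ltr0n fact_gt0.
have E0 : 0 < E by exact: expR_gt0.
have EF' : (c * x^-1) ^+ n.+2 / F <= E by apply: le_trans EF; rewrite lerDr.
rewrite ler_pdivrMr// -[leLHS]mul1r.
have -> : x ^+ 2 = x^-1 ^- 2 by rewrite exprVn invrK.
rewrite mulrAC -ler_pdivrMr ?invr_gt0 ?exprn_gt0//.
apply: (@le_trans _ _ (F / c ^+ n.+2 * ((c * x^-1) ^+ n.+2 / F))); last first.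
  by rewrite ler_pM2l// divr_gt0// exprn_gt0.
rewrite le_eqVlt; apply/orP; left; apply/eqP.
rewrite /F; move: (fact_gt0 n.+2) u0; rewrite -(ltr0n R) -(addn2 n).
move: (_`!%:R : R) (x^-1) => G u G0 u0; rewrite exprMn !exprD.
by field; rewrite !gt_eqF// ?exprn_gt0.
Qed.

Lemma is_derive_flat c n x : 0 < c ->
  is_derive x 1 (flat c n) (c * flat c n.+2 x - n%:R * flat c n.+1 x).
Proof.
move=> c0; have [x0|x0|<-] := ltgtP 0 x.
(* For positive x the function is [g] composed with the inverse; for negative x it is locally 0; at
   0 the quadratic bound decides. *)
- pose g (u : R) := u ^+ n * expR (- c * u).
  have gx : is_derive (x^-1) 1 g (n%:R * x^-1 ^+ n.-1 * expR (- c * x^-1) - c * (x^-1 ^+ n * expR (- c * x^-1))).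
    have d1 : is_derive x^-1 1 (fun u : R => u ^+ n) (n%:R * x^-1 ^+ n.-1).
      have := @is_deriveX _ _ id n x^-1 1 1 (is_derive_id _ _).
      by rewrite exprfctE /GRing.scale /= mulr1.
    have d2 : is_derive x^-1 1 (fun u => expR (- c * u)) (expR (- c * x^-1) * - c).
      apply: (@is_derive1_comp _ expR (fun u => - c * u)).
      have := @is_deriveZ _ _ _ id (- c) x^-1 1 1 (is_derive_id _ _).
      by rewrite /GRing.scale /= mulr1.
    have := is_deriveM d1 d2; congr is_derive; rewrite /GRing.scale /=; ring.
  apply: (@near_eq_is_derive _ _ _ (g \o (fun y => y^-1))).
    near=> y; rewrite /g /flat /= ifT//; near: y; exact: (lt_nbhsr x0).
  rewrite {1 2}/flat !x0; set E := expR _.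
  have -> : c * (x^-1 ^+ n.+2 * E) - n%:R * (x^-1 ^+ n.+1 * E) =
     (n%:R * x^-1 ^+ n.-1 * E - c * (x^-1 ^+ n * E)) * (- x ^- 2).
    have -> : x ^- 2 = x^-1 ^+ 2 by rewrite exprVn.
    case: (n) => [|m]; first by rewrite /= !expr0; ring.
    by rewrite /= !exprS; ring.
  apply: is_derive1_comp => //.
  have := @is_deriveV _ id x 1 1 (lt0r_neq0 x0) (is_derive_id _ _).
  by rewrite /GRing.scale /= mulr1.
- rewrite /flat !ifF ?(lt_gtF x0)// !mulr0 subrr.
  apply: (near_eq_is_derive _ (is_derive_cst (0 : R) x 1)).
  near=> y; rewrite ifF//; apply/negbTE; rewrite -leNgt ltW//; near: y; exact: (lt_nbhsl x0).
- rewrite {2 3}/flat ltxx !mulr0 subrr.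
  have lim0 : h^-1 *: ((flat c n \o shift 0) (h *: (1 : R)) - flat c n 0) @[h --> 0^'] --> (0 : R).
    rewrite {2}/flat ltxx.
    set K := (n.+2)`!%:R / c ^+ n.+2 : R.
    have K0 : 0 <= K by rewrite divr_ge0// exprn_ge0// ltW.
    apply: norm_cvg0; apply: (squeeze_cvgr (f := fun=> 0) (h := fun h => K * `|h|)).
    + near=> h; rewrite normr_ge0/= subr0 addr0 /GRing.scale/= mulr1 normrM normfV.
      have h0 : h != 0 by near: h; exact: nbhs_dnbhs_neq.
      rewrite ler_pdivrMl ?normr_gt0// (le_trans (flat_quadratic n h c0))//.
      by rewrite -/K -(real_normK (num_real h)) expr2 mulrCA.
    + exact: cvg_cst.
    + rewrite -[X in _ --> X](mulr0 K); apply: cvgMr; rewrite -[X in _ --> X](@normr0 _ R).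
      by apply: cvg_norm; exact: nbhs_dnbhs.
  by split; [apply/cvg_ex; exists 0|exact: cvg_lim].
Unshelve. all: end_near.
Qed.

Lemma smooth_flat c n : 0 < c -> smooth (flat c n).
Proof.
move=> c0 k; elim: k n => // k IH n.
exists (fun x => c * flat c n.+2 x - n%:R * flat c n.+1 x); split.
  by move=> x; exact: is_derive_flat.
have -> : (fun x => c * flat c n.+2 x - n%:R * flat c n.+1 x) =
  (fun x => c * flat c n.+2 x + (- n%:R) * flat c n.+1 x).
  by apply/funext => x; rewrite mulNr.
by apply: has_derivsD; apply: has_derivsZ.
Qed.

(** One flat factor vanishes left of a, the other right of b. The written coefficients 1 and -1
    match the affine substitution of [has_derivs_affine]. *)
Definition bump n a b x : R :=
  flat n.+1%:R^-1 0 (1 * x - a) * flat n.+1%:R^-1 0 (-1 * x + b).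

Lemma smooth_bump n a b : smooth (bump n a b).
Proof.
by move=> k; apply: has_derivsM; apply: has_derivs_affine; apply: smooth_flat; rewrite invr_gt0.
Qed.

Lemma bump_ge0 n a b x : 0 <= bump n a b x.
Proof. by rewrite mulr_ge0// flat_ge0. Qed.

Lemma flat_le1 c x : 0 <= c -> flat c 0 x <= 1.
Proof.
move=> c0; rewrite /flat; case: ifPn => // x0.
by rewrite expr0 mul1r expR_le1 mulNr oppr_le0 mulr_ge0// invr_ge0 ltW.
Qed.

Lemma bump_le1 n a b x : bump n a b x <= 1.
Proof.
have c0 : 0 <= n.+1%:R^-1 :> R by rewrite invr_ge0.
by rewrite -[leRHS]mulr1 ler_pM ?flat_ge0 ?flat_le1.
Qed.

Lemma bump_out n a b x : ~~ (a < x < b) -> bump n a b x = 0.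
Proof.
rewrite negb_and -!leNgt /bump /flat => /orP[xa|bx].
  have -> : (0 < 1 * x - a) = false by apply/negbTE; rewrite -leNgt; lra.
  by rewrite mul0r.
have -> : (0 < -1 * x + b) = false by apply/negbTE; rewrite -leNgt; lra.
by rewrite mulr0.
Qed.

Lemma bump_cvg a b x : bump n a b x @[n --> \oo] --> (\1_`]a, b[%classic x : R).
Proof.
have [axb|/negPf naxb] := boolP (a < x < b); last first.
  rewrite indicE memNset; last by rewrite /= in_itv /= naxb.
  under eq_fun do rewrite bump_out ?naxb//.
  exact: cvg_cst.
rewrite indicE mem_set; last by rewrite /= in_itv.
have flat_cvg y : 0 < y -> flat n.+1%:R^-1 0 y @[n --> \oo] --> (1 : R).
  move=> y0; rewrite /flat y0.
  under eq_fun do rewrite expr0 mul1r.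
  suff : expR (- n.+1%:R^-1 * y^-1) @[n --> \oo] --> expR (0 : R) by rewrite expR0.
  apply: (cvg_comp _ expR); last exact: continuous_expR.
  have : - n.+1%:R^-1 * y^-1 @[n --> \oo] --> - 0 * y^-1.
    by apply: cvgMl; apply: cvgN; exact: cvg_harmonic.
  by rewrite oppr0 mul0r.
have /andP[ax xb] := axb.
rewrite (_ : nat_of_bool true = 1%N)// -[X in _ --> X](mulr1 (1 : R)).
by apply: cvgM; apply: flat_cvg; lra.
Qed.

End smooth.

Section line_derivative.
Context {R : realType} {V : normedModType R}.

Lemma is_derive_line (f : V -> R) (x v : V) (df : R) :
  is_derive (0 : R) (1 : R) (fun h => f (h *: v + x)) df -> is_derive x v f df.
Proof.
pose g (h : R) := f (h *: v + x).
have E : (fun h : R => h^-1 *: ((g \o shift 0) (h *: (1 : R)) - g 0)) =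
         (fun h : R => h^-1 *: ((f \o shift x) (h *: v) - f x)).
  apply/funext => h; rewrite /g /= scale0r add0r addr0.
  by rewrite [h%:A]mulr1.
case; rewrite /derivable /derive -/g => c l.
by split; rewrite /derivable /derive -E.
Qed.

End line_derivative.

Section tensor_products.
Context {R : realType} {d : nat}.
Implicit Types (f : 'I_d -> R -> R) (x a b : 'rV[R]_d) (i j : 'I_d).

Definition tprod f x : R := \prod_i f i (x ord0 i).

Lemma continuous_tprod f : (forall i, continuous (f i)) -> continuous (tprod f).
Proof.
move=> cf; rewrite /tprod; elim: (index_enum _) => [|i r IH].
  rewrite (_ : (fun _ => _) = cst 1); first exact: cst_continuous.
  by apply/funext => x; rewrite big_nil.
under eq_fun do rewrite big_cons.
move=> x; apply: continuousM; last exact: IH.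
apply: (@continuous_comp _ _ _ (fun x : 'rV[R]_d => x ord0 i) (f i)).
  exact: coord_continuous.
exact: cf.
Qed.

Lemma is_derive_tprod f j x : (forall i, smooth (f i)) ->
  is_derive x (delta_mx ord0 j) (tprod f)
    (tprod (fun i => if i == j then (f j)^`()%classic else f i) x).
Proof.
move=> sf; apply: is_derive_line.
rewrite /tprod (bigD1 j)//= eqxx.
under [X in _ * X]eq_bigr => i /negPf ij do rewrite ij.
set C := (X in _ * X).
have -> : (fun h : R => \prod_i f i ((h *: delta_mx ord0 j + x) ord0 i)) =
    (fun h : R => f j (h + x ord0 j) * C).
  apply/funext => h; rewrite (bigD1 j)//= !mxE !eqxx/= mulr1; congr (_ * _).
  by apply: eq_bigr => i ij; rewrite !mxE (negPf ij) andbF mulr0 add0r.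
have dj : is_derive (0 : R) (1 : R) (fun h => f j (h + x ord0 j)) ((f j)^`()%classic (x ord0 j)).
  have := @is_derive1_comp _ (f j) (fun h => h + x ord0 j) 0 ((f j)^`()%classic (x ord0 j)) 1.
  rewrite mulr1 add0r; apply; first exact: smooth_is_derive.
  have := is_deriveD (is_derive_id (0 : R) 1) (is_derive_cst (x ord0 j) (0 : R) 1).
  by rewrite addr0.
have := is_deriveM dj (is_derive_cst C (0 : R) 1).
by rewrite scaler0 add0r; congr is_derive; rewrite /GRing.scale /= mulrC.
Qed.

Lemma Ck_tprod k f : (forall i, smooth (f i)) -> Ck k (tprod f).
Proof.
elim: k f => [|k IH] f sf; (split; first by apply: continuous_tprod => i; exact: smooth_continuous) => //.
split=> [i x|i]; first exact: (@ex_derive _ _ _ _ _ _ _ (is_derive_tprod i x sf)).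
have -> : pderiv i (tprod f) = tprod (fun j => if j == i then (f i)^`()%classic else f j).
  by apply/funext => x; rewrite /pderiv (@derive_val _ _ _ _ _ _ _ (is_derive_tprod i x sf)).
by apply: IH => j; case: ifP => // _; exact: smooth_derive1.
Qed.

Definition tbump n a b := tprod (fun i => bump n (a ord0 i) (b ord0 i)).

Lemma tbump_bound n a b x : 0 <= tbump n a b x <= 1.
Proof.
rewrite /tbump /tprod; elim/big_ind : _ => [|u v /andP[u0 u1] /andP[v0 v1]|i _].
- by rewrite ler01 lexx.
- by rewrite mulr_ge0//= -[leRHS]mulr1 ler_pM.
- by rewrite bump_ge0 bump_le1.
Qed.

Lemma test_fun_tbump (Omega : set 'rV[R]_d) n a b : cbox a b `<=` Omega ->
  test_fun Omega (tbump n a b).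
Proof.
move=> abO; split; first by move=> k; apply: Ck_tprod => i; exact: smooth_bump.
exists (cbox a b); split => //; first exact: compact_cbox.
move=> x xab; have [i xi] : exists i, ~~ (a ord0 i < x ord0 i < b ord0 i).
  apply: contrapT => nx; apply: xab; apply: obox_cbox => i.
  by apply/negPn/negP => xi; apply: nx; exists i.
by rewrite /tbump /tprod (bigD1 i)//= bump_out ?mul0r.
Qed.

Lemma tbump_cvg a b x : tbump n a b x @[n --> \oo] --> (\1_(obox a b) x : R).
Proof.
have -> : \1_(obox a b) x = \prod_i \1_`]a ord0 i, b ord0 i[%classic (x ord0 i) :> R.
  rewrite indicE; have [xab|xab] := boolP (x \in obox a b).
    rewrite big1// => i _; rewrite indicE mem_set//= in_itv /=.
    by move: xab; rewrite inE => /(_ i).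
  have [i xi] : exists i, ~~ (a ord0 i < x ord0 i < b ord0 i).
    apply: contrapT => nx; move/negP : xab; apply; rewrite inE => i.
    by apply/negPn/negP => xi; apply: nx; exists i.
  by rewrite (bigD1 i)//= indicE memNset ?mul0r//= in_itv/=; exact/negP.
rewrite /tbump /tprod; elim: (index_enum _) => [|i r IH].
  by under eq_fun do rewrite big_nil; rewrite big_nil; exact: cvg_cst.
under eq_fun do rewrite big_cons; rewrite big_cons; apply: cvgM => //.
exact: bump_cvg.
Qed.

End tensor_products.

(** * The fundamental lemma of the calculus of variations *)

Section fundamental_lemma.
Context {R : realType} {d : nat}.
Local Notation mu := (@lebesgue_rV R d).
Implicit Types (a b x : 'rV[R]_d) (Omega : set 'rV[R]_d) (h : 'rV[R]_d -> R).

Definition oboxes : set (set 'rV[R]_d) := [set A | exists a b, A = obox a b].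

Definition rowmax a a' : 'rV[R]_d := \row_i Num.max (a ord0 i) (a' ord0 i).
Definition rowmin a a' : 'rV[R]_d := \row_i Num.min (a ord0 i) (a' ord0 i).

Lemma setI_obox a b a' b' :
  obox a b `&` obox a' b' = obox (rowmax a a') (rowmin b b').
Proof.
apply/seteqP; split => x /=.
  move=> [xab xab'] i; rewrite !mxE gt_max lt_min.
  by have /andP[-> ->] := xab i; have /andP[-> ->] := xab' i.
move=> xI; split => i; have := xI i; rewrite !mxE gt_max lt_min.
  by move=> /andP[/andP[-> _] /andP[-> _]].
by move=> /andP[/andP[_ ->] /andP[_ ->]].
Qed.

Lemma cbox_rowmaxmin a b a' b' : cbox (rowmax a a') (rowmin b b') `<=` cbox a b.
Proof.
move=> x xI i; have := xI i; rewrite !mxE ge_max le_min.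
by move=> /andP[/andP[-> _] /andP[-> _]].
Qed.

Lemma setI_closed_oboxes : setI_closed oboxes.
Proof. by move=> _ _ [a [b ->]] [a' [b' ->]]; rewrite setI_obox; do 2 eexists. Qed.

(** Open boxes are stable under intersection, so this identity opens the way to a Dynkin-class
    argument on the coordinate sigma-algebra. *)
Lemma measurable_rV_oboxes : @measurable _ 'rV[R]_d = <<s oboxes >>.
Proof.
apply/seteqP; split; last first.
  apply: smallest_sub; first exact: sigma_algebra_measurable.
  by move=> _ [a [b ->]]; exact: measurable_obox.
apply: smallest_sub; first exact: (@sigma_algebra_measurable _ (g_sigma_algebraType oboxes)).
move=> A; rewrite -bigcup_seq => -[i _ /= [B mB <-]].
suff : measurable_fun [set: g_sigma_algebraType oboxes]
    (fun x : g_sigma_algebraType oboxes => (x : 'rV[R]_d) ord0 i).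
  by move=> /(_ measurableT B mB).
apply: (measurability _ (RGenOInfty.measurableE R)) => // _ [_ [r ->] <-].
(* An open half-space is the increasing union of boxes bounded by m in every other direction. *)
rewrite setTI (_ : _ @^-1` _ = \bigcup_m obox
  (\row_j (if j == i then r else - m%:R)) (const_mx m%:R)); last first.
  apply/seteqP; split => [x /=|x [m _] /(_ i)]; last first.
    by rewrite !mxE eqxx /= in_itv /= andbT => /andP[].
  rewrite in_itv /= andbT => rx.
  have [m mP] : exists m : nat, forall j, `|x ord0 j| < m%:R.
    exists (Num.truncn (\sum_j `|x ord0 j|)).+1 => j.
    apply: le_lt_trans (truncnS_gt _).
    by rewrite (bigD1 j)//= lerDl sumr_ge0.
  exists m => // j; rewrite !mxE; have := mP j; rewrite ltr_norml => /andP[xm ->].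
  by case: eqP => [->|_]; rewrite ?rx ?xm.
apply: (@bigcupT_measurable _ (g_sigma_algebraType oboxes)) => m.
by apply: sub_sigma_algebra; do 2 eexists.
Qed.

(** The smooth bumps lie between 0 and 1 and converge to the indicator of the open box, so dominated
    convergence with majorant |h| applies. *)
Lemma test_fun_integral_obox Omega h a b : measurable Omega ->
  mu.-integrable Omega (EFin \o h) ->
  (forall phi, test_fun Omega phi -> \int[mu]_(x in Omega) (h x * phi x) = 0) ->
  cbox a b `<=` Omega -> (\int[mu]_(x in obox a b) (h x)%:E = 0)%E.
Proof.
move=> mO ih h0 abO; have mh := measurable_int _ ih.
have obO : obox a b `<=` Omega by exact: subset_trans (@obox_cbox _ _ _ _) abO.
have mtb n : measurable_fun Omega (tbump n a b).
  apply: (measurable_funS measurableT) => //; apply: continuous_measurable_rV.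
  by apply: continuous_tprod => i; exact/smooth_continuous/smooth_bump.
have mf n : measurable_fun Omega (fun x => (h x * tbump n a b x)%:E).
  by apply/measurable_EFinP/measurable_funM => //; exact/measurable_EFinP.
have tb_le n x : (`|(h x * tbump n a b x)%:E| <= `|(h x)%:E|)%E.
  rewrite lee_fin normrM ler_piMr// ger0_norm; by have /andP[] := tbump_bound n a b x.
have -> : (\int[mu]_(x in obox a b) (h x)%:E = \int[mu]_(x in Omega) ((EFin \o h) \_ (obox a b)) x)%E.
  by rewrite -integral_mkcondr setIidr.
have [||||_ _] := @dominated_convergence _ _ _ mu Omega mO
   (fun n x => (h x * tbump n a b x)%:E) ((EFin \o h) \_ (obox a b)) (abse \o (EFin \o h)) mf.
- apply/(measurable_restrict _ _ mO); first exact: measurable_obox.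
  by apply: measurable_funS mh => // x [].
- apply: nearW => x _.
  have -> : ((EFin \o h) \_ (obox a b)) x = (h x * \1_(obox a b) x)%:E.
    by rewrite patchE indicE; case: ifP => _; rewrite ?mulr1 ?mulr0.
  by apply: cvg_EFin; [exact: nearW|apply: cvgMr; exact: tbump_cvg].
- exact: integrable_abse.
- by apply: nearW => x n _ /=; exact: tb_le.
have int0 n : (\int[mu]_(x in Omega) (h x * tbump n a b x)%:E = 0)%E.
  have i1 : mu.-integrable Omega (fun x => (h x * tbump n a b x)%:E).
    by apply: (le_integrable mO (mf n) _ ih) => x _; exact: tb_le.
  rewrite -[LHS](fineK (integrable_fin_num mO i1)); congr EFin.
  exact/h0/test_fun_tbump.
rewrite (_ : [sequence _]_n = cst 0%E); last by apply/funext => n; exact: int0.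
by move=> /cvg_lim; rewrite lim_cst// => <-.
Qed.

(** Inside a fixed rational box the measurable sets over which h integrates to 0 form a Dynkin class
    containing all boxes, hence all measurable sets. Thus h vanishes a.e. on that box, and countably
    many such boxes cover the open set. *)
Lemma fundamental_lemma Omega h : open Omega ->
  mu.-integrable Omega (EFin \o h) ->
  (forall phi, test_fun Omega phi -> \int[mu]_(x in Omega) (h x * phi x) = 0) ->
  {ae mu, forall x, Omega x -> h x = 0}.
Proof.
move=> oO ih h0; have mO := open_measurable_rV oO.
have box0 p : rat_cbox p `<=` Omega -> {ae mu, forall x, rat_obox p x -> h x = 0}.
  move=> pO.
  have sub : rat_obox p `<=` Omega by exact: subset_trans (@obox_cbox _ _ _ _) pO.
  have mB : measurable (rat_obox p : set 'rV[R]_d) by rewrite /rat_obox; exact: measurable_obox.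
  have iB : mu.-integrable (rat_obox p) (EFin \o h) by exact: integrableS ih.
  have iI S : measurable S -> mu.-integrable (rat_obox p `&` S) (EFin \o h).
    by move=> mS; apply: integrableS iB => //; exact: measurableI.
  have H S : measurable S -> (\int[mu]_(x in rat_obox p `&` S) (h x)%:E = 0)%E.
    move=> mS.
    have GS : <<s oboxes >> S by rewrite -measurable_rV_oboxes.
    apply: (dynkin_induction (P := [set S | (\int[mu]_(x in rat_obox p `&` S) (h x)%:E = 0)%E])
      measurable_rV_oboxes setI_closed_oboxes _ _ _ _ GS) => /=.
    - by rewrite setIT; exact: (test_fun_integral_obox mO ih h0 pO).
    - move=> _ [a [b ->]] /=.
      rewrite setI_obox; apply: (test_fun_integral_obox mO ih h0).
      by apply: subset_trans pO; exact: cbox_rowmaxmin.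
    - move=> S' mS' S'0.
      have : (\int[mu]_(x in rat_obox p) (h x)%:E = 0)%E.
        exact: (test_fun_integral_obox mO ih h0 pO).
      rewrite -{1}(setIT (rat_obox p)) -(setUv S') setIUr integral_setU//.
      + by rewrite S'0 add0e.
      + exact: measurableI.
      + by apply: measurableI => //; exact: measurableC.
      + by rewrite -setIUr setUv setIT; exact: measurable_int iB.
      + by apply/disj_set2P; rewrite setIACA setICr setI0.
    - move=> F mF tF F0; rewrite setI_bigcupr.
      rewrite integral_bigcup.
      + by rewrite eseries0// => i _ _; exact: F0.
      + exact: trivIset_setIl.
      + by move=> i; exact: measurableI.
      + rewrite -setI_bigcupr; apply: iI; exact: bigcupT_measurable.
  have := @integral_ae_eq _ _ _ mu _ mB (cst 0%E) (EFin \o h) iB (measurable_cst _).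
  have mem E : E `<=` rat_obox p -> measurable E ->
      (\int[mu]_(x in E) (EFin \o h) x = \int[mu]_(x in E) (cst 0 x))%E.
    by move=> EB mE; rewrite integral0 -(setIidr EB); exact: H.
  by move=> /(_ mem); apply: filterS => x + px => /(_ px) [].
(* Countable intersections of full sets are indexed by naturals, hence the enumeration of box
   indices by [unpickle]. *)
have : {ae mu, forall x, forall n p, unpickle n = Some p -> rat_cbox p `<=` Omega ->
    rat_obox p x -> h x = 0}.
  apply: ae_foralln => n; case E : (unpickle n) => [q|]; last by apply: nearW => x p.
  have [qO|qO] := pselect (rat_cbox q `<=` Omega); last first.
    by apply: nearW => x p [<-].
  by apply: filterS (box0 q qO) => x xh p [<-].
apply: filterS => x xP Ox; have [p pO px] := open_rat_box oO Ox.
by apply: (xP (pickle p) p) => //; rewrite pickleK.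
Qed.

End fundamental_lemma.

(** * Integration by parts for compactly supported functions *)

Section slices.
Context {R : realType} {V W : normedModType R}.

Lemma is_derive_slice (f : V -> R) (g : W -> R) x v y w (df : R) :
  (forall h : R, g (h *: w + y) = f (h *: v + x)) ->
  is_derive x v f df -> is_derive y w g df.
Proof.
move=> gf; have E : (fun h : R => h^-1 *: ((g \o shift y) (h *: w) - g y)) =
         (fun h : R => h^-1 *: ((f \o shift x) (h *: v) - f x)).
  apply/funext => h /=; rewrite gf; congr (_ *: (_ - _)).
  by have := gf 0; rewrite !scale0r !add0r.
case; rewrite /derivable /derive => c l.
by split; rewrite /derivable /derive E.
Qed.

End slices.

Section bounded_support.
Context {R : realType}.
Implicit Types (n : nat) (M : R).

(** Support in a cube, expressed coordinatewise so that it is inherited by the slices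
    [rV_cons (a, x)]. *)
Definition supported_in n M (F : 'rV[R]_n -> R) :=
  forall x : 'rV[R]_n, (exists i, M < `|x ord0 i|) -> F x = 0.

Lemma supported_in_cbox n M (F : 'rV[R]_n -> R) : supported_in M F ->
  forall x, ~ cbox (const_mx (- M)) (const_mx M) x -> F x = 0.
Proof.
move=> sF x xM; apply: sF; apply: contrapT => nx; apply: xM => i.
rewrite !mxE -ler_norml leNgt; apply/negP => xi; apply: nx; by exists i.
Qed.

Lemma bounded_supported n M (F : 'rV[R]_n -> R) : continuous F -> supported_in M F ->
  exists2 C, 0 <= C & forall x, `|F x| <= C.
Proof.
move=> cF sF; set B := cbox (const_mx (- M) : 'rV[R]_n) (const_mx M).
have /compact_bounded[C [_ CP]] : compact (F @` B).
  by apply: continuous_compact; [exact: continuous_subspaceT|exact: compact_cbox].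
exists (`|C| + 1); first by rewrite addr_ge0.
move=> x; have [xB|xB] := pselect (B x); last first.
  by rewrite (supported_in_cbox sF xB) normr0 addr_ge0.
have /CP : C < `|C| + 1 by rewrite (le_lt_trans (ler_norm C))// ltrDl.
by apply; exists x.
Qed.

Lemma lebesgue_rV_cbox n (a b : 'rV[R]_n) : (forall i, a ord0 i <= b ord0 i) ->
  lebesgue_rV n (cbox a b) = (\prod_i (b ord0 i - a ord0 i))%:E.
Proof. exact: lebesgue_rV_box. Qed.

Lemma integrable_supported n M (F : 'rV[R]_n -> R) : continuous F -> supported_in M F ->
  (lebesgue_rV n).-integrable [set: 'rV[R]_n] (EFin \o F).
Proof.
move=> cF sF; have [C C0 FC] := bounded_supported cF sF.
have -> : F = F \_ (cbox (const_mx (- M)) (const_mx M)).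
  apply/funext => x; rewrite patchE; case: ifPn => // /negP xB.
  by apply: (supported_in_cbox sF); rewrite inE in xB.
have mB : measurable (cbox (const_mx (- M)) (const_mx M) : set 'rV[R]_n).
  exact: measurable_cbox.
have mF : measurable_fun [set: 'rV[R]_n] F by exact: continuous_measurable_rV.
have fin : (lebesgue_rV n (cbox (const_mx (- M)%R) (const_mx M) : set 'rV[R]_n) < +oo)%E.
  have [M0|M0] := leP 0 M.
    by rewrite lebesgue_rV_cbox ?ltry// => i; rewrite !mxE; lra.
  (* For negative M the cube is empty in positive dimension, but it is the whole one-point space in
     dimension 0. *)
  case: n {F cF sF FC mB mF} => [|n].
    rewrite (_ : cbox _ _ = cbox 0 0); first by rewrite lebesgue_rV_cbox ?ltry// => -[].
    by apply/seteqP; split => x _ [].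
  rewrite (_ : cbox _ _ = set0) ?measure0 ?ltry//.
  by rewrite -subset0 => x /(_ ord0); rewrite !mxE => /andP[]; lra.
rewrite -restrict_EFin; apply: (integrable_mkcond (EFin \o F) mB).1.
apply: measurable_bounded_integrable => //.
- exact: measurable_funS mF.
- by exists C; split; [exact: num_real|move=> y Cy x _; exact: le_trans (FC x) (ltW Cy)].
Qed.

Lemma supported_pderiv n M (F : 'rV[R]_n -> R) j :
  supported_in M F -> supported_in M (pderiv j F).
Proof.
move=> sF x [i xi].
have dF : is_derive x (delta_mx ord0 j) F (0 : R).
  apply: (near_eq_is_derive _ (is_derive_cst (0 : R) x (delta_mx ord0 _))).
  have /open_nbhs_nbhs : open_nbhs x [set y : 'rV[R]_n | M < `|y ord0 i|].
    split => //; rewrite (_ : mkset _ = (fun y : 'rV[R]_n => `|y ord0 i|) @^-1` [set r | M < r])//.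
    apply: open_comp; last exact: open_gt.
    move=> y _; apply: (@continuous_comp _ _ _ (fun x : 'rV[R]_n => x ord0 i) Num.norm).
      exact: coord_continuous.
    exact: norm_continuous.
  by apply: filterS => y yi; rewrite sF//; exists i.
by rewrite /pderiv (@derive_val _ _ _ _ _ _ _ dF).
Qed.

Lemma rV_cons_line0 n (a h : R) (x : 'rV[R]_n) :
  rV_cons (h + a, x) = h *: delta_mx ord0 ord0 + rV_cons (a, x).
Proof.
apply/rowP => i; rewrite !mxE; case: (unliftP ord0 i) => [j|] -> /=; rewrite ?mulr0 ?add0r ?mulr1//.
Qed.

Lemma rV_cons_lineS n (a h : R) (x : 'rV[R]_n) j :
  rV_cons (a, h *: delta_mx ord0 j + x) = h *: delta_mx ord0 (lift ord0 j) + rV_cons (a, x).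
Proof.
apply/rowP => i; rewrite !mxE; case: (unliftP ord0 i) => [k|] -> /=.
  by rewrite !mxE (inj_eq lift_inj).
by rewrite mulr0 add0r.
Qed.

Lemma continuous_rV_cons n a : continuous (fun x : 'rV[R]_n => rV_cons (a, x)).
Proof.
move=> x; have FF : Filter (nbhs x) := nbhs_filter x.
apply/cvg_ballP => e e0; apply: filterS (nbhsx_ballx x e e0) => y [_ xy].
split => // i j; rewrite !mxE.
case: (unliftP ord0 j) => [k|] _ /=; last exact: ballxx.
exact: xy.
Qed.

Lemma continuous_rV_cons0 n (x : 'rV[R]_n) : continuous (fun a : R => rV_cons (a, x)).
Proof.
move=> a; apply/cvg_ballP => e e0; apply: filterS (nbhsx_ballx a e e0) => b ab.
split => // i j; rewrite !mxE.
case: (unliftP ord0 j) => [k|] _ /=; first exact: ballxx.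
exact: ab.
Qed.

Lemma integral_derive_supported (f g : R -> R) M : continuous g ->
  (forall a : R, is_derive a (1 : R) f (g a)) -> (forall a, M < `|a| -> f a = 0 /\ g a = 0) ->
  (\int[lebesgue_measure]_a (g a)%:E = 0)%E.
Proof.
move=> cg fg fg0; pose N := `|M| + 1.
have N0 : 0 < N by rewrite ltr_wpDl.
have MN : M < N by rewrite (le_lt_trans (ler_norm M))// ltrDl.
have -> : (\int[lebesgue_measure]_a (g a)%:E = \int[lebesgue_measure]_(a in `[(- N)%R, N]) (g a)%:E)%E.
  rewrite [RHS]integral_mkcond; apply: eq_integral => a _; rewrite patchE.
  case: ifPn => // /negP aN; rewrite (fg0 a _).2//; apply: (lt_trans MN).
  rewrite ltNge; apply/negP => aN'; apply: aN; rewrite inE /= in_itv/=.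
  by rewrite -ler_norml.
have cf : continuous f.
  move=> a; apply: differentiable_continuous; apply/derivable1_diffP.
  exact: (@ex_derive _ _ _ _ _ _ _ (fg a)).
rewrite (@continuous_FTC2 _ g f).
- by rewrite !(fg0 _ _).1 ?subee// ?normrN gtr0_norm.
- by rewrite gtrN.
- exact: continuous_subspaceT.
- split => [a _||]; first exact: (@ex_derive _ _ _ _ _ _ _ (fg a)).
    by apply: cvg_at_right_filter; exact: cf.
  by apply: cvg_at_left_filter; exact: cf.
- by move=> a _; rewrite derive1E (@derive_val _ _ _ _ _ _ _ (fg a)).
Qed.

(** Induction on the dimension with Fubini's theorem. The measure is a pushforward of a product
    through [rV_cons], and the direction j decides which integral is taken first. *)
Lemma integral_pderiv_supported n (j : 'I_n) (F : 'rV[R]_n -> R) M :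
  continuous F -> supported_in M F ->
  (forall x, derivable F x (delta_mx ord0 j)) -> continuous (pderiv j F) ->
  (\int[lebesgue_rV n]_x (pderiv j F x)%:E = 0)%E.
Proof.
elim: n j F => [|n IH] j F cF sF dF cG; first by have := ltn_ord j.
have sG := supported_pderiv j sF.
have iG := integrable_supported cG sG.
have mG : measurable_fun [set: 'rV[R]_n.+1] (EFin \o pderiv j F).
  exact: measurable_int iG.
have iGc : (@lebesgue_measure R \x lebesgue_rV n)%E.-integrable setT
    ((EFin \o pderiv j F) \o @rV_cons R n).
  apply/integrableP; split.
    by apply: measurableT_comp => //; exact: measurable_rV_cons.
  have /integrableP[_] := iG; apply: le_lt_trans.
  rewrite le_eqVlt; apply/orP; left; apply/eqP; symmetry.
  apply: (@ge0_integral_pushforward _ _ _ _ R _ (@measurable_rV_cons R n)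
    (@lebesgue_measure R \x lebesgue_rV n)%E setT (abse \o (EFin \o pderiv j F))) => //.
    exact: measurableT_comp.
  by move=> y _; rewrite /= lee_fin.
transitivity (\int[(@lebesgue_measure R \x lebesgue_rV n)%E]_z
    ((EFin \o pderiv j F) \o @rV_cons R n) z)%E.
  exact: (integral_pushforward (@measurable_rV_cons R n) mG iGc).
(* If j is not the first coordinate, the inner integral over the others vanishes by induction. If it
   is, the inner integral over the first coordinate vanishes by the fundamental theorem of
   calculus. *)
have [j' jE|jE] := unliftP ord0 j; subst j.
  rewrite -integral12_prod_meas1//; apply: integral0_eq => a _.
  rewrite /fubini_F /=.
  have dFa x : is_derive x (delta_mx ord0 j') (fun x => F (rV_cons (a, x)))
      (pderiv (lift ord0 j') F (rV_cons (a, x))).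
    apply: (is_derive_slice _ (derivableP (dF _))) => h.
    by rewrite rV_cons_lineS.
  have E : pderiv j' (fun x => F (rV_cons (a, x))) = (fun x => pderiv (lift ord0 j') F (rV_cons (a, x))).
    by apply/funext => x; rewrite {1}/pderiv (@derive_val _ _ _ _ _ _ _ (dFa x)).
  rewrite -[RHS](IH j' (fun x => F (rV_cons (a, x)))) ?E//.
  - by move=> x; apply: continuous_comp; [exact: continuous_rV_cons|exact: cF].
  - by move=> x [i xi]; apply: sF; exists (lift ord0 i); rewrite mxE liftK.
  - by move=> x; apply: continuous_comp; [exact: continuous_rV_cons|exact: cG].
rewrite -integral21_prod_meas1//; apply: integral0_eq => x _; rewrite /fubini_G /=.
apply: (@integral_derive_supported (fun a => F (rV_cons (a, x))) _ M).
- by move=> a; apply: continuous_comp; [exact: continuous_rV_cons0|exact: cG].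
- move=> a; apply: (is_derive_slice _ (derivableP (dF _))) => h.
  by rewrite -rV_cons_line0 [h%:A]mulr1.
- move=> a Ma; split; [apply: sF|apply: sG]; exists ord0; by rewrite mxE unlift_none.
Qed.

End bounded_support.

Section test_functions.
Context {R : realType} {d : nat}.
Local Notation mu := (@lebesgue_rV R d).
Variable Omega : set 'rV[R]_d.
Implicit Types (phi psi : 'rV[R]_d -> R) (i : 'I_d).

Lemma test_fun_continuous phi : test_fun Omega phi -> continuous phi.
Proof. by move=> [/(_ 0%N)[]]. Qed.

Lemma test_fun_derivable phi i x : test_fun Omega phi -> derivable phi x (delta_mx ord0 i).
Proof. by move=> [/(_ 1%N)[_ [+ _]] _]. Qed.

Lemma test_fun_out phi x : test_fun Omega phi -> ~ Omega x -> phi x = 0.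
Proof. by move=> [_ [K [_ KO out]]] Ox; apply: out => /KO. Qed.

Lemma test_fun_supported phi : test_fun Omega phi -> exists M, supported_in M phi.
Proof.
move=> [_ [K [/compact_bounded[M [_ MP]] _ out]]]; exists (`|M| + 1) => x [i xi].
apply: out => Kx; have /MP/(_ x Kx) : M < `|M| + 1.
  by rewrite (le_lt_trans (ler_norm M))// ltrDl.
apply/negP; rewrite -ltNge; apply: (lt_le_trans xi).
rewrite leNgt; apply/negP => xlt.
have : ball (0 : 'rV[R]_d) `|x ord0 i| x by rewrite mx_norm_ball /ball_ /= sub0r normrN.
by move=> [_ /(_ ord0 i)]; rewrite /ball /= mxE sub0r normrN ltxx.
Qed.

Lemma test_fun_pderiv phi i : test_fun Omega phi -> test_fun Omega (pderiv i phi).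
Proof.
move=> [Cphi [K [cK KO out]]]; split.
  by move=> k; have [_ [_ /(_ i)]] := Cphi k.+1.
exists K; split => // x Kx.
have dphi : is_derive x (delta_mx ord0 i) phi (0 : R).
  apply: (near_eq_is_derive _ (is_derive_cst (0 : R) x (delta_mx ord0 _))).
  have /open_nbhs_nbhs : open_nbhs x (~` K).
    split => //; apply: closed_openC; exact: (compact_closed (@norm_hausdorff _ _) cK).
  by apply: filterS => y Ky; rewrite out.
by rewrite /pderiv (@derive_val _ _ _ _ _ _ _ dphi).
Qed.

Lemma test_fun_L2 phi : measurable Omega -> test_fun Omega phi -> L2 Omega phi.
Proof.
move=> mO tphi; apply/(L2P mO); have cphi := test_fun_continuous tphi.
have [M sM] := test_fun_supported tphi.
have mphi := continuous_measurable_rV cphi.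
split; first exact: measurable_funS mphi.
apply: (@integrableS _ _ _ mu setT Omega) => //.
apply: (@integrable_supported _ _ M).
  by move=> x; apply: (@continuous_comp _ _ _ phi (fun y : R => y ^+ 2));
     [exact: cphi|exact: exprn_continuous].
by move=> x /sM ->; rewrite expr0n.
Qed.

(** The derivative of the product phi psi has compact support and integral 0. This makes classical
    and weak derivatives of test functions agree. *)
Lemma weak_pderiv_test_fun phi i : measurable Omega -> test_fun Omega phi ->
  weak_pderiv Omega i phi (pderiv i phi).
Proof.
move=> mO tphi psi tpsi.
have cphi := test_fun_continuous tphi; have cpsi := test_fun_continuous tpsi.
have cdphi := test_fun_continuous (test_fun_pderiv i tphi).
have cdpsi := test_fun_continuous (test_fun_pderiv i tpsi).
have [M sM] := test_fun_supported tphi.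
have dF x : is_derive x (delta_mx ord0 i) (fun x => phi x * psi x)
    (phi x * pderiv i psi x + psi x * pderiv i phi x).
  by apply: is_deriveM; apply: derivableP; exact: test_fun_derivable.
have E : pderiv i (fun x => phi x * psi x) =
    (fun x => phi x * pderiv i psi x + pderiv i phi x * psi x).
  apply/funext => x; rewrite {1}/pderiv (@derive_val _ _ _ _ _ _ _ (dF x)).
  by rewrite [psi x * _]mulrC.
have c1 : continuous (fun x => phi x * pderiv i psi x).
  by move=> x; apply: continuousM; [exact: cphi|exact: cdpsi].
have c2 : continuous (fun x => pderiv i phi x * psi x).
  by move=> x; apply: continuousM; [exact: cdphi|exact: cpsi].
have s1 : supported_in M (fun x => phi x * pderiv i psi x).
  by move=> x /sM ->; rewrite mul0r.
have s2 : supported_in M (fun x => pderiv i phi x * psi x).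
  by move=> x /(supported_pderiv i sM) ->; rewrite mul0r.
have := @integral_pderiv_supported _ _ i (fun x => phi x * psi x) M.
rewrite E => int0.
have {}int0 : \int[mu]_x (phi x * pderiv i psi x + pderiv i phi x * psi x) = 0.
  rewrite /Rintegral int0//.
  - by move=> x; apply: continuousM; [exact: cphi|exact: cpsi].
  - by move=> x /sM ->; rewrite mul0r.
  - by move=> x; exact: (continuousD (c1 x) (c2 x)).
move: int0; rewrite RintegralD//; last 2 first.
- exact: integrable_supported s1.
- exact: integrable_supported s2.
have toT f : (forall x, ~ Omega x -> f x = 0) -> \int[mu]_(x in Omega) f x = \int[mu]_x f x.
  move=> fO; rewrite Rintegral_mkcond; congr (Rintegral _ _ _); apply/funext => x.
  by rewrite patchE; case: ifPn => // /negP; rewrite inE => /fO.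
rewrite !toT => [/eqP| |]; first by rewrite addr_eq0 => /eqP.
- by move=> x Ox; rewrite (test_fun_out tpsi Ox) mulr0.
- by move=> x Ox; rewrite (test_fun_out tphi Ox) mul0r.
Qed.

End test_functions.

(** * Weak derivatives and Sobolev spaces *)

Section weak_derivatives.
Context {R : realType} {d : nat}.
Local Notation mu := (@lebesgue_rV R d).
Variable Omega : set 'rV[R]_d.
Hypotheses (oO : open Omega) (fO : (mu Omega < +oo)%E).
Implicit Types (f g h phi psi : 'rV[R]_d -> R) (i j : 'I_d) (a b : R).
Local Notation sq := (sqint mu Omega).
Local Notation "f =O g" := (aeD mu Omega f g) (at level 70).

Let mO : measurable Omega. Proof. exact: open_measurable_rV. Qed.

Lemma sqint_integrable f : sq f -> mu.-integrable Omega (EFin \o f).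
Proof.
move=> sf; have s1 : sq (cst 1).
  split => //; rewrite [X in mu.-integrable _ X](_ : _ = EFin \o cst 1); last first.
    by apply/funext => x /=; rewrite expr1n.
  apply: measurable_bounded_integrable => //.
  by exists 1; split => // y y1 x _ /=; rewrite normr1 ltW.
have := sqint_mul mO sf s1; congr (mu.-integrable _ _).
by apply/funext => x /=; rewrite mulr1.
Qed.

Lemma sqint_bounded f M : measurable_fun Omega f -> (forall x, Omega x -> `|f x| <= M) -> sq f.
Proof.
move=> mf fM; split => //; apply: measurable_bounded_integrable => //.
  exact: measurable_funX.
exists (M ^+ 2); split; first exact: num_real.
move=> y My x Ox /=; rewrite normrX (le_trans _ (ltW My))// lerXn2r ?nnegrE ?fM//.
by rewrite (le_trans _ (fM x Ox)).
Qed.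

Lemma test_fun_sqint phi : test_fun Omega phi -> sq phi.
Proof. by move=> tphi; apply/(L2P mO); exact: test_fun_L2. Qed.

Lemma test_fun_pderiv_sqint i phi : test_fun Omega phi -> sq (pderiv i phi).
Proof. by move=> tphi; exact/test_fun_sqint/test_fun_pderiv. Qed.

Lemma weak_pderiv_unique i f g h : sq g -> sq h ->
  weak_pderiv Omega i f g -> weak_pderiv Omega i f h -> g =O h.
Proof.
move=> sg sh wg wh.
have gh0 : {ae mu, forall x, Omega x -> g x - h x = 0}.
  apply: (fundamental_lemma oO); first exact/sqint_integrable/(sqintB mO).
  move=> phi tphi; have := ipBl mO sg sh (test_fun_sqint tphi); rewrite !ipE => ->.
  by apply/eqP; rewrite subr_eq0 -eqr_opp -(wg _ tphi) -(wh _ tphi).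
by apply: filterS gh0 => x + Ox => /(_ Ox)/eqP; rewrite subr_eq0 => /eqP.
Qed.

Lemma weak_pderivD i f f' g g' : sq f -> sq f' -> sq g -> sq g' ->
  weak_pderiv Omega i f f' -> weak_pderiv Omega i g g' ->
  weak_pderiv Omega i (fun x => f x + g x) (fun x => f' x + g' x).
Proof.
move=> sf sf' sg sg' wf wg phi tphi.
have := ipDl mO sf sg (test_fun_pderiv_sqint i tphi); rewrite !ipE => ->.
have := ipDl mO sf' sg' (test_fun_sqint tphi); rewrite !ipE => ->.
by rewrite (wf _ tphi) (wg _ tphi) opprD.
Qed.

Lemma weak_pderivZ i a f f' : sq f -> sq f' ->
  weak_pderiv Omega i f f' -> weak_pderiv Omega i (fun x => a * f x) (fun x => a * f' x).
Proof.
move=> sf sf' wf phi tphi.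
have := ipZl mO a sf (test_fun_pderiv_sqint i tphi); rewrite !ipE => ->.
have := ipZl mO a sf' (test_fun_sqint tphi); rewrite !ipE => ->.
by rewrite (wf _ tphi) mulrN.
Qed.

Lemma eq_weak_pderiv i f g h : sq f -> sq g -> f =O g ->
  weak_pderiv Omega i f h -> weak_pderiv Omega i g h.
Proof.
move=> sf sg fg wf phi tphi; rewrite -(wf _ tphi).
have sphi := test_fun_pderiv_sqint i tphi.
by have := eq_ipl mO (sqint_meas sg) (sqint_meas sf) (sqint_meas sphi) (aeD_sym fg); rewrite !ipE.
Qed.

Definition weakly_derivable i f := exists g, L2 Omega g /\ weak_pderiv Omega i f g.

Lemma wDP i f : weakly_derivable i f ->
  sq (wD Omega i f) /\ weak_pderiv Omega i f (wD Omega i f).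
Proof.
by move=> /(@xgetPex _ (cst 0))[L w]; split => //; apply/(L2P mO).
Qed.

Lemma wD_sqint i f : sq (wD Omega i f).
Proof.
have [/wDP[]//|nw] := pselect (weakly_derivable i f).
rewrite /wD xgetPN; first exact: sqint0.
by move=> g ?; apply: nw; exists g.
Qed.

Lemma wD_ae i f g : sq g -> weak_pderiv Omega i f g -> wD Omega i f =O g.
Proof.
move=> sg wg; have [s w] : sq (wD Omega i f) /\ weak_pderiv Omega i f (wD Omega i f).
  by apply: wDP; exists g; split => //; apply/(L2P mO).
exact: weak_pderiv_unique s sg w wg.
Qed.

(** A true equality, not one a.e.: the derivative is picked from the set of admissible candidates,
    and functions equal a.e. have the same set. *)
Lemma eq_wD i f g : sq f -> sq g -> f =O g -> wD Omega i f = wD Omega i g.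
Proof.
move=> sf sg fg; rewrite /wD; congr xget; apply/seteqP; split => h [Lh w]; split => //.
  exact: eq_weak_pderiv w.
by apply: eq_weak_pderiv w => //; exact: aeD_sym.
Qed.

Lemma wD_test_fun i phi : test_fun Omega phi -> wD Omega i phi =O pderiv i phi.
Proof.
by move=> tphi; apply: wD_ae; [exact: test_fun_pderiv_sqint|exact: weak_pderiv_test_fun].
Qed.

Lemma H1P f : H1 Omega f <-> sq f /\ forall i, weakly_derivable i f.
Proof. by split=> -[sf wf]; (split; [exact/(L2P mO)|]). Qed.

Lemma H1_sqint f : H1 Omega f -> sq f.
Proof. by move=> /H1P[]. Qed.

Lemma H1D f g : H1 Omega f -> H1 Omega g -> H1 Omega (fun x => f x + g x).
Proof.
move=> /H1P[sf wf] /H1P[sg wg]; apply/H1P; split; first exact: sqintD.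
move=> i; have [s w] := wDP (wf i); have [s' w'] := wDP (wg i).
exists (fun x => wD Omega i f x + wD Omega i g x); split; last exact: weak_pderivD.
by apply/(L2P mO); exact: sqintD.
Qed.

Lemma H1Z a f : H1 Omega f -> H1 Omega (fun x => a * f x).
Proof.
move=> /H1P[sf wf]; apply/H1P; split; first exact: sqintZ.
move=> i; have [s w] := wDP (wf i).
exists (fun x => a * wD Omega i f x); split; last exact: weak_pderivZ.
by apply/(L2P mO); exact: sqintZ.
Qed.

Lemma wDD i f g : H1 Omega f -> H1 Omega g ->
  wD Omega i (fun x => f x + g x) =O (fun x => wD Omega i f x + wD Omega i g x).
Proof.
move=> /H1P[sf wf] /H1P[sg wg].
have [s w] := wDP (wf i); have [s' w'] := wDP (wg i).
by apply: wD_ae; [exact: sqintD|exact: weak_pderivD].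
Qed.

Lemma wDZ i a f : H1 Omega f -> wD Omega i (fun x => a * f x) =O (fun x => a * wD Omega i f x).
Proof.
move=> /H1P[sf wf]; have [s w] := wDP (wf i).
by apply: wD_ae; [exact: sqintZ|exact: weak_pderivZ].
Qed.

Lemma eq_H1 f g : sq g -> f =O g -> H1 Omega f -> H1 Omega g.
Proof.
move=> sg fg /H1P[sf wf]; apply/H1P; split => // i; have [h [Lh wh]] := wf i.
by exists h; split => //; exact: eq_weak_pderiv wh.
Qed.

Lemma test_fun_H1 phi : test_fun Omega phi -> H1 Omega phi.
Proof.
move=> tphi; apply/H1P; split; first exact: test_fun_sqint.
move=> i; exists (pderiv i phi); split; last exact: weak_pderiv_test_fun.
by apply/(L2P mO); exact: test_fun_pderiv_sqint.
Qed.

Lemma CkD k f g : Ck k f -> Ck k g -> Ck k (fun x => f x + g x).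
Proof.
elim: k f g => [|k IH] f g /= [cf Cf] [cg Cg]; (split; first by move=> x; exact: (continuousD (cf x) (cg x))) => //.
have [df Cf'] := Cf; have [dg Cg'] := Cg; split=> [i x|i]; first exact: derivableD.
have -> : pderiv i (fun x => f x + g x) = (fun x => pderiv i f x + pderiv i g x).
  by apply/funext => x; rewrite /pderiv; exact: deriveD.
exact: IH.
Qed.

Lemma CkZ k a f : Ck k f -> Ck k (fun x => a * f x).
Proof.
elim: k f => [|k IH] f /= [cf Cf]; (split; first by move=> x; apply: continuousM; [exact: cst_continuous|exact: cf]) => //.
have [df Cf'] := Cf; split=> [i x|i]; first exact: derivableZ.
have -> : pderiv i (fun x => a * f x) = (fun x => a * pderiv i f x).
  by apply/funext => x; rewrite /pderiv; exact: deriveZ.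
exact: IH.
Qed.

Lemma test_funD phi psi : test_fun Omega phi -> test_fun Omega psi ->
  test_fun Omega (fun x => phi x + psi x).
Proof.
move=> [Cphi [K [cK KO Kout]]] [Cpsi [L [cL LO Lout]]]; split.
  by move=> k; apply: CkD.
exists (K `|` L); split; [exact: compactU|by move=> x []; auto|].
by move=> x /not_orP[Kx Lx]; rewrite Kout// Lout// addr0.
Qed.

Lemma test_funZ a phi : test_fun Omega phi -> test_fun Omega (fun x => a * phi x).
Proof.
move=> [Cphi [K [cK KO Kout]]]; split; first by move=> k; apply: CkZ.
by exists K; split => // x /Kout ->; rewrite mulr0.
Qed.

End weak_derivatives.

(** * Sobolev norms, Green's formula and embeddings *)

Section sobolev_spaces.
Context {R : realType} {d : nat}.
Local Notation mu := (@lebesgue_rV R d).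
Variable Omega : set 'rV[R]_d.
Hypotheses (oO : open Omega) (fO : (mu Omega < +oo)%E).
Implicit Types (f g h phi psi : 'rV[R]_d -> R) (i j : 'I_d) (a b : R).
Local Notation sq := (sqint mu Omega).
Local Notation nr := (nrm mu Omega).
Local Notation ip := (ip mu Omega).
Local Notation "f =O g" := (aeD mu Omega f g) (at level 70).

Let mO : measurable Omega. Proof. exact: open_measurable_rV. Qed.
Let sqwD i f : sq (wD Omega i f). Proof. exact: wD_sqint. Qed.
Let H1sq f : H1 Omega f -> sq f. Proof. exact: H1_sqint. Qed.

Lemma L2norm_nrm f : sq f -> L2norm Omega f = nr f.
Proof. by move=> sf; apply: L2normE => //; apply/(L2P mO). Qed.

Lemma gradnormE f : gradnorm Omega f = Num.sqrt (\sum_i nr (wD Omega i f) ^+ 2).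
Proof.
by rewrite /gradnorm; congr Num.sqrt; apply: eq_bigr => i _; rewrite L2norm_nrm.
Qed.

Lemma H1normE f : sq f -> H1norm Omega f = Num.sqrt (nr f ^+ 2 + gradnorm Omega f ^+ 2).
Proof. by move=> sf; rewrite /H1norm L2norm_nrm. Qed.

Lemma gradnorm_ge0 f : 0 <= gradnorm Omega f. Proof. exact: sqrtr_ge0. Qed.

Lemma H1norm_ge0 f : 0 <= H1norm Omega f. Proof. exact: sqrtr_ge0. Qed.

Lemma gradnorm_sqr f : gradnorm Omega f ^+ 2 = \sum_i nr (wD Omega i f) ^+ 2.
Proof. by rewrite gradnormE sqr_sqrtr// sumr_ge0// => i _; exact: sqr_ge0. Qed.

Lemma H1norm_sqr f : sq f -> H1norm Omega f ^+ 2 = nr f ^+ 2 + gradnorm Omega f ^+ 2.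
Proof.
move=> sf; rewrite (H1normE sf) sqr_sqrtr//.
by apply: addr_ge0; exact: sqr_ge0.
Qed.

Lemma eq_gradnorm f g : sq f -> sq g -> f =O g -> gradnorm Omega f = gradnorm Omega g.
Proof.
move=> sf sg fg; rewrite (gradnormE f) (gradnormE g); congr (Num.sqrt _).
by apply: eq_bigr => i _; rewrite (eq_wD oO i sf sg fg).
Qed.

Lemma nrm_wD_le i f : nr (wD Omega i f) <= gradnorm Omega f.
Proof.
rewrite -ler_sqr ?nnegrE ?nrm_ge0 ?gradnorm_ge0// gradnorm_sqr (bigD1 i)//= lerDl.
by apply: sumr_ge0 => j _; exact: sqr_ge0.
Qed.

Lemma gradnormD f g : H1 Omega f -> H1 Omega g ->
  gradnorm Omega (fun x => f x + g x) <= gradnorm Omega f + gradnorm Omega g.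
Proof.
move=> Hf Hg; rewrite (gradnormE f) (gradnormE g) gradnormE; apply: sqrt_sum_triangle => i; try exact: nrm_ge0.
rewrite nrm_ge0/= (eq_nrm mO (sqint_meas (sqwD _ _)) _ (wDD oO fO i Hf Hg)).
  exact: nrmD.
by apply: sqint_meas; exact: sqintD.
Qed.

Lemma gradnormZ a f : H1 Omega f -> gradnorm Omega (fun x => a * f x) = `|a| * gradnorm Omega f.
Proof.
move=> Hf; apply/eqP; rewrite -(@eqrXn2 _ 2) ?mulr_ge0 ?gradnorm_ge0//; apply/eqP.
rewrite exprMn !gradnorm_sqr mulr_sumr; apply: eq_bigr => i _.
rewrite (eq_nrm mO (sqint_meas (sqwD _ _)) _ (wDZ oO fO i a Hf)).
  by rewrite nrmZ// exprMn.
by apply: sqint_meas; exact: sqintZ.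
Qed.

Lemma eq_H1norm f g : sq f -> sq g -> f =O g -> H1norm Omega f = H1norm Omega g.
Proof.
move=> sf sg fg; rewrite (H1normE sf) (H1normE sg) (eq_gradnorm sf sg fg).
by rewrite (eq_nrm mO (sqint_meas sf) (sqint_meas sg) fg).
Qed.

Lemma nrm_le_H1norm f : sq f -> nr f <= H1norm Omega f.
Proof.
move=> sf; rewrite -ler_sqr ?nnegrE ?nrm_ge0 ?H1norm_ge0// H1norm_sqr// lerDl.
exact: sqr_ge0.
Qed.

Lemma gradnorm_le_H1norm f : sq f -> gradnorm Omega f <= H1norm Omega f.
Proof.
move=> sf; rewrite -ler_sqr ?nnegrE ?gradnorm_ge0 ?H1norm_ge0// H1norm_sqr// lerDr.
exact: sqr_ge0.
Qed.

Lemma H1normD f g : H1 Omega f -> H1 Omega g ->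
  H1norm Omega (fun x => f x + g x) <= H1norm Omega f + H1norm Omega g.
Proof.
move=> Hf Hg; have [sf sg] := (H1sq Hf, H1sq Hg).
(* The H^1 norm is read as the Euclidean norm of two entries, so that the finite Minkowski
   inequality applies. *)
pose v h (b : bool) := if b then nr h else gradnorm Omega h.
have E h : sq h -> H1norm Omega h = Num.sqrt (\sum_(b <- [:: true; false]) v h b ^+ 2).
  by move=> sh; rewrite (H1normE sh) !big_cons big_nil addr0.
have v0 h (b : bool) : 0 <= v h b by case: b; rewrite /v ?nrm_ge0 ?gradnorm_ge0.
rewrite (E _ sf) (E _ sg) (E _ (sqintD mO sf sg)).
by apply: sqrt_sum_triangle => // -[]; rewrite v0/= /v; [exact: nrmD|exact: gradnormD].
Qed.

Lemma H1normZ a f : H1 Omega f -> H1norm Omega (fun x => a * f x) = `|a| * H1norm Omega f.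
Proof.
move=> Hf; have sf := H1sq Hf.
apply/eqP; rewrite -(@eqrXn2 _ 2) ?mulr_ge0 ?H1norm_ge0//; apply/eqP.
rewrite exprMn; apply: (etrans (H1norm_sqr (sqintZ mO a sf))).
apply: etrans (congr1 ( *%R (`|a| ^+ 2)) (esym (H1norm_sqr sf))).
by rewrite (nrmZ mO a sf) (gradnormZ a Hf) !exprMn mulrDr.
Qed.

Lemma H10_H1 f : H10 Omega f -> H1 Omega f. Proof. by case. Qed.

Lemma H10D f g : H10 Omega f -> H10 Omega g -> H10 Omega (fun x => f x + g x).
Proof.
move=> [Hf Af] [Hg Ag]; split; first exact: H1D.
move=> e e0; have [phi tphi pe] := Af _ (divr_gt0 e0 (ltr0Sn R 1)).
have [psi tpsi qe] := Ag _ (divr_gt0 e0 (ltr0Sn R 1)).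
exists (fun x => phi x + psi x); first exact: test_funD.
rewrite (_ : _ \- _ = (fun x => (f \- phi) x + (g \- psi) x)); last first.
  by apply/funext => x /=; rewrite opprD addrACA.
have HB u v : H1 Omega u -> test_fun Omega v -> H1 Omega (u \- v).
  move=> Hu tv; have := H1D oO Hu (H1Z oO (-1) (test_fun_H1 oO tv)).
  by congr H1; apply/funext => x; rewrite mulN1r.
apply: (le_lt_trans (H1normD (HB _ _ Hf tphi) (HB _ _ Hg tpsi))).
by rewrite (splitr e); exact: (ltrD pe qe).
Qed.

Lemma H10Z a f : H10 Omega f -> H10 Omega (fun x => a * f x).
Proof.
move=> [Hf Af]; split; first exact: H1Z.
move=> e e0; have a0 : 0 < `|a| + 1 by rewrite ltr_wpDl.
have [phi tphi pe] := Af _ (divr_gt0 e0 a0).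
exists (fun x => a * phi x); first exact: test_funZ.
rewrite (_ : _ \- _ = (fun x => a * (f \- phi) x)); last by apply/funext => x /=; rewrite mulrBr.
rewrite H1normZ; last first.
  have := H1D oO Hf (H1Z oO (-1) (test_fun_H1 oO tphi)).
  by congr H1; apply/funext => x; rewrite mulN1r.
apply: (@le_lt_trans _ _ ((`|a| + 1) * H1norm Omega (f \- phi))).
  by rewrite ler_wpM2r ?H1norm_ge0// lerDl.
by rewrite -ltr_pdivlMl// mulrC.
Qed.

Lemma eq_H10 f g : sq g -> f =O g -> H10 Omega f -> H10 Omega g.
Proof.
move=> sg fg [Hf Af]; split; first exact: eq_H1 fg Hf.
move=> e e0; have [phi tphi pe] := Af e e0; exists phi; first exact: tphi.
have sphi := test_fun_sqint oO tphi.
rewrite -(@eq_H1norm (f \- phi) (g \- phi)); first exact: pe.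
- exact: (sqintB mO (H1sq Hf) sphi).
- exact: (sqintB mO sg sphi).
- by apply: filterS fg => x /= + Ox => /(_ Ox) ->.
Qed.

Lemma H10B f g : H10 Omega f -> H10 Omega g -> H10 Omega (fun x => f x - g x).
Proof.
move=> Hf Hg; have := H10D Hf (H10Z (-1) Hg).
by congr H10; apply/funext => x; rewrite mulN1r.
Qed.

Lemma H2D f g : H2 Omega f -> H2 Omega g -> H2 Omega (fun x => f x + g x).
Proof.
move=> [Hf Df] [Hg Dg]; split; first exact: H1D.
move=> i; apply: (eq_H1 oO (sqwD _ _) _ (H1D oO (Df i) (Dg i))).
exact/aeD_sym/wDD.
Qed.

Lemma H2Z a f : H2 Omega f -> H2 Omega (fun x => a * f x).
Proof.
move=> [Hf Df]; split; first exact: H1Z.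
move=> i; apply: (eq_H1 oO (sqwD _ _) _ (H1Z oO a (Df i))).
exact/aeD_sym/wDZ.
Qed.

Lemma eq_H2 f g : sq g -> f =O g -> H2 Omega f -> H2 Omega g.
Proof.
move=> sg fg [Hf Df]; split; first exact: eq_H1 fg Hf.
by move=> i; rewrite -(eq_wD oO i (H1sq Hf) sg fg); exact: Df.
Qed.

Lemma H2diamondD f g : H2diamond Omega f -> H2diamond Omega g ->
  H2diamond Omega (fun x => f x + g x).
Proof. by move=> [f1 f2] [g1 g2]; split; [exact: H10D|exact: H2D]. Qed.

Lemma H2diamondZ a f : H2diamond Omega f -> H2diamond Omega (fun x => a * f x).
Proof. by move=> [f1 f2]; split; [exact: H10Z|exact: H2Z]. Qed.

Lemma eq_H2diamond f g : sq g -> f =O g -> H2diamond Omega f -> H2diamond Omega g.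
Proof. by move=> sg fg [f1 f2]; split; [exact: eq_H10 f1|exact: eq_H2 f2]. Qed.

Lemma H2diamondB f g : H2diamond Omega f -> H2diamond Omega g ->
  H2diamond Omega (fun x => f x - g x).
Proof.
move=> Hf Hg; have := H2diamondD Hf (H2diamondZ (-1) Hg).
by congr H2diamond; apply/funext => x; rewrite mulN1r.
Qed.

Lemma laplacian_sqint f : sq (laplacian Omega f).
Proof. by apply: (sqint_sum mO) => i _. Qed.

Let ae_all (P : 'I_d -> 'rV[R]_d -> Prop) : (forall i, {ae mu, forall x, P i x}) ->
  {ae mu, forall x, forall i, P i x}.
Proof.
move=> aP; have : {ae mu, forall x, forall n : nat, forall i : 'I_d, i = n :> nat -> P i x}.
  apply: ae_foralln => n; have [nd|nd] := ltnP n d; last first.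
    by apply: nearW => x i ni; move: nd; rewrite -ni leqNgt ltn_ord.
  by apply: filterS (aP (Ordinal nd)) => x Px i ni; rewrite (_ : i = Ordinal nd)//; exact: val_inj.
by apply: filterS => x + i => /(_ i i); apply.
Qed.

Lemma laplacianD f g : H2 Omega f -> H2 Omega g ->
  laplacian Omega (fun x => f x + g x) =O (fun x => laplacian Omega f x + laplacian Omega g x).
Proof.
move=> [Hf Df] [Hg Dg].
have : {ae mu, forall x, forall i, Omega x -> wD Omega i (wD Omega i (fun x => f x + g x)) x =
    wD Omega i (wD Omega i f) x + wD Omega i (wD Omega i g) x}.
  (* Linearity of the inner derivative holds only a.e.; [eq_wD] makes this harmless under the outer
     derivative. *)
  apply: ae_all => i; rewrite (eq_wD oO i (sqwD _ _) _ (wDD oO fO i Hf Hg)).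
    exact: wDD.
  exact: sqintD.
apply: filterS => x xP Ox; rewrite /laplacian -big_split; apply: eq_bigr => i _.
exact: xP.
Qed.

Lemma laplacianZ a f : H2 Omega f ->
  laplacian Omega (fun x => a * f x) =O (fun x => a * laplacian Omega f x).
Proof.
move=> [Hf Df].
have : {ae mu, forall x, forall i, Omega x -> wD Omega i (wD Omega i (fun x => a * f x)) x =
    a * wD Omega i (wD Omega i f) x}.
  apply: ae_all => i; rewrite (eq_wD oO i (sqwD _ _) _ (wDZ oO fO i a Hf)).
    exact: wDZ.
  exact: sqintZ.
apply: filterS => x xP Ox; rewrite /laplacian mulr_sumr; apply: eq_bigr => i _.
exact: xP.
Qed.

Lemma H1norm_le_H2norm f : sq f -> H1norm Omega f <= H2norm Omega f.
Proof.
move=> sf; rewrite -[leLHS]ger0_norm ?H1norm_ge0// -sqrtr_sqr /H2norm.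
have s0 : 0 <= \sum_i \sum_j L2norm Omega (wD Omega j (wD Omega i f)) ^+ 2.
  by apply: sumr_ge0 => i _; apply: sumr_ge0 => j _; exact: sqr_ge0.
by rewrite ler_sqrt ?lerDl// addr_ge0 ?sqr_ge0.
Qed.

Lemma nrm_laplacian_le f : nr (laplacian Omega f) <= d%:R * H2norm Omega f.
Proof.
have term_le (F : 'I_d -> R) i : (forall j, 0 <= F j) -> F i <= \sum_j F j.
  by move=> F0; rewrite (bigD1 i)//= lerDl; apply: sumr_ge0.
have le_i i : nr (wD Omega i (wD Omega i f)) <= H2norm Omega f.
  have s0 k : 0 <= \sum_j L2norm Omega (wD Omega j (wD Omega k f)) ^+ 2.
    by apply: sumr_ge0 => j _; exact: sqr_ge0.
  rewrite -[leLHS]ger0_norm ?nrm_ge0// -sqrtr_sqr /H2norm ler_sqrt; last first.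
    by apply: addr_ge0; [exact: sqr_ge0|exact: sumr_ge0].
  rewrite -L2norm_nrm; last exact: sqwD.
  have := term_le (fun j => L2norm Omega (wD Omega j (wD Omega i f)) ^+ 2) i (fun=> sqr_ge0 _).
  move/le_trans; apply.
  have := term_le (fun k => \sum_j L2norm Omega (wD Omega j (wD Omega k f)) ^+ 2) i s0.
  by move/le_trans; apply; rewrite lerDr sqr_ge0.
suff key (r : seq 'I_d) : nr (fun x => \sum_(i <- r) wD Omega i (wD Omega i f) x) <= (size r)%:R * H2norm Omega f.
  have := key (index_enum 'I_d); suff -> : size (index_enum 'I_d) = d by [].
  by rewrite /index_enum -enumT size_enum_ord.
elim: r => [|i r IH].
  under eq_fun do rewrite big_nil.
  by rewrite mul0r nrm0.
under eq_fun do rewrite big_cons.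
rewrite (le_trans (nrmD mO _ _))//; first by apply: (sqint_sum mO) => j _.
by rewrite /= -natr1 mulrDl mul1r addrC lerD.
Qed.

(** For test functions the identity is the definition of the weak derivative of each component of
    grad f. Both sides are continuous in g for the H^1 norm, and H^1_0 is the closure of the test
    functions, which replaces any boundary trace. *)
Lemma green f g : H2 Omega f -> H10 Omega g ->
  \sum_i ip (wD Omega i f) (wD Omega i g) = - ip (laplacian Omega f) g.
Proof.
move=> [Hf Df] [Hg Ag]; have sg := H1sq Hg; have sl := laplacian_sqint f.
(* The defect of Green's formula, linear in h up to a.e. equality of derivatives. *)
pose B h := \sum_i ip (wD Omega i f) (wD Omega i h) + ip (laplacian Omega f) h.
have B0 phi : test_fun Omega phi -> B phi = 0.
  move=> tphi; have sphi := test_fun_sqint oO tphi.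
  rewrite /B /laplacian ip_suml// -big_split big1// => i _ /=.
  have -> : ip (wD Omega i f) (wD Omega i phi) = ip (wD Omega i f) (pderiv i phi).
    rewrite ipC [RHS]ipC; apply: eq_ipl => //; [exact: sqint_meas|..].
    - by apply: sqint_meas; exact: test_fun_pderiv_sqint.
    - exact: sqint_meas.
    - exact: wD_test_fun.
  have [_ /(_ i)/(wDP oO)[_ w]] := (H1P oO _).1 (Df i).
  by apply/eqP; rewrite addr_eq0 !ipE; apply/eqP; exact: w.
(* By Cauchy-Schwarz this C bounds the defect relative to the H^1 norm. It may vanish, hence the
   division by C + 1 below. *)
pose C := \sum_i nr (wD Omega i f) + nr (laplacian Omega f).
have C0 : 0 <= C by rewrite addr_ge0 ?sumr_ge0 ?nrm_ge0// => i _; exact: nrm_ge0.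
suff : B g = 0 by move=> /eqP; rewrite addr_eq0 => /eqP.
apply/eqP; rewrite -normr_le0; apply/ler_addgt0Pl => e e0; rewrite addr0.
have C1 : 0 < C + 1 by rewrite ltr_wpDl.
have [phi tphi pe] := Ag _ (divr_gt0 e0 C1).
have sphi := test_fun_sqint oO tphi; have Hphi := test_fun_H1 oO tphi.
pose r x := g x - phi x.
have sr : sq r by exact: sqintB.
have Hr : H1 Omega r.
  have := H1D oO Hg (H1Z oO (-1) Hphi); congr H1; apply/funext => x.
  by rewrite mulN1r.
have Br : B g = B r.
  rewrite -[RHS]addr0 -(B0 _ tphi) /B addrACA -big_split/=; congr (_ + _).
    apply: eq_bigr => i _; rewrite -ipDr//; rewrite ipC [RHS]ipC.
    apply: eq_ipl => //; [exact: sqint_meas|by apply: sqint_meas; exact: sqintD|exact: sqint_meas|].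
    rewrite -(_ : wD Omega i (fun x => r x + phi x) = wD Omega i g); first exact: wDD.
    by congr wD; apply/funext => x; rewrite subrK.
  rewrite -ipDr//; congr (ip _ _); by apply/funext => x; rewrite subrK.
rewrite Br (@le_trans _ _ (C * H1norm Omega r))//; last first.
  apply: (@le_trans _ _ ((C + 1) * H1norm Omega r)).
    by rewrite ler_wpM2r ?H1norm_ge0// lerDl.
  by rewrite -ler_pdivlMl// mulrC ltW.
rewrite (le_trans (ler_normD _ _))// mulrDl lerD//.
  rewrite mulr_suml (le_trans (ler_norm_sum _ _ _))//; apply: ler_sum => i _.
  rewrite (le_trans (cauchy_schwarz mO (sqwD _ _) (sqwD _ _)))// ler_wpM2l ?nrm_ge0//.
  exact: le_trans (nrm_wD_le i r) (gradnorm_le_H1norm sr).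
rewrite (le_trans (cauchy_schwarz mO sl sr))// ler_wpM2l ?nrm_ge0//.
exact: nrm_le_H1norm.
Qed.

(** The norm of exponent infinity is an essential supremum only on a space of positive measure, so
    this is needed to unfold it. *)
Lemma lebesgue_rV_setT_gt0 : (0 < mu [set: 'rV[R]_d])%E.
Proof.
apply: (@lt_le_trans _ _ (mu (cbox 0 (const_mx 1)))).
  rewrite lebesgue_rV_cbox => [|i]; last by rewrite !mxE ler01.
  by rewrite big1 ?lte01// => i _; rewrite !mxE subr0.
apply: le_measure => //; rewrite inE//; exact: measurable_cbox.
Qed.

(** The absolute value gives the multiplier bound a nonnegative constant without a sign condition on
    [CH]. *)
Lemma embedding_Linfty_ae (CH : R) f : embedding_H2_Linfty Omega CH -> H2diamond Omega f ->
  {ae mu, forall x, Omega x -> `|f x| <= `|CH| * nr (laplacian Omega f)}.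
Proof.
move=> emb Hf; have := emb f Hf; rewrite /Lpnorm unlock lebesgue_rV_setT_gt0.
move=> /ess_supP; apply: filterS => x /= + Ox; rewrite patchE mem_set// lee_fin.
move=> /le_trans; apply; rewrite L2norm_nrm; last exact: laplacian_sqint.
by rewrite ler_wpM2r ?nrm_ge0// ler_norm.
Qed.

Lemma ae_bounded_mul f g M : measurable_fun Omega f -> 0 <= M ->
  {ae mu, forall x, Omega x -> `|f x| <= M} -> sq g ->
  sq (fun x => f x * g x) /\ nr (fun x => f x * g x) <= M * nr g.
Proof.
move=> mf M0 fM sg; have [mg g2] := sg.
apply: nrm_fin_bound => //; first by rewrite mulr_ge0 ?nrm_ge0.
  exact: measurable_funM.
apply: (@le_trans _ _ (\int[mu]_(x in Omega) ((M ^+ 2)%:E * (g x ^+ 2)%:E))%E).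
  apply: ae_ge0_le_integral => //.
  - by move=> x _; rewrite lee_fin sqr_ge0.
  - by apply/measurable_EFinP/measurable_funX; exact: measurable_funM.
  - by move=> x _; rewrite -EFinM lee_fin mulr_ge0 ?sqr_ge0.
  - by apply: measurable_funeM; apply/measurable_EFinP/measurable_funX.
  - apply: filterS fM => x + Ox => /(_ Ox) fx; rewrite -EFinM lee_fin exprMn.
    by rewrite ler_wpM2r ?sqr_ge0// -real_normK ?num_real// lerXn2r ?nnegrE.
rewrite integralZl//; have := integral_sqr mO sg => ->.
by rewrite -EFinM exprMn.
Qed.

(** The L^2 norm of fg squared is the inner product of f^2 and g^2, and the L^2 norm of f^2 is the
    square of the L^4 norm of f. *)
Lemma embedding_L4_mul (CH : R) f g : embedding_H1_L4 Omega CH ->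
  H10 Omega f -> H10 Omega g ->
  sq (fun x => f x * g x) /\
  nr (fun x => f x * g x) <= CH ^+ 2 * gradnorm Omega f * gradnorm Omega g.
Proof.
move=> emb Hf Hg.
have sqr4 h : H10 Omega h -> sq (fun x => h x ^+ 2) /\
    nr (fun x => h x ^+ 2) <= (CH * gradnorm Omega h) ^+ 2.
  move=> Hh; have [mh _] := H1sq (H10_H1 Hh); apply: nrm_fin_bound => //.
  - exact: sqr_ge0.
  - exact: measurable_funX.
  have := emb h Hh; rewrite /Lpnorm unlock.
  set I4 := (\int[mu]_x _)%E => le4.
  have I4E : (\int[mu]_(x in Omega) ((h x ^+ 2) ^+ 2)%:E = I4)%E.
    rewrite /I4 integral_mkcond; apply: eq_integral => x _; rewrite !patchE /=.
    case: ifPn => xO; last by rewrite patchE (negPf xO) normr0 powR0.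
    rewrite patchE xO powR_mulrn// -!exprM -normrX ger0_norm//.
    by rewrite (exprM _ 2 2) sqr_ge0.
  rewrite I4E.
  have I40 : (0 <= I4)%E by apply: integral_ge0 => x _; exact: poweR_ge0.
  have c0 : 0 <= CH * gradnorm Omega h.
    by rewrite -lee_fin (le_trans _ le4)// poweR_ge0.
  case: I4 I40 le4 {I4E} => [s||] s0 //; last by rewrite poweRyr ?invr_eq0.
  rewrite poweR_EFin !lee_fin in s0 * => sle; rewrite -exprM.
  rewrite -[s](@powRr1 _ _)// -(@mulVf _ (4 : R))// powRrM.
  rewrite (powR_mulrn 4) ?powR_ge0//.
  by rewrite lerXn2r ?nnegrE ?powR_ge0.
have [mf _] := H1sq (H10_H1 Hf); have [mg _] := H1sq (H10_H1 Hg).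
have [sf2 nf2] := sqr4 f Hf; have [sg2 ng2] := sqr4 g Hg.
have e0 h : H10 Omega h -> 0 <= CH ^+ 2 * gradnorm Omega h ^+ 2.
  by move=> _; rewrite mulr_ge0 ?sqr_ge0.
apply: nrm_fin_bound => //.
- by apply: mulr_ge0; [apply: mulr_ge0; [exact: sqr_ge0|exact: gradnorm_ge0]|exact: gradnorm_ge0].
- exact: measurable_funM.
under eq_integral do rewrite exprMn.
have i2 := sqint_mul mO sf2 sg2.
rewrite -[leLHS](fineK (integrable_fin_num mO i2)) lee_fin.
rewrite -[X in X <= _]/(\int[mu]_(x in Omega) (f x ^+ 2 * g x ^+ 2)) -ipE.
apply: le_trans (ler_norm _) _; apply: (le_trans (cauchy_schwarz mO sf2 sg2)).
apply: (le_trans (ler_pM (nrm_ge0 _ _ _) (nrm_ge0 _ _ _) nf2 ng2)).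
by rewrite le_eqVlt; apply/orP; left; apply/eqP; ring.
Qed.

End sobolev_spaces.

(** * Almost everywhere statements in time *)

Section lebesgue_ae.
Context {R : realType}.
Local Notation lambda := (@lebesgue_measure R).
Implicit Types P Q S : R -> Prop.

Lemma lebesgue_ae_imply P Q : (forall x, P x -> Q x) ->
  {ae lambda, forall x, P x} -> {ae lambda, forall x, Q x}.
Proof.
by move=> PQ [N [mN N0 sub]]; exists N; split => // x /= nQ; apply: sub => /PQ.
Qed.

Lemma lebesgue_ae_imply2 P Q S : (forall x, P x -> Q x -> S x) ->
  {ae lambda, forall x, P x} -> {ae lambda, forall x, Q x} -> {ae lambda, forall x, S x}.
Proof.
move=> PQS [N [mN N0 subN]] [M [mM M0 subM]]; exists (N `|` M); split.
- exact: measurableU.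
- by rewrite measureU0.
- move=> x /= nS; have [Nx|nNx] := pselect (N x); [by left|right].
  apply: subM => /= Qx; apply: nNx; apply: subN => /= Px; exact/nS/PQS.
Qed.

Lemma lebesgue_aeT P : (forall x, P x) -> {ae lambda, forall x, P x}.
Proof. by move=> PT; apply: nearW. Qed.

Lemma lebesgue_ae_neq (a : R) : {ae lambda, forall x, x != a}.
Proof.
exists [set a]; split; [exact: measurable_set1|exact: lebesgue_measure_set1|].
by move=> x /= /negP/negPn/eqP.
Qed.

End lebesgue_ae.

(** * Absolutely continuous functions of time *)

Section absolutely_continuous.
Context {R : realType}.
Variable T : R.
Hypothesis T0 : 0 < T.
Local Notation lambda := (@lebesgue_measure R).
Implicit Types (k y f g : R -> R) (s t u x : R).

Definition bm k := measurable_fun `[0, T]%classic k /\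
  exists M, forall x, 0 <= x <= T -> `|k x| <= M.

(** A primitive of a bounded density: a Lipschitz function carrying a chosen candidate for its
    derivative. No pointwise derivative is asserted. *)
Definition ac y k := bm k /\
  forall s t, 0 <= s -> s <= t -> t <= T -> y t - y s = \int[lambda]_(x in `[s, t]) k x.

Let itv_measure s t : lambda `[s, t]%classic = if s < t then (t - s)%:E else 0%E.
Proof. by rewrite lebesgue_measure_itv /= lte_fin. Qed.

Let measure_itv_lty s t : (lambda `[s, t]%classic < +oo)%E.
Proof. by rewrite itv_measure; case: ifP => _; rewrite ltry. Qed.

Lemma bm_bound k : bm k -> exists2 M, 0 < M & forall x, 0 <= x <= T -> `|k x| <= M.
Proof.
move=> [_ [M kM]]; exists (`|M| + 1); first by rewrite ltr_wpDl.
by move=> x /kM /le_trans; apply; rewrite (le_trans (ler_norm M))// lerDl.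
Qed.

Let subT s t : 0 <= s -> t <= T -> `[s, t]%classic `<=` `[0, T]%classic.
Proof.
move=> s0 tT x /=; rewrite !in_itv/= => /andP[sx xt].
by rewrite (le_trans s0 sx) (le_trans xt tT).
Qed.

Lemma bm_integrable k s t : bm k -> 0 <= s -> t <= T ->
  lambda.-integrable `[s, t] (EFin \o k).
Proof.
move=> [mk [M kM]] s0 tT; apply: measurable_bounded_integrable => //.
- exact: measure_itv_lty.
- by apply: measurable_funS mk => //; exact: subT.
- exists M; split; first exact: num_real.
  move=> N MN x xst; have /= := subT s0 tT xst; rewrite in_itv => xT.
  by rewrite (le_trans (kM x xT))// ltW.
Qed.

Lemma bmD k g : bm k -> bm g -> bm (fun x => k x + g x).
Proof.
move=> [mk [M kM]] [mg [N gN]]; split; first exact: measurable_funD.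
by exists (M + N) => x xT; rewrite (le_trans (ler_normD _ _))// lerD ?kM ?gN.
Qed.

Lemma bmM k g : bm k -> bm g -> bm (fun x => k x * g x).
Proof.
move=> [mk [M kM]] [mg [N gN]]; split; first exact: measurable_funM.
by exists (M * N) => x xT; rewrite normrM ler_pM ?kM ?gN.
Qed.

Lemma bm_cst a : bm (fun=> a).
Proof. by split => //; exists `|a|. Qed.

Lemma bmZ a k : bm k -> bm (fun x => a * k x).
Proof. by apply: bmM; exact: bm_cst. Qed.

Lemma bm_continuous k : {within `[0, T], continuous k} -> bm k.
Proof.
move=> ck; split; first exact: subspace_continuous_measurable_fun.
have /compact_bounded[M [_ MP]] : compact (k @` `[0, T]).
  by apply: continuous_compact => //; exact: segment_compact.
exists (`|M| + 1) => x xT.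
have /MP : M < `|M| + 1 by rewrite (le_lt_trans (ler_norm M))// ltrDl.
by apply; exists x => //=; rewrite in_itv.
Qed.

Lemma int_cst a s t : s <= t -> \int[lambda]_(x in `[s, t]) a = a * (t - s).
Proof.
move=> st; rewrite Rintegral_cst//; congr (_ * _).
transitivity (fine (if s < t then (t - s)%:E else 0%E)); first by rewrite -itv_measure.
by move: st; rewrite le_eqVlt => /predU1P[->|->]; rewrite ?ltxx ?subrr.
Qed.

Lemma le_int k g s t : bm k -> bm g -> 0 <= s -> t <= T ->
  {ae lambda, forall x, s <= x <= t -> k x <= g x} ->
  \int[lambda]_(x in `[s, t]) k x <= \int[lambda]_(x in `[s, t]) g x.
Proof.
move=> bk bg s0 tT kg; have ik := bm_integrable bk s0 tT; have ig := bm_integrable bg s0 tT.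
rewrite /Rintegral; apply: fine_le; try exact: integrable_fin_num.
rewrite -sube_ge0; last by rewrite integrable_fin_num ?orbT.
rewrite -integralB//.
have igk : lambda.-integrable `[s, t] (fun x => (g x)%:E - (k x)%:E)%E by exact: integrableB.
have -> : (\int[lambda]_(x in `[s, t]) ((g x)%:E - (k x)%:E))%E =
    (\int[lambda]_(x in `[s, t]) `|(g x)%:E - (k x)%:E|)%E; last exact: integral_ge0.
apply: ae_eq_integral => //.
- exact: measurable_int igk.
- by apply: measurableT_comp => //; exact: measurable_int igk.
- apply: lebesgue_ae_imply kg => x kgx /= xst; rewrite ger0_norm// subr_ge0 kgx//.
Qed.

Lemma int_bound k M s t : bm k -> 0 <= s -> s <= t -> t <= T ->
  {ae lambda, forall x, s <= x <= t -> `|k x| <= M} ->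
  `|\int[lambda]_(x in `[s, t]) k x| <= M * (t - s).
Proof.
move=> bk s0 st tT kM; rewrite ler_norml -mulNr -!(int_cst _ st).
apply/andP; split; apply: le_int => //; try exact: bm_cst.
- by apply: lebesgue_ae_imply kM => x + xst => /(_ xst); rewrite ler_norml => /andP[].
- by apply: lebesgue_ae_imply kM => x + xst => /(_ xst); rewrite ler_norml => /andP[].
Qed.

Lemma int_chasles k s u t : bm k -> 0 <= s -> s <= u -> u <= t -> t <= T ->
  \int[lambda]_(x in `[s, t]) k x =
  \int[lambda]_(x in `[s, u]) k x + \int[lambda]_(x in `[u, t]) k x.
Proof.
move=> bk s0 su ut tT; have ik := bm_integrable bk s0 tT.
have := @Rintegral_itvB _ k (BLeft s) (BRight t) u ik.
rewrite !bnd_simp => /(_ su ut) /eqP; rewrite subr_eq addrC => /eqP ->; congr (_ + _).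
apply: Rintegral_itv_obnd_cbnd; apply: integrableS ik => // x /=.
rewrite !in_itv/= => /andP[ux ->]; rewrite andbT; exact: le_trans su (ltW ux).
Qed.

Lemma ac_lipschitz y k : ac y k -> exists2 M, 0 < M &
  forall s t, 0 <= s <= T -> 0 <= t <= T -> `|y t - y s| <= M * `|t - s|.
Proof.
move=> [bk yk]; have [M M0 kM] := bm_bound bk; exists M => //.
have key s t : 0 <= s -> s <= t -> t <= T -> `|y t - y s| <= M * `|t - s|.
  move=> s0 st tT; rewrite yk// [`|t - s|]ger0_norm ?subr_ge0// int_bound//.
  apply: lebesgue_aeT => x /andP[sx xt]; apply: kM.
  by rewrite (le_trans s0 sx) (le_trans xt tT).
move=> s t /andP[s0 sT] /andP[t0 tT]; have [st|/ltW ts] := leP s t; first exact: key.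
by rewrite distrC (distrC t); exact: key.
Qed.

Lemma lipschitz_continuous y M :
  (forall s t, 0 <= s <= T -> 0 <= t <= T -> `|y t - y s| <= M * `|t - s|) ->
  {within `[0, T], continuous y}.
Proof.
move=> yM; apply/subspace_continuousP => x /= xT; rewrite in_itv/= in xT.
apply/cvgrPdist_le => e e0; have M1 : 0 < `|M| + 1 by rewrite ltr_wpDl.
rewrite near_withinE; apply/nbhs_ballP; exists (e / (`|M| + 1)) => /=.
  by rewrite divr_gt0.
move=> z /ltW xz /=; rewrite in_itv/= => zT.
rewrite (le_trans (yM _ _ zT xT))// (@le_trans _ _ ((`|M| + 1) * `|x - z|))//.
  by rewrite ler_wpM2r// (le_trans (ler_norm M))// lerDl.
by rewrite -ler_pdivlMl// mulrC.
Qed.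

Lemma ac_continuous y k : ac y k -> {within `[0, T], continuous y}.
Proof. by move=> /ac_lipschitz[M _ yM]; exact: lipschitz_continuous yM. Qed.

Lemma ac_bm y k : ac y k -> bm y.
Proof. by move=> /ac_continuous/bm_continuous. Qed.

Lemma ac_derive f g : (forall x, is_derive x (1 : R) f (g x)) -> continuous g -> ac f g.
Proof.
move=> fg cg; split.
  by apply: bm_continuous; exact: continuous_subspaceT.
have cf : continuous f.
  move=> a; apply: differentiable_continuous; apply/derivable1_diffP.
  exact: (@ex_derive _ _ _ _ _ _ _ (fg a)).
move=> s t s0; rewrite le_eqVlt => /predU1P[<-|st] tT.
  by rewrite set_itv1 Rintegral_set1 subrr.
rewrite /Rintegral (@continuous_FTC2 _ g f)//.
- exact: continuous_subspaceT.
- split => [a _||]; first exact: (@ex_derive _ _ _ _ _ _ _ (fg a)).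
    by apply: cvg_at_right_filter; exact: cf.
  by apply: cvg_at_left_filter; exact: cf.
- by move=> a _; rewrite derive1E (@derive_val _ _ _ _ _ _ _ (fg a)).
Qed.

(** Cutting an interval into n equal parts bounds the total increment by n C ((t - s) / n)^2, which
    tends to 0. *)
Lemma quadratic_constant f (C : R) :
  (forall s t, 0 <= s -> s <= t -> t <= T -> `|f t - f s| <= C * (t - s) ^+ 2) ->
  forall s t, 0 <= s -> s <= t -> t <= T -> f t = f s.
Proof.
move=> fC s t s0 st tT; apply/eqP; rewrite -subr_eq0 -normr_le0.
have C0 : 0 <= C.
  have := fC 0 T (lexx 0) (ltW T0) (lexx T); rewrite subr0 => /(le_trans (normr_ge0 _)).
  by rewrite pmulr_lge0// exprn_gt0.
have step (n : nat) h : 0 <= h -> s + n%:R * h <= T -> `|f (s + n%:R * h) - f s| <= n%:R * (C * h ^+ 2).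
  move=> h0; elim: n => [|n IH] nT; first by rewrite !mul0r addr0 subrr normr0.
  set u := s + n%:R * h in IH *.
  have E : s + n.+1%:R * h = u + h by rewrite /u -natr1; ring.
  rewrite E in nT *; have uT : u <= T by apply: le_trans nT; rewrite lerDl.
  rewrite -(subrKA (f u)) (le_trans (ler_normD _ _))// -natr1 [leRHS]mulrDl mul1r addrC.
  apply: lerD; first exact: IH.
  have := fC u (u + h); rewrite (_ : u + h - u = h); last by ring.
  by apply => //; [rewrite /u addr_ge0// mulr_ge0|rewrite lerDl].
apply/ler_addgt0Pl => e e0; rewrite addr0.
have [n ne] : exists n : nat, C * (t - s) ^+ 2 / e < n.+1%:R.
  exists (Num.truncn (C * (t - s) ^+ 2 / e)); exact: truncnS_gt.
have n0 : 0 < n.+1%:R :> R by [].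
have E : s + n.+1%:R * ((t - s) / n.+1%:R) = t by field; exact: lt0r_neq0.
have := step n.+1 ((t - s) / n.+1%:R); rewrite E.
rewrite divr_ge0 ?subr_ge0// => /(_ isT tT)/le_trans; apply.
move: ne; rewrite ltr_pdivrMr// => /ltW; rewrite -ler_pdivrMl//; apply: le_trans.
rewrite le_eqVlt; apply/orP; left; apply/eqP; field; exact: lt0r_neq0.
Qed.

(** The abstract product rule. For a product, f(t)g(t) - f(s)g(s) = (f(t) - f(s)) g(t) + f(s) (g(t)
    - g(s)), so each integrand has one argument frozen at an endpoint. Unfreezing costs a Lipschitz
    error, hence a quadratic error per step, and the defect is constant by [quadratic_constant]. The
    same lemma serves scalar products and L^2 inner products, without differentiating almost
    everywhere. *)
Lemma mesh_lemma (c : R -> R) (p q : R -> R -> R) (C : R) :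
  (forall t, 0 <= t <= T -> bm (p ^~ t)) -> (forall s, 0 <= s <= T -> bm (q s)) ->
  bm (fun x => p x x + q x x) ->
  (forall s t, 0 <= s -> s <= t -> t <= T ->
    c t - c s = \int[lambda]_(x in `[s, t]) p x t + \int[lambda]_(x in `[s, t]) q s x) ->
  (forall x t, 0 <= x <= T -> 0 <= t <= T -> `|p x t - p x x| <= C * `|t - x|) ->
  (forall x s, 0 <= x <= T -> 0 <= s <= T -> `|q s x - q x x| <= C * `|x - s|) ->
  ac c (fun x => p x x + q x x).
Proof.
move=> bp bq bpq cpq pC qC; split => // s t s0 st tT.
have C0 : 0 <= C.
  have := pC 0 T; rewrite !lexx (ltW T0) => /(_ isT isT).
  by move=> /(le_trans (normr_ge0 _)); rewrite subr0 gtr0_norm// pmulr_lge0.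
pose f x := c x - \int[lambda]_(z in `[0, x]) (p z z + q z z).
have key s' t' : 0 <= s' -> s' <= t' -> t' <= T -> `|f t' - f s'| <= (2 * C) * (t' - s') ^+ 2.
  move=> s'0 st' tT'.
  have s'T : 0 <= s' <= T by rewrite s'0 (le_trans st' tT').
  have t'T : 0 <= t' <= T by rewrite tT' (le_trans s'0 st').
  rewrite /f (int_chasles bpq (lexx 0) s'0 st' tT').
  have -> : forall a b i j : R, a - (i + j) - (b - i) = a - b - j by move=> *; ring.
  have bpqt := bmD (bp _ t'T) (bq _ s'T).
  have ipt := bm_integrable (bp _ t'T) s'0 tT'; have iqs := bm_integrable (bq _ s'T) s'0 tT'.
  rewrite cpq// -(RintegralD _ ipt iqs)//.
  rewrite -RintegralB//; try exact: bm_integrable.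
  rewrite expr2 mulrA; apply: int_bound => //.
    by apply: bmD => //; have := bmZ (-1) bpq; congr bm; apply/funext => x; rewrite mulN1r.
  apply: lebesgue_aeT => x /andP[sx xt].
  have xT : 0 <= x <= T by rewrite (le_trans s'0 sx) (le_trans xt tT').
  rewrite (_ : _ - _ = (p x t' - p x x) + (q s' x - q x x)); last by ring.
  apply: (le_trans (ler_normD _ _)).
  rewrite (_ : 2 * C * (t' - s') = (t' - s') * C + (t' - s') * C); last by ring.
  apply: lerD.
    apply: (le_trans (pC _ _ xT t'T)); rewrite mulrC ler_wpM2r// ger0_norm ?subr_ge0//.
    by rewrite lerB.
  apply: (le_trans (qC _ _ xT s'T)); rewrite mulrC ler_wpM2r// ger0_norm ?subr_ge0//.
  by rewrite lerB.
have := quadratic_constant key s0 st tT; rewrite /f (int_chasles bpq (lexx 0) s0 st tT).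
by lra.
Qed.

Lemma ac_mul f f' g g' : ac f f' -> ac g g' ->
  ac (fun x => f x * g x) (fun x => f' x * g x + f x * g' x).
Proof.
move=> af ag; have [bf' ff'] := af; have [bg' gg'] := ag.
have bf := ac_bm af; have bg := ac_bm ag.
have [M M0 fM] := ac_lipschitz af; have [N N0 gN] := ac_lipschitz ag.
have [M' M'0 fM'] := bm_bound bf'; have [N' N'0 gN'] := bm_bound bg'.
apply: (@mesh_lemma _ (fun x t => f' x * g t) (fun s x => f s * g' x) (M' * N + N' * M)).
- by move=> t _; apply: bmM => //; exact: bm_cst.
- by move=> s _; apply: bmM => //; exact: bm_cst.
- by apply: bmD; exact: bmM.
- move=> s t s0 st tT; rewrite RintegralZr//; last exact: bm_integrable.
  rewrite RintegralZl//; last exact: bm_integrable.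
  by rewrite -ff'// -gg'//; ring.
- move=> x t xT tT; rewrite -mulrBr normrM mulrDl.
  apply: (@le_trans _ _ (M' * (N * `|t - x|))); first by rewrite ler_pM ?fM' ?gN.
  by rewrite mulrA lerDl !mulr_ge0// ltW.
- move=> x s xT sT; rewrite -mulrBl normrM mulrDl.
  apply: (@le_trans _ _ (M * `|x - s| * N')); first by rewrite ler_pM ?gN'// distrC fM.
  by rewrite mulrC mulrA lerDr !mulr_ge0// ltW.
Qed.

Lemma acD y k y' k' : ac y k -> ac y' k' -> ac (fun x => y x + y' x) (fun x => k x + k' x).
Proof.
move=> [bk yk] [bk' yk']; split; first exact: bmD.
move=> s t s0 st tT; rewrite RintegralD//; try exact: bm_integrable.
by rewrite -yk// -yk'//; ring.
Qed.

Lemma acZ a y k : ac y k -> ac (fun x => a * y x) (fun x => a * k x).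
Proof.
move=> [bk yk]; split; first exact: bmZ.
move=> s t s0 st tT; rewrite RintegralZl//; try exact: bm_integrable.
by rewrite -yk//; ring.
Qed.

Lemma ac_sum I (r : seq I) (F F' : I -> R -> R) : (forall i, ac (F i) (F' i)) ->
  ac (fun x => \sum_(i <- r) F i x) (fun x => \sum_(i <- r) F' i x).
Proof.
move=> aF; elim: r => [|i r IH].
  under eq_fun do rewrite big_nil; under [X in ac _ X]eq_fun do rewrite big_nil.
  split; first exact: bm_cst.
  by move=> s t s0 st tT; rewrite int_cst// mul0r subrr.
by under eq_fun do rewrite big_cons; under [X in ac _ X]eq_fun do rewrite big_cons; exact: acD.
Qed.

(** The function exp(- A t) F(t) is absolutely continuous with density at most D. *)
Lemma gronwall F k (A D : R) : ac F k -> F 0 = 0 -> 0 <= A -> 0 <= D ->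
  {ae lambda, forall x, 0 < x < T -> k x <= A * F x + D} ->
  forall t, 0 <= t <= T -> F t <= D * T * expR (A * T).
Proof.
move=> aF F0 A0 D0 kAD t /andP[t0 tT].
have aE : ac (fun x => expR (- A * x)) (fun x => expR (- A * x) * - A).
  apply: ac_derive.
    move=> x; apply: (@is_derive1_comp _ expR (fun u => - A * u)).
    have := @is_deriveZ _ _ _ id (- A) x 1 1 (is_derive_id _ _).
    by rewrite /GRing.scale /= mulr1.
  move=> x; apply: cvgMl; apply: (cvg_comp (fun x => - A * x) expR); last exact: continuous_expR.
  by apply: cvgMr.
have [bG aG] := ac_mul aE aF.
have := aG 0 t (lexx 0) t0 tT; rewrite F0 mulr0 subr0 => GE.
have : expR (- A * t) * F t <= D * t.
  rewrite GE -[t in leRHS]subr0 -(int_cst _ t0); apply: le_int => //; first exact: bm_cst.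
  (* The differential inequality is given on the open interval only, so the endpoints are
     discarded. *)
  have sing0 : {ae lambda, forall x, x != 0 /\ x != t}.
    by apply: (lebesgue_ae_imply2 _ (lebesgue_ae_neq 0) (lebesgue_ae_neq t)).
  apply: lebesgue_ae_imply2 kAD sing0 => x kx [x0 xt] /andP[x0' xt'].
  have xT : 0 < x < T by rewrite lt_def x0 x0' (lt_le_trans _ tT)// lt_def eq_sym xt.
  apply: (@le_trans _ _ (expR (- A * x) * D)).
    rewrite (_ : _ + _ = expR (- A * x) * (k x - A * F x)); last by ring.
    by rewrite ler_wpM2l ?expR_ge0// lerBlDl; exact: kx.
  by rewrite ler_piMl// expR_le1 mulNr oppr_le0 mulr_ge0.
rewrite mulNr expRN ler_pdivrMl ?expR_gt0// => /le_trans; apply.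
rewrite mulrC ler_pM// ?mulr_ge0 ?expR_ge0// ?ler_wpM2l//.
by rewrite ler_expR ler_wpM2l.
Qed.

End absolutely_continuous.

(** * Weak derivatives of scalar functions of time *)

Section smooth_step.
Context {R : realType}.

Lemma has_derivs_comp k (f g : R -> R) : has_derivs k f -> has_derivs k g ->
  has_derivs k (f \o g).
Proof.
elim: k f g => // k IH f g kf kg.
have [f' [ff' kf']] := kf; have [g' [gg' kg']] := kg.
exists (fun x => f' (g x) * g' x); split; first by move=> x; exact: is_derive1_comp.
by apply: has_derivsM => //; apply: (IH f' g) => //; exact: has_derivsW.
Qed.

(** The inner difference is nonpositive for x <= 0 and constant for x >= 1, and the outer [flat]
    cuts off its nonpositive part. The final value [step 1] is left unnormalised and becomes the
    mass of the mollifiers. *)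
Definition step (x : R) := flat 1 0 (flat 1 0 1 + (-1) * flat 1 0 ((-1) * x + 1)).

Lemma smooth_step : smooth step.
Proof.
move=> k; apply: (@has_derivs_comp k (flat 1 0) (fun x => flat 1 0 1 + (-1) * flat 1 0 ((-1) * x + 1))).
  exact: smooth_flat.
apply: has_derivsD; first exact: has_derivs_cst.
by apply: has_derivsZ; apply: (@has_derivs_affine _ k (flat 1 0)); exact: smooth_flat.
Qed.

Lemma step_le0 x : x <= 0 -> step x = 0.
Proof.
move=> x0; rewrite /step {1}/flat; case: ifPn => //.
have x1 : 0 < -1 * x + 1 :> R by lra.
rewrite /flat ltr01 x1 !expr0 !mul1r mulN1r subr_gt0 ltr_expR.
rewrite !mulN1r ltrN2 ltf_pV2 ?posrE//; last by lra.
by move=> ?; exfalso; lra.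
Qed.

Lemma step_ge1 x : 1 <= x -> step x = step 1.
Proof.
move=> x1; rewrite /step; congr (flat _ _ (_ + _ * _)).
by rewrite /flat !ifF//; apply/negbTE; rewrite -leNgt; lra.
Qed.

Lemma step1_gt0 : 0 < step 1.
Proof.
rewrite /step [X in _ * X](_ : _ = 0); last first.
  by rewrite /flat ifF//; apply/negbTE; rewrite -leNgt; lra.
rewrite mulr0 addr0.
have flat0 y : 0 < y -> 0 < flat 1 0 y :> R.
  by move=> y0; rewrite /flat y0 mulr_gt0 ?expR_gt0// exprn_gt0// invr_gt0.
exact/flat0/flat0.
Qed.

End smooth_step.

Section weak_time_derivative.
Context {R : realType}.
Variable T : R.
Hypothesis T0 : 0 < T.
Local Notation lambda := (@lebesgue_measure R).
Implicit Types (k y f g phi : R -> R) (s t u x : R).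

Lemma time_testP phi : time_test T phi -> smooth phi /\
  exists a b : R, [/\ 0 < a, b < T & forall t, ~~ (a <= t <= b) -> phi t = 0].
Proof. by move=> [/smoothP]. Qed.

Lemma int_oo_cc k : bm T k -> \int[lambda]_(x in `]0, T[) k x = \int[lambda]_(x in `[0, T]) k x.
Proof.
move=> bk; have ik := bm_integrable bk (lexx 0) (lexx T).
rewrite Rintegral_itv_bndo_bndc.
  rewrite Rintegral_itv_obnd_cbnd//; apply: integrableS ik => //.
  by apply: subset_itvr; rewrite bnd_simp.
by apply: integrableS ik => //; apply: subset_itv; rewrite bnd_simp.
Qed.

Lemma smooth_bm phi : smooth phi -> bm T phi.
Proof. by move=> /smooth_continuous cphi; apply: bm_continuous; exact: continuous_subspaceT. Qed.

Lemma smooth_ac phi : smooth phi -> ac T phi phi^`()%classic.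
Proof.
move=> sphi; apply: ac_derive => // [x|]; first exact: smooth_is_derive.
exact/smooth_continuous/smooth_derive1.
Qed.

Lemma ac_weak y k : ac T y k -> forall phi, time_test T phi ->
  \int[lambda]_(t in `]0, T[) (phi^`()%classic t * y t) =
  - \int[lambda]_(t in `]0, T[) (phi t * k t).
Proof.
move=> ayk phi /time_testP[sphi [a [b [a0 bT phi0]]]].
have [bk _] := ayk; have by_ := ac_bm ayk.
have bphi := smooth_bm sphi; have bphi' := smooth_bm (smooth_derive1 sphi).
rewrite !int_oo_cc; try exact: bmM.
have [_ /(_ 0 T (lexx 0) (ltW T0) (lexx T))] := ac_mul T0 (smooth_ac sphi) ayk.
rewrite !phi0 ?mul0r ?subr0; last 2 first.
- by rewrite negb_and -ltNge a0.
- by rewrite negb_and -!ltNge bT orbT.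
rewrite RintegralD//; try by apply: bm_integrable => //; exact: bmM.
by move=> /esym/eqP; rewrite addr_eq0 => /eqP.
Qed.

Lemma within_continuous_dist (e : R -> R) : {within `[0, T], continuous e} ->
  forall x, 0 <= x <= T -> forall h, 0 < h -> exists2 del, 0 < del &
  forall z, 0 <= z <= T -> `|x - z| < del -> `|e x - e z| <= h.
Proof.
move=> /subspace_continuousP ce x xT h h0.
have xI : `[0, T]%classic x by rewrite /= in_itv.
have /cvgrPdist_le/(_ h h0) := ce x xI; rewrite near_withinE => /nbhs_ballP[del /= del0 H].
exists del => // z zT xz; apply: (H z) => //=; by rewrite in_itv.
Qed.

(** The step stretched to rise over [x0, x0 + e]. Its derivative [st'] is a smooth kernel
    concentrated there, of mass [step 1] when the interval lies in [0, T]. *)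
Let st (e x0 x : R) := step (e^-1 * x + - x0 / e).
Let st' (e x0 x : R) := e^-1 * (step^`()%classic (e^-1 * x + - x0 / e)).

Let smooth_st e x0 : smooth (st e x0).
Proof. move=> k; apply: (@has_derivs_affine _ k step); exact: smooth_step. Qed.

Let is_derive_st e x0 x : is_derive x 1 (st e x0) (st' e x0 x).
Proof.
rewrite /st' mulrC.
have -> : st e x0 = step \o (fun x => e^-1 * x + - x0 / e) by [].
apply: is_derive1_comp; first exact/smooth_is_derive/smooth_step.
have ds : is_derive x 1 (fun z : R => e^-1 * z) e^-1.
  have := @is_deriveZ _ _ _ id e^-1 x 1 1 (is_derive_id _ _).
  by rewrite /GRing.scale /= mulr1.
have := is_deriveD ds (is_derive_cst (- x0 / e) x 1).
by rewrite addr0.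
Qed.

Let smooth_st' e x0 : smooth (st' e x0).
Proof.
move=> k; apply: has_derivsZ; apply: (@has_derivs_affine _ k step^`()%classic).
exact/smooth_derive1/smooth_step.
Qed.

Let ac_st e x0 : ac T (st e x0) (st' e x0).
Proof. by apply: ac_derive => //; apply: smooth_continuous; exact: smooth_st'. Qed.

Let derive_step_out x : x < 0 \/ 1 < x -> step^`()%classic x = 0.
Proof.
have dcst (c y : R) : (\forall z \near y, (cst c : R -> R) z = step z) -> step^`()%classic y = 0.
  move=> H; have := @near_eq_is_derive _ _ _ _ _ _ _ _ H (is_derive_cst c y 1).
  by rewrite derive1E => /(@derive_val _ _ _ _ _ _ _).
case=> xx.
  apply: (dcst 0); near=> z; rewrite step_le0//; near: z.
  exact: lt_le_nbhsl.
apply: (dcst (step 1)); near=> z; rewrite step_ge1 ?ltW//; near: z.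
exact: lt_nbhsr.
Unshelve. all: end_near.
Qed.

Let M := xget 0 [set M | 0 < M /\ forall x : R, 0 <= x <= 1 -> `|step^`()%classic x| <= M].

Let MP : 0 < M /\ forall x : R, 0 <= x <= 1 -> `|step^`()%classic x| <= M.
Proof.
have [M' M'0 H] : exists2 M, 0 < M & forall x : R, 0 <= x <= 1 -> `|step^`()%classic x| <= M.
  apply: (@bm_bound _ 1); apply: bm_continuous; apply: continuous_subspaceT.
  exact/smooth_continuous/smooth_derive1/smooth_step.
by apply: (@xgetPex _ 0 [set M | 0 < M /\ _]); exists M'.
Qed.

Let int_st' e x0 : 0 < e -> 0 <= x0 -> x0 + e <= T ->
  \int[lambda]_(x in `[0, T]) st' e x0 x = step 1.
Proof.
move=> e0 x00 xT; have [_ <-//] := ac_st e x0; last exact: ltW.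
rewrite /st mulr0 add0r (step_le0 (x := - x0 / e)) ?subr0; last first.
  by rewrite mulNr oppr_le0 divr_ge0// ltW.
rewrite step_ge1// mulrC mulNr -mulrBl ler_pdivlMr// mul1r; lra.
Qed.

Let st'_mean f e x0 h : bm T f -> 0 < e -> 0 <= x0 -> x0 + e <= T ->
  (forall x, x0 <= x <= x0 + e -> `|f x| <= h) ->
  `|\int[lambda]_(x in `[0, T]) (st' e x0 x * f x)| <= M * h.
Proof.
move=> bf e0 x00 xT fh; have [M0 stM] := MP.
have e0' : 0 < e^-1 by rewrite invr_gt0.
have bst : bm T (st' e x0) := smooth_bm (@smooth_st' e x0).
have bsf := bmM bst bf.
have xx : x0 <= x0 + e by rewrite lerDl ltW.
have out0 s t : 0 <= s -> s <= t -> t <= T -> (t <= x0 \/ x0 + e <= s) ->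
    \int[lambda]_(x in `[s, t]) (st' e x0 x * f x) = 0.
  move=> s0 sst tT out; apply/eqP; rewrite -normr_le0 -[leRHS](mul0r (t - s)).
  apply: (int_bound bsf s0 sst tT).
  apply: (lebesgue_ae_imply2 _ (lebesgue_ae_neq x0) (lebesgue_ae_neq (x0 + e))) => x nx1 nx2 /andP[sx xt].
  rewrite /st' derive_step_out ?mulr0 ?mul0r ?normr0// mulrC mulNr -mulrBl.
  case: out => out; [left|right].
    by rewrite pmulr_llt0// subr_lt0 lt_neqAle nx1 (le_trans xt).
  rewrite ltr_pdivlMr// mul1r ltrBrDl lt_neqAle eq_sym nx2/=; exact: le_trans sx.
rewrite (int_chasles bsf (lexx 0) x00 (le_trans xx xT) (lexx T)).
rewrite out0//; [|exact: le_trans xx xT|by left].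
rewrite (int_chasles bsf x00 xx xT (lexx T)) (out0 (x0 + e) T)//; last 2 first.
- exact: le_trans xx.
- by right.
rewrite add0r addr0; apply: le_trans (_ : e^-1 * M * h * (x0 + e - x0) <= _).
  apply: (int_bound bsf) => //; apply: lebesgue_aeT => x xe; rewrite normrM ler_pM//; last exact: fh.
  rewrite /st' normrM gtr0_norm// ler_wpM2l ?(ltW e0')//; apply: stM.
  move: xe => /andP[x1 x2]; rewrite mulrC mulNr -mulrBl divr_ge0 ?subr_ge0 ?(ltW e0)//=.
  by rewrite ler_pdivrMr// mul1r lerBlDl.
rewrite (_ : x0 + e - x0 = e); last by ring.
rewrite le_eqVlt; apply/orP; left; apply/eqP; field; exact: lt0r_neq0.
Qed.

(* The kernels are hidden behind an existential: conversion must not unfold them. *)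
Let mollifier : exists (S' : R -> R -> R -> R) (M m : R), [/\ 0 < M, 0 < m,
  (forall e x0, bm T (S' e x0)),
  (forall e s t, 0 < e -> 0 < s -> s < t -> t + e < T -> exists2 phi, time_test T phi &
    forall x, phi^`()%classic x = S' e s x - S' e t x) &
  forall e x0, 0 < e -> 0 <= x0 -> x0 + e <= T ->
  \int[lambda]_(x in `[0, T]) S' e x0 x = m /\
  forall f h, bm T f -> (forall x, x0 <= x <= x0 + e -> `|f x| <= h) ->
    `|\int[lambda]_(x in `[0, T]) (S' e x0 x * f x)| <= M * h].
Proof.
exists st', M, (step 1); split.
- by have [] := MP.
- exact: step1_gt0.
- by move=> e x0; apply: smooth_bm; exact: smooth_st'.
- move=> e s t e0 s0 st0 teT; exists (fun x => st e s x + (-1) * st e t x).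
    split; first by apply/smoothP => k; apply: has_derivsD; [|apply: has_derivsZ]; exact: smooth_st.
    exists s, (t + e); split => // x; rewrite negb_and -!ltNge => /orP[xs|xt].
      have neg a : x <= a -> e^-1 * x + - a / e <= 0.
        by move=> xa; rewrite mulrC mulNr -mulrBl pmulr_lle0 ?invr_gt0// subr_le0.
      by rewrite /st !step_le0 ?mulr0 ?addr0//; apply: neg; lra.
    have pos a : a + e <= x -> 1 <= e^-1 * x + - a / e.
      by move=> xa; rewrite mulrC mulNr -mulrBl ler_pdivlMr// mul1r lerBrDl.
    by rewrite /st !(step_ge1 (x := _ + _)) ?mulN1r ?subrr//; apply: pos; lra.
  move=> x; rewrite derive1E -(mulN1r (st' e t x)); apply: derive_val.
  have dt := @is_deriveZ _ _ _ (st e t) (-1) x 1 _ (is_derive_st e t x).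
  exact: (is_deriveD (is_derive_st e s x) dt).
- move=> e x0 e0 x00 x0T; split; first exact: int_st'.
  by move=> f h bf fh; exact: st'_mean.
Qed.

(** Du Bois-Reymond: the difference of two steps placed at s and t is a test function whose
    derivative is the difference of two kernels. Averages of e near s and near t therefore agree,
    and continuity compares them with e(s) and e(t). *)
Lemma weak_constant (e : R -> R) : {within `[0, T], continuous e} ->
  (forall phi, time_test T phi -> \int[lambda]_(t in `]0, T[) (phi^`()%classic t * e t) = 0) ->
  forall s t, 0 <= s <= T -> 0 <= t <= T -> e s = e t.
Proof.
move=> ce we; have be := bm_continuous ce.
have [S' [M' [m [M0 m0 bS tS SP]]]] := mollifier.
have inner s t : 0 < s -> s < t -> t < T -> e s = e t.
  move=> s0 sst tT; apply/eqP; rewrite -subr_eq0 -normr_le0; apply/ler_addgt0Pl => h h0; rewrite addr0.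
  (* Each average misses the point value by at most M' h1 before division by the mass m; two such
     errors add up to m h. *)
  pose h1 := h * m / (2 * M').
  have h10 : 0 < h1 by rewrite divr_gt0 ?mulr_gt0.
  have sT : 0 <= s <= T by rewrite ltW//= ltW// (lt_trans sst).
  have tT' : 0 <= t <= T by rewrite !ltW// (lt_trans s0).
  have [d1 d10 H1] := within_continuous_dist ce sT h10.
  have [d2 d20 H2] := within_continuous_dist ce tT' h10.
  (* The kernels extend to the right of s and t, so the width must stay below both moduli of
     continuity and below T - t. *)
  pose ep := Num.min (Num.min d1 d2) (T - t) / 2.
  have mm0 : 0 < Num.min (Num.min d1 d2) (T - t) by rewrite !lt_min d10 d20 subr_gt0 tT.
  have ep0 : 0 < ep by rewrite divr_gt0.
  have ep_lt : ep < Num.min (Num.min d1 d2) (T - t) by rewrite /ep; lra.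
  move: ep_lt; rewrite !lt_min => /andP[/andP[ep1 ep2] epT].
  have tep : t + ep < T by lra.
  have [phi tphi phiE] := tS ep s t ep0 s0 sst tep.
  have mean x0 del : 0 <= x0 -> x0 + ep <= T -> ep < del ->
      (forall z, 0 <= z <= T -> `|x0 - z| < del -> `|e x0 - e z| <= h1) ->
      `|\int[lambda]_(x in `[0, T]) (S' ep x0 x * e x) - m * e x0| <= M' * h1.
    move=> x00 x0T epd H; have [Sm Sh] := SP ep x0 ep0 x00 x0T.
    have be0 : bm T (fun x => e x - e x0) by apply: bmD => //; exact: bm_cst.
    have <- : \int[lambda]_(x in `[0, T]) (S' ep x0 x * (e x - e x0)) =
        \int[lambda]_(x in `[0, T]) (S' ep x0 x * e x) - m * e x0.
      have iA := bm_integrable (bmM (bS ep x0) be) (lexx 0) (lexx T).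
      have iB := bm_integrable (bmM (bS ep x0) (bm_cst T (e x0))) (lexx 0) (lexx T).
      rewrite -Sm -(RintegralZr _ _ (bm_integrable (bS ep x0) (lexx 0) (lexx T)))//.
      rewrite -(RintegralB _ iA iB)//.
      by apply: eq_Rintegral => x _; rewrite mulrBr.
    apply: Sh => // x /andP[x1 x2]; rewrite distrC; apply: H; first by apply/andP; split; lra.
    by rewrite distrC ger0_norm ?subr_ge0//; lra.
  have m1 := mean s d1 (ltW s0) (ltac:(lra)) ep1 H1.
  have m2 := mean t d2 (ltW (lt_trans s0 sst)) (ltW tep) ep2 H2.
  have := we _ tphi.
  rewrite int_oo_cc; last by apply: bmM => //; exact: smooth_bm (smooth_derive1 (time_testP tphi).1).
  under eq_Rintegral do rewrite phiE mulrBl.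
  rewrite RintegralB//; last 2 first.
  - by apply: bm_integrable => //; exact: bmM.
  - by apply: bm_integrable => //; exact: bmM.
  move: m1 m2; set J1 := Rintegral _ _ _; set J2 := Rintegral _ _ _ => m1 m2 E.
  rewrite -(ler_pM2l m0) -{1}(gtr0_norm m0) -normrM.
  rewrite (_ : m * (e s - e t) = (J2 - m * e t) - (J1 - m * e s)); last by lra.
  apply: (le_trans (ler_normB _ _)); apply: (le_trans (lerD m2 m1)).
  rewrite le_eqVlt; apply/orP; left; apply/eqP; rewrite /h1; field; exact: lt0r_neq0.
(* Test functions do not reach the endpoints; there e is compared by continuity with an interior
   point on the segment from s towards T / 2. *)
have mid s : 0 <= s <= T -> e s = e (T / 2).
  move=> sT; apply/eqP; rewrite -subr_eq0 -normr_le0; apply/ler_addgt0Pl => h h0; rewrite addr0.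
  have [del del0 H] := within_continuous_dist ce sT h0.
  pose l := Num.min 1 (del / (2 * T)).
  have l0 : 0 < l by rewrite lt_min ltr01 divr_gt0// mulr_gt0.
  have l1 : l <= 1 by rewrite ge_min lexx.
  have ld : l * T < del.
    have : l <= del / (2 * T) by rewrite ge_min lexx orbT.
    by rewrite ler_pdivlMr ?mulr_gt0//; nra.
  pose z := s + l * (T / 2 - s).
  move: sT => /andP[s0 sT].
  have lT : 0 < l * T by rewrite mulr_gt0.
  have ls : 0 <= (1 - l) * s by rewrite mulr_ge0 ?subr_ge0.
  have lTs : 0 <= (1 - l) * (T - s) by rewrite mulr_ge0 ?subr_ge0.
  have zb : 0 < z < T by apply/andP; split; rewrite /z; lra.
  have -> : e (T / 2) = e z.
    have T2 : 0 < T / 2 < T by apply/andP; split; lra.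
    have [zT|zT|->//] := ltgtP z (T / 2).
      by apply/esym/inner => //; [case/andP: zb|case/andP: T2].
    by apply/inner => //; [case/andP: T2|case/andP: zb].
  apply: H; first by case/andP: zb => *; rewrite !ltW.
  apply: le_lt_trans ld; rewrite /z opprD addNKr normrN normrM (gtr0_norm l0) ler_wpM2l ?(ltW l0)//.
  by rewrite ler_norml; apply/andP; split; lra.
by move=> s t sT tT; rewrite (mid s)// (mid t).
Qed.

Lemma ac_primitive k : bm T k -> ac T (fun t => \int[lambda]_(x in `[0, t]) k x) k.
Proof.
move=> bk; split => // s t s0 sst tT.
by rewrite (int_chasles bk (lexx 0) s0 sst tT) addrAC subrr add0r.
Qed.

(** The difference of y and the primitive of k is continuous with zero weak derivative, hence
    constant. *)
Lemma weak_ac y k : {within `[0, T], continuous y} -> bm T k ->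
  (forall phi, time_test T phi -> \int[lambda]_(t in `]0, T[) (phi^`()%classic t * y t) =
    - \int[lambda]_(t in `]0, T[) (phi t * k t)) -> ac T y k.
Proof.
move=> cy bk wyk; have aY := ac_primitive bk.
set Y := fun t => _ in aY; have by_ := bm_continuous cy; have bY := ac_bm aY.
have cY := ac_continuous aY.
have ce : {within `[0, T], continuous (fun t => y t - Y t)}.
  by move=> x; apply: cvgB; [exact: cy|exact: cY].
have we phi : time_test T phi -> \int[lambda]_(t in `]0, T[) (phi^`()%classic t * (y t - Y t)) = 0.
  move=> tphi; have bphi' := smooth_bm (smooth_derive1 (time_testP tphi).1).
  rewrite int_oo_cc; last by apply: bmM => //; have := bmD by_ (bmZ (-1) bY);
    congr bm; apply/funext => x; rewrite mulN1r.
  under eq_Rintegral do rewrite mulrBr.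
  rewrite RintegralB//; try by apply: bm_integrable => //; exact: bmM.
  rewrite -!int_oo_cc; try exact: bmM.
  by rewrite wyk// (ac_weak aY tphi) subrr.
have eC := weak_constant ce we; split => // s t s0 sst tT.
have [_ <-//] := aY; have := eC s t; rewrite s0 (le_trans sst tT) (le_trans s0 sst) tT.
by move=> /(_ isT isT); rewrite -/(Y s) -/(Y t); lra.
Qed.

(** The function h is a weak derivative of 0, so its primitive vanishes on [0, T]; Lebesgue's
    differentiation theorem recovers h. *)
Lemma weak_zero_ae h : bm T h ->
  (forall phi, time_test T phi -> \int[lambda]_(t in `]0, T[) (phi t * h t) = 0) ->
  {ae lambda, forall t, 0 < t < T -> h t = 0}.
Proof.
move=> bh wh.
have [_ a0] : ac T (cst 0) h.
  apply: weak_ac => //; first by apply: continuous_subspaceT => x; exact: cvg_cst.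
  move=> phi tphi; rewrite wh// oppr0.
  by under eq_Rintegral do rewrite mulr0; rewrite Rintegral_cst ?mul0r.
pose f := h \_ `[0, T].
have intf : lambda.-integrable setT (EFin \o f).
  by rewrite -restrict_EFin; apply/integrable_restrict => //; rewrite setTI; exact: (bm_integrable bh (lexx 0) (lexx T)).
have intf' (z : R) : lambda.-integrable [set` Interval (BLeft 0) (BRight z)] (EFin \o f).
  by apply: integrableS intf => //; exact: measurable_itv.
have locf : locally_integrable [set: R] f by apply: integrable_locally => //; exact: (bm_integrable bh (lexx 0) (lexx T)).
have /= := FTC1 intf' locf.
apply: lebesgue_ae_imply => x + /andP[x0 xT] => /(_ _)[]; first by rewrite lte_fin.
move=> _ F'; have fx : f x = h x by rewrite /f patchE mem_set//= in_itv/= !ltW.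
rewrite -fx -F' derive1E.
have near0 : \forall z \near x, (cst 0 : R -> R) z = \int[lambda]_(t in `[0, z]) f t.
  near=> z; have z0 : 0 < z by near: z; exact: lt_nbhsr.
  have zT : z < T by near: z; exact: lt_nbhsl.
  have := a0 0 z (lexx 0) (ltW z0) (ltW zT); rewrite subrr => E; rewrite [LHS]E.
  apply: eq_Rintegral => t; rewrite inE/= in_itv/= => /andP[t0 tz].
  by rewrite /f patchE mem_set//= in_itv/= t0 (le_trans tz (ltW zT)).
have := @near_eq_is_derive _ _ _ _ _ _ _ _ near0 (is_derive_cst 0 x 1).
by move=> /(@derive_val _ _ _ _ _ _ _).
Unshelve. all: end_near.
Qed.

End weak_time_derivative.

Section nonmeasurable_integrand.
Local Open Scope ereal_scope.
Context d (T : measurableType d) (R : realType) (mu : {measure set T -> \bar R}).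

Import HBSimple HBNNSimple.

(* Without measurability: the integral of a nonnegative function is the supremum of
   the integrals of the simple functions below it. *)
Lemma le_ae_integral (D : set T) (f g : T -> \bar R) :
  (forall x, D x -> 0 <= f x) -> (forall x, D x -> 0 <= g x) ->
  {ae mu, forall x, D x -> f x <= g x} ->
  \int[mu]_(x in D) f x <= \int[mu]_(x in D) g x.
Proof.
move=> f0 g0 [N [mN N0 sub]]; rewrite !ge0_integralE//.
apply: ge_ereal_sup => _ [h /= hf <-].
have mNc : measurable (~` N) by exact: measurableC.
have hE y : proj_nnsfun h mNc y = (h \_ (~` N)) y by rewrite mrestrict.
apply: ereal_sup_ubound => /=; exists (proj_nnsfun h mNc) => [x|].
  rewrite hE patchE; case: ifPn => [/set_mem nxN|_]; last by apply: erestrict_ge0.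
  rewrite (le_trans (hf x))// !patchE; case: ifPn => // xD.
  by apply: contrapT => fg; apply: nxN; apply: sub => /= /(_ (set_mem xD)).
rewrite -!integralT_nnsfun; apply: ae_eq_integral => //.
- exact/measurable_EFinP.
- exact/measurable_EFinP.
- exists N; split => // x /=; apply: contra_notP => nxN _.
  by rewrite mindicE mem_set ?mulr1.
Qed.

End nonmeasurable_integrand.

(** * Finitely valued functions of time *)

Section finitely_valued.
Import HBSimple.
Context {R : realType}.
Local Notation lambda := (@lebesgue_measure R).
Local Notation mset A := (measurable (A : set (measurableTypeR R))).

(** A measurable label in a finite type followed by an arbitrary map. The target carries no
    structure, so composition and pairing are immediate, unlike for sums over possibly overlapping
    sets. *)
Definition finvalued V (f : R -> V) := exists (J : finType) (b : R -> J) (v : J -> V),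
  (forall j, mset [set t | b t = j]) /\ forall t, f t = v (b t).

Lemma finvalued_comp V W (G : V -> W) (f : R -> V) : finvalued f -> finvalued (fun t => G (f t)).
Proof.
by move=> [J [b [v [mb fv]]]]; exists J, b, (G \o v); split => // t; rewrite fv.
Qed.

Lemma finvalued_pair V W (f : R -> V) (g : R -> W) :
  finvalued f -> finvalued g -> finvalued (fun t => (f t, g t)).
Proof.
move=> [J [b [v [mb fv]]]] [J' [b' [v' [mb' fv']]]].
exists (J * J')%type, (fun t => (b t, b' t)), (fun j => (v j.1, v' j.2)); split=> [[j j']|t].
  rewrite (_ : [set _ | _] = [set t | b t = j] `&` [set t | b' t = j']).
    exact: measurableI.
  by apply/seteqP; split => t /= [-> ->].
by rewrite fv fv'.
Qed.

Lemma finvalued_comp2 V W Z (G : V -> W -> Z) (f : R -> V) (g : R -> W) :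
  finvalued f -> finvalued g -> finvalued (fun t => G (f t) (g t)).
Proof.
by move=> ff fg; exact: (finvalued_comp (fun p => G p.1 p.2) (finvalued_pair ff fg)).
Qed.

Lemma finvalued_cst V (a : V) : finvalued (fun=> a).
Proof.
exists unit, (fun=> tt), (fun=> a); split => // -[].
by rewrite (_ : [set _ | _] = setT)//; apply/seteqP.
Qed.

Lemma finvalued_measurable (f : R -> R) (D : set R) : mset D -> finvalued f -> measurable_fun D f.
Proof.
move=> mD [J [b [v [mb fv]]]]; apply: (@measurable_funS _ _ _ _ setT) => // _ Y mY.
rewrite setTI (_ : f @^-1` Y = \bigcup_(j in [set j | Y (v j)]) [set t | b t = j]).
  by apply: fin_bigcup_measurable => [|j _]; [exact: finite_finset|exact: mb].
apply/seteqP; split => t /=; first by rewrite fv => Yt; exists (b t).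
by move=> [j /= Yj bj]; rewrite fv bj.
Qed.

Lemma finvalued_in (A : set R) : mset A -> finvalued (fun t => t \in A).
Proof.
move=> mA; exists bool, (fun t => t \in A), id; split => // -[].
  by rewrite (_ : [set _ | _] = A)//; apply/seteqP; split => t /=; [move/set_mem|exact: mem_set].
rewrite (_ : [set _ | _] = ~` A); first exact: measurableC.
by apply/seteqP; split => t /=; [move=> /negP; rewrite inE|move=> nA; apply/negP; rewrite inE].
Qed.

Lemma finvalued_ffun n (A : 'I_n -> set R) : (forall i, mset (A i)) ->
  finvalued (fun t => [ffun i => t \in A i]).
Proof.
move=> mA; exists {ffun 'I_n -> bool}, (fun t => [ffun i => t \in A i]), id; split => // j.
have mAi i : mset [set t | (t \in A i) = j i].
  have [K [b [v [mb Ab]]]] := finvalued_in (mA i).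
  rewrite (_ : [set _ | _] = \bigcup_(k in [set k | v k = j i]) [set t | b t = k]).
    by apply: fin_bigcup_measurable => [|k _]; [exact: finite_finset|exact: mb].
  apply/seteqP; split => t /=; first by rewrite Ab => vt; exists (b t).
  by move=> [k /= vk bk]; rewrite Ab bk.
rewrite (_ : [set _ | _] = \bigcap_(i in [set: 'I_n]) [set t | (t \in A i) = j i]).
  by apply: fin_bigcap_measurable => [|i _]; [exact: finite_finset|exact: mAi].
apply/seteqP; split => t /=; first by move=> <- i _ /=; rewrite ffunE.
by move=> H; apply/ffunP => i; rewrite ffunE; exact: H.
Qed.

Lemma finvalued_sfun (g : {sfun measurableTypeR R >-> R}) : finvalued (fun t => g t).
Proof.
have /finite_seqP[s sE] := @fimfunP _ _ g.
have gs t : g t \in s by suff : [set` s] (g t) by []; rewrite -sE; exists t.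
exists (seq_sub s), (fun t => SeqSub (gs t)), (@ssval _ s); split => // j.
rewrite (_ : [set _ | _] = g @^-1` [set ssval j]); first exact: measurable_sfunP.
apply/seteqP; split => t /=; first by move=> <-.
by move=> gj; exact: val_inj.
Qed.

Lemma finvalued_approx (D : set R) (phi : R -> R) : mset D -> measurable_fun D phi ->
  exists f : nat -> R -> R, (forall n, finvalued (f n)) /\
    forall t, D t -> f n t @[n --> \oo] --> phi t.
Proof.
move=> mD mphi; have mphi' : measurable_fun D (EFin \o phi) by exact/measurable_EFinP.
have [g gphi] := approximation_sfun mD mphi'.
exists (fun n t => g n t); split => [n|t Dt]; first exact: finvalued_sfun.
by have /fine_cvg := gphi t Dt.
Qed.

Lemma finvalued_bounded (f : R -> R) : finvalued f -> exists M, forall t, f t <= M.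
Proof.
move=> [J [b [v [_ fv]]]]; exists (\sum_j `|v j|) => t; rewrite fv (bigD1 (b t))//=.
by rewrite (le_trans (ler_norm _))// lerDl sumr_ge0.
Qed.

Variable T : R.
Local Notation I := (`]0, T[%classic : set R).

Lemma finvalued_integrable (f : R -> R) : finvalued f -> lambda.-integrable I (EFin \o f).
Proof.
move=> ff; apply: measurable_bounded_integrable => //.
- suff : (lambda I < +oo)%E by [].
  by rewrite lebesgue_measure_itv /=; case: ifP => _; rewrite -?EFinB ltry.
- exact: finvalued_measurable.
- have [M fM] := finvalued_bounded (finvalued_comp (fun a : R => `|a|) ff).
  by exists M; split; [exact: num_real|move=> N MN x _ /=; rewrite (le_trans (fM x))// ltW].
Qed.

(** The weights depend on the label map alone, so integration is one fixed finite linear combination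
    and commutes with every linear operation on the values. *)
Lemma finvalued_integral (J : finType) (b : R -> J) : (forall j, mset [set t | b t = j]) ->
  exists c : J -> R, forall G : J -> R,
    \int[lambda]_(t in I) G (b t) = \sum_j c j * G j.
Proof.
move=> mb; have fb V (G : J -> V) : finvalued (fun t => G (b t)) by exists J, b, G.
exists (fun j => \int[lambda]_(t in I) (b t == j)%:R) => G.
have GE t : G (b t) = \sum_j (b t == j)%:R * G j.
  rewrite (bigD1 (b t))//= eqxx mul1r big1 ?addr0// => j.
  by rewrite eq_sym => /negPf ->; rewrite mul0r.
under eq_Rintegral do rewrite GE.
elim: (index_enum J) => [|j r IH].
  under eq_Rintegral do rewrite big_nil; rewrite big_nil.
  by rewrite /Rintegral integral0.
under eq_Rintegral do rewrite big_cons; rewrite big_cons -IH.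
rewrite RintegralD//; last 2 first.
- exact: (finvalued_integrable (fb _ (fun k => (k == j)%:R * G j))).
- exact: (finvalued_integrable (fb _ (fun k => \sum_(i <- r) (k == i)%:R * G i))).
congr (_ + _); rewrite RintegralZr//.
exact: (finvalued_integrable (fb _ (fun k => (k == j)%:R))).
Qed.

Context {d : nat}.
Implicit Types (X : @fspace R d).

Lemma finvalued_ts X (s : tsimple X) : finvalued (ts_fun s).
Proof.
have [J [b [v [mb bE]]]] := finvalued_ffun (@ts_setP _ _ _ s).
exists J, b, (fun j x => \sum_i (v j i)%:R * @ts_val _ _ _ s i x); split => // t.
by apply/funext => x; apply: eq_bigr => i _; rewrite -bE ffunE indicE.
Qed.

Lemma finvalued_tsimple X (f : R -> 'rV[R]_d -> R) : finvalued f -> (forall t, fmem X (f t)) ->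
  exists s : tsimple X, ts_fun s = f.
Proof.
move=> [J [b [v [mb fv]]]] fX.
(* A label that is never attained may carry a value outside X; it is replaced by [f 0], which lies
   in X. *)
pose v' j := if `[< fmem X (v j) >] then v j else f 0.
have v'X j : fmem X (v' j) by rewrite /v'; case: asboolP => // _; exact: fX.
have fv' t : f t = v' (b t).
  by rewrite /v'; case: asboolP => // H; exfalso; apply: H; rewrite -fv.
exists (@TSimple R d X #|J| (fun i => [set t | b t = enum_val i]) (fun i => v' (enum_val i))
  (fun i => mb _) (fun i => v'X _)).
apply/funext => t; apply/funext => x; rewrite /ts_fun /=.
have -> : \sum_(i < #|J|) \1_[set t | b t = enum_val i] t * v' (enum_val i) x =
    \sum_(j in J) (b t == j)%:R * v' j x.
  rewrite [RHS]big_enum_val; apply: eq_bigr => i _; rewrite indicE; congr (_%:R * _).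
  by case: eqP => bt; [rewrite mem_set|rewrite memNset].
rewrite (bigD1 (b t))//= eqxx mul1r big1 ?addr0 ?fv'// => j /negPf.
by rewrite eq_sym => ->; rewrite mul0r.
Qed.

Lemma ts_intE X (s : tsimple X) : ts_int T s = fun x => \int[lambda]_(t in I) ts_fun s t x.
Proof.
apply/funext => x; rewrite /ts_int /ts_fun; elim: (index_enum _) => [|i r IH].
  rewrite big_nil; under eq_Rintegral do rewrite big_nil.
  by rewrite /Rintegral integral0.
have fi k : finvalued (fun t => \1_(@ts_set _ _ _ s k) t * @ts_val _ _ _ s k x).
  apply: (finvalued_comp (fun a : R => a * @ts_val _ _ _ s k x)).
  by apply: (finvalued_comp (fun a : bool => a%:R : R)); apply: finvalued_in; exact: ts_setP.
have fs : finvalued (fun t => \sum_(k <- r) \1_(@ts_set _ _ _ s k) t * @ts_val _ _ _ s k x).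
  elim: r {IH} => [|k r IH]; first by under eq_fun do rewrite big_nil; exact: finvalued_cst.
  by under eq_fun do rewrite big_cons; exact: (finvalued_comp2 +%R).
rewrite big_cons IH; under [RHS]eq_Rintegral do rewrite big_cons.
rewrite RintegralD//; [|exact: finvalued_integrable..].
congr (_ + _); rewrite RintegralZr//.
  by rewrite /Rintegral integral_indic//; exact: ts_setP.
apply: finvalued_integrable; apply: (finvalued_comp (fun a : bool => a%:R : R)).
by apply: finvalued_in; exact: ts_setP.
Qed.

End finitely_valued.

Lemma cvg0_le (R : realType) (a b : nat -> R) : (forall n, 0 <= a n <= b n) ->
  b n @[n --> \oo] --> (0 : R) -> a n @[n --> \oo] --> (0 : R).
Proof.
by move=> ab b0; apply: (@squeeze_cvgr _ _ _ _ (fun=> 0) b) => //; [exact: nearW|exact: cvg_cst].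
Qed.

Lemma le_cvg0 (R : realType) (a : R) (b : nat -> R) : (forall n, a <= b n) ->
  b n @[n --> \oo] --> (0 : R) -> a <= 0.
Proof.
move=> ab b0; apply/ler_addgt0Pl => e e0; have /cvgr0_norm_lt/(_ e e0)[N _ H] := b0.
rewrite addr0; apply: (le_trans (ab N)); apply: (le_trans (ler_norm _)); apply: ltW.
exact: (H N (leqnn N)).
Qed.

Lemma cvge0_le (R : realType) (a b : nat -> \bar R) : (forall n, 0 <= a n <= b n)%E ->
  b n @[n --> \oo] --> 0%E -> a n @[n --> \oo] --> 0%E.
Proof.
move=> ab b0; have H : \forall n \near \oo, ((fun=> 0) n <= a n <= b n)%E by exact: nearW.
exact: (squeeze_cvge H (cvg_cst _) b0).
Qed.

(** * Strong measurability and Bochner integrals *)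

Section seminormed_spaces.
Context {R : realType} {d : nat}.
Implicit Types (X Y Z : @fspace R d) (f g : 'rV[R]_d -> R) (a : R).

(** The axioms that an [fspace] lacks. Nonnegativity is required outside the members too, so that
    squeezing needs no membership proof. *)
Record seminormed X : Prop := Seminormed {
  sn0 : fmem X (fun=> 0);
  snD : forall f g, fmem X f -> fmem X g -> fmem X (fun x => f x + g x);
  snZ : forall a f, fmem X f -> fmem X (fun x => a * f x);
  sn_ge0 : forall f, 0 <= fnorm X f;
  sn_normD : forall f g, fmem X f -> fmem X g ->
    fnorm X (fun x => f x + g x) <= fnorm X f + fnorm X g;
  sn_normZ : forall a f, fmem X f -> fnorm X (fun x => a * f x) = `|a| * fnorm X f }.

Variable X : @fspace R d.
Hypothesis sX : seminormed X.

Let BE f g : (fun x => f x - g x) = (fun x => f x + (-1) * g x).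
Proof. by apply/funext => x; rewrite mulN1r. Qed.

Lemma snB f g : fmem X f -> fmem X g -> fmem X (fun x => f x - g x).
Proof. by move=> Xf Xg; rewrite BE; apply: (snD sX) => //; exact: (snZ sX). Qed.

Lemma sn_normB f g : fmem X f -> fmem X g -> fnorm X (fun x => f x - g x) <= fnorm X f + fnorm X g.
Proof.
move=> Xf Xg; rewrite BE; apply: (le_trans (sn_normD sX Xf (snZ sX _ Xg))).
by rewrite (sn_normZ sX)// normrN normr1 mul1r.
Qed.

Lemma sn_normC f g : fmem X f -> fmem X g -> fnorm X (fun x => f x - g x) = fnorm X (fun x => g x - f x).
Proof.
move=> Xf Xg; rewrite -[RHS]mul1r -[1 in RHS]normr1 -normrN -(sn_normZ sX); last exact: snB.
by congr (fnorm X _); apply/funext => x; rewrite mulN1r opprB.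
Qed.

Lemma sn_norm_le f g : fmem X f -> fmem X g -> fnorm X f <= fnorm X (fun x => f x - g x) + fnorm X g.
Proof.
move=> Xf Xg; have := sn_normD sX (snB Xf Xg) Xg.
by congr (fnorm X _ <= _); apply/funext => x; rewrite subrK.
Qed.

Lemma sn_dist f g : fmem X f -> fmem X g -> `|fnorm X f - fnorm X g| <= fnorm X (fun x => f x - g x).
Proof.
move=> Xf Xg; rewrite ler_norml; apply/andP; split.
  by have := sn_norm_le Xg Xf; rewrite (sn_normC Xg Xf); lra.
by have := sn_norm_le Xf Xg; lra.
Qed.

Lemma sn_norm0 : fnorm X (fun=> 0) = 0.
Proof.
have := sn_normZ sX 0 (sn0 sX); by rewrite normr0 !mul0r.
Qed.

Lemma sn_sum I (r : seq I) (F : I -> 'rV[R]_d -> R) : (forall i, fmem X (F i)) ->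
  fmem X (fun x => \sum_(i <- r) F i x).
Proof.
move=> XF; elim: r => [|i r IH].
  by under eq_fun do rewrite big_nil; exact: sn0.
by under eq_fun do rewrite big_cons; exact: (snD sX).
Qed.

Lemma fmem_ts_fun (s : tsimple X) t : fmem X (ts_fun s t).
Proof. by apply: sn_sum => i; apply: (snZ sX); exact: ts_valP. Qed.

End seminormed_spaces.

Section strongly_measurable.
Context {R : realType} {d : nat}.
Variable T : R.
Hypothesis T0 : 0 < T.
Local Notation lambda := (@lebesgue_measure R).
Local Notation I := (`]0, T[%classic : set R).
Implicit Types (X Y Z : @fspace R d) (u v : R -> 'rV[R]_d -> R) (w : 'rV[R]_d -> R).

(** Bounded strong measurability demanded at every time of [0, T] rather than a.e. on (0, T), so
    that values can be manipulated pointwise. [Linfty_strong] and [strong_Linfty] pass between the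
    two notions. *)
Definition strong X u := [/\ forall t, 0 <= t <= T -> fmem X (u t),
  exists M, forall t, 0 <= t <= T -> fnorm X (u t) <= M &
  exists f : nat -> R -> 'rV[R]_d -> R, [/\ forall k, finvalued (f k),
    forall k t, fmem X (f k t) &
    forall t, 0 <= t <= T -> fnorm X (fun x => u t x - f k t x) @[k --> \oo] --> (0 : R)]].

Let II t : I t -> 0 <= t <= T.
Proof. by rewrite /= in_itv/= => /andP[t0 tT]; rewrite !ltW. Qed.

Lemma strong_bound X u : strong X u -> exists2 M, 0 < M & forall t, 0 <= t <= T -> fnorm X (u t) <= M.
Proof.
move=> [_ [M uM] _]; exists (`|M| + 1); first by rewrite ltr_wpDl.
by move=> t tT; rewrite (le_trans (uM t tT))// (le_trans (ler_norm M))// lerDl.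
Qed.

Section one_space.
Variable X : @fspace R d.
Hypothesis sX : seminormed X.

(** Approximants of norm above M + 1 are set to 0. At each time this happens only finitely often,
    since the approximants come within distance 1 of u. *)
Lemma strong_bounded_approx u : strong X u -> exists M, exists f : nat -> R -> 'rV[R]_d -> R,
  [/\ 0 < M, forall t, 0 <= t <= T -> fnorm X (u t) <= M, forall k, finvalued (f k),
    forall k t, fmem X (f k t) /\ fnorm X (f k t) <= M &
    forall t, 0 <= t <= T -> fnorm X (fun x => u t x - f k t x) @[k --> \oo] --> (0 : R)].
Proof.
move=> su; have [M M0 uM] := strong_bound su; have [Xu _ [f [ff Xf uf]]] := su.
exists (M + 1), (fun k t => if fnorm X (f k t) <= M + 1 then f k t else (fun=> 0)); split.
- by rewrite addr_gt0.
- by move=> t /uM/le_trans; apply; rewrite lerDl.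
- by move=> k; apply: (finvalued_comp (fun g => if fnorm X g <= M + 1 then g else (fun=> 0))).
- move=> k t; case: ifPn => // _; split; first exact: sn0.
  by rewrite (sn_norm0 sX) ltW// addr_gt0.
- move=> t tT; have ut := uf t tT; apply: cvg_trans ut; apply: near_eq_cvg.
  have /cvgr0_norm_lt/(_ 1 ltr01) := uf t tT; apply: filterS => k ut1.
  rewrite ifT//; have := sn_norm_le sX (Xf k t) (Xu t tT).
  rewrite (sn_normC sX (Xf k t) (Xu t tT)); have := uM t tT.
  by move: ut1; rewrite ger0_norm ?(sn_ge0 sX)//; lra.
Qed.

Lemma strong_fnorm u : strong X u -> bm T (fun t => fnorm X (u t)).
Proof.
move=> [Xu [M uM] [f [ff Xf uf]]]; split; last first.
  by exists M => t tT; rewrite ger0_norm ?(sn_ge0 sX)//; exact: uM.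
apply: (@measurable_fun_cvg _ _ _ _ (fun k t => fnorm X (f k t))) => //.
  by move=> k; apply: finvalued_measurable => //; exact: finvalued_comp.
move=> t; rewrite /= in_itv => tT; apply/cvgrPdist_lt => e e0.
have /cvgr0_norm_lt/(_ e e0) := uf t tT; apply: filterS => k.
rewrite ger0_norm ?(sn_ge0 sX)// => /(le_lt_trans _); apply.
exact: sn_dist (Xu t tT) (Xf k t).
Qed.

Lemma strong_finvalued f : finvalued f -> (forall t, fmem X (f t)) -> strong X f.
Proof.
move=> ff Xf; split => //.
  have [M fM] := finvalued_bounded (finvalued_comp (fnorm X) ff).
  by exists M => t _.
exists (fun=> f); split => // t _.
rewrite (_ : (fun x => f t x - f t x) = (fun=> 0)); last by apply/funext => x; rewrite subrr.
by rewrite (sn_norm0 sX); exact: cvg_cst.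
Qed.

Lemma strongD u v : strong X u -> strong X v -> strong X (fun t x => u t x + v t x).
Proof.
move=> [Xu [M uM] [f [ff Xf uf]]] [Xv [N vN] [g [fg Xg vg]]]; split.
- by move=> t tT; apply: (snD sX); [exact: Xu|exact: Xv].
- exists (M + N) => t tT; apply: (le_trans (sn_normD sX (Xu t tT) (Xv t tT))).
  by apply: lerD; [exact: uM|exact: vN].
- exists (fun k t x => f k t x + g k t x); split.
  + by move=> k; exact: (finvalued_comp2 (fun (a b : 'rV[R]_d -> R) x => a x + b x) (ff k) (fg k)).
  + by move=> k t; apply: (snD sX).
  + move=> t tT; apply: (@cvg0_le _ _ (fun k => fnorm X (fun x => u t x - f k t x) + fnorm X (fun x => v t x - g k t x))).
      move=> k; rewrite (sn_ge0 sX)/=.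
      rewrite (_ : (fun x => _) = (fun x => (u t x - f k t x) + (v t x - g k t x))).
        by apply: (sn_normD sX); apply: (snB sX); [exact: Xu|exact: Xf|exact: Xv|exact: Xg].
      by apply/funext => x; ring.
    by rewrite -[X in _ --> X](addr0 0); apply: cvgD; [exact: uf|exact: vg].
Qed.

Lemma strongM (phi : R -> R) u : bm T phi -> strong X u -> strong X (fun t x => phi t * u t x).
Proof.
move=> [mphi [N phiN]] [Xu [M uM] [f [ff Xf uf]]]; split.
- by move=> t tT; apply: (snZ sX); exact: Xu.
- exists (N * M) => t tT; rewrite (sn_normZ sX); last exact: Xu.
  by apply: ler_pM => //; [exact: (sn_ge0 sX)|exact: phiN|exact: uM].
have [g [fg phig]] := finvalued_approx (measurable_itv `[0, T]) mphi.
exists (fun k t x => g k t * f k t x); split.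
- by move=> k; exact: (finvalued_comp2 (fun a (b : 'rV[R]_d -> R) x => a * b x) (fg k) (ff k)).
- by move=> k t; apply: (snZ sX).
move=> t tT; have fu : fnorm X (f k t) @[k --> \oo] --> fnorm X (u t).
  apply/cvgrPdist_lt => e e0; have /cvgr0_norm_lt/(_ e e0) := uf t tT; apply: filterS => k.
  rewrite ger0_norm ?(sn_ge0 sX)// => /(le_lt_trans _); apply.
  exact: sn_dist (Xu t tT) (Xf k t).
apply: (@cvg0_le _ _ (fun k => `|phi t| * fnorm X (fun x => u t x - f k t x) + `|phi t - g k t| * fnorm X (f k t))).
  move=> k; rewrite (sn_ge0 sX)/= -(sn_normZ sX); last exact: snB (Xu t tT) (Xf k t).
  rewrite -(sn_normZ sX)//.
  rewrite (_ : (fun x => _ - _) = (fun x => phi t * (u t x - f k t x) + (phi t - g k t) * f k t x)).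
    by apply: (sn_normD sX); apply: (snZ sX) => //; exact: snB (Xu t tT) (Xf k t).
  by apply/funext => x; ring.
have g0 : `|phi t - g k t| @[k --> \oo] --> (0 : R).
  have phit : g k t @[k --> \oo] --> phi t by apply: phig; rewrite /= in_itv.
  rewrite -(@normr0 _ R) -(subrr (phi t)); apply: cvg_norm; apply: cvgB => //; exact: cvg_cst.
rewrite [X in _ --> X](_ : 0 = `|phi t| * 0 + 0 * fnorm X (u t)); last by ring.
by apply: cvgD; [apply: cvgMr; exact: uf|exact: cvgM].
Qed.

Lemma strongB u v : strong X u -> strong X v -> strong X (fun t x => u t x - v t x).
Proof.
move=> su sv; have := strongD su (strongM (bm_cst T (-1)) sv).
by congr strong; apply/funext => t; apply/funext => x; rewrite mulN1r.
Qed.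

(** Setting u and its simple approximants to 0 outside a measurable set of full measure turns all
    a.e. properties into pointwise ones. *)
Lemma Linfty_strong u : Linfty T X u ->
  exists2 u', strong X u' & {ae lambda, forall t, I t -> u' t = u t}.
Proof.
move=> [Xu [s su] [M uM]].
have [N [mN N0 sub]] : {ae lambda, forall t, I t -> [/\ fmem X (u t),
    fnorm X (u t \- ts_fun (s k) t) @[k --> \oo] --> (0 : R) & fnorm X (u t) <= M]}.
  have H := lebesgue_ae_imply2 (fun t (a : I t -> fmem X (u t)) b => conj a b) Xu su.
  apply: lebesgue_ae_imply2 H uM => t [a b] e It; split; [exact: a|exact: b|exact: e].
pose A := I `\` N.
have mA : measurable (A : set (measurableTypeR R)) by exact: measurableD.
have AP t : A t -> [/\ fmem X (u t),
    fnorm X (u t \- ts_fun (s k) t) @[k --> \oo] --> (0 : R) & fnorm X (u t) <= M].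
  by move=> [It nN]; apply: contrapT => h; apply: nN; apply: sub => /= /(_ It).
exists (fun t => if t \in A then u t else (fun=> 0)).
  split.
  - by move=> t _; case: ifPn => [/set_mem/AP[]//|_]; exact: sn0.
  - exists (Num.max M 0) => t _; case: ifPn => [/set_mem/AP[_ _ uM']|_].
      by rewrite le_max uM'.
    by rewrite (sn_norm0 sX) le_max lexx orbT.
  - exists (fun k t => if t \in A then ts_fun (s k) t else (fun=> 0)); split.
    + move=> k; apply: (finvalued_comp2 (fun (b : bool) (g : 'rV[R]_d -> R) => if b then g else (fun=> 0))).
        exact: finvalued_in.
      exact: finvalued_ts.
    + by move=> k t; case: ifPn => _; [exact: fmem_ts_fun|exact: sn0].
    + move=> t _; case: ifPn => [/set_mem/AP[]//|_].
      under eq_fun do under eq_fun do rewrite subrr.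
      by rewrite (sn_norm0 sX); exact: cvg_cst.
exists N; split => // t /=; apply: contra_notP => nN It; rewrite ifT//.
by rewrite mem_set.
Qed.

Lemma strong_Linfty u v : strong X u -> {ae lambda, forall t, I t -> u t = v t} -> Linfty T X v.
Proof.
move=> [Xu [M uM] [f [ff Xf uf]]] uv.
have [s sf] := choice (fun k => finvalued_tsimple (ff k) (Xf k)).
split.
- by apply: lebesgue_ae_imply uv => t uv It; rewrite -(uv It); exact: Xu (II It).
- exists s; apply: lebesgue_ae_imply uv => t uv It; rewrite -(uv It).
  by under eq_fun do rewrite sf; exact: uf (II It).
- exists M; apply: lebesgue_ae_imply uv => t uv It; rewrite -(uv It).
  exact: uM (II It).
Qed.

Lemma fmem_integral h : finvalued h -> (forall t, fmem X (h t)) ->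
  fmem X (fun x => \int[lambda]_(t in I) h t x).
Proof.
move=> fh Xh; have [s sh] := finvalued_tsimple fh Xh.
rewrite -sh -ts_intE; apply: (sn_sum sX) => i; apply: (snZ sX); exact: ts_valP.
Qed.

(* [bochner_int] with simple functions replaced by finitely valued ones. *)
Definition bint u w := [/\ ae_mem T X u, fmem X w &
  exists f : nat -> R -> 'rV[R]_d -> R,
  [/\ forall k, finvalued (f k), forall k t, fmem X (f k t),
    {ae lambda, forall t, I t -> fnorm X (fun x => u t x - f k t x) @[k --> \oo] --> (0 : R)},
    (\int[lambda]_(t in I) (fnorm X (fun x => u t x - f k t x))%:E)%E @[k --> \oo] --> 0%E &
    fnorm X (fun x => \int[lambda]_(t in I) f k t x - w x) @[k --> \oo] --> (0 : R)]].

Lemma bochner_intP u w : bochner_int T X u w <-> bint u w.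
Proof.
split=> [[Xu Xw [s [su s0 sw]]]|[Xu Xw [f [ff Xf uf f0 fw]]]]; split => //.
  exists (fun k => ts_fun (s k)); split => //.
  - by move=> k; exact: finvalued_ts.
  - by move=> k t; exact: fmem_ts_fun.
  - by move: sw; under eq_fun do rewrite ts_intE.
have [s sf] := choice (fun k => finvalued_tsimple (ff k) (Xf k)).
exists s; split.
- apply: lebesgue_ae_imply uf => t uf It.
  by under eq_fun do rewrite sf; exact: uf It.
- by under eq_fun do under eq_integral do rewrite sf.
- by under eq_fun do rewrite ts_intE sf.
Qed.

(** A Bochner integral sees u only through distances to members of X. These distances need not be
    measurable in time, so the two error integrals are compared by a.e. inequalities in both
    directions. *)
Lemma bint_ae u v w : {ae lambda, forall t, I t -> fmem X (v t) /\
    forall f, fmem X f -> fnorm X (fun x => v t x - f x) = fnorm X (fun x => u t x - f x)} ->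
  bint u w -> bint v w.
Proof.
move=> uv [Xu Xw [f [ff Xf uf f0 fw]]]; split => //.
  by apply: lebesgue_ae_imply uv => t + It => /(_ It)[].
exists f; split => //.
  apply: lebesgue_ae_imply2 uv uf => t uv uf It.
  by have [_ uvE] := uv It; under eq_fun do rewrite uvE//; exact: uf.
apply: cvg_trans f0; apply: near_eq_cvg; apply: nearW => k.
by apply/eqP; rewrite eq_le; apply/andP; split; apply: le_ae_integral => [t _|t _|];
  rewrite ?lee_fin ?(sn_ge0 sX)//; apply: lebesgue_ae_imply uv => t uv It;
  have [_ ->] := uv It.
Qed.

(** Strong measurability makes the error norms measurable, which lets the integral of their sum
    split. *)
Lemma bint_sub u v w w' : strong X u -> strong X v -> bint u w -> bint v w' ->
  bint (fun t x => u t x - v t x) (fun x => w x - w' x).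
Proof.
move=> su sv [Xu Xw [f [ff Xf uf f0 fw]]] [Xv Xw' [g [fg Xg vg g0 gw']]]; split.
- by apply: lebesgue_ae_imply2 Xu Xv => t a b It; exact: (snB sX (a It) (b It)).
- exact: snB.
have tri (a b a' b' : 'rV[R]_d -> R) : fmem X a -> fmem X b -> fmem X a' -> fmem X b' ->
    0 <= fnorm X (fun x => (a x - b x) - (a' x - b' x)) <=
    fnorm X (fun x => a x - a' x) + fnorm X (fun x => b x - b' x).
  move=> Xa Xb Xa' Xb'; rewrite (sn_ge0 sX)/=.
  rewrite (_ : (fun x => _) = (fun x => (a x - a' x) - (b x - b' x))).
    by apply: sn_normB => //; exact: snB.
  by apply/funext => x; ring.
exists (fun k t x => f k t x - g k t x); split.
- by move=> k; exact: (finvalued_comp2 (fun (a b : 'rV[R]_d -> R) x => a x - b x) (ff k) (fg k)).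
- by move=> k t; exact: snB.
- apply: lebesgue_ae_imply2 uf vg => t uf vg It; have [Xut _ _] := su; have [Xvt _ _] := sv.
  apply: (@cvg0_le _ _ (fun k => fnorm X (fun x => u t x - f k t x) + fnorm X (fun x => v t x - g k t x))).
    by move=> k; apply: tri; [exact: Xut (II It)|exact: Xvt (II It)|exact: Xf|exact: Xg].
  by rewrite -[X in _ --> X](addr0 0); apply: cvgD; [exact: uf|exact: vg].
- have mI u' h : strong X u' -> finvalued h -> (forall t, fmem X (h t)) ->
      measurable_fun I (fun t => (fnorm X (fun x => u' t x - h t x))%:E).
    move=> su' fh Xh; apply/measurable_EFinP.
    have [mn _] := strong_fnorm (strongB su' (strong_finvalued fh Xh)).
    by apply: measurable_funS mn => //; apply: subset_itv; rewrite bnd_simp.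
  apply: (@cvge0_le _ _ (fun k =>
    (\int[lambda]_(t in I) (fnorm X (fun x => u t x - f k t x))%:E +
     \int[lambda]_(t in I) (fnorm X (fun x => v t x - g k t x))%:E)%E)).
  + move=> k; apply/andP; split.
      by apply: integral_ge0 => t _; rewrite lee_fin (sn_ge0 sX).
    rewrite -ge0_integralD//; last 4 first.
    * by move=> t _; rewrite lee_fin (sn_ge0 sX).
    * exact: mI.
    * by move=> t _; rewrite lee_fin (sn_ge0 sX).
    * exact: mI.
    apply: le_ae_integral => [t _|t _|]; first by rewrite lee_fin (sn_ge0 sX).
      by rewrite -EFinD lee_fin addr_ge0// (sn_ge0 sX).
    apply: lebesgue_ae_imply2 Xu Xv => t a b It; rewrite -EFinD lee_fin.
    by have /andP[] := tri _ _ _ _ (a It) (b It) (Xf k t) (Xg k t).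
  + by rewrite -[X in _ --> X](adde0 0%E); apply: cvgeD => //; rewrite fin_num_adde_defl.
- have fi (h : R -> 'rV[R]_d -> R) x : finvalued h -> lambda.-integrable I (EFin \o (fun t => h t x)).
    by move=> fh; apply: finvalued_integrable; exact: (finvalued_comp (fun a : 'rV[R]_d -> R => a x)).
  apply: (@cvg0_le _ _ (fun k => fnorm X (fun x => \int[lambda]_(t in I) f k t x - w x) +
      fnorm X (fun x => \int[lambda]_(t in I) g k t x - w' x))).
    move=> k; under eq_fun do rewrite (RintegralB _ (fi _ _ (ff k)) (fi _ _ (fg k)))//.
    by apply: tri => //; exact: fmem_integral.
  by rewrite -[X in _ --> X](addr0 0); apply: cvgD; [exact: fw|exact: gw'].
Qed.

(** The Bochner integrals are moved to strong representatives, subtracted there, and moved back. *)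
Lemma weak_tderiv_sub u u' v v' : Linfty T X u -> Linfty T X u' -> Linfty T X v -> Linfty T X v' ->
  weak_tderiv T X u v -> weak_tderiv T X u' v' ->
  weak_tderiv T X (fun t x => u t x - u' t x) (fun t x => v t x - v' t x).
Proof.
move=> /Linfty_strong[U sU UE] /Linfty_strong[U' sU' UE'] /Linfty_strong[V sV VE] /Linfty_strong[V' sV' VE'].
move=> uv uv' phi tphi; have [sphi _] := time_testP tphi.
have [w [uw vw]] := uv phi tphi; have [w' [uw' vw']] := uv' phi tphi.
have key (psi : R -> R) a a' A A' z z' : smooth psi -> strong X A -> strong X A' ->
    {ae lambda, forall t, I t -> A t = a t} -> {ae lambda, forall t, I t -> A' t = a' t} ->
    bochner_int T X (fun t x => psi t * a t x) z -> bochner_int T X (fun t x => psi t * a' t x) z' ->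
    bochner_int T X (fun t x => psi t * (a t x - a' t x)) (fun x => z x - z' x).
  move=> spsi sA sA' Aa Aa' /bochner_intP az /bochner_intP az'; apply/bochner_intP.
  have bpsi := @smooth_bm _ T _ spsi.
  have sA1 := strongM bpsi sA; have sA1' := strongM bpsi sA'.
  have Az : bint (fun t x => psi t * A t x) z.
    apply: bint_ae az; apply: lebesgue_ae_imply Aa => t Aa It; rewrite -(Aa It); split => //.
    by have [XA _ _] := sA1; exact: XA (II It).
  have Az' : bint (fun t x => psi t * A' t x) z'.
    apply: bint_ae az'; apply: lebesgue_ae_imply Aa' => t Aa' It; rewrite -(Aa' It); split => //.
    by have [XA _ _] := sA1'; exact: XA (II It).
  apply: bint_ae (bint_sub sA1 sA1' Az Az').
  apply: lebesgue_ae_imply2 Aa Aa' => t Aa Aa' It; rewrite -(Aa It) -(Aa' It).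
  have E : (fun x => psi t * (A t x - A' t x)) = (fun x => psi t * A t x - psi t * A' t x).
    by apply/funext => x; rewrite mulrBr.
  split=> [|f Xf]; first by rewrite E; have [XA _ _] := strongB sA1 sA1'; exact: XA (II It).
  by congr (fnorm X _); apply/funext => x; rewrite mulrBr.
exists (fun x => w x - w' x); split.
  exact: (key _ _ _ _ _ _ _ (smooth_derive1 sphi) sU sU' UE UE' uw uw').
have := key phi v v' V V' _ _ sphi sV sV' VE VE' vw vw'.
by congr bochner_int; apply/funext => x; rewrite opprB addrC opprK.
Qed.

Lemma LinftyB u v : Linfty T X u -> Linfty T X v -> Linfty T X (fun t x => u t x - v t x).
Proof.
move=> /Linfty_strong[U sU UE] /Linfty_strong[V sV VE]; apply: strong_Linfty (strongB sU sV) _.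
by apply: lebesgue_ae_imply2 UE VE => t a b It; rewrite (a It) (b It).
Qed.

Lemma Winfty_sub k u v : Winfty T X k u -> Winfty T X k v -> Winfty T X k (fun t x => u t x - v t x).
Proof.
elim: k u v => [|k IH] u v /= [Lu Wu] [Lv Wv]; split; try exact: LinftyB; first by [].
have [u' [uu' Wu']] := Wu; have [v' [vv' Wv']] := Wv.
exists (fun t x => u' t x - v' t x); split; last exact: IH.
by apply: weak_tderiv_sub => //; [case: k {IH Wu Wv} Wu' Wv' => [|k] []|case: k {IH Wu Wv} Wu' Wv' => [|k] _ []].
Qed.

Lemma WinftyW k u : Winfty T X k.+1 u -> Winfty T X k u.
Proof.
elim: k u => [|k IH] u [Lu [v [uv Wv]]]; first by split.
by split => //; exists v; split => //; exact: IH.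
Qed.

End one_space.

(** The Lipschitz bound is a separate hypothesis because A may be linear only up to a.e. equality,
    as for the chosen weak derivative [wD]. *)
Lemma strong_map X Y (A : ('rV[R]_d -> R) -> 'rV[R]_d -> R) (C : R) u :
  seminormed X -> seminormed Y -> 0 <= C ->
  (forall f, fmem X f -> fmem Y (A f)) -> (forall f, fmem X f -> fnorm Y (A f) <= C * fnorm X f) ->
  (forall f g, fmem X f -> fmem X g ->
    fnorm Y (fun x => A f x - A g x) <= C * fnorm X (fun x => f x - g x)) ->
  strong X u -> strong Y (fun t => A (u t)).
Proof.
move=> sX sY C0 AXY AC AB [Xu [M uM] [f [ff Xf uf]]]; split.
- by move=> t tT; exact/AXY/Xu.
- exists (C * M) => t tT; apply: (le_trans (AC _ (Xu t tT))); rewrite ler_wpM2l//; exact: uM.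
- exists (fun k t => A (f k t)); split.
  + by move=> k; exact: finvalued_comp.
  + by move=> k t; exact: AXY.
  + move=> t tT; apply: (@cvg0_le _ _ (fun k => C * fnorm X (fun x => u t x - f k t x))).
      by move=> k; rewrite (sn_ge0 sY)/=; apply: AB; [exact: Xu|exact: Xf].
    by rewrite -(mulr0 C); apply: cvgMr; exact: uf.
Qed.

(** The error splits as B(u - f_k, v) + B(f_k, v - g_k); the second term needs approximants bounded
    uniformly in k. *)
Lemma strong_bilinear X Y Z (B : ('rV[R]_d -> R) -> ('rV[R]_d -> R) -> 'rV[R]_d -> R) (C : R) u v :
  seminormed X -> seminormed Y -> seminormed Z -> 0 <= C ->
  (forall f g, fmem X f -> fmem Y g -> fmem Z (B f g)) ->
  (forall f g, fmem X f -> fmem Y g -> fnorm Z (B f g) <= C * (fnorm X f * fnorm Y g)) ->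
  (forall f f' g x, B f g x - B f' g x = B (fun y => f y - f' y) g x) ->
  (forall f g g' x, B f g x - B f g' x = B f (fun y => g y - g' y) x) ->
  strong X u -> strong Y v -> strong Z (fun t => B (u t) (v t)).
Proof.
move=> sX sY sZ C0 BZ BC Bl Br su sv.
have [M [f [M0 uM ff fM uf]]] := strong_bounded_approx sX su.
have [N [g [N0 vN fg gN vg]]] := strong_bounded_approx sY sv.
have [Xu _ _] := su; have [Yv _ _] := sv; split.
- by move=> t tT; apply: BZ; [exact: Xu|exact: Yv].
- exists (C * (M * N)) => t tT; apply: (le_trans (BC _ _ (Xu t tT) (Yv t tT))).
  rewrite ler_wpM2l// ler_pM//; [exact: (sn_ge0 sX)|exact: (sn_ge0 sY)|exact: uM|exact: vN].
- exists (fun k t => B (f k t) (g k t)); split.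
  + by move=> k; exact: finvalued_comp2.
  + by move=> k t; apply: BZ; [have [] := fM k t|have [] := gN k t].
  + move=> t tT; apply: (@cvg0_le _ _ (fun k => C * (fnorm X (fun x => u t x - f k t x) * N) +
        C * (M * fnorm Y (fun x => v t x - g k t x)))).
      move=> k; rewrite (sn_ge0 sZ)/=; have [Xf fM'] := fM k t; have [Yg gN'] := gN k t.
      have Xuf := snB sX (Xu t tT) Xf; have Yvg := snB sY (Yv t tT) Yg.
      rewrite (_ : (fun x => _) = (fun x => B (fun y => u t y - f k t y) (v t) x +
          B (f k t) (fun y => v t y - g k t y) x)); last first.
        by apply/funext => x; rewrite -Bl -Br; ring.
      apply: (le_trans (sn_normD sZ (BZ _ _ Xuf (Yv t tT)) (BZ _ _ Xf Yvg))); apply: lerD.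
        apply: (le_trans (BC _ _ Xuf (Yv t tT))); rewrite ler_wpM2l// ler_wpM2l ?(sn_ge0 sX)//.
        exact: vN.
      by apply: (le_trans (BC _ _ Xf Yvg)); rewrite ler_wpM2l// ler_wpM2r ?(sn_ge0 sY).
    rewrite [X in _ --> X](_ : 0 = C * (0 * N) + C * (M * 0)); last by ring.
    apply: cvgD; apply: cvgMr; [apply: cvgMl; exact: uf|apply: cvgMr; exact: vg].
Qed.

End strongly_measurable.

(** * Integrals of functions with values in L^2 *)

Section L2_valued.
Context {R : realType} {d : nat}.
Local Notation mu := (@lebesgue_rV R d).
Local Notation lambda := (@lebesgue_measure R).
Variables (T : R) (Omega : set 'rV[R]_d).
Hypothesis T0 : 0 < T.
Hypotheses (oO : open Omega) (fO : (mu Omega < +oo)%E).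
Local Notation sq := (sqint mu Omega).
Local Notation nr := (nrm mu Omega).
Local Notation ip := (ip mu Omega).
Local Notation "f =O g" := (aeD mu Omega f g) (at level 70).
Local Notation I := (`]0, T[%classic : set R).
Implicit Types (f g h w : 'rV[R]_d -> R) (u v a b U V : R -> 'rV[R]_d -> R).
Let mO : measurable Omega. Proof. exact: open_measurable_rV. Qed.
Let sqwD i f : sq (wD Omega i f). Proof. exact: wD_sqint. Qed.

Lemma H2normE f : H2norm Omega f =
  Num.sqrt (H1norm Omega f ^+ 2 + \sum_i gradnorm Omega (wD Omega i f) ^+ 2).
Proof.
rewrite /H2norm; congr (Num.sqrt (_ + _)); apply: eq_bigr => i _.
rewrite (gradnorm_sqr oO (wD Omega i f)); apply: eq_bigr => j _; congr (_ ^+ 2).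
exact: (L2norm_nrm oO (sqwD j _)).
Qed.

Lemma H2norm_ge0 f : 0 <= H2norm Omega f. Proof. exact: sqrtr_ge0. Qed.

Lemma H2normD f g : H2 Omega f -> H2 Omega g ->
  H2norm Omega (fun x => f x + g x) <= H2norm Omega f + H2norm Omega g.
Proof.
move=> [Hf Df] [Hg Dg].
(* The H^2 norm is the Euclidean norm of the H^1 norm and of the gradient norms of the first
   derivatives; [None] indexes the former. *)
pose v h (o : option 'I_d) := if o is Some i then gradnorm Omega (wD Omega i h) else H1norm Omega h.
have E h : H2norm Omega h =
    Num.sqrt (\sum_(o <- None :: map Some (index_enum 'I_d)) v h o ^+ 2).
  by rewrite H2normE big_cons big_map.
have v0 h o : 0 <= v h o by case: o => [i|]; [exact: gradnorm_ge0|exact: H1norm_ge0].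
rewrite (E f) (E g) (E (fun x => f x + g x)); apply: sqrt_sum_triangle => // o.
rewrite v0 /=; case: o => [i|]; last exact: (H1normD oO fO).
apply: le_trans (gradnormD oO fO (Df i) (Dg i)); rewrite le_eqVlt; apply/orP; left; apply/eqP.
exact: (eq_gradnorm oO (sqwD _ _) (sqintD mO (sqwD _ _) (sqwD _ _)) (wDD oO fO i Hf Hg)).
Qed.

Lemma H2normZ (c : R) f : H2 Omega f -> H2norm Omega (fun x => c * f x) = `|c| * H2norm Omega f.
Proof.
move=> [Hf Df]; rewrite (H2normE f) (H2normE (fun x => c * f x)).
have cE : `|c| = Num.sqrt (`|c| ^+ 2) by rewrite sqrtr_sqr normr_id.
rewrite [X in _ = X * _]cE -sqrtrM ?sqr_ge0//; congr Num.sqrt.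
rewrite mulrDr mulr_sumr (H1normZ oO fO c Hf) exprMn; congr (_ + _).
apply: eq_bigr => i _; rewrite -exprMn -(gradnormZ oO fO c (Df i)); congr (_ ^+ 2).
exact: (eq_gradnorm oO (sqwD _ _) (sqintZ mO c (sqwD _ _)) (wDZ oO fO i c Hf)).
Qed.

Lemma sq_fmem f : fmem (XL2 Omega) f <-> sq f. Proof. exact: L2P. Qed.

Lemma seminormed_L2 : seminormed (XL2 Omega).
Proof.
split => /=.
- exact/(L2P mO)/sqint0.
- by move=> f g /(L2P mO) sf /(L2P mO) sg; apply/(L2P mO)/sqintD.
- by move=> c f /(L2P mO) sf; apply/(L2P mO)/sqintZ.
- exact: L2norm_ge0.
- move=> f g /(L2P mO) sf /(L2P mO) sg.
  rewrite (L2norm_nrm oO sf) (L2norm_nrm oO sg) (L2norm_nrm oO (sqintD mO sf sg)).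
  exact: nrmD.
- move=> c f /(L2P mO) sf; rewrite (L2norm_nrm oO sf) (L2norm_nrm oO (sqintZ mO c sf)).
  exact: nrmZ.
Qed.

Lemma seminormed_H10 : seminormed (XH10 Omega).
Proof.
have H00 : H10 Omega (fun=> 0).
  have t0 : test_fun Omega (fun=> 0 : R).
    split; last by exists set0; split => //; exact: compact0.
    elim=> [|k IH] /=; split; try exact: cst_continuous; first by [].
    split=> [i x|i]; first exact: derivable_cst.
    by rewrite (_ : pderiv i _ = fun=> 0)//; apply/funext => x; exact: derive_cst.
  split; first exact: test_fun_H1.
  move=> e e0; exists (fun=> 0) => //.
  rewrite (_ : _ \- _ = (fun x => 0 * (fun=> 0) x)); last first.
    by apply/funext => x /=; rewrite mul0r subrr.
  by rewrite (H1normZ oO fO 0 (test_fun_H1 oO t0)) normr0 mul0r.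
split => /=.
- exact: H00.
- by move=> f g; exact: (H10D oO fO).
- by move=> c f; exact: (H10Z oO fO).
- exact: H1norm_ge0.
- by move=> f g /H10_H1 Hf /H10_H1 Hg; exact: (H1normD oO fO Hf Hg).
- by move=> c f /H10_H1 Hf; exact: (H1normZ oO fO c Hf).
Qed.

Lemma seminormed_H2 : seminormed (XH2 Omega).
Proof.
have H00 := sn0 seminormed_H10.
split => /=.
- split => //; split; first exact: H10_H1 H00.
  move=> i; apply: (eq_H1 oO (sqwD i _) _ (H10_H1 H00)).
  have := wDZ oO fO i 0 (H10_H1 H00).
  have -> : (fun x : 'rV[R]_d => 0 * (fun=> 0) x) = (fun=> 0 : R) by apply/funext => x; rewrite mul0r.
  have -> : (fun x => 0 * wD Omega i (fun=> 0) x) = (fun=> 0) by apply/funext => x; rewrite mul0r.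
  by move=> H; apply: aeD_sym.
- by move=> f g; exact: (H2diamondD oO fO).
- by move=> c f; exact: (H2diamondZ oO fO).
- exact: H2norm_ge0.
- by move=> f g [_ Hf] [_ Hg]; exact: (H2normD Hf Hg).
- by move=> c f [_ Hf]; exact: (H2normZ c Hf).
Qed.

Let sL2 := seminormed_L2.

Lemma strong_sq u t : strong T (XL2 Omega) u -> 0 <= t <= T -> sq (u t).
Proof. by move=> [Xu _ _] tT; apply/sq_fmem/Xu. Qed.

Lemma strong_nrm u : strong T (XL2 Omega) u -> bm T (fun t => nr (u t)).
Proof.
move=> su; have [mu_ [M uM]] := strong_fnorm sL2 su; split.
  apply: (eq_measurable_fun _ _ mu_) => t; rewrite inE/= in_itv/= => tT.
  exact: (L2norm_nrm oO (strong_sq su tT)).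
by exists M => t tT; rewrite -(L2norm_nrm oO (strong_sq su tT)); exact: uM.
Qed.

Lemma strong_L2_approx u : strong T (XL2 Omega) u -> exists M, exists f : nat -> R -> 'rV[R]_d -> R,
  [/\ 0 < M, forall t, 0 <= t <= T -> nr (u t) <= M, forall k, finvalued (f k),
    forall k t, sq (f k t) /\ nr (f k t) <= M &
    forall t, 0 <= t <= T -> nr (fun x => u t x - f k t x) @[k --> \oo] --> (0 : R)].
Proof.
move=> su; have [M [f [M0 uM ff fM uf]]] := strong_bounded_approx sL2 su.
exists M, f; split => //.
- by move=> t tT; rewrite -(L2norm_nrm oO (strong_sq su tT)); exact: uM.
- by move=> k t; have [/sq_fmem sf fM'] := fM k t; split; rewrite -?(L2norm_nrm oO sf).
- move=> t tT; have := uf t tT; apply: cvg_trans; apply: near_eq_cvg; apply: nearW => k.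
  have [/sq_fmem sf _] := fM k t.
  exact: (L2norm_nrm oO (sqintB mO (strong_sq su tT) sf)).
Qed.

Lemma strong_ip u v : strong T (XL2 Omega) u -> strong T (XL2 Omega) v ->
  bm T (fun t => ip (u t) (v t)).
Proof.
move=> su sv; have [M [f [M0 uM ff fM uf]]] := strong_L2_approx su.
have [N [g [N0 vN fg gN vg]]] := strong_L2_approx sv; split; last first.
  exists (M * N) => t tT; apply: (le_trans (cauchy_schwarz mO (strong_sq su tT) (strong_sq sv tT))).
  by rewrite ler_pM ?nrm_ge0//; [exact: uM|exact: vN].
apply: (@measurable_fun_cvg _ _ _ _ (fun k t => ip (f k t) (g k t))) => //.
  by move=> k; apply: finvalued_measurable => //; exact: (finvalued_comp2 ip (ff k) (fg k)).
move=> t; rewrite /= in_itv/= => tT; have [sut svt] := (strong_sq su tT, strong_sq sv tT).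
apply/subr_cvg0; apply: (@norm_cvg0 _ R).
apply: (@cvg0_le _ _ (fun k => nr (fun x => u t x - f k t x) * N + M * nr (fun x => v t x - g k t x))).
  move=> k; rewrite normr_ge0/=; have [sf fM'] := fM k t; have [sg gN'] := gN k t.
  rewrite (_ : _ - _ = - (ip (fun x => u t x - f k t x) (g k t) + ip (u t) (fun x => v t x - g k t x))).
    rewrite normrN; apply: (le_trans (ler_normD _ _)); apply: lerD.
      apply: (le_trans (cauchy_schwarz mO (sqintB mO sut sf) sg)).
      by rewrite ler_wpM2l ?nrm_ge0.
    apply: (le_trans (cauchy_schwarz mO sut (sqintB mO svt sg))).
    by rewrite ler_wpM2r ?nrm_ge0//; exact: uM.
  by rewrite (ipBl mO sut sf sg) (ipBr mO svt sg sut); ring.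
rewrite [X in _ --> X](_ : 0 = 0 * N + M * 0); last by ring.
by apply: cvgD; [apply: cvgMl; exact: uf|apply: cvgMr; exact: vg].
Qed.

Lemma strong_cst g : sq g -> strong T (XL2 Omega) (fun=> g).
Proof. by move=> sg; apply: strong_finvalued => // [|_]; [exact: finvalued_cst|exact/sq_fmem]. Qed.

Lemma strong_ipr u g : strong T (XL2 Omega) u -> sq g -> bm T (fun t => ip (u t) g).
Proof. by move=> su sg; exact: (strong_ip su (strong_cst sg)). Qed.

Lemma integral_ip (h : R -> 'rV[R]_d -> R) g : finvalued h -> (forall t, sq (h t)) -> sq g ->
  ip (fun x => \int[lambda]_(t in I) h t x) g = \int[lambda]_(t in I) ip (h t) g.
Proof.
move=> [J [b [v [mb hv]]]] sh sg; have [c cE] := finvalued_integral T mb.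
pose v' j := if `[< sq (v j) >] then v j else (fun=> 0).
have sv' j : sq (v' j) by rewrite /v'; case: asboolP => // _; exact: sqint0.
have hv' t : h t = v' (b t).
  by rewrite /v'; case: asboolP => // H; exfalso; apply: H; rewrite -hv.
under [in RHS]eq_Rintegral do rewrite hv'.
rewrite (cE (fun j => ip (v' j) g)).
rewrite (_ : (fun x => _) = (fun x => \sum_j c j * v' j x)); last first.
  apply/funext => x; rewrite -(cE (fun j => v' j x)).
  by apply: eq_Rintegral => t _; rewrite hv'.
rewrite (ip_suml mO)//; last by move=> j; exact: sqintZ.
by apply: eq_bigr => j _; rewrite (ipZl mO).
Qed.

(** Pairing the integral with itself and applying Cauchy-Schwarz under the integral sign gives the
    inequality multiplied by the norm of the integral. *)
Lemma nrm_integral_le (h : R -> 'rV[R]_d -> R) : finvalued h -> (forall t, sq (h t)) ->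
  nr (fun x => \int[lambda]_(t in I) h t x) <= \int[lambda]_(t in I) nr (h t).
Proof.
move=> fh sh; set w := (fun x => _).
have sw : sq w by apply/sq_fmem; apply: (fmem_integral T sL2 fh) => t; exact/sq_fmem.
have sth : strong T (XL2 Omega) h by apply: strong_finvalued => // t; exact/sq_fmem.
have bn := strong_nrm sth; have bw := strong_ipr sth sw.
have : nr w ^+ 2 <= nr w * \int[lambda]_(t in I) nr (h t).
  rewrite nrm_sqr {1}/w (integral_ip fh sh sw) !int_oo_cc//.
  rewrite -RintegralZl//; last exact: (bm_integrable bn (lexx 0) (lexx T)).
  apply: (le_int bw (bmZ (nr w) bn)) => //.
  apply: lebesgue_aeT => t _; rewrite mulrC (le_trans (ler_norm _))//.
  exact: cauchy_schwarz.
have [->|w0] := eqVneq (nr w) 0; last by rewrite expr2 ler_pM2l// lt_def w0 nrm_ge0.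
move=> _; rewrite int_oo_cc//; rewrite -[leLHS](mul0r (T - 0)) -(int_cst 0 (ltW T0)).
apply: (le_int (bm_cst T 0) bn) => //.
by apply: lebesgue_aeT => t _; exact: nrm_ge0.
Qed.

Lemma int_cvg0 (k : nat -> R -> R) M : (forall n, bm T (k n)) ->
  (forall n t, 0 <= t <= T -> 0 <= k n t <= M) ->
  (forall t, 0 <= t <= T -> k n t @[n --> \oo] --> (0 : R)) ->
  \int[lambda]_(t in I) k n t @[n --> \oo] --> (0 : R) /\
  (\int[lambda]_(t in I) (k n t)%:E)%E @[n --> \oo] --> 0%E.
Proof.
move=> bk kM k0.
have sub t : I t -> 0 <= t <= T by rewrite /= in_itv/= => /andP[t0 tT]; rewrite !ltW.
have subI : I `<=` `[0, T]%classic by apply: subset_itv; rewrite bnd_simp.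
have mk n : measurable_fun I (fun t => (k n t)%:E).
  by apply/measurable_EFinP; have [mk _] := bk n; exact: measurable_funS mk.
have ik n : lambda.-integrable I (EFin \o k n).
  exact: integrableS (bm_integrable (bk n) (lexx 0) (lexx T)).
have [||||_ _ kc] := @dominated_convergence _ _ _ lambda I (measurable_itv _)
  (fun n t => (k n t)%:E) (fun=> 0%E) (fun=> M%:E) mk.
- exact: measurable_cst.
- apply: lebesgue_aeT => t It; apply: cvg_EFin; first exact: nearW.
  exact: k0 (sub t It).
- apply: integrableS (bm_integrable (bm_cst T M) (lexx 0) (lexx T)) => //.
- apply: lebesgue_aeT => t n It; have /andP[k0' kM'] := kM n t (sub t It).
  by rewrite lee_fin ger0_norm.
have {}kc : (\int[lambda]_(t in I) (k n t)%:E)%E @[n --> \oo] --> 0%E.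
  by move: kc; rewrite integral0.
split => //; have /fine_cvg := kc; apply: cvg_trans; apply: near_eq_cvg.
exact: nearW.
Qed.

Lemma nrm_vanish_int u (f : nat -> R -> 'rV[R]_d -> R) M : strong T (XL2 Omega) u ->
  (forall t, 0 <= t <= T -> nr (u t) <= M) -> (forall k, finvalued (f k)) ->
  (forall k t, sq (f k t) /\ nr (f k t) <= M) ->
  (forall t, 0 <= t <= T -> nr (fun x => u t x - f k t x) @[k --> \oo] --> (0 : R)) ->
  [/\ forall k, bm T (fun t => nr (fun x => u t x - f k t x)),
    \int[lambda]_(t in I) nr (fun x => u t x - f k t x) @[k --> \oo] --> (0 : R) &
    (\int[lambda]_(t in I) (nr (fun x => u t x - f k t x))%:E)%E @[k --> \oo] --> 0%E].
Proof.
move=> su uM ff fM uf.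
have bk k : bm T (fun t => nr (fun x => u t x - f k t x)).
  apply/strong_nrm/strongB => //; apply: strong_finvalued => // t.
  by apply/sq_fmem; have [] := fM k t.
have [|//|c1 c2] := int_cvg0 bk (M := M + M); last by split.
move=> k t tT; have [sf fMk] := fM k t; rewrite nrm_ge0/=.
by apply: (le_trans (nrmB mO (strong_sq su tT) sf)); apply: lerD => //; exact: uM.
Qed.

(** The integrals of the finitely valued approximants form a Cauchy sequence by [nrm_integral_le],
    so completeness of L^2 provides the value. *)
Lemma bint_exists u : strong T (XL2 Omega) u -> exists w, bint T (XL2 Omega) u w.
Proof.
move=> su; have [M [f [M0 uM ff fM uf]]] := strong_L2_approx su.
have [bk c1 c2] := nrm_vanish_int su uM ff fM uf.
have sf k t : sq (f k t) by have [] := fM k t.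
pose F k x := \int[lambda]_(t in I) f k t x.
have sF k : sq (F k).
  by apply/sq_fmem; apply: (fmem_integral T sL2 (ff k)) => t; exact/sq_fmem.
have [|w sw Fw] := sqint_complete mO sF.
  move=> e e0; have e2 : 0 < e / 2 by rewrite divr_gt0.
  have /cvgr0_norm_lt/(_ _ e2)[N _ HN] := c1; exists N => m n Nm Nn.
  have fi k x : lambda.-integrable I (EFin \o (fun t => f k t x)).
    by apply: finvalued_integrable; exact: (finvalued_comp (fun a : 'rV[R]_d -> R => a x)).
  have fmn : finvalued (fun t x => f m t x - f n t x).
    exact: (finvalued_comp2 (fun (a b : 'rV[R]_d -> R) x => a x - b x) (ff m) (ff n)).
  have smn t : sq (fun x => f m t x - f n t x) by exact: sqintB.
  have -> : (fun x => F m x - F n x) = (fun x => \int[lambda]_(t in I) (f m t x - f n t x)).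
    by apply/funext => x; rewrite RintegralB.
  apply: (le_lt_trans (nrm_integral_le fmn smn)).
  have stmn : strong T (XL2 Omega) (fun t x => f m t x - f n t x).
    by apply: strong_finvalued => // t; exact/sq_fmem.
  have Hm := HN m Nm; have Hn := HN n Nn.
  have I0 k : 0 <= \int[lambda]_(t in I) nr (fun x => u t x - f k t x).
    by rewrite /Rintegral fine_ge0//; apply: integral_ge0 => t _; rewrite lee_fin nrm_ge0.
  rewrite /= ger0_norm// in Hm; rewrite /= ger0_norm// in Hn.
  apply: (@le_lt_trans _ _ (\int[lambda]_(t in I) nr (fun x => u t x - f m t x) +
    \int[lambda]_(t in I) nr (fun x => u t x - f n t x))); last by lra.
  have im := bm_integrable (bk m) (lexx 0) (lexx T); have jn := bm_integrable (bk n) (lexx 0) (lexx T).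
  rewrite (int_oo_cc (bk m)) (int_oo_cc (bk n)) (int_oo_cc (strong_nrm stmn)).
  rewrite -(RintegralD _ im jn)//; apply: (le_int (strong_nrm stmn) (bmD (bk m) (bk n))) => //.
  apply: lebesgue_aeT => t tT; have sut := strong_sq su tT.
  rewrite (_ : (fun x => f m t x - f n t x) = (fun x => (u t x - f n t x) - (u t x - f m t x))).
    rewrite addrC; exact: (nrmB mO (sqintB mO sut (sf n t)) (sqintB mO sut (sf m t))).
  by apply/funext => x; ring.
exists w; split.
- by apply: lebesgue_aeT => t; rewrite /= in_itv/= => /andP[t0 tT]; have [Xu _ _] := su; apply: Xu; rewrite !ltW.
- exact/sq_fmem.
have sub t : I t -> 0 <= t <= T by rewrite /= in_itv/= => /andP[t0 tT]; rewrite !ltW.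
have nE k t : I t -> L2norm Omega (fun x => u t x - f k t x) = nr (fun x => u t x - f k t x).
  by move=> It; exact: (L2norm_nrm oO (sqintB mO (strong_sq su (sub t It)) (sf k t))).
exists f; split => //.
- by move=> k t; exact/sq_fmem.
- apply: lebesgue_aeT => t It; have := uf t (sub t It); apply: cvg_trans; apply: near_eq_cvg.
  by apply: nearW => k; apply/esym; exact: nE.
- apply: cvg_trans c2; apply: near_eq_cvg; apply: nearW => k; apply: eq_integral => t.
  by rewrite inE => It; congr EFin; apply/esym; exact: nE.
- apply: cvg_trans Fw; apply: near_eq_cvg; apply: nearW => k.
  exact/esym/(L2norm_nrm oO (sqintB mO (sF k) sw)).
Qed.

(** The bridge from Bochner integrals to scalar ones: both sides differ by at most the norm of g
    times two error terms that vanish along the approximation. *)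
Lemma bint_ip u w g : strong T (XL2 Omega) u -> bint T (XL2 Omega) u w -> sq g ->
  ip w g = \int[lambda]_(t in I) ip (u t) g.
Proof.
move=> su [_ /sq_fmem sw [f [ff Xf uf f0 fw]]] sg.
have sf k t : sq (f k t) by exact/sq_fmem.
have sub t : I t -> 0 <= t <= T by rewrite /= in_itv/= => /andP[t0 tT]; rewrite !ltW.
have stf k : strong T (XL2 Omega) (f k) by exact: strong_finvalued.
have bk k := strong_nrm (strongB sL2 su (stf k)).
have nE k t : I t -> L2norm Omega (fun x => u t x - f k t x) = nr (fun x => u t x - f k t x).
  by move=> It; exact: (L2norm_nrm oO (sqintB mO (strong_sq su (sub t It)) (sf k t))).
pose F k x := \int[lambda]_(t in I) f k t x.
have sF k : sq (F k) by apply/sq_fmem; exact: (fmem_integral T sL2 (ff k)).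
pose e k := \int[lambda]_(t in I) nr (fun x => u t x - f k t x).
have e0 : e k @[k --> \oo] --> (0 : R).
  have /fine_cvg := f0; apply: cvg_trans; apply: near_eq_cvg; apply: nearW => k.
  by congr fine; apply: eq_integral => t; rewrite inE => It /=; rewrite (nE k t It).
have w0 : nr (fun x => F k x - w x) @[k --> \oo] --> (0 : R).
  apply: cvg_trans fw; apply: near_eq_cvg; apply: nearW => k.
  exact: (L2norm_nrm oO (sqintB mO (sF k) sw)).
have bug := strong_ipr su sg.
apply/eqP; rewrite -subr_eq0 -normr_le0.
have H k : `|ip w g - \int[lambda]_(t in I) ip (u t) g| <=
    nr (fun x => F k x - w x) * nr g + e k * nr g.
  have bfg := strong_ipr (stf k) sg.
  rewrite (_ : _ - _ = - ip (fun x => F k x - w x) g -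
      (\int[lambda]_(t in I) ip (u t) g - \int[lambda]_(t in I) ip (f k t) g)); last first.
    by rewrite (ipBl mO (sF k) sw sg) (integral_ip (ff k) (sf k) sg); ring.
  apply: (le_trans (ler_normB _ _)); rewrite normrN; apply: lerD.
    exact: (cauchy_schwarz mO (sqintB mO (sF k) sw) sg).
  have iu := bm_integrable bug (lexx 0) (lexx T); have jf := bm_integrable bfg (lexx 0) (lexx T).
  rewrite (int_oo_cc bug) (int_oo_cc bfg) -(RintegralB _ iu jf)// /e (int_oo_cc (bk k)).
  rewrite -RintegralZr//; last exact: (bm_integrable (bk k) (lexx 0) (lexx T)).
  have bB : bm T (fun t => ip (u t) g - ip (f k t) g).
    by have := bmD bug (bmZ (-1) bfg); congr bm; apply/funext => t; rewrite mulN1r.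
  have bR : bm T (fun t => nr (fun x => u t x - f k t x) * nr g) by apply: bmM => //; exact: bm_cst.
  have bN : bm T (fun t => -1 * (nr (fun x => u t x - f k t x) * nr g)) by exact: bmZ.
  have CS t : 0 <= t <= T -> `|ip (u t) g - ip (f k t) g| <= nr (fun x => u t x - f k t x) * nr g.
    move=> tT; rewrite -(ipBl mO (strong_sq su tT) (sf k t) sg).
    exact: (cauchy_schwarz mO (sqintB mO (strong_sq su tT) (sf k t)) sg).
  rewrite ler_norml; apply/andP; split.
    rewrite -mulN1r -RintegralZl//; last exact: (bm_integrable bR (lexx 0) (lexx T)).
    apply: (le_int bN bB) => //; apply: lebesgue_aeT => t /CS; rewrite ler_norml => /andP[+ _].
    by rewrite mulN1r.
  by apply: (le_int bB bR) => //; apply: lebesgue_aeT => t /CS; rewrite ler_norml => /andP[].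
apply: (le_cvg0 H); rewrite [X in _ --> X](_ : 0 = 0 * nr g + 0 * nr g); last by ring.
by apply: cvgD; apply: cvgMl.
Qed.

End L2_valued.

(** * Weak time derivatives in L^2 *)

Section L2_time_derivative.
Context {R : realType} {d : nat}.
Local Notation mu := (@lebesgue_rV R d).
Local Notation lambda := (@lebesgue_measure R).
Variables (T : R) (Omega : set 'rV[R]_d).
Hypothesis T0 : 0 < T.
Hypotheses (oO : open Omega) (fO : (mu Omega < +oo)%E).
Local Notation sq := (sqint mu Omega).
Local Notation nr := (nrm mu Omega).
Local Notation ip := (ip mu Omega).
Local Notation "f =O g" := (aeD mu Omega f g) (at level 70).
Local Notation I := (`]0, T[%classic : set R).
Local Notation L2 := (XL2 Omega).
Implicit Types (f g h w : 'rV[R]_d -> R) (u v a b U V : R -> 'rV[R]_d -> R).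
Let mO : measurable Omega. Proof. exact: open_measurable_rV. Qed.
Let sL2 := seminormed_L2 oO.
Let sub t : I t -> 0 <= t <= T.
Proof. by rewrite /= in_itv/= => /andP[t0 tT]; rewrite !ltW. Qed.

Lemma int_ae_eq (k k' : R -> R) : bm T k -> bm T k' ->
  {ae lambda, forall t, I t -> k t = k' t} ->
  \int[lambda]_(t in I) k t = \int[lambda]_(t in I) k' t.
Proof.
move=> bk bk' kk'; rewrite !int_oo_cc//.
have ends : {ae lambda, forall t, 0 <= t <= T -> k t = k' t}.
  have E : {ae lambda, forall t, t != 0 /\ t != T}.
    exact: (lebesgue_ae_imply2 (fun t x y => conj x y) (lebesgue_ae_neq 0) (lebesgue_ae_neq T)).
  apply: lebesgue_ae_imply2 kk' E => t kk' [t0 tT] /andP[t0' tT']; apply: kk'.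
  by rewrite /= in_itv/= !lt_neqAle t0' tT' eq_sym t0 tT.
apply/eqP; rewrite eq_le; apply/andP; split.
  by apply: (le_int bk bk') => //; apply: lebesgue_ae_imply ends => t + tT => ->.
by apply: (le_int bk' bk) => //; apply: lebesgue_ae_imply ends => t + tT => ->.
Qed.

(** The weak derivative tested against fixed weights in space. The class P is either all weights or
    the bounded ones; only the latter can be multiplied into a product of two L^2 functions. *)
Definition scalar_weak U V (P : ('rV[R]_d -> R) -> Prop) := forall phi, time_test T phi ->
  forall g, sq g -> P g ->
  \int[lambda]_(t in I) (phi^`()%classic t * ip (U t) g) = - \int[lambda]_(t in I) (phi t * ip (V t) g).

Definition bounded_fun g := exists M : R, forall x, Omega x -> `|g x| <= M.

Lemma bint_scale_ip (psi : R -> R) u U w g : smooth psi -> strong T L2 U ->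
  {ae lambda, forall t, I t -> U t = u t} -> bochner_int T L2 (fun t x => psi t * u t x) w ->
  sq g -> ip w g = \int[lambda]_(t in I) (psi t * ip (U t) g).
Proof.
move=> spsi sU Uu /(bochner_intP T sL2) uw sg.
have sU' := strongM sL2 (@smooth_bm _ T _ spsi) sU.
have Uw : bint T L2 (fun t x => psi t * U t x) w.
  apply: (bint_ae sL2 _ uw); apply: lebesgue_ae_imply Uu => t Uu It; rewrite -(Uu It); split => //.
  by have [XU _ _] := sU'; exact: XU (sub It).
rewrite (bint_ip oO sU' Uw sg); apply: eq_Rintegral => t; rewrite inE => /sub tT.
exact: (ipZl mO _ (strong_sq oO sU tT) sg).
Qed.

Lemma weak_tderiv_scalar u v U V : strong T L2 U -> strong T L2 V ->
  {ae lambda, forall t, I t -> U t = u t} -> {ae lambda, forall t, I t -> V t = v t} ->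
  weak_tderiv T L2 u v -> scalar_weak U V (fun=> True).
Proof.
move=> sU sV Uu Vv uv phi tphi g sg _; have [sphi _] := time_testP tphi.
have [w [uw vw]] := uv phi tphi.
rewrite -(bint_scale_ip (smooth_derive1 sphi) sU Uu uw sg) -(bint_scale_ip sphi sV Vv vw sg).
have [_ Xw _] := uw; have sw : sq w by apply/(L2P mO).
rewrite (_ : (fun x => - w x) = (fun x => (-1) * w x)); last by apply/funext => x; rewrite mulN1r.
by rewrite (ipZl mO _ sw sg) mulN1r opprK.
Qed.

Lemma bounded_fun_sq g : measurable_fun Omega g -> bounded_fun g -> sq g.
Proof. by move=> mg [M gM]; exact: (sqint_bounded oO fO mg gM). Qed.

(* Bounded weights suffice: truncate w at height 1. *)
Lemma bounded_test_zero w : sq w -> (forall g, sq g -> bounded_fun g -> ip w g = 0) -> nr w = 0.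
Proof.
move=> sw wg; have mw := sqint_meas sw.
pose g x := Num.min (Num.max (w x) (-1)) 1.
have mg : measurable_fun Omega g.
  by apply: measurable_minr => //; apply: measurable_maxr.
have gE x : [\/ w x <= -1 /\ g x = -1, 1 <= w x /\ g x = 1 | g x = w x].
  rewrite /g; have [w1|w1] := leP (w x) (-1).
    by apply: Or31; split=> //; rewrite min_l//; lra.
  have [w2|w2] := leP 1 (w x); first by apply: Or32; split.
  by apply: Or33.
have bg : bounded_fun g.
  exists 1 => x _; rewrite ler_norml.
  by rewrite /g ge_min lexx orbT andbT le_min le_max lexx orbT/=; lra.
have sg := bounded_fun_sq mg bg.
have : ip g g <= 0.
  rewrite -(wg g sg bg) -subr_ge0 -(ipBl mO sw sg sg) ipE; apply: Rintegral_ge0 => // x _.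
  by case: (gE x) => [[? ->]|[? ->]|->]; rewrite ?subrr ?mul0r//; nra.
rewrite -nrm_sqr => g0; have {}g0 : nr g = 0.
  by apply/eqP; rewrite -sqrf_eq0 eq_le g0 sqr_ge0.
have gO := nrm0_ae mO sg g0.
have m0 : measurable_fun Omega (fun=> 0 : R) by exact: measurable_cst.
rewrite (eq_nrm mO mw m0 _) ?nrm0//.
apply: filterS gO => x /[apply] g0x; case: (gE x) => [[_]|[_]|<-//]; rewrite g0x => E; exfalso.
  by move/eqP: E; rewrite eq_sym oppr_eq0 oner_eq0.
by move/eqP: E; rewrite eq_sym oner_eq0.
Qed.

(** The Bochner integrals w and w' of both sides exist, and w + w' is orthogonal to every bounded
    weight, hence null. Thus - w serves in place of w', as distances in L^2 do not distinguish
    them. *)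
Lemma scalar_weak_tderiv u v U V : strong T L2 U -> strong T L2 V ->
  {ae lambda, forall t, I t -> U t = u t} -> {ae lambda, forall t, I t -> V t = v t} ->
  scalar_weak U V bounded_fun -> weak_tderiv T L2 u v.
Proof.
move=> sU sV Uu Vv UV phi tphi; have [sphi _] := time_testP tphi.
have sphi' := smooth_derive1 sphi.
have key psi A a : smooth psi -> strong T L2 A -> {ae lambda, forall t, I t -> A t = a t} ->
    exists w, [/\ sq w, bint T L2 (fun t x => psi t * a t x) w &
      forall g, sq g -> ip w g = \int[lambda]_(t in I) (psi t * ip (A t) g)].
  move=> spsi sA Aa; have sA' := strongM sL2 (@smooth_bm _ T _ spsi) sA.
  have [w Aw] := bint_exists T0 oO sA'.
  have aw : bint T L2 (fun t x => psi t * a t x) w.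
    apply: (bint_ae sL2 _ Aw); apply: lebesgue_ae_imply Aa => t Aa It; rewrite -(Aa It); split => //.
    by have [XA _ _] := sA'; exact: XA (sub It).
  exists w; split => //; first by have [_ Xw _] := aw; apply/(L2P mO).
  move=> g sg; apply: (bint_scale_ip spsi sA Aa _ sg); exact/(bochner_intP T sL2).
have [w [sw uw wE]] := key _ _ _ sphi' sU Uu; have [w' [sw' vw' w'E]] := key _ _ _ sphi sV Vv.
exists w; split; first exact/(bochner_intP T sL2).
have ww : nr (fun x => w x + w' x) = 0.
  apply: bounded_test_zero => [|g sg bg]; first exact: sqintD.
  by rewrite (ipDl mO sw sw' sg) (wE _ sg) (w'E _ sg) (UV _ tphi g sg bg) addNr.
apply/(bochner_intP T sL2); have [Xv _ [f [ff Xf vf f0 fw]]] := vw'; split => //.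
  apply/(L2P mO); have := sqintZ mO (-1) sw.
  by congr sqint; apply/funext => x; rewrite mulN1r.
exists f; split => //; apply: cvg_trans fw; apply: near_eq_cvg; apply: nearW => k.
set F := (fun x => \int[lambda]_(t in I) f k t x).
have sF : sq F by apply/(L2P mO); exact: (fmem_integral T sL2 (ff k) (Xf k)).
have s1 : sq (fun x => F x - w' x) by exact: sqintB.
have s2 : sq (fun x => F x - - w x).
  have := sqintD mO sF sw; by congr sqint; apply/funext => x; rewrite opprK.
change (L2norm Omega (fun x => F x - w' x) = L2norm Omega (fun x => F x - - w x)).
rewrite (L2norm_nrm oO s1) (L2norm_nrm oO s2).
apply: (eq_nrm mO (sqint_meas s1) (sqint_meas s2)).
have := nrm0_ae mO (sqintD mO sw sw') ww; apply: filterS => x H Ox.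
by rewrite opprK; have /eqP := H Ox; rewrite addr_eq0 => /eqP ->.
Qed.

(** The exceptional null set depends on g, but the approximants of e take countably many values in
    all, so one null set serves them. Outside it the squared norm of e equals its product with e -
    f_k, which vanishes in the limit. *)
Lemma strong_ip_zero e : strong T L2 e ->
  (forall g, sq g -> {ae lambda, forall t, I t -> ip (e t) g = 0}) ->
  {ae lambda, forall t, I t -> nr (e t) = 0}.
Proof.
move=> se eg; have [M [f [M0 eM ff fM ef]]] := strong_L2_approx oO se.
have ae_k k : {ae lambda, forall t, I t -> ip (e t) (f k t) = 0}.
  have [J [b [v [mb fv]]]] := ff k.
  have H (r : seq J) : {ae lambda, forall t, forall j, j \in r -> I t -> sq (v j) -> ip (e t) (v j) = 0}.
    elim: r => [|j r IH]; first exact: lebesgue_aeT.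
    have Hj : {ae lambda, forall t, I t -> sq (v j) -> ip (e t) (v j) = 0}.
      have [sv|nsv] := pselect (sq (v j)).
        by apply: lebesgue_ae_imply (eg _ sv) => t H It _; exact: H.
      by apply: lebesgue_aeT => t _ /nsv.
    apply: lebesgue_ae_imply2 Hj IH => t Hj IH i; rewrite in_cons => /predU1P[->//|]; exact: IH.
  apply: lebesgue_ae_imply (H (index_enum J)) => t Ht It; rewrite fv; apply: Ht => //.
  by rewrite -fv; have [] := fM k t.
have [N [mN N0 subN]] : {ae lambda, forall t, forall k, I t -> ip (e t) (f k t) = 0}.
  by apply: ae_foralln => k; exact: ae_k.
exists N; split => // t /= nt; apply: subN => /= Ht; apply: nt => It.
have set_ := strong_sq oO se (sub It).
apply/eqP; rewrite eq_le nrm_ge0 andbT.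
have [//|n0] := leP (nr (e t)) 0.
have H k : nr (e t) <= nr (fun x => e t x - f k t x).
  have [sf _] := fM k t.
  rewrite -(ler_pM2l n0) -expr2 nrm_sqr.
  have -> : ip (e t) (e t) = ip (e t) (fun x => e t x - f k t x).
    by rewrite (ipBr mO set_ sf set_) (Ht k It) subr0.
  by rewrite (le_trans (ler_norm _))// (cauchy_schwarz mO set_ (sqintB mO set_ sf)).
by have := le_cvg0 H (ef t (sub It)); rewrite leNgt n0.
Qed.

Lemma scalar_weak_unique U V V' : strong T L2 U -> strong T L2 V -> strong T L2 V' ->
  scalar_weak U V (fun=> True) -> scalar_weak U V' (fun=> True) ->
  {ae lambda, forall t, I t -> V t =O V' t}.
Proof.
move=> sU sV sV' UV UV'; have se := strongB sL2 sV sV'.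
have /= e0 : {ae lambda, forall t, I t -> nr (fun x => V t x - V' t x) = 0}.
  apply: (strong_ip_zero se) => g sg.
  have be := strong_ipr oO se sg; have bV := strong_ipr oO sV sg; have bV' := strong_ipr oO sV' sg.
  have := weak_zero_ae T0 be; suff H : forall phi, time_test T phi ->
      \int[lambda]_(t in I) (phi t * ip (fun x => V t x - V' t x) g) = 0.
    move=> /(_ H); apply: lebesgue_ae_imply => t H' It; apply: H'.
    by move: It; rewrite /= in_itv.
  move=> phi tphi; have bphi := @smooth_bm _ T _ (time_testP tphi).1.
  have i1 := bm_integrable (bmM bphi bV) (lexx 0) (lexx T).
  have i2 := bm_integrable (bmM bphi bV') (lexx 0) (lexx T).
  rewrite (int_oo_cc (bmM bphi be)).
  transitivity (\int[lambda]_(t in `[0, T]) (phi t * ip (V t) g - phi t * ip (V' t) g)).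
    apply: eq_Rintegral => t; rewrite inE/= in_itv/= => tT.
    by rewrite (ipBl mO (strong_sq oO sV tT) (strong_sq oO sV' tT) sg) mulrBr.
  rewrite (RintegralB _ i1 i2)// -!int_oo_cc; [|exact: bmM..].
  have := UV phi tphi g sg Logic.I; have := UV' phi tphi g sg Logic.I; move=> -> /oppr_inj ->; exact: subrr.
apply: lebesgue_ae_imply e0 => t e0 It.
exact: (nrm_aeD mO (strong_sq oO sV (sub It)) (strong_sq oO sV' (sub It)) (e0 It)).
Qed.

Lemma dtP u : (exists v, Linfty T L2 v /\ weak_tderiv T L2 u v) ->
  Linfty T L2 (dt T Omega u) /\ weak_tderiv T L2 u (dt T Omega u).
Proof. by move=> H; exact: (@xgetPex _ _ [set v | Linfty T L2 v /\ weak_tderiv T L2 u v]). Qed.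

(** Equality a.e. in time and space, bundled with square integrability so that inner products and
    norms can be exchanged at once. *)
Definition eqae u v := {ae lambda, forall t, I t -> [/\ sq (u t), sq (v t) & u t =O v t]}.

Lemma eqae_sym u v : eqae u v -> eqae v u.
Proof. by apply: lebesgue_ae_imply => t H It; have [a b c] := H It; split => //; exact: aeD_sym. Qed.

Lemma eqae_trans v u U : eqae u v -> eqae v U -> eqae u U.
Proof.
apply: lebesgue_ae_imply2 => t H H' It; have [a b c] := H It; have [a' b' c'] := H' It; split => //.
by apply: filterS2 c c' => x xe xe' Ox; rewrite xe// xe'.
Qed.

Lemma eqae_eq u v : Linfty T L2 u -> {ae lambda, forall t, I t -> u t = v t} -> eqae u v.
Proof.
move=> [Xu _ _]; apply: lebesgue_ae_imply2 Xu => t Xu e It.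
have su : sq (u t) by apply/(L2P mO); exact: Xu.
by rewrite -(e It); split => //; apply: nearW.
Qed.

Lemma strong_LinftyW U : strong T L2 U -> Linfty T L2 U.
Proof. by move=> sU; exact: (strong_Linfty sU (lebesgue_aeT (fun _ _ => erefl))). Qed.

Lemma eqae_refl U : strong T L2 U -> eqae U U.
Proof. by move=> sU; exact: (eqae_eq (strong_LinftyW sU) (lebesgue_aeT (fun _ _ => erefl))). Qed.

Lemma strong_eqae_ip U V : strong T L2 U -> strong T L2 V -> eqae U V -> forall psi g, bm T psi -> sq g ->
  \int[lambda]_(t in I) (psi t * ip (U t) g) = \int[lambda]_(t in I) (psi t * ip (V t) g).
Proof.
move=> sU sV UV psi g bpsi sg; apply: int_ae_eq.
- by apply: bmM => //; exact: strong_ipr.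
- by apply: bmM => //; exact: strong_ipr.
apply: lebesgue_ae_imply UV => t UV It; have [a b c] := UV It; congr (_ * _).
exact: (eq_ipl mO (sqint_meas a) (sqint_meas b) (sqint_meas sg) c).
Qed.

Lemma scalar_weak_eqae U U' V V' P : strong T L2 U -> strong T L2 U' -> strong T L2 V ->
  strong T L2 V' -> eqae U U' -> eqae V V' -> scalar_weak U V P -> scalar_weak U' V' P.
Proof.
move=> sU sU' sV sV' UU VV UV phi tphi g sg Pg; have [sphi _] := time_testP tphi.
rewrite -(strong_eqae_ip sU sU' UU (@smooth_bm _ T _ (smooth_derive1 sphi)) sg).
by rewrite -(strong_eqae_ip sV sV' VV (@smooth_bm _ T _ sphi) sg); exact: UV.
Qed.

Definition rep U u := strong T L2 U /\ eqae U u.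

Lemma Linfty_rep u : Linfty T L2 u -> exists2 U, rep U u & {ae lambda, forall t, I t -> U t = u t}.
Proof.
move=> Lu; have [U sU Uu] := Linfty_strong sL2 Lu; exists U => //; split => //.
exact: eqae_eq (strong_LinftyW sU) Uu.
Qed.

Lemma Linfty_eqae U u : rep U u -> Linfty T L2 u.
Proof.
move=> [sU Uu]; have [_ [s Us] [M UM]] := strong_LinftyW sU.
have sts k t : sq (ts_fun (s k) t) by apply/(L2P mO); exact: (fmem_ts_fun sL2).
split.
- by apply: lebesgue_ae_imply Uu => t H It; have [_ b _] := H It; apply/(L2P mO).
- exists s; apply: lebesgue_ae_imply2 Uu Us => t H + It => /(_ It); have [p q e] := H It.
  apply: cvg_trans; apply: near_eq_cvg; apply: nearW => k.
  have sp := sqintB mO p (sts k t); have sq' := sqintB mO q (sts k t).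
  apply: (etrans (L2norm_nrm oO sp)); apply: etrans (esym (L2norm_nrm oO sq')).
  apply: (eq_nrm mO (sqint_meas sp) (sqint_meas sq')).
  by apply: filterS e => x xe Ox; rewrite xe.
- exists M; apply: lebesgue_ae_imply2 Uu UM => t H UM It; have [p q e] := H It.
  apply: le_trans (UM It); rewrite le_eqVlt; apply/orP; left; apply/eqP.
  apply: (etrans (L2norm_nrm oO q)); apply: etrans (esym (L2norm_nrm oO p)).
  by apply/esym; exact: (eq_nrm mO (sqint_meas p) (sqint_meas q) e).
Qed.

(** How the chosen derivative [dt] is computed: a candidate checked against bounded weights only is
    a weak derivative, and uniqueness then identifies it with [dt u] and gives the identity for all
    weights. *)
Lemma dt_rep u U V : Linfty T L2 u -> rep U u -> strong T L2 V ->
  scalar_weak U V bounded_fun -> [/\ Linfty T L2 (dt T Omega u), rep V (dt T Omega u) & scalar_weak U V (fun=> True)].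
Proof.
(* [U t] agrees with [u t] only a.e. in space, whereas [U'] agrees with u as a function at almost
   every time. *)
move=> Lu [sU Uu] sV UV; have [U' [sU' U'u'] U'u] := Linfty_rep Lu.
have UU' : eqae U U' by exact: eqae_trans Uu (eqae_sym U'u').
have VV := eqae_refl sV.
have UV' : scalar_weak U' V bounded_fun by exact: scalar_weak_eqae UU' VV UV.
have uV := scalar_weak_tderiv sU' sV U'u (lebesgue_aeT (fun _ _ => erefl)) UV'.
have LV := strong_LinftyW sV.
have [Ldt udt] : Linfty T L2 (dt T Omega u) /\ weak_tderiv T L2 u (dt T Omega u) by apply: dtP; exists V.
have [W [sW WV] Wdt] := Linfty_rep Ldt.
have U'W := weak_tderiv_scalar sU' sW U'u Wdt udt.
have U'V := weak_tderiv_scalar sU' sV U'u (lebesgue_aeT (fun _ _ => erefl)) uV.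
have VW : eqae V W.
  apply: lebesgue_ae_imply (scalar_weak_unique sU' sV sW U'V U'W) => t VW It; split.
  - exact: strong_sq sV (sub It).
  - exact: strong_sq sW (sub It).
  - exact: VW.
split => //; first by split => //; exact: eqae_trans VW WV.
exact: scalar_weak_eqae (eqae_sym UU') VV U'V.
Qed.

(** Allows iteration: a derivative of u is also [dt] of any u' equal to it a.e., even though [dt]
    depends on a choice at each level. *)
Lemma weak_dt u u' v : Linfty T L2 u -> Linfty T L2 u' -> Linfty T L2 v -> eqae u u' ->
  weak_tderiv T L2 u v ->
  [/\ Linfty T L2 (dt T Omega u'), eqae v (dt T Omega u') &
   forall U V, rep U u -> rep V v -> scalar_weak U V (fun=> True)].
Proof.
move=> Lu Lu' Lv uu' uv.
have [U [sU Uu] Uu'] := Linfty_rep Lu; have [V [sV Vv] Vv'] := Linfty_rep Lv.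
have UV := weak_tderiv_scalar sU sV Uu' Vv' uv.
have rU : rep U u' by split => //; exact: eqae_trans Uu uu'.
have [Ldt [_ Vdt] _] := dt_rep Lu' rU sV (fun phi tphi g sg _ => UV phi tphi g sg Logic.I).
split => //; first exact: eqae_trans (eqae_sym Vv) Vdt.
move=> U1 V1 [sU1 U1u] [sV1 V1v]; apply: (scalar_weak_eqae sU sU1 sV sV1 _ _ UV).
  exact: eqae_trans Uu (eqae_sym U1u).
exact: eqae_trans Vv (eqae_sym V1v).
Qed.

Section embedding.
Variable X : @fspace R d.
Hypotheses (sX : seminormed X) (XL : forall f, fmem X f -> sq f /\ nr f <= fnorm X f).

Let XL2 f : fmem X f -> fmem L2 f.
Proof. by move=> /XL[sf _]; exact/(L2P mO). Qed.

Let XLn f : fmem X f -> fnorm L2 f <= fnorm X f.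
Proof. by move=> /XL[sf nf]; rewrite /= (L2norm_nrm oO sf). Qed.

Lemma strong_embed U : strong T X U -> strong T L2 U.
Proof.
apply: (strong_map (A := id) sX sL2 ler01) => [f|f|f g] Xf; first exact: XL2.
  by rewrite mul1r; exact: XLn.
by move=> Xg; rewrite mul1r; apply: XLn; exact: snB.
Qed.

Lemma Linfty_embed u : Linfty T X u -> Linfty T L2 u.
Proof. by move=> /(Linfty_strong sX)[U /strong_embed sU Uu]; exact: strong_Linfty sU Uu. Qed.

(** Bochner integrals in a space embedded in L^2 are Bochner integrals in L^2, so derivatives found
    in H^1_0 or H^2 coincide with the L^2 ones. *)
Lemma weak_tderiv_embed u v : weak_tderiv T X u v -> weak_tderiv T L2 u v.
Proof.
suff key a w : bochner_int T X a w -> bochner_int T L2 a w.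
  by move=> uv phi tphi; have [w [uw vw]] := uv phi tphi; exists w; split; exact: key.
move=> /(bochner_intP T sX)[Xa Xw [f [ff Xf af f0 fw]]]; apply/(bochner_intP T sL2); split.
- by apply: lebesgue_ae_imply Xa => t Xa It; exact/XL2/Xa.
- exact: XL2.
exists f; split => //.
- by move=> k t; exact: XL2.
- apply: lebesgue_ae_imply2 Xa af => t Xa af It; apply: cvg0_le (af It) => k.
  by rewrite L2norm_ge0; apply: XLn; exact: (snB sX (Xa It) (Xf k t)).
- apply: cvge0_le f0 => k; apply/andP; split.
    by apply: integral_ge0 => t _; rewrite lee_fin L2norm_ge0.
  apply: le_ae_integral => [t _|t _|]; first by rewrite lee_fin L2norm_ge0.
    by rewrite lee_fin (sn_ge0 sX).
  apply: lebesgue_ae_imply Xa => t Xa It; rewrite lee_fin.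
  by apply: XLn; exact: (snB sX (Xa It) (Xf k t)).
- apply: cvg0_le fw => k; rewrite L2norm_ge0; apply: XLn; apply: (snB sX) => //.
  exact: (fmem_integral T sX (ff k) (Xf k)).
Qed.

End embedding.

End L2_time_derivative.

Lemma dist_within_continuous (R : realType) (T : R) (y : R -> R) :
  (forall x, 0 <= x <= T -> forall h, 0 < h -> exists2 del, 0 < del &
    forall z, 0 <= z <= T -> `|x - z| < del -> `|y x - y z| <= h) ->
  {within `[0, T], continuous y}.
Proof.
move=> H; apply/subspace_continuousP => x /= xT; rewrite in_itv/= in xT.
apply/cvgrPdist_le => e e0; have [del del0 Hd] := H x xT e e0.
rewrite near_withinE; apply/nbhs_ballP; exists del => //= z xz /=.
by rewrite in_itv/= => zT; exact: Hd.
Qed.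

(** * Absolutely continuous functions with values in L^2 *)

Section L2_absolutely_continuous.
Context {R : realType} {d : nat}.
Local Notation mu := (@lebesgue_rV R d).
Local Notation lambda := (@lebesgue_measure R).
Variables (T : R) (Omega : set 'rV[R]_d).
Hypothesis T0 : 0 < T.
Hypotheses (oO : open Omega) (fO : (mu Omega < +oo)%E).
Local Notation sq := (sqint mu Omega).
Local Notation nr := (nrm mu Omega).
Local Notation ip := (ip mu Omega).
Local Notation "f =O g" := (aeD mu Omega f g) (at level 70).
Local Notation I := (`]0, T[%classic : set R).
Local Notation L2 := (XL2 Omega).
Implicit Types (f g h w : 'rV[R]_d -> R) (u v a b U V : R -> 'rV[R]_d -> R).
Let mO : measurable Omega. Proof. exact: open_measurable_rV. Qed.
Let sL2 := seminormed_L2 oO.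
Let sub t : I t -> 0 <= t <= T.
Proof. by rewrite /= in_itv/= => /andP[t0 tT]; rewrite !ltW. Qed.

Definition L2_continuous a := forall t, 0 <= t <= T -> forall e, 0 < e -> exists2 del, 0 < del &
  forall s, 0 <= s <= T -> `|t - s| < del -> nr (fun x => a t x - a s x) <= e.

(** Approximants come from evaluating a at finitely valued approximations of the time variable. *)
Lemma continuous_strong a : (forall t, 0 <= t <= T -> sq (a t)) -> L2_continuous a -> strong T L2 a.
Proof.
move=> sa ca.
have [M aM] : exists M, forall t, 0 <= t <= T -> nr (a t) <= M.
  have /bm_continuous[_ [M aM]] : {within `[0, T], continuous (fun t => nr (a t))}.
    apply: dist_within_continuous => t tT h h0; have [del del0 H] := ca t tT h h0.
    exists del => // s sT ts; apply: le_trans (H s sT ts).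
    exact: (ler_dist_nrm mO (sa t tT) (sa s sT)).
  by exists M => t /aM; rewrite ger0_norm ?nrm_ge0.
have [phi [fphi phiE]] : exists f : nat -> R -> R, (forall n, finvalued (f n)) /\
    forall t, `[0, T]%classic t -> f n t @[n --> \oo] --> id t.
  by apply: finvalued_approx => //; exact: measurable_id.
(* Clamping keeps the approximate times inside [0, T] without increasing their distance to t. *)
pose cl (s : R) := Num.max 0 (Num.min s T).
have clT s : 0 <= cl s <= T.
  by rewrite /cl le_max lexx/= ge_max (ltW T0) ge_min lexx orbT.
have cl_dist s t : 0 <= t <= T -> `|t - cl s| <= `|t - s|.
  move=> /andP[t0 tT]; rewrite /cl; have [sT|sT] := leP s T.
    have [s0|s0] := leP 0 s; first exact: lexx.
    by rewrite subr0 !ger0_norm; lra.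
  by rewrite max_r ?(ltW T0)// !ler0_norm; lra.
split.
- by move=> t tT; apply/(L2P mO); exact: sa.
- by exists M => t tT; rewrite /= (L2norm_nrm oO (sa t tT)); exact: aM.
exists (fun k t => a (cl (phi k t))); split.
- by move=> k; exact: (finvalued_comp (fun s => a (cl s)) (fphi k)).
- by move=> k t; apply/(L2P mO); exact: sa.
- move=> t tT; have sd k := sqintB mO (sa t tT) (sa _ (clT (phi k t))).
  have : nr (fun x => a t x - a (cl (phi k t)) x) @[k --> \oo] --> (0 : R).
    apply/cvgr0Pnorm_le => e e0; have [del del0 H] := ca t tT e e0.
    have tI : `[0, T]%classic t by rewrite /= in_itv.
    have /cvgrPdist_lt/(_ del del0) := phiE t tI; apply: filterS => k pk.
    by rewrite ger0_norm ?nrm_ge0//; apply: H => //; exact: le_lt_trans (cl_dist _ _ tT) pk.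
  apply: cvg_trans; apply: near_eq_cvg; apply: nearW => k.
  exact/esym/(L2norm_nrm oO (sd k)).
Qed.

(** Absolute continuity in L^2, tested against each fixed function; the bounded strongly measurable
    density makes a Lipschitz in norm. *)
Definition hac a a' := [/\ forall t, 0 <= t <= T -> sq (a t), strong T L2 a' &
  forall g, sq g -> ac T (fun t => ip (a t) g) (fun t => ip (a' t) g)].

(** The increment is tested against itself, and one factor of its norm is cancelled. *)
Lemma hac_lipschitz a a' : hac a a' -> exists2 M, 0 < M &
  forall s t, 0 <= s <= T -> 0 <= t <= T -> nr (fun x => a t x - a s x) <= M * `|t - s|.
Proof.
move=> [sa sa' aa']; have [M M0 aM] := bm_bound (strong_nrm oO sa'); exists M => //.
have key s t : 0 <= s <= T -> 0 <= t <= T -> s <= t -> nr (fun x => a t x - a s x) <= M * `|t - s|.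
  move=> sT tT st; have /andP[s0 _] := sT; have /andP[_ tT'] := tT.
  have sw := sqintB mO (sa t tT) (sa s sT); set w := (fun x => _) in sw *.
  have [bw wE] := aa' w sw; have := wE s t s0 st tT'.
  rewrite -(ipBl mO (sa t tT) (sa s sT) sw) -/w -nrm_sqr => nE.
  have : nr w ^+ 2 <= (M * nr w) * (t - s).
    rewrite -[leLHS]ger0_norm ?sqr_ge0// nE; apply: (int_bound bw) => //.
    apply: lebesgue_aeT => x /andP[sx xt].
    have xT : 0 <= x <= T by rewrite (le_trans s0 sx) (le_trans xt tT').
    apply: (le_trans (cauchy_schwarz mO (strong_sq oO sa' xT) sw)); rewrite ler_wpM2r ?nrm_ge0//.
    by rewrite (le_trans (ler_norm _))// aM.
  have [w0|w0] := leP (nr w) 0; first by move=> _; rewrite (le_trans w0)// mulr_ge0// ltW.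
  by rewrite expr2 mulrAC ler_pM2r// (ger0_norm (x := t - s)) ?subr_ge0.
move=> s t sT tT; have [st|/ltW ts] := leP s t; first exact: key.
by rewrite (nrmC mu Omega (a t)) distrC; exact: key.
Qed.

Lemma hac_continuous a a' : hac a a' -> L2_continuous a.
Proof.
move=> aa' t tT e e0; have [M M0 aM] := hac_lipschitz aa'.
exists (e / M); first by rewrite divr_gt0.
move=> s sT ts; apply: (le_trans (aM s t sT tT)).
by rewrite -ler_pdivlMl// mulrC ltW.
Qed.

Lemma hac_strong a a' : hac a a' -> strong T L2 a.
Proof. by move=> aa'; apply: continuous_strong (hac_continuous aa'); have [] := aa'. Qed.

Lemma weak_hac a a' : (forall t, 0 <= t <= T -> sq (a t)) -> L2_continuous a -> strong T L2 a' ->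
  scalar_weak T Omega a a' (fun=> True) -> hac a a'.
Proof.
move=> sa ca sa' aa'; split => // g sg.
apply: weak_ac => //; last by move=> phi tphi; exact: aa'.
  apply: dist_within_continuous => t tT h h0.
  have h1 : 0 < h / (nr g + 1) by rewrite divr_gt0// ltr_wpDl ?nrm_ge0.
  have [del del0 H] := ca t tT _ h1; exists del => // s sT ts.
  rewrite -(ipBl mO (sa t tT) (sa s sT) sg).
  apply: (le_trans (cauchy_schwarz mO (sqintB mO (sa t tT) (sa s sT)) sg)).
  apply: (le_trans (ler_wpM2r (nrm_ge0 _ _ _) (H s sT ts))).
  rewrite -mulrA ler_piMr ?(ltW h0)// mulrC ler_pdivrMr ?ltr_wpDl ?nrm_ge0// mul1r.
  by rewrite lerDl.
exact: strong_ipr.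
Qed.

Lemma hacD a a' b b' : hac a a' -> hac b b' ->
  hac (fun t x => a t x + b t x) (fun t x => a' t x + b' t x).
Proof.
move=> [sa sa' aa'] [sb sb' bb']; split.
- by move=> t tT; exact: (sqintD mO (sa t tT) (sb t tT)).
- exact: (strongD sL2 sa' sb').
- move=> g sg; have [bm1 H] := acD (aa' g sg) (bb' g sg).
  have bm2 := strong_ipr oO (strongD sL2 sa' sb') sg.
  split => // s t s0 st tT.
  have sT' : 0 <= s <= T by rewrite s0 (le_trans st tT).
  have tT' : 0 <= t <= T by rewrite tT (le_trans s0 st).
  rewrite (ipDl mO (sa t tT') (sb t tT') sg) (ipDl mO (sa s sT') (sb s sT') sg) H//.
  apply: eq_Rintegral => x; rewrite inE/= in_itv/= => /andP[sx xt].
  have xT : 0 <= x <= T by rewrite (le_trans s0 sx) (le_trans xt tT).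
  by rewrite (ipDl mO (strong_sq oO sa' xT) (strong_sq oO sb' xT) sg).
Qed.

Lemma hacZ (c : R) a a' : hac a a' -> hac (fun t x => c * a t x) (fun t x => c * a' t x).
Proof.
move=> [sa sa' aa']; have sca' := strongM sL2 (bm_cst T c) sa'; split => //.
- by move=> t tT; exact: (sqintZ mO c (sa t tT)).
- move=> g sg; have [bm1 H] := acZ c (aa' g sg); split; first exact: strong_ipr.
  move=> s t s0 st tT.
  have sT' : 0 <= s <= T by rewrite s0 (le_trans st tT).
  have tT' : 0 <= t <= T by rewrite tT (le_trans s0 st).
  rewrite (ipZl mO c (sa t tT') sg) (ipZl mO c (sa s sT') sg) H//.
  apply: eq_Rintegral => x; rewrite inE/= in_itv/= => /andP[sx xt].
  have xT : 0 <= x <= T by rewrite (le_trans s0 sx) (le_trans xt tT).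
  by rewrite (ipZl mO c (strong_sq oO sa' xT) sg).
Qed.

Lemma hacB a a' b b' : hac a a' -> hac b b' ->
  hac (fun t x => a t x - b t x) (fun t x => a' t x - b' t x).
Proof.
move=> aa' /(hacZ (-1)) bb'; have := hacD aa' bb'.
by congr hac; apply/funext => t; apply/funext => x; rewrite mulN1r.
Qed.

Lemma bounded_mul_sq g f : measurable_fun Omega g -> bounded_fun Omega g -> sq f ->
  sq (fun x => f x * g x).
Proof.
move=> mg [M gM] sf; have := sqint_bounded_mul mO mg gM sf.
by congr sqint; apply/funext => x; rewrite mulrC.
Qed.

Lemma bounded_mul_nrm g : measurable_fun Omega g -> bounded_fun Omega g ->
  exists2 M, 0 <= M & forall f, sq f -> nr (fun x => f x * g x) <= M * nr f.
Proof.
move=> mg [M gM]; exists `|M| => // f sf.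
have gM' : {ae mu, forall x, Omega x -> `|g x| <= `|M|}.
  by apply: nearW => x Ox; rewrite (le_trans (gM x Ox))// ler_norm.
have [_] := ae_bounded_mul oO mg (normr_ge0 M) gM' sf.
by congr (nr _ <= _); apply/funext => x; rewrite mulrC.
Qed.

Lemma ip_mulA f g h : ip f (fun x => h x * g x) = ip h (fun x => f x * g x).
Proof. by rewrite !ipE; apply: eq_Rintegral => x _; rewrite mulrCA. Qed.

Lemma strong_bounded_mul a g : measurable_fun Omega g -> bounded_fun Omega g -> strong T L2 a ->
  strong T L2 (fun t x => a t x * g x).
Proof.
move=> mg bg; have [M M0 HM] := bounded_mul_nrm mg bg.
have sm f : fmem L2 f -> sq f by move=> /(L2P mO).
apply: (strong_map (A := fun f x => f x * g x) sL2 sL2 M0) => [f /sm sf|f /sm sf|f f' /sm sf /sm sf'].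
- by apply/(L2P mO); exact: bounded_mul_sq.
- by rewrite /= (L2norm_nrm oO (bounded_mul_sq mg bg sf)) (L2norm_nrm oO sf); exact: HM.
- have sB := sqintB mO sf sf'; rewrite /= (L2norm_nrm oO sB).
  rewrite (_ : (fun x => _) = (fun x => (f x - f' x) * g x)).
    by rewrite (L2norm_nrm oO (bounded_mul_sq mg bg sB)); exact: HM.
  by apply/funext => x; rewrite mulrBl.
Qed.

(** The mesh argument for inner products. The weight g is bounded so that b g stays in L^2; g = 1
    gives the derivative of the squared norm, and general g gives weak derivatives of pointwise
    products. *)
Lemma hac_mul a a' b b' g : hac a a' -> hac b b' -> measurable_fun Omega g -> bounded_fun Omega g ->
  ac T (fun t => ip (a t) (fun x => b t x * g x))
       (fun t => ip (a' t) (fun x => b t x * g x) + ip (b' t) (fun x => a t x * g x)).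
Proof.
move=> aa' bb' mg bg; have sa := hac_strong aa'; have sb := hac_strong bb'.
have [sqa sa' aE] := aa'; have [sqb sb' bE] := bb'.
have [Ma Ma0 aL] := hac_lipschitz aa'; have [Mb Mb0 bL] := hac_lipschitz bb'.
have [Na Na0 aN] := bm_bound (strong_nrm oO sa'); have [Nb Nb0 bN] := bm_bound (strong_nrm oO sb').
have [G G0 gG] := bounded_mul_nrm mg bg.
have sag := strong_bounded_mul mg bg sa; have sbg := strong_bounded_mul mg bg sb.
have aN' t : 0 <= t <= T -> nr (a' t) <= Na by move=> tT; rewrite (le_trans (ler_norm _))// aN.
have bN' t : 0 <= t <= T -> nr (b' t) <= Nb by move=> tT; rewrite (le_trans (ler_norm _))// bN.
apply: (@mesh_lemma _ T T0 _ (fun x t => ip (a' x) (fun y => b t y * g y))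
  (fun s x => ip (b' x) (fun y => a s y * g y)) (Na * (G * Mb) + Nb * (G * Ma))).
- by move=> t tT; apply: (strong_ipr oO sa'); exact: (strong_sq oO sbg tT).
- by move=> s sT; apply: (strong_ipr oO sb'); exact: (strong_sq oO sag sT).
- by apply: bmD; exact: strong_ip.
- move=> s t s0 st tT.
  have sT' : 0 <= s <= T by rewrite s0 (le_trans st tT).
  have tT' : 0 <= t <= T by rewrite tT (le_trans s0 st).
  have [_ <-//] := aE _ (strong_sq oO sbg tT'); have [_ <-//] := bE _ (strong_sq oO sag sT').
  by rewrite (ip_mulA (b t)) (ip_mulA (b s)); ring.
- move=> x t xT tT; have := sqintB mO (sqb t tT) (sqb x xT) => sB.
  rewrite -(ipBr mO (strong_sq oO sbg tT) (strong_sq oO sbg xT) (strong_sq oO sa' xT)).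
  rewrite (_ : (fun y => _) = (fun y => (b t y - b x y) * g y)); last by apply/funext => y; rewrite mulrBl.
  apply: (le_trans (cauchy_schwarz mO (strong_sq oO sa' xT) (bounded_mul_sq mg bg sB))).
  rewrite mulrDl -[leLHS]addr0; apply: lerD; last by rewrite !mulr_ge0// ltW.
  rewrite -!mulrA; apply: ler_pM; rewrite ?nrm_ge0//; first exact: aN'.
  by apply: (le_trans (gG _ sB)); rewrite ler_wpM2l//; exact: bL.
- move=> x s xT sT; have := sqintB mO (sqa s sT) (sqa x xT) => sB.
  rewrite -(ipBr mO (strong_sq oO sag sT) (strong_sq oO sag xT) (strong_sq oO sb' xT)).
  rewrite (_ : (fun y => _) = (fun y => (a s y - a x y) * g y)); last by apply/funext => y; rewrite mulrBl.
  apply: (le_trans (cauchy_schwarz mO (strong_sq oO sb' xT) (bounded_mul_sq mg bg sB))).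
  rewrite mulrDl -[leLHS]add0r; apply: lerD; first by rewrite !mulr_ge0// ltW.
  rewrite -!mulrA; apply: ler_pM; rewrite ?nrm_ge0//; first exact: bN'.
  by apply: (le_trans (gG _ sB)); rewrite ler_wpM2l// distrC; exact: aL.
Qed.

Lemma hac_sqr a a' : hac a a' -> ac T (fun t => ip (a t) (a t)) (fun t => 2 * ip (a' t) (a t)).
Proof.
move=> aa'; have m1 : measurable_fun Omega (fun=> 1 : R) by exact: measurable_cst.
have b1 : bounded_fun Omega (fun=> 1) by exists 1 => x _; rewrite normr1.
have := hac_mul aa' aa' m1 b1.
have E t : (fun x => a t x * 1) = a t by apply/funext => x; rewrite mulr1.
by congr ac; apply/funext => t; rewrite E// mulr2n mulrDl !mul1r.
Qed.

(** The value at t is the Bochner integral over the fixed interval (0, T) of a' cut off after t by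
    [chi], which avoids integrals over varying intervals. *)
Lemma hac_primitive a' : strong T L2 a' -> exists2 b, hac b a' & nr (b 0) = 0.
Proof.
move=> sa'; pose chi (t x : R) : R := if x <= t then 1 else 0.
have bchi t : bm T (chi t).
  split; last by exists 1 => x _; rewrite /chi; case: ifP => _; rewrite ?normr1 ?normr0.
  apply: (@finvalued_measurable _ (chi t)) => //.
  rewrite (_ : chi t = fun x => if x \in (`]-oo, t]%classic : set R) then 1 else 0).
    by apply: (finvalued_comp (fun c : bool => if c then 1 else 0 : R)); exact: finvalued_in.
  by apply/funext => x; rewrite /chi mem_setE in_itv.
have [b bE] := choice (fun t => bint_exists T0 oO (strongM sL2 (bchi t) sa')).
have bint_ t g : 0 <= t <= T -> sq g -> ip (b t) g = \int[lambda]_(x in `[0, t]) ip (a' x) g.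
  move=> /andP[t0 tT] sg; rewrite (bint_ip oO (strongM sL2 (bchi t) sa') (bE t) sg).
  have big := strong_ipr oO sa' sg; have bc := bmM (bchi t) big.
  have -> : \int[lambda]_(x in I) ip (fun y => chi t x * a' x y) g = \int[lambda]_(x in I) (chi t x * ip (a' x) g).
    apply: eq_Rintegral => x; rewrite inE => /sub xT.
    exact: (ipZl mO _ (strong_sq oO sa' xT) sg).
  rewrite (int_oo_cc bc) (int_chasles bc (lexx 0) t0 tT (lexx T)).
  rewrite [X in _ + X](_ : _ = 0) ?addr0.
    apply: eq_Rintegral => x; rewrite inE/= in_itv/= => /andP[_ xt].
    by rewrite /chi xt mul1r.
  apply/eqP; rewrite -normr_le0 -[leRHS](mul0r (T - t)); apply: (int_bound bc) => //.
  apply: lebesgue_ae_imply (lebesgue_ae_neq t) => x xt /andP[tx _].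
  have -> : chi t x = 0 by rewrite /chi ifF//; apply/negbTE; rewrite -ltNge lt_neqAle eq_sym xt.
  by rewrite mul0r normr0.
have sb t : sq (b t) by have [_ Xb _] := bE t; apply/(L2P mO).
exists b; last first.
  have := bint_ 0 (b 0) _ (sb 0); rewrite lexx (ltW T0) => /(_ isT).
  rewrite set_itv1 Rintegral_set1 -nrm_sqr => /eqP.
  by rewrite sqrf_eq0 => /eqP.
split => // g sg; have aP := ac_primitive (strong_ipr oO sa' sg).
have [bk kE] := aP; split => // s t s0 st tT.
rewrite !bint_//; first exact: kE.
  by rewrite s0 (le_trans st tT).
by rewrite tT (le_trans s0 st).
Qed.

Lemma initial_value_rep u w : Linfty T L2 u -> sq w -> initial_value T Omega u w ->
  exists a, [/\ forall t, 0 <= t <= T -> sq (a t), L2_continuous a, eqae T Omega a u &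
    nr (fun x => a 0 x - w x) = 0].
Proof.
move=> [Xu _ _] sw [v [Lv cv vu v0]]; exists v.
have sv t : 0 <= t <= T -> sq (v t) by move=> tT; apply/(L2P mO); exact: Lv.
split => //.
- move=> t tT e e0; have /cvgr0_norm_le/(_ e e0) := cv t tT.
  rewrite near_withinE => /nbhs_ballP[del /= del0 H]; exists del => // s sT ts.
  have sI : `[0, T]%classic s by rewrite /= in_itv.
  have := H s ts sI; have sB := sqintB mO (sv s sT) (sv t tT).
  have -> : L2norm Omega (v s \- v t) = nr (fun x => v s x - v t x) := L2norm_nrm oO sB.
  by rewrite ger0_norm ?nrm_ge0// nrmC.
- apply: lebesgue_ae_imply2 Xu vu => t Xu vu It.
  have su : sq (u t) by apply/(L2P mO); exact: Xu.
  have svt := sv t (sub It); split => //; apply: (nrm_aeD mO svt su).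
  by rewrite -(vu It); apply/esym; exact: (L2norm_nrm oO (sqintB mO svt su)).
- have T00 : (0 : R) <= 0 <= T by apply/andP; split => //; exact: ltW.
  exact: (etrans (esym (L2norm_nrm oO (sqintB mO (sv 0 T00) sw))) v0).
Qed.

Lemma hac_zero_integral v a t g : hac v a -> nr (v 0) = 0 -> 0 <= t <= T -> sq g ->
  ip (v t) g = \int[lambda]_(x in `[0, t]) ip (a x) g.
Proof.
move=> [sv sa va] v0 /andP[t0 tT] sg; have [_ H] := va g sg.
rewrite -(H 0 t (lexx 0) t0 tT); suff -> : ip (v 0) g = 0 by rewrite subr0.
have T00 : (0 : R) <= 0 <= T by apply/andP; split => //; exact: ltW.
apply/eqP; rewrite -normr_le0; apply: (le_trans (cauchy_schwarz mO (sv 0 T00) sg)).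
by rewrite v0 mul0r.
Qed.

(** Spatial derivative and time integral commute: testing with phi moves the derivative onto phi,
    and both sides become the same scalar integral. Thus the gradient of v inherits absolute
    continuity although its time derivative lies in H^1 only at almost every time. *)
Lemma wD_primitive i v a Z b : hac v a -> nr (v 0) = 0 ->
  hac b (fun t => wD Omega i (Z t)) -> nr (b 0) = 0 -> eqae T Omega a Z ->
  {ae lambda, forall t, I t -> H1 Omega (Z t)} ->
  forall t, 0 <= t <= T -> wD Omega i (v t) =O b t.
Proof.
move=> va v0 bD b0 aZ HZ t tT; have [sv sa _] := va; have [sb sD _] := bD.
apply: (wD_ae oO fO (sb t tT)) => phi tphi.
have sphi := test_fun_sqint oO tphi; have sdphi := test_fun_pderiv_sqint oO i tphi.
have -> : \int[mu]_(x in Omega) (v t x * pderiv i phi x) = ip (v t) (pderiv i phi) by rewrite ipE.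
have -> : \int[mu]_(x in Omega) (b t x * phi x) = ip (b t) phi by rewrite ipE.
rewrite (hac_zero_integral va v0 tT sdphi) (hac_zero_integral bD b0 tT sphi).
have /andP[t0 tT'] := tT.
have b1 := strong_ipr oO sa sdphi; have b2 := strong_ipr oO sD sphi.
have b2' := bmZ (-1) b2.
have E : {ae lambda, forall s, 0 <= s <= t -> ip (a s) (pderiv i phi) = -1 * ip (wD Omega i (Z s)) phi}.
  have ne : {ae lambda, forall s : R, s != 0 /\ s != T}.
    exact: (lebesgue_ae_imply2 (fun s x y => conj x y) (lebesgue_ae_neq 0) (lebesgue_ae_neq T)).
  have H := lebesgue_ae_imply2 (fun s x y => conj x y) aZ HZ.
  apply: lebesgue_ae_imply2 H ne => s [H1s H2s] [s0 sT] /andP[s0' st].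
  have Is : I s.
    by rewrite /= in_itv/= !lt_neqAle eq_sym s0 s0' sT (le_trans st tT').
  have [p q e] := H1s Is; have /(H1P oO)[_ /(_ i) wd] := H2s Is.
  rewrite (eq_ipl mO (sqint_meas p) (sqint_meas q) (sqint_meas sdphi) e) mulN1r.
  have [_ /(_ phi tphi)] := wDP oO wd.
  by rewrite !ipE.
rewrite -mulN1r -RintegralZl//; last exact: (bm_integrable b2 (lexx 0) tT').
apply/eqP; rewrite eq_le; apply/andP; split.
  by apply: (le_int b1 b2') => //; apply: lebesgue_ae_imply E => s + st => ->.
by apply: (le_int b2' b1) => //; apply: lebesgue_ae_imply E => s + st => ->.
Qed.

End L2_absolutely_continuous.

(** * Regularity of solutions and the nonlinear term *)

Section regular_solutions.
Context {R : realType} {d : nat}.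
Local Notation mu := (@lebesgue_rV R d).
Local Notation lambda := (@lebesgue_measure R).
Variables (T : R) (Omega : set 'rV[R]_d).
Hypothesis T0 : 0 < T.
Hypotheses (oO : open Omega) (fO : (mu Omega < +oo)%E).
Local Notation sq := (sqint mu Omega).
Local Notation nr := (nrm mu Omega).
Local Notation ip := (ip mu Omega).
Local Notation "f =O g" := (aeD mu Omega f g) (at level 70).
Local Notation I := (`]0, T[%classic : set R).
Local Notation L2 := (XL2 Omega).
Local Notation dt := (dt T Omega).
Local Notation eqae := (eqae T Omega).
Local Notation hac := (hac T Omega).
Local Notation rep := (rep T Omega).
Implicit Types (f g h w : 'rV[R]_d -> R) (p u v a b U V : R -> 'rV[R]_d -> R).
Let mO : measurable Omega. Proof. exact: open_measurable_rV. Qed.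
Let sL2 := seminormed_L2 oO.
Let sH10 := seminormed_H10 oO fO.
Let sH2 := seminormed_H2 oO fO.
Let sub t : I t -> 0 <= t <= T.
Proof. by rewrite /= in_itv/= => /andP[t0 tT]; rewrite !ltW. Qed.

(** A product of two L^2 functions is a priori only integrable, so the product rule is tested with
    bounded weights. S and S' are square-integrable representatives of the product and of its formal
    derivative. *)
Lemma product_weak a a' b b' S S' : hac a a' -> hac b b' -> strong T L2 S -> strong T L2 S' ->
  {ae lambda, forall t, I t -> S t =O (fun x => a t x * b t x)} ->
  {ae lambda, forall t, I t -> S' t =O (fun x => a' t x * b t x + b' t x * a t x)} ->
  scalar_weak T Omega S S' (bounded_fun Omega).
Proof.
move=> aa' bb' sS sS' SE SE' phi tphi g sg bg; have mg := sqint_meas sg.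
have aG := hac_mul T0 oO aa' bb' mg bg; have [bG _] := aG.
have bS := strong_ipr oO sS sg; have bS' := strong_ipr oO sS' sg.
have bphi := @smooth_bm _ T _ (time_testP tphi).1.
have bphi' := @smooth_bm _ T _ (smooth_derive1 (time_testP tphi).1).
have [sa sa' _] := aa'; have [sb sb' _] := bb'.
have := ac_weak T0 aG tphi.
rewrite (int_ae_eq (bmM bphi' (ac_bm aG)) (bmM bphi' bS)); last first.
  apply: lebesgue_ae_imply SE => t SE It; congr (_ * _).
  have sat := sqint_meas (sa t (sub It)); have sbt := sqint_meas (sb t (sub It)).
  rewrite (eq_ipl mO (sqint_meas (strong_sq oO sS (sub It))) (measurable_funM sat sbt) mg (SE It)).
  by rewrite !ipE; apply: eq_Rintegral => x _; rewrite mulrA.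
rewrite (int_ae_eq (bmM bphi bG) (bmM bphi bS'))//.
apply: lebesgue_ae_imply SE' => t SE' It; congr (_ * _).
have tT := sub It.
have sat := sa t tT; have sbt := sb t tT; have sat' := strong_sq oO sa' tT; have sbt' := strong_sq oO sb' tT.
have mE : measurable_fun Omega (fun x => a' t x * b t x + b' t x * a t x).
  exact: (measurable_funD (measurable_funM (sqint_meas sat') (sqint_meas sbt)) (measurable_funM (sqint_meas sbt') (sqint_meas sat))).
rewrite (eq_ipl mO (sqint_meas (strong_sq oO sS' tT)) mE mg (SE' It)) !ipE.
rewrite -(RintegralD _ (sqint_mul mO sat' (bounded_mul_sq oO mg bg sbt))
  (sqint_mul mO sbt' (bounded_mul_sq oO mg bg sat)))//.
by apply: eq_Rintegral => x _; ring.
Qed.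

Lemma H2_mul CH f g : embedding_H2_Linfty Omega CH -> H2diamond Omega f -> sq g ->
  sq (fun x => f x * g x) /\ nr (fun x => f x * g x) <= `|CH| * nr (laplacian Omega f) * nr g.
Proof.
move=> CHP Hf sg; have sf : sq f by have [/H10_H1/(H1_sqint oO)] := Hf.
have M0 : 0 <= `|CH| * nr (laplacian Omega f) by rewrite mulr_ge0 ?nrm_ge0.
exact: (ae_bounded_mul oO (sqint_meas sf) M0 (embedding_Linfty_ae oO CHP Hf) sg).
Qed.

Lemma strong_mul CH U V : embedding_H2_Linfty Omega CH -> strong T (XH2 Omega) U -> strong T L2 V ->
  strong T L2 (fun t x => U t x * V t x).
Proof.
move=> CHP sU sV; have C0 : 0 <= `|CH| * d%:R by rewrite mulr_ge0.
have C1 f g : fmem (XH2 Omega) f -> fmem L2 g -> fmem L2 (fun x => f x * g x).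
  by move=> Hf /(L2P mO) sg; apply/(L2P mO); have [] := H2_mul CHP Hf sg.
have C2 f g : fmem (XH2 Omega) f -> fmem L2 g -> fnorm L2 (fun x => f x * g x) <=
    (`|CH| * d%:R) * (fnorm (XH2 Omega) f * fnorm L2 g).
  move=> Hf /(L2P mO) sg; have [s1 n1] := H2_mul CHP Hf sg.
  rewrite /= (L2norm_nrm oO s1) (L2norm_nrm oO sg); apply: (le_trans n1).
  rewrite mulrA; apply: ler_wpM2r; first exact: nrm_ge0.
  rewrite -mulrA; apply: ler_wpM2l; first exact: normr_ge0.
  exact: nrm_laplacian_le.
exact: (strong_bilinear (B := fun f g x => f x * g x) sH2 sL2 sL2 C0 C1 C2
  (fun f f' g x => esym (mulrBl _ _ _)) (fun f g g' x => esym (mulrBr _ _ _)) sU sV).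
Qed.

(* The continuous L^2 representatives a_j of the time derivatives of p, together
   with strongly measurable representatives b_j in the finer spaces. *)
Record regular p a0 a1 a2 a3 b0 b1 b2 : Prop := Regular {
  reg_hac0 : hac a0 a1; reg_hac1 : hac a1 a2; reg_hac2 : hac a2 a3;
  reg_a0 : eqae a0 p; reg_a1 : eqae a1 (dt p); reg_a2 : eqae a2 (dt (dt p));
  reg_a3 : eqae a3 (dt (dt (dt p)));
  reg_sb0 : strong T (XH2 Omega) b0; reg_sb1 : strong T (XH2 Omega) b1;
  reg_sb2 : strong T (XH10 Omega) b2;
  reg_b0 : eqae b0 p; reg_b1 : eqae b1 (dt p); reg_b2 : eqae b2 (dt (dt p)) }.

Let H10L f : fmem (XH10 Omega) f -> sq f /\ nr f <= fnorm (XH10 Omega) f.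
Proof.
by move=> /H10_H1/(H1_sqint oO) sf; split => //; exact: nrm_le_H1norm.
Qed.

Let H2H1 f : fmem (XH2 Omega) f -> fmem (XH10 Omega) f /\ fnorm (XH10 Omega) f <= fnorm (XH2 Omega) f.
Proof.
move=> [Hf _]; split => //; have [sf _] := H10L Hf; exact: H1norm_le_H2norm.
Qed.

Let H2L f : fmem (XH2 Omega) f -> sq f /\ nr f <= fnorm (XH2 Omega) f.
Proof.
by move=> /H2H1[/H10L[sf nf] ff]; split => //; exact: le_trans nf ff.
Qed.

Lemma strong_H2_H10 U : strong T (XH2 Omega) U -> strong T (XH10 Omega) U.
Proof.
apply: (strong_map (A := id) sH2 sH10 ler01) => [f|f|f g] Hf; first by have [] := H2H1 Hf.
  by rewrite mul1r; have [] := H2H1 Hf.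
by move=> Hg; rewrite mul1r; have [] := H2H1 (snB sH2 Hf Hg).
Qed.

Lemma wDB i f g : H1 Omega f -> H1 Omega g ->
  wD Omega i (fun x => f x - g x) =O (fun x => wD Omega i f x - wD Omega i g x).
Proof.
move=> Hf Hg; have Hg' := H1Z oO (-1) Hg.
have E1 := wDD oO fO i Hf Hg'; have E2 := wDZ oO fO i (-1) Hg.
have E : (fun x => f x + -1 * g x) = (fun x => f x - g x) by apply/funext => x; rewrite mulN1r.
rewrite E in E1; apply: filterS2 E1 E2 => x H1 H2 Ox.
by rewrite (H1 Ox) (H2 Ox) mulN1r.
Qed.

Lemma strong_wD i U : strong T (XH10 Omega) U -> strong T L2 (fun t => wD Omega i (U t)).
Proof.
apply: (strong_map (A := wD Omega i) sH10 sL2 ler01) => [f|f|f g] Hf.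
- by apply/(L2P mO); exact: wD_sqint.
- rewrite mul1r /= (L2norm_nrm oO (wD_sqint oO i f)); apply: (le_trans (nrm_wD_le oO i f)).
  by apply: gradnorm_le_H1norm => //; have [] := H10L Hf.
move=> Hg; rewrite mul1r.
have Hfg := snB sH10 Hf Hg; have [sfg _] := H10L Hfg.
have sB := sqintB mO (wD_sqint oO i f) (wD_sqint oO i g).
apply: le_trans (gradnorm_le_H1norm oO sfg); apply: le_trans (nrm_wD_le oO i _).
rewrite /= (L2norm_nrm oO sB) le_eqVlt; apply/orP; left; apply/eqP.
apply: (eq_nrm mO (sqint_meas sB) (sqint_meas (wD_sqint oO i _))).
apply: aeD_sym; exact: (wDB i (H10_H1 Hf) (H10_H1 Hg)).
Qed.

(** Each of the three memberships in [XW] brings its own chain of weak derivatives. They are all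
    identified with the same iterated [dt], and the initial conditions supply the continuous
    representatives. *)
Lemma XW_regular p w0 w1 w2 : XW T Omega p -> sq w0 -> sq w1 -> sq w2 ->
  initial_value T Omega p w0 -> initial_value T Omega (dt p) w1 -> initial_value T Omega (dt (dt p)) w2 ->
  exists a0 a1 a2 a3 b0 b1 b2, regular p a0 a1 a2 a3 b0 b1 b2 /\
    [/\ nr (fun x => a0 0 x - w0 x) = 0, nr (fun x => a1 0 x - w1 x) = 0 &
        nr (fun x => a2 0 x - w2 x) = 0].
Proof.
move=> [[Lp [v1 [pv1 [Lv1 [v2 [v12 [Lv2 [v3 [v23 [Lv3 _]]]]]]]]]]
  [LHp [h1 [ph1 [Lh1 [h2 [h12 [Lh2 _]]]]]]] [LH2p [g1 [pg1 [Lg1 _]]]]].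
move=> s0 s1 s2 i0 i1 i2.
have pp : eqae p p.
  by have [U [sU Up] _] := Linfty_rep oO Lp; exact: eqae_trans (eqae_sym Up) Up.
have [Ldp v1p w01] := weak_dt T0 oO fO Lp Lp Lv1 pp pv1.
have [Lddp v2p w12] := weak_dt T0 oO fO Lv1 Ldp Lv2 v1p v12.
have [Ldddp v3p w23] := weak_dt T0 oO fO Lv2 Lddp Lv3 v2p v23.
have [a0 [sa0 ca0 a0p a00]] := initial_value_rep T0 oO Lp s0 i0.
have [a1 [sa1 ca1 a1p a10]] := initial_value_rep T0 oO Ldp s1 i1.
have [a2 [sa2 ca2 a2p a20]] := initial_value_rep T0 oO Lddp s2 i2.
have [a3 [sa3 a3p] _] := Linfty_rep oO Ldddp.
have ta0 := continuous_strong T0 oO sa0 ca0; have ta1 := continuous_strong T0 oO sa1 ca1.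
have ta2 := continuous_strong T0 oO sa2 ca2.
have r0 : rep a0 p by [].
have r1 : rep a1 v1 by split => //; exact: eqae_trans a1p (eqae_sym v1p).
have r2 : rep a2 v2 by split => //; exact: eqae_trans a2p (eqae_sym v2p).
have r3 : rep a3 v3 by split => //; exact: eqae_trans a3p (eqae_sym v3p).
have [b0 sb0 b0p] := Linfty_strong sH2 LH2p.
have [b1 sb1 b1g] := Linfty_strong sH2 Lg1.
have [b2 sb2 b2h] := Linfty_strong sH10 Lh2.
have eH2 b u : strong T (XH2 Omega) b -> {ae lambda, forall t, I t -> b t = u t} -> eqae b u.
  by move=> sb bu; exact: (eqae_eq oO (strong_LinftyW (strong_embed oO sH2 H2L sb)) bu).
(* The derivatives found in H^2 and H^1_0 are viewed in L^2, where [weak_dt] identifies them with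
   [dt p] and [dt (dt p)]. *)
have Lg1' := Linfty_embed oO sH2 H2L Lg1.
have [_ g1p _] := weak_dt T0 oO fO Lp Lp Lg1' pp (weak_tderiv_embed oO sH2 H2L pg1).
have Lh1' := Linfty_embed oO sH10 H10L Lh1; have Lh2' := Linfty_embed oO sH10 H10L Lh2.
have [_ h1p _] := weak_dt T0 oO fO Lp Lp Lh1' pp (weak_tderiv_embed oO sH10 H10L ph1).
have [_ h2p _] := weak_dt T0 oO fO Lh1' Ldp Lh2' h1p (weak_tderiv_embed oO sH10 H10L h12).
have W01 := weak_hac T0 oO sa0 ca0 ta1 (w01 _ _ r0 r1).
have W12 := weak_hac T0 oO sa1 ca1 ta2 (w12 _ _ r1 r2).
have W23 := weak_hac T0 oO sa2 ca2 sa3 (w23 _ _ r2 r3).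
have c0 := eH2 _ _ sb0 b0p; have c1 := eqae_trans (eH2 _ _ sb1 b1g) g1p.
have c2 := eqae_trans (eqae_eq oO (strong_LinftyW (strong_embed oO sH10 H10L sb2)) b2h) h2p.
exists a0, a1, a2, a3, b0, b1, b2.
exact: (conj (Regular W01 W12 W23 a0p a1p a2p a3p sb0 sb1 sb2 c0 c1 c2) (And3 a00 a10 a20)).
Qed.

(** The chosen derivative of the square is computed by exhibiting candidates for its first and
    second derivatives and applying [dt_rep] twice. *)
Lemma nonlinear_dt CH k p a0 a1 a2 a3 b0 b1 b2 : embedding_H2_Linfty Omega CH ->
  regular p a0 a1 a2 a3 b0 b1 b2 ->
  {ae lambda, forall t, I t -> dt (dt (fun s y => k * p s y ^+ 2)) t =O
    (fun x => 2 * k * (dt p t x ^+ 2 + p t x * dt (dt p) t x))}.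
Proof.
move=> CHP [h0 h1 h2 e0 e1 e2 e3 sb0 sb1 sb2 f0 f1 f2].
have sb0' := strong_embed oO sH2 H2L sb0; have sb1' := strong_embed oO sH2 H2L sb1.
have sa2 := hac_strong T0 oO h2.
(* The H^2-valued factors make the products strongly measurable in L^2; the absolutely continuous
   [a0] and [a1], equal to them a.e., carry the product rule. *)
pose S0 t x := k * (b0 t x * b0 t x).
pose S1 t x := (2 * k) * (b0 t x * b1 t x).
pose S2 t x := (2 * k) * (b1 t x * b1 t x + b0 t x * a2 t x).
have sS0 : strong T L2 S0 by apply: (strongM sL2 (bm_cst T k)); exact: (strong_mul CHP sb0 sb0').
have sS1 : strong T L2 S1 by apply: (strongM sL2 (bm_cst T (2 * k))); exact: (strong_mul CHP sb0 sb1').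
have sS2 : strong T L2 S2.
  by apply: (strongM sL2 (bm_cst T (2 * k))); exact: (strongD sL2 (strong_mul CHP sb1 sb1') (strong_mul CHP sb0 sa2)).
have all t : I t -> [/\ sq (a0 t), sq (p t) & a0 t =O p t] -> [/\ sq (b0 t), sq (p t) & b0 t =O p t] ->
    [/\ sq (a1 t), sq (dt p t) & a1 t =O dt p t] -> [/\ sq (b1 t), sq (dt p t) & b1 t =O dt p t] ->
    {ae mu, forall x, Omega x -> [/\ a0 t x = p t x, b0 t x = p t x, a1 t x = dt p t x & b1 t x = dt p t x]}.
  move=> It [_ _ x0] [_ _ y0] [_ _ x1] [_ _ y1].
  have P : {ae mu, forall x, Omega x -> a0 t x = p t x /\ b0 t x = p t x}.
    by apply: filterS2 x0 y0 => x e f Ox; split; [exact: e|exact: f].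
  by apply: filterS3 P x1 y1 => x e f g Ox; have [-> ->] := e Ox; rewrite f// g.
have allae : {ae lambda, forall t, I t -> {ae mu, forall x, Omega x ->
    [/\ a0 t x = p t x, b0 t x = p t x, a1 t x = dt p t x & b1 t x = dt p t x]}}.
  have A := lebesgue_ae_imply2 (fun t x y => conj x y) e0 f0.
  have B := lebesgue_ae_imply2 (fun t x y => conj x y) e1 f1.
  by apply: lebesgue_ae_imply2 A B => t [x0 y0] [x1 y1] It; apply: all => //; [exact: x0|exact: y0|exact: x1|exact: y1].
have W01 : scalar_weak T Omega S0 S1 (bounded_fun Omega).
  apply: (product_weak (hacZ oO k h0) h0 sS0 sS1).
    apply: lebesgue_ae_imply allae => t H It; apply: filterS (H It) => x E Ox.
    by rewrite /S0; have [-> -> _ _] := E Ox; ring.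
  apply: lebesgue_ae_imply allae => t H It; apply: filterS (H It) => x E Ox.
  by rewrite /S1; have [-> -> -> ->] := E Ox; ring.
have W12 : scalar_weak T Omega S1 S2 (bounded_fun Omega).
  apply: (product_weak (hacZ oO (2 * k) h0) h1 sS1 sS2).
    apply: lebesgue_ae_imply allae => t H It; apply: filterS (H It) => x E Ox.
    by rewrite /S1; have [-> -> -> ->] := E Ox; ring.
  apply: lebesgue_ae_imply allae => t H It; apply: filterS (H It) => x E Ox.
  by rewrite /S2; have [-> -> -> ->] := E Ox; ring.
have r0 : rep S0 (fun s y => k * p s y ^+ 2).
  split => //; apply: lebesgue_ae_imply2 f0 (eqae_refl oO sS0) => t f0 r It.
  have [_ sp bp] := f0 It; have [sS _ _] := r It.
  have SE : S0 t =O (fun y => k * p t y ^+ 2).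
    by apply: filterS bp => x E Ox; rewrite /S0 (E Ox) expr2.
  split => //; apply: (aeD_sqint mO _ SE sS).
  by apply: measurable_funM => //; apply: measurable_funX; exact: (sqint_meas sp).
have [Ld1 r1 _] := dt_rep T0 oO fO (Linfty_eqae oO r0) r0 sS1 W01.
have [Ld2 [_ r2] _] := dt_rep T0 oO fO Ld1 r1 sS2 W12.
have B := lebesgue_ae_imply2 (fun t x y => conj x y) r2 e2.
apply: lebesgue_ae_imply2 allae B => t H [r2t e2t] It.
have [_ _ r] := r2t It; have [_ _ e] := e2t It.
apply: filterS3 (H It) r e => x E Er Ee Ox; rewrite -(Er Ox) /S2 (Ee Ox).
by have [_ -> _ ->] := E Ox; rewrite expr2.
Qed.

End regular_solutions.

(** * Algebra of the energy estimate *)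

(** The splitting decides the estimates: the second difference is multiplied by P0, which is bounded
    in space, and p2, only in H^1_0, is left with the zeroth difference, which is in H^1_0 as well.
    The delta term falls on L1 alone. *)
Lemma equation_difference (R : comPzRingType) (tau c k delta P0 P1 P2 P3 L0 L1 p0 p1 p2 p3 l0 l1 : R) :
  tau * P3 + P2 - (delta + tau * c ^+ 2) * L1 - c ^+ 2 * L0 = k * (P1 ^+ 2 + P0 * P2) ->
  tau * p3 + p2 - (0 + tau * c ^+ 2) * l1 - c ^+ 2 * l0 = k * (p1 ^+ 2 + p0 * p2) ->
  tau * (P3 - p3) + (P2 - p2) = c ^+ 2 * (tau * (L1 - l1) + (L0 - l0)) +
    (delta * L1 + k * ((P0 * (P2 - p2) + p2 * (P0 - p0)) + (P1 * (P1 - p1) + p1 * (P1 - p1)))).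
Proof.
move=> eP ep.
have -> : tau * (P3 - p3) + (P2 - p2) = (tau * P3 + P2) - (tau * p3 + p2) by ring.
have -> : tau * P3 + P2 = k * (P1 ^+ 2 + P0 * P2) + (delta + tau * c ^+ 2) * L1 + c ^+ 2 * L0.
  by rewrite -eP; ring.
have -> : tau * p3 + p2 = k * (p1 ^+ 2 + p0 * p2) + (0 + tau * c ^+ 2) * l1 + c ^+ 2 * l0.
  by rewrite -ep; ring.
by ring.
Qed.

(** Here x, y, n, w are the norms of z_t, q_t, q_tt, grad q, and u is the squared norm of grad z. In
    the rate, 1 absorbs the forcing delta M x, the factor 4 the nonlinear terms, 3 / tau the terms
    obtained by solving for q_tt and grad q_t, and the last summand the part of the cross term with
    u, which the energy carries with weight c^2. *)
Lemma growth_arith (R : realFieldType) (tau c M k h e x y n w u delta l q s : R) :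
  0 < tau -> 0 < c -> 0 <= M -> 0 <= k -> 0 <= h -> 0 <= e -> 0 <= x -> 0 <= y -> 0 <= n ->
  0 <= w -> 0 <= u -> tau * n <= x + y ->
  l <= (delta * M + k * M * (h * n + e * w + 2 * h * y)) * x ->
  q <= n * y -> tau * s <= (u + w ^+ 2) / 2 ->
  l + q + s <= (1 + 4 * (k * M * (h / tau + 2 * h + e)) + 3 / tau + (tau * c ^+ 2)^-1) *
    (x ^+ 2 / 2 + c ^+ 2 / 2 * u + y ^+ 2 / 2 + w ^+ 2 / 2) + M ^+ 2 / 2 * delta ^+ 2.
Proof.
move=> tau0 c0 M0 k0 h0 e0 x0 y0 n0 w0 u0 tn lb qb sb.
set m := k * M in lb *; have m0 : 0 <= m by exact: mulr_ge0.
set i := tau^-1; have i0 : 0 < i by rewrite invr_gt0.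
set j := (tau * c ^+ 2)^-1; have c2 : 0 < c ^+ 2 by rewrite exprn_gt0.
have j0 : 0 < j by rewrite invr_gt0 mulr_gt0.
have jc : j * c ^+ 2 = i by rewrite /j /i; field; rewrite !lt0r_neq0.
have {}tn : n <= i * (x + y) by rewrite -(ler_pM2l tau0) mulrA divff ?mul1r// lt0r_neq0.
have {}sb : s <= i * ((u + w ^+ 2) / 2) by rewrite -(ler_pM2l tau0) [leRHS]mulrA divff ?mul1r// lt0r_neq0.
set L := m * (h * i + 2 * h + e).
have hi0 : 0 <= h * i by rewrite mulr_ge0// ltW.
have L0 : 0 <= L by rewrite /L mulr_ge0// !addr_ge0// mulr_ge0.
have b1 : m * (h * n + e * w + 2 * h * y) * x <= L * ((x + y + w) * x).
  rewrite (_ : L * _ = m * ((h * i + 2 * h + e) * (x + y + w)) * x); last by rewrite /L; ring.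
  apply: ler_wpM2r => //; apply: ler_wpM2l => //.
  have := ler_wpM2l h0 tn.
  have := mulr_ge0 hi0 w0; have := mulr_ge0 h0 x0; have := mulr_ge0 h0 w0.
  have := mulr_ge0 e0 x0; have := mulr_ge0 e0 y0; lra.
(* From here on Young's inequality turns each mixed product into squares present in the energy. *)
have b2 : (x + y + w) * x <= 2 * x ^+ 2 + y ^+ 2 / 2 + w ^+ 2 / 2.
  have := sqr_ge0 (x - y); have := sqr_ge0 (x - w); rewrite !expr2; lra.
have b3 : delta * M * x <= M ^+ 2 / 2 * delta ^+ 2 + x ^+ 2 / 2.
  have := sqr_ge0 (delta * M - x); rewrite !expr2; lra.
have b4 : n * y <= i * (x ^+ 2 / 2 + 3 / 2 * y ^+ 2).
  apply: (le_trans (ler_wpM2r y0 tn)); rewrite -(mulrA i); apply: ler_wpM2l => //; first exact: ltW.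
  have := sqr_ge0 (x - y); rewrite !expr2; lra.
have b5 := ler_wpM2l L0 b2.
have X0 := sqr_ge0 x; have Y0 := sqr_ge0 y; have W0 := sqr_ge0 w.
move: X0 Y0 W0 b2 b3 b4 b5 sb; set X := x ^+ 2; set Y := y ^+ 2; set W := w ^+ 2 => X0 Y0 W0 b2 b3 b4 b5 sb.
have lb' : l <= M ^+ 2 / 2 * delta ^+ 2 + X / 2 + L * (2 * X + Y / 2 + W / 2).
  apply: (le_trans lb); rewrite mulrDl; apply: lerD => //; exact: le_trans b1 b5.
have i0' := ltW i0; have j0' := ltW j0.
have cu : 0 <= c ^+ 2 * u by rewrite mulr_ge0// ltW.
have q1 := mulr_ge0 L0 Y0; have q2 := mulr_ge0 L0 W0; have q3 := mulr_ge0 i0' X0.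
have q4 := mulr_ge0 i0' W0; have q5 := mulr_ge0 j0' X0; have q6 := mulr_ge0 j0' Y0.
have q7 := mulr_ge0 j0' W0; have q8 := mulr_ge0 L0 cu; have q9 := mulr_ge0 i0' cu.
have E : j * (c ^+ 2 / 2 * u) = i * u / 2 by rewrite -jc; ring.
have -> : (1 + 4 * L + 3 * i + j) * (X / 2 + c ^+ 2 / 2 * u + Y / 2 + W / 2) =
  (1 + 4 * L + 3 * i) * (X / 2 + (c ^+ 2 * u) / 2 + Y / 2 + W / 2) + j * (X / 2 + Y / 2 + W / 2) + i * u / 2.
  by rewrite -E; ring.
move: cu q8 q9; set V := c ^+ 2 * u => cu q8 q9; lra.
Qed.

(** The terms in w^2 add up to 3 c^2 / 2, which the summand 3 c^2 matches exactly; the 4 covers all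
    others. *)
Lemma energy_arith (R : realFieldType) (c t2 x y n w u g : R) : 0 <= u ->
  t2 * g <= 2 * u + 2 * w ^+ 2 -> t2 * n <= 2 * x ^+ 2 + 2 * y ^+ 2 ->
  t2 / 2 * n + t2 * c ^+ 2 / 2 * g + c ^+ 2 / 2 * w ^+ 2 <=
  (4 + 3 * c ^+ 2) * (x ^+ 2 / 2 + c ^+ 2 / 2 * u + y ^+ 2 / 2 + w ^+ 2 / 2).
Proof.
move=> u0 gb nb; have C0 := sqr_ge0 c; have X0 := sqr_ge0 x; have Y0 := sqr_ge0 y; have W0 := sqr_ge0 w.
move: C0 X0 Y0 W0 gb nb; set C := c ^+ 2; set X := x ^+ 2; set Y := y ^+ 2; set W := w ^+ 2 => C0 X0 Y0 W0 gb nb.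
have h := ler_wpM2l C0 gb; have CX := mulr_ge0 C0 X0; have CY := mulr_ge0 C0 Y0.
have CW := mulr_ge0 C0 W0; have CU := mulr_ge0 C0 u0; have CCU := mulr_ge0 C0 CU.
by lra.
Qed.

(** * The energy estimate *)

Section static_estimates.
Context {R : realType} {d : nat}.
Local Notation mu := (@lebesgue_rV R d).
Variables (Omega : set 'rV[R]_d).
Hypotheses (oO : open Omega) (fO : (mu Omega < +oo)%E).
Local Notation sq := (sqint mu Omega).
Local Notation nr := (nrm mu Omega).
Local Notation ip := (ip mu Omega).
Local Notation "f =O g" := (aeD mu Omega f g) (at level 70).
Local Notation lap := (laplacian Omega).
Implicit Types (f g h : 'rV[R]_d -> R).
Let mO : measurable Omega. Proof. exact: open_measurable_rV. Qed.
Let sqwD i f : sq (wD Omega i f). Proof. exact: wD_sqint. Qed.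

Lemma laplacianB f g : H2 Omega f -> H2 Omega g ->
  lap (fun x => f x - g x) =O (fun x => lap f x - lap g x).
Proof.
move=> Hf Hg; have Hg' := H2Z oO fO (-1) Hg.
have E1 := laplacianD oO fO Hf Hg'; have E2 := laplacianZ oO fO (-1) Hg.
have E : (fun x => f x + -1 * g x) = (fun x => f x - g x) by apply/funext => x; rewrite mulN1r.
rewrite E in E1; apply: filterS2 E1 E2 => x H1 H2 Ox.
by rewrite (H1 Ox) (H2 Ox) mulN1r.
Qed.

Lemma wD_lin i (a : R) f g : H1 Omega f -> H1 Omega g ->
  wD Omega i (fun x => a * f x + g x) =O (fun x => a * wD Omega i f x + wD Omega i g x).
Proof.
move=> Hf Hg; have Hf' := H1Z oO a Hf.
have E1 := wDD oO fO i Hf' Hg; have E2 := wDZ oO fO i a Hf.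
by apply: filterS2 E1 E2 => x H1 H2 Ox; rewrite (H1 Ox) (H2 Ox).
Qed.

Lemma laplacian_lin (a : R) f g : H2 Omega f -> H2 Omega g ->
  lap (fun x => a * f x + g x) =O (fun x => a * lap f x + lap g x).
Proof.
move=> Hf Hg; have Hf' := H2Z oO fO a Hf.
have E1 := laplacianD oO fO Hf' Hg; have E2 := laplacianZ oO fO a Hf.
by apply: filterS2 E1 E2 => x H1 H2 Ox; rewrite (H1 Ox) (H2 Ox).
Qed.

Lemma H2diamond_sq f : H2diamond Omega f -> sq f.
Proof. by move=> [/H10_H1/(H1_sqint oO)]. Qed.

Lemma H10_sq f : H10 Omega f -> sq f.
Proof. by move=> /H10_H1/(H1_sqint oO). Qed.

Lemma nrm_sum4 f1 f2 f3 f4 (m1 m2 m3 m4 : R) : sq f1 -> sq f2 -> sq f3 -> sq f4 ->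
  nr f1 <= m1 -> nr f2 <= m2 -> nr f3 <= m3 -> nr f4 <= m4 ->
  sq (fun x => (f1 x + f2 x) + (f3 x + f4 x)) /\
  nr (fun x => (f1 x + f2 x) + (f3 x + f4 x)) <= (m1 + m2) + (m3 + m4).
Proof.
move=> s1 s2 s3 s4 n1 n2 n3 n4; have s12 := sqintD mO s1 s2; have s34 := sqintD mO s3 s4.
split; first exact: sqintD.
apply: (le_trans (nrmD mO s12 s34)); apply: lerD.
  by apply: (le_trans (nrmD mO s1 s2)); exact: lerD.
by apply: (le_trans (nrmD mO s3 s4)); exact: lerD.
Qed.

Variables (tau c k delta M CH2 CH1 : R).
Hypotheses (tau0 : 0 < tau) (c0 : 0 < c) (delta0 : 0 <= delta) (M0 : 0 <= M).
Hypotheses (CH2P : embedding_H2_Linfty Omega CH2) (CH1P : embedding_H1_L4 Omega CH1).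
Variables (P0 P1 P2 P3 p0 p1 p2 p3 : 'rV[R]_d -> R).
Hypotheses (HP0 : H2diamond Omega P0) (HP1 : H2diamond Omega P1) (HP2 : H10 Omega P2) (sP3 : sq P3).
Hypotheses (Hp0 : H2diamond Omega p0) (Hp1 : H2diamond Omega p1) (Hp2 : H10 Omega p2) (sp3 : sq p3).
Hypotheses (MP0 : nr (lap P0) <= M) (MP1 : nr (lap P1) <= M) (Mp1 : nr (lap p1) <= M)
  (Mp2 : gradnorm Omega p2 <= M).
Hypothesis equP : {ae mu, forall x, Omega x ->
  tau * P3 x + P2 x - (delta + tau * c ^+ 2) * lap P1 x - c ^+ 2 * lap P0 x =
  k * (P1 x ^+ 2 + P0 x * P2 x)}.
Hypothesis equp : {ae mu, forall x, Omega x ->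
  tau * p3 x + p2 x - (0 + tau * c ^+ 2) * lap p1 x - c ^+ 2 * lap p0 x =
  k * (p1 x ^+ 2 + p0 x * p2 x)}.

(** All functions are values at one fixed time: index j marks the j-th time derivative, capitals
    belong to p^(delta). The combinations [z], [zt], [ztt] are related here only through the two
    equations. *)
Let q0 x := P0 x - p0 x.
Let q1 x := P1 x - p1 x.
Let q2 x := P2 x - p2 x.
Let q3 x := P3 x - p3 x.
Let z x := tau * q1 x + q0 x.
Let zt x := tau * q2 x + q1 x.
Let ztt x := tau * q3 x + q2 x.

Let Hq0 : H2diamond Omega q0. Proof. exact: (H2diamondB oO fO HP0 Hp0). Qed.
Let Hq1 : H2diamond Omega q1. Proof. exact: (H2diamondB oO fO HP1 Hp1). Qed.
Let Hq2 : H10 Omega q2. Proof. exact: (H10B oO fO HP2 Hp2). Qed.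
Let sq1 : sq q1. Proof. exact: H2diamond_sq. Qed.
Let sq2 : sq q2. Proof. exact: H10_sq. Qed.
Let sq3 : sq q3. Proof. exact: sqintB. Qed.
Let Hz : H2diamond Omega z.
Proof. exact: (H2diamondD oO fO (H2diamondZ oO fO tau Hq1) Hq0). Qed.
Let Hzt : H10 Omega zt.
Proof. by have [Hq1' _] := Hq1; exact: (H10D oO fO (H10Z oO fO tau Hq2) Hq1'). Qed.
Let szt : sq zt. Proof. exact: H10_sq. Qed.
Let sztt : sq ztt. Proof. exact: (sqintD mO (sqintZ mO tau sq3) sq2). Qed.

(** Three of the four products have an H^2 factor with Laplacian at most M, hence a bounded one; the
    product of p2 and q0 is bounded by the L^4 embedding. *)
Let source : exists f, [/\ sq f, ztt =O (fun x => c ^+ 2 * lap z x + f x) &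
  nr f <= delta * M + `|k| * M * (`|CH2| * nr q2 + CH1 ^+ 2 * gradnorm Omega q0 + 2 * `|CH2| * nr q1)].
Proof.
have [_ hP0] := HP0; have [_ hP1] := HP1; have [_ hp0] := Hp0; have [_ hp1] := Hp1.
have [tq0 hq0] := Hq0; have [_ hq1] := Hq1.
pose N x := (P0 x * q2 x + p2 x * q0 x) + (P1 x * q1 x + p1 x * q1 x).
have [sN nN] : sq N /\ nr N <= (`|CH2| * M * nr q2 + CH1 ^+ 2 * M * gradnorm Omega q0) +
    (`|CH2| * M * nr q1 + `|CH2| * M * nr q1).
  have mulH f g : H2diamond Omega f -> nr (lap f) <= M -> sq g ->
      sq (fun x => f x * g x) /\ nr (fun x => f x * g x) <= `|CH2| * M * nr g.
    move=> Hf fM sg; have [s n] := H2_mul oO CH2P Hf sg; split=> [//|].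
    apply: (le_trans n); apply: ler_wpM2r; first exact: nrm_ge0.
    by apply: ler_wpM2l; first exact: normr_ge0.
  have [s1 n1] := mulH P0 q2 HP0 MP0 sq2; have [s3 n3] := mulH P1 q1 HP1 MP1 sq1.
  have [s4 n4] := mulH p1 q1 Hp1 Mp1 sq1.
  have [s2 n2] := embedding_L4_mul oO CH1P Hp2 tq0.
  apply: (nrm_sum4 s1 s2 s3 s4 n1 _ n3 n4); apply: (le_trans n2).
  apply: ler_wpM2r; first exact: gradnorm_ge0.
  by apply: ler_wpM2l; first exact: sqr_ge0.
have sL := laplacian_sqint oO P1.
exists (fun x => delta * lap P1 x + k * N x); split.
- exact: (sqintD mO (sqintZ mO delta sL) (sqintZ mO k sN)).
- have E0 := laplacianB hP0 hp0; have E1 := laplacianB hP1 hp1; have E2 := laplacian_lin tau hq1 hq0.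
  have E01 : {ae mu, forall x, Omega x -> lap q0 x = lap P0 x - lap p0 x /\ lap q1 x = lap P1 x - lap p1 x}.
    by apply: filterS2 E0 E1 => x e0 e1 Ox; split; [exact: e0|exact: e1].
  have Ez : {ae mu, forall x, Omega x ->
      lap z x = tau * (lap P1 x - lap p1 x) + (lap P0 x - lap p0 x)}.
    by apply: filterS2 E01 E2 => x e e2 Ox; have [l0 l1] := e Ox; rewrite (e2 Ox) l0 l1.
  apply: filterS3 Ez equP equp => x ez eP' ep'' Ox; have eP := eP' Ox; have ep' := ep'' Ox.
  rewrite (ez Ox); exact: (equation_difference eP ep').
- apply: (le_trans (nrmD mO (sqintZ mO delta sL) (sqintZ mO k sN))).
  rewrite (nrmZ mO delta sL) (nrmZ mO k sN) (ger0_norm delta0); apply: lerD.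
    exact: (ler_wpM2l delta0 MP1).
  rewrite -(mulrA `|k| M); apply: (ler_wpM2l (normr_ge0 k)); apply: (le_trans nN).
  move: (nr q2) (nr q1) (gradnorm Omega q0) => n y w.
  by rewrite [leRHS](_ : _ = `|CH2| * M * n + CH1 ^+ 2 * M * w + (`|CH2| * M * y + `|CH2| * M * y)) ?lexx//; ring.
Qed.

(** Green's formula cancels the contribution of [c^2 lap z], so that only the source is left against
    [zt]. *)
Let rate : ip ztt zt + c ^+ 2 * (\sum_i ip (wD Omega i zt) (wD Omega i z)) <=
  (delta * M + `|k| * M * (`|CH2| * nr q2 + CH1 ^+ 2 * gradnorm Omega q0 + 2 * `|CH2| * nr q1)) * nr zt.
Proof.
have [f [sf fE fn]] := source; have [_ hz] := Hz; have sL := laplacian_sqint oO z.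
have -> : \sum_i ip (wD Omega i zt) (wD Omega i z) = - ip (lap z) zt.
  by rewrite -(green oO fO hz Hzt); apply: eq_bigr => i _; rewrite ipC.
have scL := sqintZ mO (c ^+ 2) sL; have sE := sqintD mO scL sf.
rewrite (eq_ipl mO (sqint_meas sztt) (sqint_meas sE) (sqint_meas szt) fE).
rewrite (ipDl mO scL sf szt) (ipZl mO (c ^+ 2) sL szt) mulrN addrAC subrr add0r.
apply: (le_trans (ler_norm _)); apply: (le_trans (cauchy_schwarz mO sf szt)).
by apply: ler_wpM2r; first exact: nrm_ge0.
Qed.

(** Free of delta, so that the exponential factor in the Groenwall bound is uniform in the
    viscosity. *)
Definition growth_rate : R :=
  1 + 4 * (`|k| * M * (`|CH2| / tau + 2 * `|CH2| + CH1 ^+ 2)) + 3 / tau + (tau * c ^+ 2)^-1.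

Definition static_energy := ip zt zt / 2 + c ^+ 2 / 2 * (\sum_i ip (wD Omega i z) (wD Omega i z)) +
  ip q1 q1 / 2 + (\sum_i ip (wD Omega i q0) (wD Omega i q0)) / 2.

Let tau_q2 : tau * nr q2 <= nr zt + nr q1.
Proof.
rewrite -{1}(gtr0_norm tau0) -(nrmZ mO tau sq2).
rewrite (_ : (fun x => _) = (fun x => zt x - q1 x)); first exact: nrmB.
by apply/funext => x; rewrite /zt addrK.
Qed.

Let wDz i : (fun x => tau * wD Omega i q1 x) =O (fun x => wD Omega i z x - wD Omega i q0 x).
Proof.
have [/H10_H1 h0 _] := Hq0; have [/H10_H1 h1 _] := Hq1.
by apply: filterS (wD_lin i tau h1 h0) => x E Ox; rewrite (E Ox) addrK.
Qed.

Let swB i : sq (fun x => wD Omega i z x - wD Omega i q0 x).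
Proof. exact: (sqintB mO (sqwD i z) (sqwD i q0)). Qed.

Let ip_young f g : sq f -> sq g -> ip f g <= (ip f f + ip g g) / 2.
Proof.
by move=> sf sg; have := ip_ge0 mu Omega (fun x => f x - g x); rewrite (ip_sqB mO sf sg); lra.
Qed.

(** The left-hand side is what the time derivative of the energy becomes at a fixed time. *)
Lemma static_growth :
  ip ztt zt + c ^+ 2 * (\sum_i ip (wD Omega i zt) (wD Omega i z)) + ip q2 q1 +
    \sum_i ip (wD Omega i q1) (wD Omega i q0) <=
  growth_rate * static_energy + M ^+ 2 / 2 * delta ^+ 2.
Proof.
have x0 := nrm_ge0 mu Omega zt; have y0 := nrm_ge0 mu Omega q1; have n0 := nrm_ge0 mu Omega q2.
have w0 := gradnorm_ge0 Omega q0.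
have sumE : \sum_i ip (wD Omega i q0) (wD Omega i q0) = gradnorm Omega q0 ^+ 2.
  by rewrite (gradnorm_sqr oO q0); apply: eq_bigr => i _; rewrite nrm_sqr.
have u0 : 0 <= \sum_i ip (wD Omega i z) (wD Omega i z).
  by apply: sumr_ge0 => i _; exact: ip_ge0.
(* Multiplying by tau lets grad z - grad q replace tau grad q_t, since grad q_t is not controlled on
   its own. *)
have crossE : tau * (\sum_i ip (wD Omega i q1) (wD Omega i q0)) <=
    (\sum_i ip (wD Omega i z) (wD Omega i z) + gradnorm Omega q0 ^+ 2) / 2.
  rewrite -sumE -big_split/= mulr_suml mulr_sumr; apply: ler_sum => i _.
  rewrite -(ipZl mO tau (sqwD i q1) (sqwD i q0)).
  rewrite (eq_ipl mO (sqint_meas (sqintZ mO tau (sqwD i q1))) (sqint_meas (swB i))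
    (sqint_meas (sqwD i q0)) (wDz i)).
  rewrite (ipBl mO (sqwD i z) (sqwD i q0) (sqwD i q0)).
  have := ip_young (sqwD i z) (sqwD i q0); have := ip_ge0 mu Omega (wD Omega i q0); lra.
have q21 : ip q2 q1 <= nr q2 * nr q1.
  exact: (le_trans (ler_norm _) (cauchy_schwarz mO sq2 sq1)).
rewrite /static_energy /growth_rate sumE -!nrm_sqr.
exact: (growth_arith tau0 c0 M0 (normr_ge0 k) (normr_ge0 CH2) (sqr_ge0 CH1) x0 y0 n0 w0 u0 tau_q2 rate q21 crossE).
Qed.

Lemma static_energy_bound :
  tau ^+ 2 / 2 * nr q2 ^+ 2 + tau ^+ 2 * c ^+ 2 / 2 * gradnorm Omega q1 ^+ 2 +
    c ^+ 2 / 2 * gradnorm Omega q0 ^+ 2 <= (4 + 3 * c ^+ 2) * static_energy.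
Proof.
have x0 := nrm_ge0 mu Omega zt; have y0 := nrm_ge0 mu Omega q1; have n0 := nrm_ge0 mu Omega q2.
have sumE : \sum_i ip (wD Omega i q0) (wD Omega i q0) = gradnorm Omega q0 ^+ 2.
  by rewrite (gradnorm_sqr oO q0); apply: eq_bigr => i _; rewrite nrm_sqr.
have u0 : 0 <= \sum_i ip (wD Omega i z) (wD Omega i z).
  by apply: sumr_ge0 => i _; exact: ip_ge0.
have grad1 : tau ^+ 2 * gradnorm Omega q1 ^+ 2 <=
    2 * (\sum_i ip (wD Omega i z) (wD Omega i z)) + 2 * gradnorm Omega q0 ^+ 2.
  rewrite -sumE (gradnorm_sqr oO q1) !mulr_sumr -big_split/=; apply: ler_sum => i _.
  have sT := sqintZ mO tau (sqwD i q1).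
  rewrite -[tau](gtr0_norm tau0) -exprMn -(nrmZ mO tau (sqwD i q1)).
  rewrite (eq_nrm mO (sqint_meas sT) (sqint_meas (swB i)) (wDz i)) nrm_sqr.
  rewrite (ip_sqB mO (sqwD i z) (sqwD i q0)).
  have := ip_ge0 mu Omega (fun x => wD Omega i z x + wD Omega i q0 x).
  by rewrite (ip_sqD mO (sqwD i z) (sqwD i q0)); lra.
have n2 : tau ^+ 2 * nr q2 ^+ 2 <= 2 * nr zt ^+ 2 + 2 * nr q1 ^+ 2.
  rewrite -exprMn; apply: (@le_trans _ _ ((nr zt + nr q1) ^+ 2)).
    by rewrite ler_sqr ?nnegrE ?tau_q2 ?addr_ge0// mulr_ge0// ltW.
  by have := sqr_ge0 (nr zt - nr q1); rewrite sqrrB sqrrD !mulr2n; lra.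
rewrite /static_energy sumE -!nrm_sqr.
exact: (energy_arith c u0 grad1 n2).
Qed.

End static_estimates.

(** * Integration of the energy inequality in time *)

Section energy_estimate.
Context {R : realType} {d : nat}.
Local Notation mu := (@lebesgue_rV R d).
Local Notation lambda := (@lebesgue_measure R).
Variables (T : R) (Omega : set 'rV[R]_d).
Hypothesis T0 : 0 < T.
Hypotheses (oO : open Omega) (fO : (mu Omega < +oo)%E).
Local Notation sq := (sqint mu Omega).
Local Notation nr := (nrm mu Omega).
Local Notation ip := (ip mu Omega).
Local Notation "f =O g" := (aeD mu Omega f g) (at level 70).
Local Notation I := (`]0, T[%classic : set R).
Local Notation lap := (laplacian Omega).
Local Notation dt := (dt T Omega).
Local Notation eqae := (eqae T Omega).
Local Notation hac := (hac T Omega).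
Implicit Types (f g h w : 'rV[R]_d -> R) (u v a b U V : R -> 'rV[R]_d -> R).
Let mO : measurable Omega. Proof. exact: open_measurable_rV. Qed.
Let sH10 := seminormed_H10 oO fO.
Let sub t : I t -> 0 <= t <= T.
Proof. by rewrite /= in_itv/= => /andP[t0 tT]; rewrite !ltW. Qed.

Let aerefl f : f =O f.
Proof. by apply: nearW. Qed.

Lemma regular_mem p a0 a1 a2 a3 b0 b1 b2 : regular T Omega p a0 a1 a2 a3 b0 b1 b2 ->
  {ae lambda, forall t, I t -> [/\ H2diamond Omega (p t), H2diamond Omega (dt p t),
    H10 Omega (dt (dt p) t) & sq (dt (dt (dt p)) t)]}.
Proof.
move=> [_ _ _ _ _ _ e3 [m0 _ _] [m1 _ _] [m2 _ _] f0 f1 f2].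
have F01 := lebesgue_ae_imply2 (fun t x y => conj x y) f0 f1.
have F23 := lebesgue_ae_imply2 (fun t x y => conj x y) f2 e3.
apply: lebesgue_ae_imply2 F01 F23 => t [x0 x1] [x2 x3] It.
have [_ p0 q0] := x0 It; have [_ p1 q1] := x1 It; have [_ p2 q2] := x2 It; have [_ p3 _] := x3 It.
have tT := sub It.
exact: (And4 (eq_H2diamond oO p0 q0 (m0 t tT)) (eq_H2diamond oO p1 q1 (m1 t tT))
  (eq_H10 oO p2 q2 (m2 t tT)) p3).
Qed.

Lemma eqaeB u u' v v' : eqae u u' -> eqae v v' ->
  eqae (fun t x => u t x - v t x) (fun t x => u' t x - v' t x).
Proof.
apply: lebesgue_ae_imply2 => t H H' It; have [s1 s2 e] := H It; have [s1' s2' e'] := H' It.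
split; [exact: sqintB|exact: sqintB|].
by apply: filterS2 e e' => x E E' Ox; rewrite (E Ox) (E' Ox).
Qed.

Lemma eqae_lin (r : R) u u' v v' : eqae u u' -> eqae v v' ->
  eqae (fun t x => r * u t x + v t x) (fun t x => r * u' t x + v' t x).
Proof.
apply: lebesgue_ae_imply2 => t H H' It; have [s1 s2 e] := H It; have [s1' s2' e'] := H' It.
split; [exact: (sqintD mO (sqintZ mO r s1) s1')|exact: (sqintD mO (sqintZ mO r s2) s2')|].
by apply: filterS2 e e' => x E E' Ox; rewrite (E Ox) (E' Ox).
Qed.

Lemma eq_ip2 f f' g g' : sq f -> sq f' -> f =O f' -> sq g -> sq g' -> g =O g' -> ip f g = ip f' g'.
Proof.
move=> sf sf' ff sg sg' gg.
rewrite (eq_ipl mO (sqint_meas sf) (sqint_meas sf') (sqint_meas sg) ff).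
by rewrite ipC (eq_ipl mO (sqint_meas sg) (sqint_meas sg') (sqint_meas sf') gg) ipC.
Qed.

Variables (tau c k delta M CH2 CH1 : R).
Hypotheses (tau0 : 0 < tau) (c0 : 0 < c) (delta0 : 0 <= delta) (M0 : 0 <= M).
Hypotheses (CH2P : embedding_H2_Linfty Omega CH2) (CH1P : embedding_H1_L4 Omega CH1).
Variables (P p : R -> 'rV[R]_d -> R).
Variables (A0 A1 A2 A3 B0 B1 B2 a0 a1 a2 a3 b0 b1 b2 : R -> 'rV[R]_d -> R).
Hypotheses (rP : regular T Omega P A0 A1 A2 A3 B0 B1 B2) (rp : regular T Omega p a0 a1 a2 a3 b0 b1 b2).
Hypotheses (init0 : nr (fun x => A0 0 x - a0 0 x) = 0) (init1 : nr (fun x => A1 0 x - a1 0 x) = 0)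
  (init2 : nr (fun x => A2 0 x - a2 0 x) = 0).
Hypothesis boundP : {ae lambda, forall t, I t ->
  [/\ nr (lap (P t)) <= M, nr (lap (dt P t)) <= M, nr (lap (dt p t)) <= M &
      gradnorm Omega (dt (dt p) t) <= M]}.
Hypothesis equP : {ae lambda, forall t, I t -> {ae mu, forall x, Omega x ->
  tau * dt (dt (dt P)) t x + dt (dt P) t x - (delta + tau * c ^+ 2) * lap (dt P t) x - c ^+ 2 * lap (P t) x =
  k * (dt P t x ^+ 2 + P t x * dt (dt P) t x)}}.
Hypothesis equp : {ae lambda, forall t, I t -> {ae mu, forall x, Omega x ->
  tau * dt (dt (dt p)) t x + dt (dt p) t x - (0 + tau * c ^+ 2) * lap (dt p t) x - c ^+ 2 * lap (p t) x =
  k * (dt p t x ^+ 2 + p t x * dt (dt p) t x)}}.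

(** Three layers of representatives of the differences: [al0], ..., [a'] are absolutely continuous
    or strongly measurable in L^2, [W1] and [Z1] represent q_t and z_t with values in H^1_0, and
    [q0], ..., [ztt] are built from the chosen derivatives. *)
Let al0 t x := A0 t x - a0 t x.
Let al1 t x := A1 t x - a1 t x.
Let al2 t x := A2 t x - a2 t x.
Let al3 t x := A3 t x - a3 t x.
Let h01 : hac al0 al1. Proof. exact: (hacB oO (reg_hac0 rP) (reg_hac0 rp)). Qed.
Let h12 : hac al1 al2. Proof. exact: (hacB oO (reg_hac1 rP) (reg_hac1 rp)). Qed.
Let h23 : hac al2 al3. Proof. exact: (hacB oO (reg_hac2 rP) (reg_hac2 rp)). Qed.
Let v t x := tau * al1 t x + al0 t x.
Let a t x := tau * al2 t x + al1 t x.
Let a' t x := tau * al3 t x + al2 t x.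
Let hv : hac v a. Proof. exact: (hacD oO (hacZ oO tau h12) h01). Qed.
Let ha : hac a a'. Proof. exact: (hacD oO (hacZ oO tau h23) h12). Qed.
Let W1 t x := B1 t x - b1 t x.
Let Z1 t x := tau * (B2 t x - b2 t x) + W1 t x.
Let sW1 : strong T (XH10 Omega) W1.
Proof. exact: (strongB sH10 (strong_H2_H10 oO fO (reg_sb1 rP)) (strong_H2_H10 oO fO (reg_sb1 rp))). Qed.
Let sZ1 : strong T (XH10 Omega) Z1.
Proof.
exact: (strongD sH10 (strongM sH10 (bm_cst T tau) (strongB sH10 (reg_sb2 rP) (reg_sb2 rp))) sW1).
Qed.
Let q0 t x := P t x - p t x.
Let q1 t x := dt P t x - dt p t x.
Let q2 t x := dt (dt P) t x - dt (dt p) t x.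
Let q3 t x := dt (dt (dt P)) t x - dt (dt (dt p)) t x.
Let z t x := tau * q1 t x + q0 t x.
Let zt t x := tau * q2 t x + q1 t x.
Let ztt t x := tau * q3 t x + q2 t x.
Let e0 : eqae al0 q0. Proof. exact: (eqaeB (reg_a0 rP) (reg_a0 rp)). Qed.
Let e1 : eqae al1 q1. Proof. exact: (eqaeB (reg_a1 rP) (reg_a1 rp)). Qed.
Let e2 : eqae al2 q2. Proof. exact: (eqaeB (reg_a2 rP) (reg_a2 rp)). Qed.
Let e3 : eqae al3 q3. Proof. exact: (eqaeB (reg_a3 rP) (reg_a3 rp)). Qed.
Let ev : eqae v z. Proof. exact: (eqae_lin tau e1 e0). Qed.
Let ea : eqae a zt. Proof. exact: (eqae_lin tau e2 e1). Qed.
Let ea' : eqae a' ztt. Proof. exact: (eqae_lin tau e3 e2). Qed.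
Let eW : eqae W1 q1. Proof. exact: (eqaeB (reg_b1 rP) (reg_b1 rp)). Qed.
Let eZ : eqae Z1 zt. Proof. exact: (eqae_lin tau (eqaeB (reg_b2 rP) (reg_b2 rp)) eW). Qed.

Let T00 : (0 : R) <= 0 <= T. Proof. by apply/andP; split => //; exact: ltW. Qed.

Let comb0 (u0 u1 : 'rV[R]_d -> R) : sq u0 -> sq u1 -> nr u0 = 0 -> nr u1 = 0 ->
  nr (fun x => tau * u1 x + u0 x) = 0.
Proof.
move=> s0 s1 n0 n1; apply/eqP; rewrite eq_le nrm_ge0 andbT.
by apply: (le_trans (nrmD mO (sqintZ mO tau s1) s0)); rewrite (nrmZ mO tau s1) n0 n1 mulr0 addr0.
Qed.

Let v00 : nr (v 0) = 0.
Proof. by have [s0 _ _] := h01; have [s1 _ _] := h12; exact: (comb0 (s0 _ T00) (s1 _ T00) init0 init1). Qed.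

Let a00 : nr (a 0) = 0.
Proof. by have [s1 _ _] := h12; have [s2 _ _] := h23; exact: (comb0 (s1 _ T00) (s2 _ T00) init1 init2). Qed.

Let H1_of U : strong T (XH10 Omega) U -> {ae lambda, forall t, I t -> H1 Omega (U t)}.
Proof. by move=> [mU _ _]; apply: lebesgue_aeT => t It; exact: (H10_H1 (mU t (sub It))). Qed.

Let primitives U : strong T (XH10 Omega) U ->
  exists b : 'I_d -> R -> 'rV[R]_d -> R, forall i, hac (b i) (fun t => wD Omega i (U t)) /\ nr (b i 0) = 0.
Proof.
move=> sU; have H i : exists b, hac b (fun t => wD Omega i (U t)) /\ nr (b 0) = 0.
  by have [b hb nb] := hac_primitive T0 oO (strong_wD oO fO i sU); exists b.
by have [b bP] := choice H; exists b.
Qed.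

Let stat := static_energy Omega tau c.
Let rate := growth_rate tau c k M CH2 CH1.
Let D := M ^+ 2 / 2 * delta ^+ 2.

Let rate0 : 0 <= rate.
Proof.
have L0 : 0 <= `|k| * M * (`|CH2| / tau + 2 * `|CH2| + CH1 ^+ 2).
  have h0 : 0 <= `|CH2| / tau by rewrite divr_ge0// ltW.
  have h1 : 0 <= 2 * `|CH2| by rewrite mulr_ge0.
  exact: (mulr_ge0 (mulr_ge0 (normr_ge0 k) M0) (addr_ge0 (addr_ge0 h0 h1) (sqr_ge0 CH1))).
have i0 : 0 <= 3 / tau by rewrite divr_ge0// ltW.
have j0 : 0 <= (tau * c ^+ 2)^-1 by rewrite invr_ge0 mulr_ge0 ?sqr_ge0// ltW.
by rewrite /rate /growth_rate !addr_ge0// mulr_ge0.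
Qed.

(** The absolutely continuous energy and its density are identified at almost every time with the
    fixed-time expressions, to which the static estimates apply. *)
Let energy_rate (b g : 'I_d -> R -> 'rV[R]_d -> R) :
  (forall i, hac (b i) (fun t => wD Omega i (Z1 t)) /\ nr (b i 0) = 0) ->
  (forall i, hac (g i) (fun t => wD Omega i (W1 t)) /\ nr (g i 0) = 0) ->
  {ae lambda, forall t, I t ->
    [/\ ip (a t) (a t) / 2 + c ^+ 2 / 2 * (\sum_i ip (b i t) (b i t)) + ip (al1 t) (al1 t) / 2 +
          (\sum_i ip (g i t) (g i t)) / 2 =
        stat (P t) (dt P t) (dt (dt P) t) (p t) (dt p t) (dt (dt p) t),
      ip (a' t) (a t) + c ^+ 2 * (\sum_i ip (wD Omega i (Z1 t)) (b i t)) + ip (al2 t) (al1 t) +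
          \sum_i ip (wD Omega i (W1 t)) (g i t) <=
        rate * stat (P t) (dt P t) (dt (dt P) t) (p t) (dt p t) (dt (dt p) t) + D &
      tau ^+ 2 / 2 * nr (q2 t) ^+ 2 + tau ^+ 2 * c ^+ 2 / 2 * gradnorm Omega (q1 t) ^+ 2 +
        c ^+ 2 / 2 * gradnorm Omega (q0 t) ^+ 2 <=
      (4 + 3 * c ^+ 2) * stat (P t) (dt P t) (dt (dt P) t) (p t) (dt p t) (dt (dt p) t)]}.
Proof.
move=> hb hg.
have F1 := lebesgue_ae_imply2 (fun t x y => conj x y) (regular_mem rP) (regular_mem rp).
have F2 := lebesgue_ae_imply2 (fun t x y => conj x y) equP equp.
have F3 := lebesgue_ae_imply2 (fun t x y => conj x y) e0 e1.
have F4 := lebesgue_ae_imply2 (fun t x y => conj x y) e2 ev.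
have F5 := lebesgue_ae_imply2 (fun t x y => conj x y) ea ea'.
have F6 := lebesgue_ae_imply2 (fun t x y => conj x y) eW eZ.
have G1 := lebesgue_ae_imply2 (fun t x y => conj x y) F1 F2.
have G2 := lebesgue_ae_imply2 (fun t x y => conj x y) F3 F4.
have G3 := lebesgue_ae_imply2 (fun t x y => conj x y) F5 F6.
have H1' := lebesgue_ae_imply2 (fun t x y => conj x y) G1 boundP.
have H2' := lebesgue_ae_imply2 (fun t x y => conj x y) G2 G3.
apply: lebesgue_ae_imply2 H1' H2' => t [[[mP mp] [xP xp]] bd] [[[y0 y1] [y2 yv]] [[ya ya'] [yW yZ]]] It.
have tT := sub It.
have [mP0 mP1 mP2 mP3] := mP It; have [mp0 mp1 mp2 mp3] := mp It.
have [bd0 bd1 bd2 bd3] := bd It.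
have [sl0 sq0' eq0'] := y0 It; have [sl1 sq1' eq1'] := y1 It; have [sl2 sq2' eq2'] := y2 It.
have [sv sz ez] := yv It; have [sa szt ezt] := ya It; have [sa' sztt eztt] := ya' It.
have [sW sq1'' eW'] := yW It; have [sZ szt' eZ'] := yZ It.
have SG := static_growth oO fO tau0 c0 delta0 M0 CH2P CH1P mP0 mP1 mP2 mP3 mp0 mp1 mp2 mp3
  bd0 bd1 bd2 bd3 (xP It) (xp It).
have SE := static_energy_bound oO fO c tau0 mP0 mP1 mP2 mp0 mp1 mp2.
have swD i f : sq (wD Omega i f) by exact: wD_sqint.
(* Both start from 0, so the time primitive of the derivative of z_t is the derivative of z
   itself. *)
have bz i : b i t =O wD Omega i (z t).
  have := wD_primitive T0 oO fO hv v00 (hb i).1 (hb i).2 (eqae_trans ea (eqae_sym eZ)) (H1_of sZ1) tT.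
  by rewrite (eq_wD oO i sv sz ez); exact: aeD_sym.
have gq i : g i t =O wD Omega i (q0 t).
  have := wD_primitive T0 oO fO h01 init0 (hg i).1 (hg i).2 (eqae_trans e1 (eqae_sym eW)) (H1_of sW1) tT.
  by rewrite (eq_wD oO i sl0 sq0' eq0'); exact: aeD_sym.
have sb i : sq (b i t) by have [[s _ _] _] := hb i; exact: s.
have sg i : sq (g i t) by have [[s _ _] _] := hg i; exact: s.
have X1 : ip (a t) (a t) = ip (zt t) (zt t) := eq_ip2 sa szt ezt sa szt ezt.
have X2 : \sum_i ip (b i t) (b i t) = \sum_i ip (wD Omega i (z t)) (wD Omega i (z t)).
  by apply: eq_bigr => i _; exact: (eq_ip2 (sb i) (swD i _) (bz i) (sb i) (swD i _) (bz i)).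
have X3 : ip (al1 t) (al1 t) = ip (q1 t) (q1 t) := eq_ip2 sl1 sq1' eq1' sl1 sq1' eq1'.
have X4 : \sum_i ip (g i t) (g i t) = \sum_i ip (wD Omega i (q0 t)) (wD Omega i (q0 t)).
  by apply: eq_bigr => i _; exact: (eq_ip2 (sg i) (swD i _) (gq i) (sg i) (swD i _) (gq i)).
have X5 : ip (a' t) (a t) = ip (ztt t) (zt t) := eq_ip2 sa' sztt eztt sa szt ezt.
have X6 : \sum_i ip (wD Omega i (Z1 t)) (b i t) = \sum_i ip (wD Omega i (zt t)) (wD Omega i (z t)).
  apply: eq_bigr => i _; rewrite (eq_wD oO i sZ szt' eZ').
  exact: (eq_ip2 (swD i _) (swD i _) (aerefl _) (sb i) (swD i _) (bz i)).
have X7 : ip (al2 t) (al1 t) = ip (q2 t) (q1 t) := eq_ip2 sl2 sq2' eq2' sl1 sq1' eq1'.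
have X8 : \sum_i ip (wD Omega i (W1 t)) (g i t) = \sum_i ip (wD Omega i (q1 t)) (wD Omega i (q0 t)).
  apply: eq_bigr => i _; rewrite (eq_wD oO i sW sq1'' eW').
  exact: (eq_ip2 (swD i _) (swD i _) (aerefl _) (sg i) (swD i _) (gq i)).
rewrite X1 X2 X3 X4 X5 X6 X7 X8.
exact: (And3 erefl SG SE).
Qed.

Lemma difference_bound : {ae lambda, forall t, I t ->
  tau ^+ 2 / 2 * nr (fun x => dt (dt P) t x - dt (dt p) t x) ^+ 2 +
  tau ^+ 2 * c ^+ 2 / 2 * gradnorm Omega (fun x => dt P t x - dt p t x) ^+ 2 +
  c ^+ 2 / 2 * gradnorm Omega (fun x => P t x - p t x) ^+ 2 <=
  (4 + 3 * c ^+ 2) * (M ^+ 2 / 2 * delta ^+ 2 * T * expR (growth_rate tau c k M CH2 CH1 * T))}.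
Proof.
have [b hb] := primitives sZ1; have [g hg] := primitives sW1.
have key := energy_rate hb hg.
pose F t := ip (a t) (a t) / 2 + c ^+ 2 / 2 * (\sum_i ip (b i t) (b i t)) + ip (al1 t) (al1 t) / 2 +
  (\sum_i ip (g i t) (g i t)) / 2.
pose F' t := ip (a' t) (a t) + c ^+ 2 * (\sum_i ip (wD Omega i (Z1 t)) (b i t)) + ip (al2 t) (al1 t) +
  \sum_i ip (wD Omega i (W1 t)) (g i t).
(* The gradient terms enter through the primitives [b i] and [g i], which makes every summand a
   squared norm of an absolutely continuous function. *)
have acF : ac T F F'.
  have c1 := acZ 2^-1 (hac_sqr T0 oO ha).
  have c2 := acZ (c ^+ 2 / 2) (ac_sum (index_enum 'I_d) (fun i => hac_sqr T0 oO (hb i).1)).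
  have c3 := acZ 2^-1 (hac_sqr T0 oO h12).
  have c4 := acZ 2^-1 (ac_sum (index_enum 'I_d) (fun i => hac_sqr T0 oO (hg i).1)).
  have := acD (acD (acD c1 c2) c3) c4.
  congr ac; apply/funext => t; first by rewrite /F; ring.
  by rewrite /F' -!mulr_sumr; field.
have F00 : F 0 = 0.
  have z0 (u : 'rV[R]_d -> R) : nr u = 0 -> ip u u = 0 by rewrite -nrm_sqr => ->; rewrite expr0n.
  rewrite /F (z0 _ a00) (z0 _ init1) !big1 ?mulr0 ?mul0r ?addr0// => i _; apply: z0.
    by have [] := hg i.
  by have [] := hb i.
have D0 : 0 <= D by rewrite mulr_ge0 ?sqr_ge0// divr_ge0 ?sqr_ge0.
have kF : {ae lambda, forall t, 0 < t < T -> F' t <= rate * F t + D}.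
  apply: lebesgue_ae_imply key => t H tT; have It : I t by rewrite /= in_itv.
  by have [E1 E2 _] := H It; rewrite /F E1.
have FB := gronwall T0 acF F00 rate0 D0 kF.
apply: lebesgue_ae_imply key => t H It; have [E1 _ E3] := H It.
apply: (le_trans E3); apply: ler_wpM2l; first by rewrite addr_ge0// mulr_ge0// sqr_ge0.
by rewrite -E1; exact: FB (sub It).
Qed.

End energy_estimate.

(** * From the energy inequality to the linear rate *)

Lemma bounded_lebesgue_rV_lty (R : realType) (d : nat) (Omega : set 'rV[R]_d) :
  open Omega -> bounded_set Omega -> (lebesgue_rV d Omega < +oo)%E.
Proof.
move=> oO [N [_ /(_ (`|N| + 1))]]; have N1 : N < `|N| + 1 by rewrite (le_lt_trans (ler_norm N))// ltrDl.
set r := `|N| + 1 in N1 *; move=> /(_ N1) bO; have r0 : 0 <= r by rewrite addr_ge0.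
pose u : 'rV[R]_d := const_mx r.
have sub : Omega `<=` cbox (- u) u.
  move=> x Ox i; rewrite !mxE -ler_norml; apply: le_trans (bO x Ox).
  rewrite [leRHS]mx_normrE; exact: (le_bigmax_cond _ (fun j => `|x j.1 j.2|) (isT : xpredT (ord0, i))).
have ab i : (- u) ord0 i <= u ord0 i by rewrite !mxE; lra.
apply: le_lt_trans (le_measure _ _ _ sub) _; rewrite ?inE.
- exact: open_measurable_rV.
- exact: measurable_cbox.
- have := ltry (\prod_i (u ord0 i - (- u) ord0 i)); rewrite -(lebesgue_rV_cbox ab).
  by apply: le_lt_trans.
Qed.

Section conclusion.
Context {R : realType} {d : nat}.
Local Notation mu := (@lebesgue_rV R d).
Local Notation lambda := (@lebesgue_measure R).
Variables (T : R) (Omega : set 'rV[R]_d).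
Hypothesis T0 : 0 < T.
Hypotheses (oO : open Omega) (fO : (mu Omega < +oo)%E).
Local Notation nr := (nrm mu Omega).
Local Notation ip := (ip mu Omega).
Local Notation "f =O g" := (aeD mu Omega f g) (at level 70).
Local Notation I := (`]0, T[%classic : set R).
Local Notation lap := (laplacian Omega).
Local Notation dt := (dt T Omega).
Local Notation eqae := (eqae T Omega).
Local Notation hac := (hac T Omega).
Let mO : measurable Omega. Proof. exact: open_measurable_rV. Qed.

Lemma hac_scalar_weak a a' S : hac a a' -> scalar_weak T Omega a a' S.
Proof. by move=> [_ _ aa'] phi tphi g sg _; exact: (ac_weak T0 (aa' g sg)). Qed.

(** Being a choice, [dt] is not additive on the nose. The differences of the representatives show
    that it is additive a.e., as the energy norm of the difference requires. *)
Lemma regular_difference P A0 A1 A2 A3 B0 B1 B2 p a0 a1 a2 a3 b0 b1 b2 :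
  regular T Omega P A0 A1 A2 A3 B0 B1 B2 -> regular T Omega p a0 a1 a2 a3 b0 b1 b2 ->
  [/\ eqae (fun t x => P t x - p t x) (fun t x => P t x - p t x),
    eqae (dt (fun t x => P t x - p t x)) (fun t x => dt P t x - dt p t x) &
    eqae (dt (dt (fun t x => P t x - p t x))) (fun t x => dt (dt P) t x - dt (dt p) t x)].
Proof.
move=> rP rp.
have h01 := hacB oO (reg_hac0 rP) (reg_hac0 rp); have h12 := hacB oO (reg_hac1 rP) (reg_hac1 rp).
have h23 := hacB oO (reg_hac2 rP) (reg_hac2 rp).
have e0 := eqaeB oO (reg_a0 rP) (reg_a0 rp); have e1 := eqaeB oO (reg_a1 rP) (reg_a1 rp).
have e2 := eqaeB oO (reg_a2 rP) (reg_a2 rp).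
have r0 : rep T Omega _ _ := conj (hac_strong T0 oO h01) e0.
have [L1 r1 _] := dt_rep T0 oO fO (Linfty_eqae oO r0) r0 (hac_strong T0 oO h12) (hac_scalar_weak h01).
have [_ [_ r2] _] := dt_rep T0 oO fO L1 r1 (hac_strong T0 oO h23) (hac_scalar_weak h12).
split.
- exact: eqae_trans (eqae_sym e0) e0.
- by have [_ r1'] := r1; exact: eqae_trans (eqae_sym r1') e1.
- exact: eqae_trans (eqae_sym r2) e2.
Qed.

Lemma ess_sup_I_le (f : R -> R) (y : R) : {ae lambda, forall t, I t -> f t <= y} ->
  (ess_sup (mrestr lambda (measurable_itv `]0%R, T[)) (fun t => (f t)%:E) <= y%:E)%E.
Proof.
move=> [N [mN N0 sub]]; apply/ess_supP; exists (N `|` ~` I); split.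
- by apply: measurableU => //; exact: measurableC.
- change (lambda ((N `|` ~` I) `&` I) = 0%E); rewrite setIUl setICl setU0; apply: (@subset_measure0 _ _ _ lambda _ N) => //.
  exact: measurableI.
- move=> t /= ft; have [It|nIt] := pselect (I t); last by right.
  by left; apply: sub => /= /(_ It) fy; apply: ft; rewrite lee_fin.
Qed.

Lemma solution_regular CH tau c k delta p0 p1 p2 p : embedding_H2_Linfty Omega CH ->
  H2diamond Omega p0 -> H2diamond Omega p1 -> H10 Omega p2 ->
  JMGT_solution T Omega tau c k delta p0 p1 p2 p ->
  exists a0 a1 a2 a3 b0 b1 b2, regular T Omega p a0 a1 a2 a3 b0 b1 b2 /\
    [/\ nr (fun x => a0 0 x - p0 x) = 0, nr (fun x => a1 0 x - p1 x) = 0,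
        nr (fun x => a2 0 x - p2 x) = 0 &
    {ae lambda, forall t, I t -> {ae mu, forall x, Omega x ->
      tau * dt (dt (dt p)) t x + dt (dt p) t x - (delta + tau * c ^+ 2) * lap (dt p t) x
      - c ^+ 2 * lap (p t) x = k * (dt p t x ^+ 2 + p t x * dt (dt p) t x)}}].
Proof.
move=> CHP Hp0 Hp1 Hp2 [Xp ep [i0 i1 i2]].
have [a0 [a1 [a2 [a3 [b0 [b1 [b2 [rp [z0 z1 z2]]]]]]]]] := XW_regular T0 oO fO Xp
  (H2diamond_sq oO Hp0) (H2diamond_sq oO Hp1) (H10_sq oO Hp2) i0 i1 i2.
exists a0, a1, a2, a3, b0, b1, b2.
refine (conj rp (And4 z0 z1 z2 _)).
have nl := nonlinear_dt T0 oO fO k CHP rp.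
apply: lebesgue_ae_imply2 ep nl => t e n It.
apply: filterS2 (e It) (n It) => x ex nx Ox.
rewrite (ex Ox) (nx Ox); move: (dt p t x) (p t x) (dt (dt p) t x) => y1 y0 y2; by field.
Qed.

End conclusion.

Theorem theorem4p3 (R : realType) (d : nat) (Omega : set 'rV[R]_d)
  (tau c delta_bar k CH2 CH1 C K r T : R) (p0 p1 p2 : 'rV[R]_d -> R)
  (p : R -> R -> 'rV[R]_d -> R)
  (d_range : (1 <= d <= 3)%N)
  (Omega_open : open Omega)
  (Omega_bounded : bounded_set Omega)
  (Omega_regular : C11_domain Omega \/
    polygonal Omega /\ convex_set (Omega : set (convex_lmodType 'rV[R]_d)))
  (tau_gt0 : 0 < tau) (c_gt0 : 0 < c) (delta_bar_gt0 : 0 < delta_bar)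
  (CH2P : embedding_H2_Linfty Omega CH2)
  (CH1P : embedding_H1_L4 Omega CH1)
  (C_gt0 : 0 < C) (K_gt0 : 0 < K)
  (CKP : wellposed Omega tau c k delta_bar CH2 CH1 C K)
  (r_gt0 : 0 < r) (T_gt0 : 0 < T)
  (smallP : exists2 Rad : R, 0 < Rad & small_data k CH2 CH1 C K r T Rad)
  (p0P : H2diamond Omega p0) (p1P : H2diamond Omega p1) (p2P : H10 Omega p2)
  (dataP : data_energy Omega p0 p1 p2 <= r ^+ 2)
  (pP : forall delta : R, 0 <= delta <= delta_bar ->
     JMGT_solution T Omega tau c k delta p0 p1 p2 (p delta)) :
  exists2 Cst : R, 0 < Cst &
    forall delta : R, 0 < delta <= delta_bar ->
      let q := fun t x => p delta t x - p 0 t x in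
      Espace T Omega q /\ (Enorm T Omega tau c q <= (Cst * delta)%:E)%E.
Proof.
have oO := Omega_open; have fO := bounded_lebesgue_rV_lty oO Omega_bounded.
have mO := open_measurable_rV oO.
have [Rad Rad0 sm] := smallP.
(* The well-posedness bound is the same for every delta, including 0, so M and everything derived
   from it are uniform. *)
pose B := C * expR (K * (Rad ^+ 2 + 1) * T) * data_energy Omega p0 p1 p2.
have B0 : 0 <= B.
  by rewrite /B !mulr_ge0 ?expR_ge0 ?(ltW C_gt0)// /data_energy !addr_ge0 ?sqr_ge0.
pose M := Num.sqrt B; have M0 : 0 <= M := sqrtr_ge0 B.
pose rate := growth_rate tau c k M CH2 CH1.
pose K0 := (4 + 3 * c ^+ 2) * (M ^+ 2 / 2 * T * expR (rate * T)).
have K00 : 0 <= K0.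
  have c2 : 0 <= 4 + 3 * c ^+ 2 by rewrite addr_ge0// mulr_ge0// sqr_ge0.
  have T00 := ltW T_gt0; have m2 : 0 <= M ^+ 2 / 2 by rewrite divr_ge0// sqr_ge0.
  exact: (mulr_ge0 c2 (mulr_ge0 (mulr_ge0 m2 T00) (expR_ge0 _))).
(* The added 1 keeps the constant positive when [K0] vanishes, for instance for zero data. *)
exists (Num.sqrt K0 + 1); first by rewrite ltr_wpDl ?sqrtr_ge0.
move=> delta /andP[delta0 delta_le] q.
have dP : 0 <= delta <= delta_bar by rewrite (ltW delta0).
have d0 : (0 : R) <= 0 <= delta_bar by apply/andP; split => //; exact: ltW.
have solP := pP _ dP; have solp := pP _ d0.
have [XP _ _] := solP; have [Xp _ _] := solp.
have [XP2 XP1 _] := XP; have [Xp2 Xp1 _] := Xp.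
have [_ _ /(_ _ solP) bdP] := CKP _ _ _ r_gt0 T_gt0 Rad0 sm _ _ _ p0P p1P p2P dataP _ dP.
have [_ _ /(_ _ solp) bdp] := CKP _ _ _ r_gt0 T_gt0 Rad0 sm _ _ _ p0P p1P p2P dataP _ d0.
have [A0 [A1 [A2 [A3 [B0' [B1' [B2' [rP [z0 z1 z2 eP]]]]]]]]] :=
  solution_regular T_gt0 oO fO CH2P p0P p1P p2P solP.
have [a0 [a1 [a2 [a3 [b0 [b1 [b2 [rp [y0 y1 y2 ep]]]]]]]]] :=
  solution_regular T_gt0 oO fO CH2P p0P p1P p2P solp.
split.
  (* Membership in the energy space follows by dropping one time derivative from [XW]. *)
  split; first by apply: (Winfty_sub (seminormed_L2 oO)); exact: WinftyW.
  by apply: (Winfty_sub (seminormed_H10 oO fO)); exact: WinftyW.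
have T0 := T_gt0.
have s0 := H2diamond_sq oO p0P; have s1 := H2diamond_sq oO p1P; have s2 := H10_sq oO p2P.
have T00 : (0 : R) <= 0 <= T by apply/andP; split => //; exact: ltW.
(* Both solutions start from the same data, so their continuous representatives coincide at time
   0. *)
have init (u v w : 'rV[R]_d -> R) : sqint (lebesgue_rV d) Omega u -> sqint (lebesgue_rV d) Omega v ->
    sqint (lebesgue_rV d) Omega w -> nrm (lebesgue_rV d) Omega (fun x => u x - w x) = 0 ->
    nrm (lebesgue_rV d) Omega (fun x => v x - w x) = 0 ->
    nrm (lebesgue_rV d) Omega (fun x => u x - v x) = 0.
  move=> su sv sw uw vw; apply/eqP; rewrite eq_le nrm_ge0 andbT.
  rewrite (_ : (fun x => u x - v x) = (fun x => (u x - w x) - (v x - w x))).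
    by apply: (le_trans (nrmB mO (sqintB mO su sw) (sqintB mO sv sw))); rewrite uw vw addr0.
  by apply/funext => x; ring.
have at0 u u' : hac T Omega u u' -> sqint (lebesgue_rV d) Omega (u 0).
  by move=> [su _ _]; exact: su.
have i0 := init _ _ _ (at0 _ _ (reg_hac0 rP)) (at0 _ _ (reg_hac0 rp)) s0 z0 y0.
have i1 := init _ _ _ (at0 _ _ (reg_hac1 rP)) (at0 _ _ (reg_hac1 rp)) s1 z1 y1.
have i2 := init _ _ _ (at0 _ _ (reg_hac2 rP)) (at0 _ _ (reg_hac2 rp)) s2 z2 y2.
have le_M (x y w : R) : 0 <= x -> 0 <= y -> 0 <= w -> x ^+ 2 + y ^+ 2 + w ^+ 2 <= B ->
    [/\ x <= M, y <= M & w <= M].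
  have le1 (s a b : R) : 0 <= s -> 0 <= a -> 0 <= b -> s ^+ 2 + (a + b) <= B -> s <= M.
    move=> s0' a0' b0' sB; rewrite -(ger0_norm s0') -sqrtr_sqr ler_sqrt//.
    by apply: le_trans sB; rewrite lerDl addr_ge0.
  move=> x0 y0' w0 xyw; have X := sqr_ge0 x; have Y := sqr_ge0 y; have W := sqr_ge0 w.
  split.
  - by apply: (le1 _ _ _ x0 Y W); rewrite addrA.
  - by apply: (le1 _ _ _ y0' X W); rewrite addrA (addrC (y ^+ 2)).
  - by apply: (le1 _ _ _ w0 X Y); rewrite addrC.
have lapE f : L2norm Omega (laplacian Omega f) = nrm (lebesgue_rV d) Omega (laplacian Omega f).
  exact: (L2norm_nrm oO (laplacian_sqint oO f)).
have bd : {ae @lebesgue_measure R, forall t, `]0, T[%classic t ->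
    [/\ nrm (lebesgue_rV d) Omega (laplacian Omega (p delta t)) <= M,
        nrm (lebesgue_rV d) Omega (laplacian Omega (dt T Omega (p delta) t)) <= M,
        nrm (lebesgue_rV d) Omega (laplacian Omega (dt T Omega (p 0) t)) <= M &
        gradnorm Omega (dt T Omega (dt T Omega (p 0)) t) <= M]}.
  apply: lebesgue_ae_imply2 bdP bdp => t bP bp It.
  have tT : 0 < t < T by move: It; rewrite /= in_itv.
  have [_ l1 l0] := le_M _ _ _ (gradnorm_ge0 _ _) (L2norm_ge0 _ _) (L2norm_ge0 _ _) (bP tT).
  have [g2 l1' _] := le_M _ _ _ (gradnorm_ge0 _ _) (L2norm_ge0 _ _) (L2norm_ge0 _ _) (bp tT).
  split; last exact: g2.
  - by rewrite -(lapE (p delta t)); exact: l0.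
  - by rewrite -(lapE (dt T Omega (p delta) t)); exact: l1.
  - by rewrite -(lapE (dt T Omega (p 0) t)); exact: l1'.
have main := difference_bound T0 oO fO tau_gt0 c_gt0 (ltW delta0) M0 CH2P CH1P rP rp i0 i1 i2 bd eP ep.
have [e0 e1 e2] := regular_difference T0 oO fO rP rp.
apply: ess_sup_I_le.
have E01 := lebesgue_ae_imply2 (fun t x y => conj x y) e0 e1.
have E2m := lebesgue_ae_imply2 (fun t x y => conj x y) e2 main.
apply: lebesgue_ae_imply2 E01 E2m => t [x0 x1] [x2 xm] It.
have [_ sq0 _] := x0 It; have [sq1 sq1' eq1] := x1 It; have [sq2 sq2' eq2] := x2 It.
have := xm It; rewrite -(eq_gradnorm oO sq1 sq1' eq1).
rewrite -(eq_nrm mO (sqint_meas sq2) (sqint_meas sq2') eq2) -(L2norm_nrm oO sq2).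
move=> H; have {}H : energy T Omega tau c q t <= K0 * delta ^+ 2.
  by apply: (le_trans H); rewrite le_eqVlt; apply/orP; left; apply/eqP; rewrite /K0; ring.
have d2 : 0 <= delta ^+ 2 by exact: sqr_ge0.
(* The energy is quadratic in delta; its square root gives the linear rate. *)
apply: (@le_trans _ _ (Num.sqrt (K0 * delta ^+ 2))).
  by rewrite ler_sqrt// mulr_ge0.
rewrite sqrtrM// sqrtr_sqr (gtr0_norm delta0) ler_wpM2r ?(ltW delta0)//.
by rewrite lerDl.
Qed.
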